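(* Let $F$ be a number field, $S$ a finite set of places of $F$ containing all primes ramified in $\bar\rho$, all primes above $p$ and all infinite places, and $\bar\rho:\Gamma_S\to G(k)$ a continuous representation such that $\bar\rho(\Gamma_S)$ contains the image of $G^{\mathrm{sc}}(k)$ in $G(k)$. Assume that $[F(\mu_p):F]=p-1$ and that $p-1$ is greater than $8\,\#Z_{G^{\mathrm{sc}}}$ and greater than $(2h-2)\,\#Z_{G^{\mathrm{sc}}}$ if $\#Z_{G^{\mathrm{sc}}}$ is even, resp. $(4h-4)\,\#Z_{G^{\mathrm{sc}}}$ if $\#Z_{G^{\mathrm{sc}}}$ is odd ($h$ the Coxeter number of $G$, $Z_{G^{\mathrm{sc}}}$ the centre of $G^{\mathrm{sc}}$). Assume given smooth local deformation conditions $\mathcal{D}_v$, $v\in S$, with tangent spaces $\mathcal{N}_v$, such that $\dim_k H^1_{\mathcal{N}}(\Gamma_S,\bar\rho(\mathfrak{g}^{\mathrm{der}}))=\dim_k H^1_{\mathcal{N}^\perp}(\Gamma_S,\bar\rho(\mathfrak{g}^{\mathrm{der}})^* )=n\neq 0$. Let $Q=\{q_1,\dots,q_m\}$, $m\in\{n+1,n+3\}$, be an ordered auxiliary set of nice primes and $d\ge 2$ an integer such that: (a) $\rho_{S\cup Q}^{Q\text{-new}}:\Gamma_{S\cup Q}\to G(R_{S\cup Q}^{Q\text{-new}})=G(W(k))$ is ramified mod $p^d$ at all $q\in Q$; (b) for each $1\le i\le m$ there is an auxiliary set $Q_i\subset Q$ with $\{q_1,\dots,q_{i-1}\}\subset Q_i$,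 $q_i\notin Q_i$, such that $\rho_{S\cup Q_i}^{Q_i\text{-new}}\equiv\rho_{S\cup Q}^{Q\text{-new}}$ mod $p^{d-1}$, $\rho_{S\cup Q_i}^{Q_i\text{-new}}$ mod $p^{d-1}$ is special at $q_i$, and $\rho_{S\cup Q_i}^{Q_i\text{-new}}$ mod $p^{d}$ is not special at $q_i$. For each $q\in Q$ let $m_q$ be the largest integer such that $\rho_{S\cup Q}^{Q\text{-new}}$ is unramified at $q$ modulo $p^{m_q}$. Let $\pi:R_{S\cup Q}\to R_{S\cup Q}^{Q\text{-new}}=W(k)$ be the natural surjection. Then $$\ker(\pi)/\ker(\pi)^2\;\cong\;\bigoplus_{q\in Q}W(k)/p^{m_q}W(k).$$ In particular, $\ker(\pi)/\ker(\pi)^2$ is a finite $W(k)$-module and $\mathrm{Spec}(R_{S\cup Q}^{Q\text{-new}})$ is an irreducible component of $\mathrm{Spec}(R_{S\cup Q})$.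
   Context: Groups and notation. $k$ is a finite field of characteristic $p$, $W(k)$ its ring of Witt vectors. $G$ is a split connected reductive group scheme over $W(k)$ whose derived group $G^{\mathrm{der}}$ is almost simple, $G^{\mathrm{sc}}$ is the simply connected cover of $G^{\mathrm{der}}$, $\mu:G\to C$ is the maximal torus quotient, and $\mathfrak{g}^{\mathrm{der}}$ is the Lie algebra of $G^{\mathrm{der}}$. Throughout $p$ is greater than the Coxeter number of $G$. For a set $X$ of places, $\Gamma_X$ is the Galois group of the maximal extension of $F$ unramified outside $X$ and the infinite places; $\Gamma_v$ is the absolute Galois group of $F_v$, $I_v$ its inertia group. $\kappa$ is the $p$-adic cyclotomic character (and its reductions). $\bar\rho(\mathfrak{g}^{\mathrm{der}})$ is $\mathfrak{g}^{\mathrm{der}}\otimes k$ with Galois action through $\bar\rho$ and the adjoint representation; $M^*=\mathrm{Hom}(M,k(\kappa))$. A continuous lift $\nu:\Gamma_S\to C(W(k))$ of $\mu\circ\bar\rho$ is fixed, and all lifts/deformations are required to give $\nu$ after composing with $\mu$. Deformation conditions. A local deformation condition $\mathcal{D}_v$ is a class of lifts of $\bar\rho|_{\Gamma_v}$ to complete noetherian local $W(k)$-algebras with residue field $k$, stable under conjugation by $\widehat G(A)=\ker(G(A)\to G(k))$, in the usual sense of deformation theory (relatively representable); it is smooth if lifts in $\mathcal{D}_v$ extend along surjections; its tangent space is $\mathcal{N}_v\subset H^1(\Gamma_v,\bar\rho(\mathfrak{g}^{\mathrm{der}}))$. Congruence of deformations means equality up to $\widehat G$-conjugacy. Selmer groups.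 $H^1_{\mathcal{N}}(\Gamma_X,M)=\ker(H^1(\Gamma_X,M)\to\bigoplus_{v\in X}H^1(\Gamma_v,M)/\mathcal{N}_v)$, and $H^1_{\mathcal{N}^\perp}(\Gamma_X,M^* )$ is defined using the annihilators $\mathcal{N}_v^\perp$ of $\mathcal{N}_v$ under local Tate duality. Nice primes. A prime $q$ of $F$ (not above $p$) is nice for $\bar\rho$ if: $\mathrm{Norm}(q)\not\equiv\pm1$ mod $p$; $\bar\rho(I_q)=\{1\}$ and $\bar\rho(\mathrm{Frob}_q)$ is regular semisimple in $G(k)$; and, with $T$ the identity component of the centralizer of $\bar\rho(\mathrm{Frob}_q)$ (assumed to be a maximal split torus, lifted to a split maximal torus of $G$ over $W(k)$, also denoted $T$), there is a unique root $\alpha\in\Phi(G,T)$ such that $\Gamma_q$ acts on $\mathfrak{g}_\alpha\otimes k$ by $\kappa$. Special condition. Let $H_\alpha\subset G$ be generated by $T$ and the root subgroup $U_\alpha$; $\alpha$ extends to $H_\alpha\to\mathbb{G}_m$. A lift $\rho:\Gamma_q\to G(A)$ of $\bar\rho|_{\Gamma_q}$ is in the (smooth) condition $\mathcal{D}_q$ if it is $\widehat G(A)$-conjugate to a lift factoring through $H_\alpha(A)$ with $\alpha\circ\rho=\kappa$; $\mathcal{N}_q$ is its tangent space. A lift of $\bar\rho$ to $G(W(k)/p^n)$ is special at $q$ if its restriction to $\Gamma_q$ lies in $\mathcal{D}_q$. Auxiliary sets and deformation rings. A finite set $Q$ of nice primes disjoint from $S$ is auxiliary if $H^1_{\mathcal{N}}(\Gamma_{S\cup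 Q},\bar\rho(\mathfrak{g}^{\mathrm{der}}))=0$ (with $\mathcal{N}_v$ the tangent space of the given condition $\mathcal{D}_v$ at $v\in S$, and $\mathcal{N}_q\subset H^1(\Gamma_q,\bar\rho(\mathfrak{g}^{\mathrm{der}}))$ the tangent space of the condition $\mathcal{D}_q$, consisting of lifts $\widehat G(A)$-conjugate to a lift factoring through $H_\alpha(A)$ whose composite with $\alpha$ is $\kappa$, at $q\in Q$). $R_{S\cup Q}^{Q\text{-new}}$ is the universal ring for deformations of $\bar\rho$ to $\Gamma_{S\cup Q}$ that are in $\mathcal{D}_v$ for all $v\in S\cup Q$; it is $W(k)$ when $Q$ is auxiliary, with universal deformation $\rho_{S\cup Q}^{Q\text{-new}}$. $R_{S\cup Q}$ is the universal ring for deformations of $\bar\rho$ to $\Gamma_{S\cup Q}$ that are in $\mathcal{D}_v$ for all $v\in S$, with no condition at $v\in Q$. *)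

(* Defs.v *)
From HB Require Import structures.
From mathcomp Require Import all_boot all_order all_algebra all_field.
From mathcomp Require Import mpoly boolp.

Set Implicit Arguments.
Unset Strict Implicit.
Unset Printing Implicit Defensive.

Import GRing.Theory.
Local Open Scope ring_scope.

Section Ideals.
Variable A : comNzRingType.
Implicit Types I J : A -> Prop.

Definition is_ideal I : Prop :=
  [/\ I 0, (forall x y, I x -> I y -> I (x + y)) & (forall a x, I x -> I (a * x))].

Definition idmul I J (x : A) : Prop :=
  exists r : seq (A * A),
    (forall u, u \in r -> I u.1 /\ J u.2) /\ x = \sum_(u <- r) u.1 * u.2.

Fixpoint idpow I (n : nat) : A -> Prop :=
  if n is n'.+1 then idmul I (idpow I n') else fun _ => True.

Definition noetherian : Prop :=
  forall I, is_ideal I -> exists (n : nat) (e : 'I_n -> A),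
    forall x, I x <-> exists c : 'I_n -> A, x = \sum_i c i * e i.

Definition adically_complete I : Prop :=
  (forall x, (forall n, idpow I n x) -> x = 0) /\
  (forall u : nat -> A, (forall n, idpow I n (u n.+1 - u n)) ->
     exists l, forall n, idpow I n (l - u n)).

Definition is_prime_ideal I : Prop :=
  [/\ is_ideal I, ~ I 1 & forall x y, I (x * y) -> I x \/ I y].

Definition spec : Type := {P : A -> Prop | is_prime_ideal P}.

Definition spec_closed (Z : spec -> Prop) : Prop :=
  exists E : A -> Prop, forall P : spec, Z P <-> (forall x, E x -> sval P x).

Definition spec_irreducible (Z : spec -> Prop) : Prop :=
  (exists P, Z P) /\
  (forall Z1 Z2, spec_closed Z1 -> spec_closed Z2 ->
     (forall P, Z P -> Z1 P \/ Z2 P) ->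
     (forall P, Z P -> Z1 P) \/ (forall P, Z P -> Z2 P)).

Definition irreducible_component (Z : spec -> Prop) : Prop :=
  [/\ spec_closed Z, spec_irreducible Z &
      forall Z', spec_closed Z' -> spec_irreducible Z' ->
        (forall P, Z P -> Z' P) -> forall P, Z' P -> Z P].

End Ideals.

Definition rker (A B : nzRingType) (f : A -> B) : A -> Prop := fun x => f x = 0.

Definition spec_image (A B : comNzRingType) (f : A -> B) : spec A -> Prop :=
  fun P => exists P' : spec B, forall x, sval P x <-> sval P' (f x).

Definition pdiv_pow (W : comNzRingType) (p n : nat) (x : W) : Prop :=
  exists y, x = (p ^ n)%:R * y.

(* [W], with [res : W -> k], is the strict p-ring with residue field [k]; this
   determines the Witt vectors of a perfect field up to unique isomorphism. *)
Definition is_witt_ring (p : nat) (k : finFieldType) (W : comNzRingType)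
    (res : {rmorphism W -> k}) : Prop :=
  [/\ p \in [pchar k],
      (forall a, exists w, res w = a),
      (forall w, res w = 0 <-> pdiv_pow p 1 w),
      (forall w : W, p%:R * w = 0 -> w = 0) &
      adically_complete (fun w : W => pdiv_pow p 1 w)].

(* Complete noetherian local W-algebras with residue field k. *)
Definition is_coef (k : finFieldType) (W : comNzRingType)
    (res : {rmorphism W -> k}) (A : comNzRingType) (str : {rmorphism W -> A})
    (red : {rmorphism A -> k}) : Prop :=
  [/\ (forall w, red (str w) = res w),
      (forall a, exists x, red x = a),
      (forall x, red x <> 0 -> exists y, x * y = 1),
      noetherian A & adically_complete (rker red)].

Definition is_coef_hom (k : finFieldType) (W A B : comNzRingType)
    (strA : {rmorphism W -> A}) (redA : {rmorphism A -> k})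
    (strB : {rmorphism W -> B}) (redB : {rmorphism B -> k})
    (f : {rmorphism A -> B}) : Prop :=
  (forall w, f (strA w) = strB w) /\ (forall x, redB (f x) = redA x).

(* [(A, str)] is W/p^n, and [red] its projection to k. *)
Definition is_trunc (p n : nat) (k : finFieldType) (W : comNzRingType)
    (res : {rmorphism W -> k}) (A : comNzRingType) (str : {rmorphism W -> A})
    (red : {rmorphism A -> k}) : Prop :=
  [/\ (forall x, exists w, str w = x),
      (forall w, str w = 0 <-> pdiv_pow p n w) &
      (forall w, red (str w) = res w)].

(* A W-linear isomorphism I/J -> \bigoplus_j W/p^(e j), given through lifts
   [f] to W^m of its values. *)
Definition subquotient_iso (p m : nat) (W R : comNzRingType)
    (str : {rmorphism W -> R}) (I J : R -> Prop) (e : 'I_m -> nat) : Prop :=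
  exists f : R -> 'I_m -> W,
  [/\ (forall x y, I x -> I y ->
         forall j, pdiv_pow p (e j) (f (x + y) j - (f x j + f y j))),
      (forall w x, I x -> forall j, pdiv_pow p (e j) (f (str w * x) j - w * f x j)),
      (forall x, I x -> (J x <-> forall j, pdiv_pow p (e j) (f x j))) &
      (forall a : 'I_m -> W, exists2 x, I x &
         forall j, pdiv_pow p (e j) (f x j - a j))].

Definition finite_subquotient (R : comNzRingType) (I J : R -> Prop) : Prop :=
  exists r : seq R, forall x, I x -> exists2 y, y \in r & J (x - y).

Definition dualnum (A : Type) : Type := (A * A)%type.

Section Dual.
Variable A : comNzRingType.

HB.instance Definition _ := GRing.Zmodule.on (dualnum A).

Definition dual_one : dualnum A := (1, 0).
Definition dual_mul (x y : dualnum A) : dualnum A :=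
  (x.1 * y.1, x.1 * y.2 + x.2 * y.1).

Lemma dual_mulA : associative dual_mul.
Proof.
move=> [x x'] [y y'] [z z']; rewrite /dual_mul /=; congr (_, _).
  exact: mulrA.
by rewrite !mulrDr !mulrDl !mulrA addrA.
Qed.

Lemma dual_mulC : commutative dual_mul.
Proof.
move=> [x x'] [y y']; rewrite /dual_mul /=; congr (_, _); first exact: mulrC.
by rewrite addrC [x * y']mulrC [x' * y]mulrC.
Qed.

Lemma dual_mul1 : left_id dual_one dual_mul.
Proof. by move=> [x x']; rewrite /dual_mul /= !mul1r mul0r addr0. Qed.

Lemma dual_mulDl : left_distributive dual_mul +%R.
Proof.
move=> [x x'] [y y'] [z z']; rewrite /dual_mul /=; congr (_, _).
  exact: mulrDl.
by rewrite !mulrDl addrACA.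
Qed.

Lemma dual_one_neq0 : dual_one != 0.
Proof. by apply/eqP => -[] /eqP; rewrite oner_eq0. Qed.

HB.instance Definition _ := GRing.Zmodule_isComNzRing.Build (dualnum A)
  dual_mulA dual_mulC dual_mul1 dual_mulDl dual_one_neq0.

Definition dual_red (x : dualnum A) : A := x.1.

Lemma dual_red_additive : zmod_morphism dual_red.
Proof. by []. Qed.
Lemma dual_red_multiplicative : monoid_morphism dual_red.
Proof. by []. Qed.
HB.instance Definition _ :=
  GRing.isZmodMorphism.Build (dualnum A) A dual_red dual_red_additive.
HB.instance Definition _ :=
  GRing.isMonoidMorphism.Build (dualnum A) A dual_red dual_red_multiplicative.

Variables (B : comNzRingType) (s : {rmorphism B -> A}).

Definition dual_str (b : B) : dualnum A := (s b, 0).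

Lemma dual_str_additive : zmod_morphism dual_str.
Proof.
move=> x y; rewrite /dual_str rmorphB.
by congr (_, _); rewrite ?subr0.
Qed.
Lemma dual_str_multiplicative : monoid_morphism dual_str.
Proof.
split=> [|x y]; rewrite /dual_str ?rmorph1 // rmorphM.
by congr (_, _); rewrite /= mulr0 mul0r addr0.
Qed.
HB.instance Definition _ :=
  GRing.isZmodMorphism.Build B (dualnum A) dual_str dual_str_additive.
HB.instance Definition _ :=
  GRing.isMonoidMorphism.Build B (dualnum A) dual_str dual_str_multiplicative.

End Dual.

Definition inverses (A : nzRingType) (N : nat) (g h : 'M[A]_N) : Prop :=
  g *m h = 1%:M /\ h *m g = 1%:M.

Section GeometricPoints.
Variables (K : closedFieldType) (N : nat).
Implicit Types H Z : 'M[K]_N -> Prop.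

Definition zclosed Z : Prop :=
  exists E : {mpoly K[N * N]} -> Prop, forall g, g \in unitmx ->
    (Z g <-> forall f, E f -> f.@[fun i => mxvec g 0 i] = 0).

Definition zconnected Z : Prop :=
  forall Z1 Z2, zclosed Z1 -> zclosed Z2 ->
    (forall g, Z g -> Z1 g \/ Z2 g) -> (forall g, ~ [/\ Z g, Z1 g & Z2 g]) ->
    (forall g, Z g -> Z1 g) \/ (forall g, Z g -> Z2 g).

Definition is_subgroup H : Prop :=
  [/\ (forall g, H g -> g \in unitmx), H 1%:M,
      (forall g h, H g -> H h -> H (g *m h)) & (forall g, H g -> H (invmx g))].

Definition is_normal_in H' H : Prop :=
  (forall g, H' g -> H g) /\
  (forall g h, H g -> H' h -> H' (g *m h *m invmx g)).

Definition is_unipotent H : Prop :=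
  forall g, H g -> char_poly g = ('X - 1) ^+ N.

Definition is_reductive H : Prop :=
  forall U, is_subgroup U -> zclosed U -> zconnected U -> is_normal_in U H ->
    is_unipotent U -> forall g, U g -> g = 1%:M.

Definition is_torus H : Prop :=
  [/\ is_subgroup H, zclosed H, zconnected H &
      exists2 c, c \in unitmx & forall g, H g -> is_diag_mx (c *m g *m invmx c)].

Definition is_maximal_torus H H' : Prop :=
  [/\ is_torus H', (forall g, H' g -> H g) &
      forall H'', is_torus H'' -> (forall g, H'' g -> H g) ->
        (forall g, H' g -> H'' g) -> forall g, H'' g -> H' g].

Definition is_semisimple_mx (g : 'M[K]_N) : Prop :=
  exists2 c, c \in unitmx & is_diag_mx (c *m g *m invmx c).

Definition commutator_subgroup H (g : 'M[K]_N) : Prop :=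
  forall D, is_subgroup D ->
    (forall x y, H x -> H y -> D (x *m y *m invmx x *m invmx y)) -> D g.

Definition centralizer H (g x : 'M[K]_N) : Prop := H x /\ x *m g = g *m x.

Definition identity_component H (g : 'M[K]_N) : Prop :=
  exists Y, [/\ (forall x, Y x -> H x), zconnected Y, Y 1%:M & Y g].

Definition is_almost_simple H : Prop :=
  (exists2 g, H g & g <> 1%:M) /\
  (forall H', is_subgroup H' -> zclosed H' -> zconnected H' ->
     is_normal_in H' H ->
     (forall g, H' g -> g = 1%:M) \/ (forall g, H g -> H' g)).

End GeometricPoints.

(* An affine group scheme of finite type over [B] is a closed subgroup scheme
   of GL_N, cut out by finitely many equations in the matrix entries; its
   points in a B-algebra [s : B -> A] are matrices over [A].  Over a discrete
   valuation ring every flat affine group scheme of finite type is of this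
   form.  Morphisms are natural transformations of functors of points. *)

Section GroupSchemes.
Variable B : comNzRingType.

Definition eq_points (N : nat) (E : seq {mpoly B[N * N]}) (A : comNzRingType)
    (s : {rmorphism B -> A}) (g : 'M[A]_N) : Prop :=
  (exists h, inverses g h) /\
  (forall f, f \in E -> mmap s (fun i => mxvec g 0 i) f = 0).

Record lingroup (N : nat) := LinGroup {
  lg_eqs : seq {mpoly B[N * N]};
  lg_one : forall (A : comNzRingType) (s : {rmorphism B -> A}),
    eq_points lg_eqs s 1%:M;
  lg_mul : forall (A : comNzRingType) (s : {rmorphism B -> A}) (g h : 'M[A]_N),
    eq_points lg_eqs s g -> eq_points lg_eqs s h -> eq_points lg_eqs s (g *m h);
  lg_inv : forall (A : comNzRingType) (s : {rmorphism B -> A}) (g h : 'M[A]_N),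
    eq_points lg_eqs s g -> inverses g h -> eq_points lg_eqs s h }.

Definition pts (N : nat) (G : lingroup N) (A : comNzRingType)
    (s : {rmorphism B -> A}) : 'M[A]_N -> Prop := eq_points (lg_eqs G) s.

Definition is_alg_hom (A A' : comNzRingType) (s : {rmorphism B -> A})
    (s' : {rmorphism B -> A'}) (f : {rmorphism A -> A'}) : Prop :=
  forall b, f (s b) = s' b.

Record lghom (N M : nat) (G : lingroup N) (H : lingroup M) := LGHom {
  hom_at : forall (A : comNzRingType), {rmorphism B -> A} -> 'M[A]_N -> 'M[A]_M;
  hom_pts : forall (A : comNzRingType) (s : {rmorphism B -> A}) g,
    pts G s g -> pts H s (hom_at s g);
  hom_mul : forall (A : comNzRingType) (s : {rmorphism B -> A}) g h,
    pts G s g -> pts G s h -> hom_at s (g *m h) = hom_at s g *m hom_at s h;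
  hom_nat : forall (A A' : comNzRingType) (s : {rmorphism B -> A})
      (s' : {rmorphism B -> A'}) (f : {rmorphism A -> A'}) g,
    is_alg_hom s s' f -> pts G s g ->
    hom_at s' (map_mx f g) = map_mx f (hom_at s g) }.

Record lgchar (N : nat) (G : lingroup N) := LGChar {
  chr_at : forall (A : comNzRingType), {rmorphism B -> A} -> 'M[A]_N -> A;
  chr_unit : forall (A : comNzRingType) (s : {rmorphism B -> A}) g,
    pts G s g -> exists b, chr_at s g * b = 1;
  chr_mul : forall (A : comNzRingType) (s : {rmorphism B -> A}) g h,
    pts G s g -> pts G s h -> chr_at s (g *m h) = chr_at s g * chr_at s h;
  chr_nat : forall (A A' : comNzRingType) (s : {rmorphism B -> A})
      (s' : {rmorphism B -> A'}) (f : {rmorphism A -> A'}) g,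
    is_alg_hom s s' f -> pts G s g ->
    chr_at s' (map_mx f g) = f (chr_at s g) }.

Definition chr_eq (N : nat) (G : lingroup N) (a b : lgchar G) : Prop :=
  forall (A : comNzRingType) (s : {rmorphism B -> A}) g,
    pts G s g -> chr_at a s g = chr_at b s g.

Definition chr_trivial (N : nat) (G : lingroup N) (a : lgchar G) : Prop :=
  forall (A : comNzRingType) (s : {rmorphism B -> A}) g,
    pts G s g -> chr_at a s g = 1.

Definition lgsub (N : nat) (H G : lingroup N) : Prop :=
  forall (A : comNzRingType) (s : {rmorphism B -> A}) g, pts H s g -> pts G s g.

Definition lg_iso (N M : nat) (G : lingroup N) (H : lingroup M) (f : lghom G H) :
    Prop :=
  forall (A : comNzRingType) (s : {rmorphism B -> A}),
    (forall g g', pts G s g -> pts G s g' -> hom_at f s g = hom_at f s g' -> g = g')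
    /\ (forall h, pts H s h -> exists2 g, pts G s g & hom_at f s g = h).

(* Infinitesimal lifting criterion; finite presentation is built in. *)
Definition lg_smooth (N : nat) (G : lingroup N) : Prop :=
  forall (A A' : comNzRingType) (s : {rmorphism B -> A})
      (s' : {rmorphism B -> A'}) (f : {rmorphism A -> A'}),
    is_alg_hom s s' f -> (forall y, exists x, f x = y) ->
    (forall x y, f x = 0 -> f y = 0 -> x * y = 0) ->
    forall g', pts G s' g' -> exists2 g, pts G s g & map_mx f g = g'.

Definition lg_reductive (N : nat) (G : lingroup N) : Prop :=
  lg_smooth G /\
  (forall (K : closedFieldType) (s : {rmorphism B -> K}),
     zconnected (pts G s) /\ is_reductive (pts G s)).

(* T is isomorphic to G_m^r. *)
Definition split_torus_rank (N : nat) (T : lingroup N) (r : nat) : Prop :=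
  exists chi : 'I_r -> lgchar T,
  forall (A : comNzRingType) (s : {rmorphism B -> A}) (a : 'I_r -> A),
    (forall i, exists b, a i * b = 1) ->
    exists! t, pts T s t /\ forall i, chr_at (chi i) s t = a i.

Definition split_maximal_torus (N : nat) (G T : lingroup N) : Prop :=
  [/\ lgsub T G, (exists r, split_torus_rank T r) &
      forall (K : closedFieldType) (s : {rmorphism B -> K}),
        is_maximal_torus (pts G s) (pts T s)].

Definition split_reductive (N : nat) (G : lingroup N) : Prop :=
  lg_reductive G /\ exists T : lingroup N, split_maximal_torus G T.

Definition is_derived_group (N : nat) (G Gder : lingroup N) : Prop :=
  [/\ lgsub Gder G, lg_smooth Gder &
      forall (K : closedFieldType) (s : {rmorphism B -> K}) g,
        pts Gder s g <-> commutator_subgroup (pts G s) g].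

Definition lg_almost_simple (N : nat) (G : lingroup N) : Prop :=
  forall (K : closedFieldType) (s : {rmorphism B -> K}), is_almost_simple (pts G s).

Definition is_max_torus_quotient (N M : nat) (G : lingroup N) (C : lingroup M)
    (mu : lghom G C) : Prop :=
  (exists r, split_torus_rank C r) /\
  (forall (M' : nat) (C' : lingroup M') (f : lghom G C'),
     (exists r, split_torus_rank C' r) ->
     exists f' : lghom C C',
       (forall (A : comNzRingType) (s : {rmorphism B -> A}) g, pts G s g ->
          hom_at f s g = hom_at f' s (hom_at mu s g)) /\
       (forall f'' : lghom C C',
          (forall (A : comNzRingType) (s : {rmorphism B -> A}) g, pts G s g ->
             hom_at f s g = hom_at f'' s (hom_at mu s g)) ->
          forall (A : comNzRingType) (s : {rmorphism B -> A}) c, pts C s c ->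
             hom_at f'' s c = hom_at f' s c)).

Definition central_isogeny (N M : nat) (H : lingroup N) (H' : lingroup M)
    (f : lghom H H') : Prop :=
  [/\ (forall (K : closedFieldType) (s : {rmorphism B -> K}) h', pts H' s h' ->
         exists2 h, pts H s h & hom_at f s h = h'),
      (forall (A : comNzRingType) (s : {rmorphism B -> A}) z h,
         pts H s z -> hom_at f s z = 1%:M -> pts H s h -> z *m h = h *m z) &
      (forall (K : closedFieldType) (s : {rmorphism B -> K}),
         exists r : seq 'M[K]_N, forall z,
           pts H s z -> hom_at f s z = 1%:M -> z \in r)].

Definition is_simply_connected_cover (N M : nat) (H : lingroup N)
    (Hsc : lingroup M) (f : lghom Hsc H) : Prop :=
  [/\ lg_reductive Hsc, central_isogeny f &
      forall (M' : nat) (H' : lingroup M') (f' : lghom H' Hsc),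
        lg_reductive H' -> central_isogeny f' -> lg_iso f'].

(* The order of the centre (for reductive groups a finite flat group scheme of
   multiplicative type when finite), read on characteristic 0 geometric fibres,
   where it is etale. *)
Definition center_order (N : nat) (G : lingroup N) (z : nat) : Prop :=
  forall (K : closedFieldType) (s : {rmorphism B -> K}), [pchar K] =i pred0 ->
  exists e : 'I_z -> 'M[K]_N, injective e /\
    forall g, (pts G s g /\ forall x, pts G s x -> g *m x = x *m g)
              <-> exists i, g = e i.

(* The Lie algebra: matrices X with 1 + eps X in G(A[eps]). *)
Definition dual_mx (A : comNzRingType) (N : nat) (g X : 'M[A]_N) : 'M[dualnum A]_N :=
  \matrix_(i, j) ((g i j, X i j) : dualnum A).

Definition lie (N : nat) (G : lingroup N) (A : comNzRingType)
    (s : {rmorphism B -> A}) (X : 'M[A]_N) : Prop :=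
  pts G (dual_str s) (dual_mx 1%:M X).

Definition root_space (N : nat) (G T : lingroup N) (a : lgchar T)
    (X : 'M[B]_N) : Prop :=
  lie G (idfun : {rmorphism B -> B}) X /\
  (forall (A : comNzRingType) (s : {rmorphism B -> A}) t t',
     pts T s t -> inverses t t' ->
     t *m map_mx s X *m t' = chr_at a s t *: map_mx s X).

Definition is_root (N : nat) (G T : lingroup N) (a : lgchar T) : Prop :=
  ~ chr_trivial a /\ exists2 X, root_space G a X & X <> 0.

(* For an irreducible root system, #roots = h * (semisimple rank). *)
Definition coxeter_number (N M : nat) (G : lingroup N) (C : lingroup M)
    (h : nat) : Prop :=
  exists (T : lingroup N) (r c n : nat) (Phi : 'I_n -> lgchar T),
  [/\ split_maximal_torus G T,
      split_torus_rank T r /\ split_torus_rank C c,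
      (forall i, is_root G (Phi i)) /\
        (forall i j, chr_eq (Phi i) (Phi j) -> i = j),
      (forall a, is_root G a -> exists i, chr_eq a (Phi i)) &
      n = (h * (r - c))%N].

(* A parametrization x : G_a -> U_a of the root subgroup of [a]. *)
Record root_subgroup (N : nat) (G T : lingroup N) (a : lgchar T) := RootSubgroup {
  ru_at : forall (A : comNzRingType), {rmorphism B -> A} -> A -> 'M[A]_N;
  ru_pts : forall (A : comNzRingType) (s : {rmorphism B -> A}) u,
    pts G s (ru_at s u);
  ru_add : forall (A : comNzRingType) (s : {rmorphism B -> A}) u v,
    ru_at s (u + v) = ru_at s u *m ru_at s v;
  ru_inj : forall (A : comNzRingType) (s : {rmorphism B -> A}), injective (ru_at s);
  ru_nat : forall (A A' : comNzRingType) (s : {rmorphism B -> A})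
      (s' : {rmorphism B -> A'}) (f : {rmorphism A -> A'}) u,
    is_alg_hom s s' f -> ru_at s' (f u) = map_mx f (ru_at s u);
  ru_conj : forall (A : comNzRingType) (s : {rmorphism B -> A}) t t' u,
    pts T s t -> inverses t t' ->
    t *m ru_at s u *m t' = ru_at s (chr_at a s t * u) }.

(* [y] lies in H_a(A), where H_a = T U_a is a semidirect product, and the
   extension of [a] to H_a (trivial on U_a) takes the value [c] at [y]. *)
Definition in_Halpha (N : nat) (G T : lingroup N) (a : lgchar T)
    (x : root_subgroup G a) (A : comNzRingType) (s : {rmorphism B -> A})
    (y : 'M[A]_N) (c : A) : Prop :=
  exists t u, [/\ pts T s t, y = t *m ru_at x s u & chr_at a s t = c].

End GroupSchemes.

Definition lie_space (B : comNzRingType) (k : finFieldType) (N : nat)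
    (G : lingroup B N) (s : {rmorphism B -> k}) : {vspace 'M[k]_N} :=
  <<[seq X <- enum 'M[k]_N | `[< lie G s X >]]>>%VS.

(* [algC] is the algebraic closure of the number field [F], embedded by [iota].
   Places of F are represented by places of algC, two of which represent the
   same place of F when their restrictions agree; the absolute Galois group of
   F_v is the decomposition group of the chosen place above v. *)

Definition aut : Type := {rmorphism algC -> algC}.

Inductive place : Type :=
  | FinPlace of (algC -> Prop)   (* a maximal ideal of the ring Aint *)
  | InfPlace of aut.           (* the absolute value x |-> |t x| *)

Definition finite_place (P : algC -> Prop) : Prop :=
  [/\ (forall x, P x -> x \in Aint), P 0 /\ ~ P 1,
      (forall x y, P x -> P y -> P (x + y)) /\
        (forall a x, a \in Aint -> P x -> P (a * x)),
      (forall x y, x \in Aint -> y \in Aint -> P (x * y) -> P x \/ P y) &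
      exists2 x, P x & x <> 0].

Definition is_place (v : place) : Prop :=
  if v is FinPlace P then finite_place P else True.

Section Galois.
Variables (F : fieldExtType rat) (iota : {rmorphism F -> algC}).

Definition same_place (v w : place) : Prop :=
  match v, w with
  | FinPlace P, FinPlace P' => forall x, P (iota x) <-> P' (iota x)
  | InfPlace t, InfPlace t' => forall x, `|t (iota x)| = `|t' (iota x)|
  | _, _ => False
  end.

Definition absgal (s : aut) : Prop := forall x, s (iota x) = iota x.

Definition dec (v : place) (s : aut) : Prop :=
  absgal s /\ match v with
           | FinPlace P => forall x, P (s x) <-> P x
           | InfPlace t => forall x, `|t (s x)| = `|t x|
           end.

Definition inert (P : algC -> Prop) (s : aut) : Prop :=
  dec (FinPlace P) s /\ forall x, x \in Aint -> P (s x - x).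

Definition frob (P : algC -> Prop) (n : nat) (s : aut) : Prop :=
  dec (FinPlace P) s /\ forall x, x \in Aint -> P (s x - x ^+ n).

(* The residue field of F at P has n elements. *)
Definition place_norm (P : algC -> Prop) (n : nat) : Prop :=
  exists t : 'I_n -> F, (forall i, iota (t i) \in Aint) /\
    forall x, iota x \in Aint -> exists! i, P (iota x - iota (t i)).

Definition elt (H : aut -> Prop) : Type := {s : aut | H s}.

Definition is_comp (H : aut -> Prop) (u s t : elt H) : Prop :=
  forall x, sval u x = sval s (sval t x).

Definition agree_on (H : aut -> Prop) (e : seq algC) (s t : elt H) : Prop :=
  forall x, x \in e -> sval s x = sval t x.

Definition restr (v : place) (X : Type) (f : elt absgal -> X) : elt (dec v) -> X :=
  fun s => f (exist _ (sval s) (proj1 (svalP s))).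

(* The maximal extension of F unramified outside the places [v i], i in I, and
   the infinite places. *)
Definition max_unram (I : Type) (v : I -> place) (x : algC) : Prop :=
  forall P, finite_place P -> (forall i, ~ same_place (v i) (FinPlace P)) ->
  forall s, inert P s -> s x = x.

(* f is a function on the quotient Gal(max_unram v / F) of Gal(algC / F). *)
Definition factors (I : Type) (v : I -> place) (X : Type) (f : elt absgal -> X) : Prop :=
  forall s t : elt absgal, (forall x, max_unram v x -> sval s x = sval t x) -> f s = f t.

Definition locally_constant (H : aut -> Prop) (X : Type) (f : elt H -> X) : Prop :=
  forall s, exists e, forall t, agree_on e s t -> f t = f s.

Definition adically_continuous (H : aut -> Prop) (A : comNzRingType) (N : nat)
    (m : A -> Prop) (f : elt H -> 'M[A]_N) : Prop :=
  forall n s, exists e, forall t, agree_on e s t ->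
    forall i j, idpow m n (f t i j - f s i j).

Definition is_cyclotomic (p : nat) (W : comNzRingType) (kap : elt absgal -> W) : Prop :=
  forall (s : elt absgal) n z a, (p ^ n)%N.-primitive_root z -> sval s z = z ^+ a ->
    pdiv_pow p n (kap s - a%:R).

Section Cohomology.
Variables (k : fieldType) (V : lmodType k).

Definition cocycle (H : aut -> Prop) (act : elt H -> V -> V) (c : elt H -> V) : Prop :=
  locally_constant c /\ (forall u s t, is_comp u s t -> c u = c s + act s (c t)).

Definition coboundary (H : aut -> Prop) (act : elt H -> V -> V) (c : elt H -> V) : Prop :=
  exists x, forall s, c s = act s x - x.

(* Cocycles whose classes lie in the Selmer group; [L i] is the set of cocycles
   representing the classes of the local condition at [v i]. *)
Definition selmer (act : elt absgal -> V -> V) (I : Type) (v : I -> place)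
    (L : forall i, (elt (dec (v i)) -> V) -> Prop) (c : elt absgal -> V) : Prop :=
  [/\ cocycle act c, factors v c & forall i, L i (restr c)].

Definition class_dim (act : elt absgal -> V -> V) (Z : (elt absgal -> V) -> Prop)
    (n : nat) : Prop :=
  exists b : 'I_n -> elt absgal -> V, (forall i, Z (b i)) /\
    forall c, Z c -> exists! a : {ffun 'I_n -> k},
      coboundary act (fun s => c s - \sum_i a i *: b i s).

End Cohomology.

Section Deformations.
Variables (p : nat) (k : finFieldType) (W : comNzRingType).
Variable res : {rmorphism W -> k}.
Variables (N M : nat) (G : lingroup W N) (Gder : lingroup W N) (C : lingroup W M).
Variable mu : lghom G C.
Variable kap : elt absgal -> W.

Definition is_rep (H : aut -> Prop) (n : nat) (X : lingroup W n) (A : comNzRingType)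
    (str : {rmorphism W -> A}) (m : A -> Prop) (rho : elt H -> 'M[A]_n) : Prop :=
  [/\ (forall s, pts X str (rho s)),
      (forall u s t, is_comp u s t -> rho u = rho s *m rho t) &
      adically_continuous m rho].

Section Lifts.
Variables (rhob : elt absgal -> 'M[k]_N) (nu : elt absgal -> 'M[W]_M).

Definition is_lift (H : aut -> Prop) (rb : elt H -> 'M[k]_N) (n : elt H -> 'M[W]_M)
    (A : comNzRingType) (str : {rmorphism W -> A}) (red : {rmorphism A -> k})
    (rho : elt H -> 'M[A]_N) : Prop :=
  [/\ is_rep G str (rker red) rho,
      (forall s, map_mx red (rho s) = rb s) &
      (forall s, hom_at mu str (rho s) = map_mx str (n s))].

(* The pairs (g, g^-1) with g in ker(G(A) -> G(k)). *)
Definition Ghat (A : comNzRingType) (str : {rmorphism W -> A})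
    (red : {rmorphism A -> k}) (g g' : 'M[A]_N) : Prop :=
  [/\ pts G str g, inverses g g' & map_mx red g = 1%:M].

Definition strictly_equiv (H : aut -> Prop) (A : comNzRingType)
    (str : {rmorphism W -> A}) (red : {rmorphism A -> k})
    (rho rho' : elt H -> 'M[A]_N) : Prop :=
  exists g g', Ghat str red g g' /\ forall s, rho' s = g *m rho s *m g'.

Definition loc_lift (v : place) (A : comNzRingType) (str : {rmorphism W -> A})
    (red : {rmorphism A -> k}) (rho : elt (dec v) -> 'M[A]_N) : Prop :=
  is_lift (restr rhob) (restr nu) str red rho.

Definition loc_cond (v : place) : Type :=
  forall A : comNzRingType, {rmorphism W -> A} -> {rmorphism A -> k} ->
    (elt (dec v) -> 'M[A]_N) -> Prop.

Definition is_deformation_condition (v : place) (D : loc_cond v) : Prop :=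
  [/\ (forall (A : comNzRingType) (str : {rmorphism W -> A})
          (red : {rmorphism A -> k}) rho,
         D A str red rho -> is_coef res str red /\ loc_lift str red rho),
      D k res (idfun : {rmorphism k -> k}) (restr rhob),
      (forall (A : comNzRingType) (str : {rmorphism W -> A})
          (red : {rmorphism A -> k}) rho rho',
         D A str red rho -> strictly_equiv str red rho rho' -> D A str red rho') &
      (* relative representability, by a quotient of the base *)
      (forall (A : comNzRingType) (str : {rmorphism W -> A})
          (red : {rmorphism A -> k}) rho,
         is_coef res str red -> loc_lift str red rho ->
         exists I : A -> Prop, is_ideal I /\
           forall (A' : comNzRingType) (str' : {rmorphism W -> A'})
             (red' : {rmorphism A' -> k}) (f : {rmorphism A -> A'}),
             is_coef res str' red' -> is_coef_hom str red str' red' f ->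
             (D A' str' red' (fun s => map_mx f (rho s)) <->
              forall x, I x -> f x = 0))].

Definition is_smooth_condition (v : place) (D : loc_cond v) : Prop :=
  forall (A A' : comNzRingType) (str : {rmorphism W -> A}) (red : {rmorphism A -> k})
    (str' : {rmorphism W -> A'}) (red' : {rmorphism A' -> k})
    (f : {rmorphism A' -> A}) rho,
    is_coef res str red -> is_coef res str' red' ->
    is_coef_hom str' red' str red f -> (forall y, exists x, f x = y) ->
    D A str red rho ->
    exists2 rho', D A' str' red' rho' & forall s, map_mx f (rho' s) = rho s.

Definition special_lift (T : lingroup W N) (a : lgchar T) (x : root_subgroup G a)
    (v : place) : loc_cond v :=
  fun A str red rho => loc_lift str red rho /\
    exists rho', strictly_equiv str red rho rho' /\
      forall s, in_Halpha x str (rho' s) (str (restr kap s)).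

Definition special_mod (T : lingroup W N) (a : lgchar T) (x : root_subgroup G a)
    (v : place) (n : nat) (rho : elt absgal -> 'M[W]_N) : Prop :=
  exists (A : comNzRingType) (str : {rmorphism W -> A}) (red : {rmorphism A -> k}),
    is_trunc p n res str red /\
    special_lift x str red (restr (v := v) (fun s => map_mx str (rho s))).

Definition congruent_mod (n : nat) (rho rho' : elt absgal -> 'M[W]_N) : Prop :=
  exists (A : comNzRingType) (str : {rmorphism W -> A}) (red : {rmorphism A -> k}),
    is_trunc p n res str red /\
    strictly_equiv str red (fun s => map_mx str (rho s))
                           (fun s => map_mx str (rho' s)).

Definition unramified_mod (P : algC -> Prop) (n : nat) (rho : elt absgal -> 'M[W]_N) : Prop :=
  forall s : elt absgal, inert P (sval s) ->
    forall i j, pdiv_pow p n (rho s i j - (1%:M : 'M[W]_N) i j).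

Definition glob_lift (I : Type) (v : I -> place) (D : forall i, loc_cond (v i))
    (A : comNzRingType) (str : {rmorphism W -> A}) (red : {rmorphism A -> k})
    (rho : elt absgal -> 'M[A]_N) : Prop :=
  [/\ is_lift rhob nu str red rho, factors v rho &
      forall i, D i A str red (restr rho)].

Definition is_universal (I : Type) (v : I -> place) (D : forall i, loc_cond (v i))
    (R : comNzRingType) (strR : {rmorphism W -> R}) (redR : {rmorphism R -> k})
    (rhoR : elt absgal -> 'M[R]_N) : Prop :=
  [/\ is_coef res strR redR, glob_lift D strR redR rhoR &
      forall (A : comNzRingType) (str : {rmorphism W -> A})
        (red : {rmorphism A -> k}) rho,
        is_coef res str red -> glob_lift D str red rho ->
        exists f : {rmorphism R -> A},
          [/\ is_coef_hom strR redR str red f,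
              strictly_equiv str red (fun s => map_mx f (rhoR s)) rho &
              forall f' : {rmorphism R -> A},
                is_coef_hom strR redR str red f' ->
                strictly_equiv str red (fun s => map_mx f' (rhoR s)) rho ->
                f' =1 f]].

Let gder := lie_space Gder res.

Definition ad_act (H : aut -> Prop) (rb : elt H -> 'M[k]_N) (s : elt H)
    (X : subvs_of gder) : subvs_of gder :=
  vsproj gder (rb s *m vsval X *m invmx (rb s)).

Definition addual_act (H : aut -> Prop) (rb : elt H -> 'M[k]_N) (kp : elt H -> W)
    (s : elt H) (f : 'Hom(subvs_of gder, k^o)) : 'Hom(subvs_of gder, k^o) :=
  linfun (fun X : subvs_of gder =>
    res (kp s) *: f (vsproj gder (invmx (rb s) *m vsval X *m rb s))).

Definition tangent (v : place) (D : loc_cond v) (c : elt (dec v) -> subvs_of gder) :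
    Prop :=
  cocycle (ad_act (restr rhob)) c /\
  D (dualnum k) (dual_str res) (@dual_red k)
    (fun s => dual_mx (restr rhob s) (vsval (c s) *m restr rhob s)).

(* The annihilator under the cup product
   H^1(M) x H^1(M^* ) -> H^2(k(kappa)), which is the local Tate pairing up to
   identifying the target with (a subspace of) k. *)
Definition tate_perp (v : place) (L : (elt (dec v) -> subvs_of gder) -> Prop)
    (c' : elt (dec v) -> 'Hom(subvs_of gder, k^o)) : Prop :=
  cocycle (addual_act (restr rhob) (restr kap)) c' /\
  (forall c, L c -> exists b : elt (dec v) -> k, locally_constant b /\
     forall u s t, is_comp u s t ->
       addual_act (restr rhob) (restr kap) s (c' t) (c s) =
       res (restr kap s) * b t - b u + b s).

Definition ad_selmer (I : Type) (v : I -> place) (D : forall i, loc_cond (v i)) :=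
  selmer (ad_act rhob) (fun i => @tangent (v i) (D i)).

Definition ad_dual_selmer (I : Type) (v : I -> place) (D : forall i, loc_cond (v i)) :=
  selmer (addual_act rhob kap) (fun i => tate_perp (@tangent (v i) (D i))).

End Lifts.

Record nice_data := NiceData {
  nice_place : algC -> Prop;
  nice_torus : lingroup W N;
  nice_root : lgchar nice_torus;
  nice_unip : root_subgroup G nice_root }.

Definition acts_by_kappa (rhob : elt absgal -> 'M[k]_N) (v : place) (T : lingroup W N)
    (a : lgchar T) : Prop :=
  forall (s : elt (dec v)) X, root_space G a X ->
    restr rhob s *m map_mx res X *m invmx (restr rhob s)
      = res (restr kap s) *: map_mx res X.

Definition is_nice (rhob : elt absgal -> 'M[k]_N) (q : nice_data) : Prop :=
  let P := nice_place q in let T := nice_torus q in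
  [/\ finite_place P /\ ~ P p%:R,
      (exists n, [/\ place_norm P n, n <> 1 %[mod p], n.+1 <> 0 %[mod p] &
         forall s : elt absgal, frob P n (sval s) ->
         forall (K : closedFieldType) (j : {rmorphism k -> K}),
           is_semisimple_mx (map_mx j (rhob s)) /\
           (forall x, pts T (j \o res : {rmorphism W -> K}) x <->
              identity_component
                (centralizer (pts G (j \o res : {rmorphism W -> K}))
                             (map_mx j (rhob s))) x)]),
      (forall s : elt absgal, inert P (sval s) -> rhob s = 1%:M),
      split_maximal_torus G T &
      [/\ is_root G (nice_root q), acts_by_kappa rhob (FinPlace P) (nice_root q) &
          forall b : lgchar T, is_root G b -> acts_by_kappa rhob (FinPlace P) b ->
            chr_eq b (nice_root q)]].

(* The places of S together with the nice primes q_j, j in J. *)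
Definition SQ_index (ns m : nat) (J : {set 'I_m}) : Type :=
  ('I_ns + {j : 'I_m | j \in J})%type.

Definition SQ_place (ns m : nat) (vS : 'I_ns -> place) (q : 'I_m -> nice_data)
    (J : {set 'I_m}) (i : SQ_index ns J) : place :=
  match i with
  | inl a => vS a
  | inr j => FinPlace (nice_place (q (sval j)))
  end.

Definition SQ_new (rhob : elt absgal -> 'M[k]_N) (nu : elt absgal -> 'M[W]_M)
    (ns m : nat) (vS : 'I_ns -> place) (DS : forall a, loc_cond (vS a))
    (q : 'I_m -> nice_data) (J : {set 'I_m}) (i : SQ_index ns J) :
    loc_cond (SQ_place vS q i) :=
  match i with
  | inl a => DS a
  | inr j => special_lift rhob nu (nice_unip (q (sval j)))
                          (v := FinPlace (nice_place (q (sval j))))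
  end.

Definition SQ_old (rhob : elt absgal -> 'M[k]_N) (nu : elt absgal -> 'M[W]_M)
    (ns m : nat) (vS : 'I_ns -> place) (DS : forall a, loc_cond (vS a))
    (q : 'I_m -> nice_data) (J : {set 'I_m}) (i : SQ_index ns J) :
    loc_cond (SQ_place vS q i) :=
  match i with
  | inl a => DS a
  | inr j => @loc_lift rhob nu (FinPlace (nice_place (q (sval j))))
  end.

Definition is_auxiliary (rhob : elt absgal -> 'M[k]_N) (nu : elt absgal -> 'M[W]_M)
    (ns m : nat) (vS : 'I_ns -> place) (DS : forall a, loc_cond (vS a))
    (q : 'I_m -> nice_data) (J : {set 'I_m}) : Prop :=
  forall c, ad_selmer rhob (@SQ_new rhob nu ns m vS DS q J) c ->
    coboundary (ad_act rhob) c.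

End Deformations.

(* S represents a finite set of places of F containing those above p and the
   infinite ones. *)
Definition is_place_set (p ns : nat) (vS : 'I_ns -> place) : Prop :=
  [/\ (forall a, is_place (vS a)),
      (forall a b, same_place (vS a) (vS b) -> a = b),
      (forall P, finite_place P -> P p%:R -> exists a, same_place (vS a) (FinPlace P)) &
      (forall t, exists a, same_place (vS a) (InfPlace t))].

(* [F(mu_p) : F] = d *)
Definition cyclotomic_degree (p d : nat) : Prop :=
  exists (z : algC) (f : {poly F}),
    [/\ p.-primitive_root z, f \is monic, irreducible_poly f,
        root (map_poly iota f) z & size f = d.+1].

End Galois.

Arguments SQ_new {F iota k W N M G C} mu kap rhob nu {ns m vS} DS q J i A _ _ _.
Arguments SQ_old {F iota k W N M G C} mu rhob nu {ns m vS} DS q J i A _ _ _.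

(* Main.v *)
(* No global duality is needed.  Write K for the kernel of pi and D = d - 1; hypotheses (a) and (b)
   force m_q = D for every q in Q.  At q_i, conjugate the universal lift so that modulo K it lies in
   H_alpha and sends Frobenius into T; then Frobenius goes to (1 + X) t with X over K, and y_i is the
   coordinate of [X, e_alpha] along the root vector e_alpha.

   - A lift to a square-zero extension of a special lift is special as soon as this coordinate
     vanishes: the ad(Frobenius)-invariants of Lie G are Lie T, and by niceness the eigenspace of the
     norm of q is the root line.  Universality of the Q-new and of the unrestricted ring then gives
     K = (y_1, ..., y_m).
   - The tame relation at an inertia element ramified mod p^d gives p^D y_i in K^2 + p^(2D) K, hence
     p^D K is contained in K^2 by Nakayama.
   - The auxiliary deformations give points x_i of the unrestricted ring congruent to pi mod p^D.
     Being special at q_j for j < i, and not special mod p^d at q_i, they satisfy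
     x_i(y_j) = 0 mod p^d for j < i and x_i(y_i) <> 0 mod p^d, so kappa |-> (x_i(kappa) / p^D)_i is
     triangular on the y_j with unit diagonal and identifies K/K^2 with (W/p^D)^m.
   - The determinant of p^D - (kappa_jl), where p^D y_j = sum kappa_jl y_l, kills K and is not in K,
     whence the irreducible component.

   The eigenspace statements come from arcs in the centralizer of Frobenius, and from the trace form
   in characteristic 0 for multiplicity one of roots; inertia is controlled by lifting
   automorphisms of residue rings to algC. *)
Require Import Defs.
From HB Require Import structures.
From mathcomp Require Import all_boot all_order all_algebra all_field.
From mathcomp Require Import mpoly boolp zify ring.
From mathcomp Require classical_sets.

Set Implicit Arguments.
Unset Strict Implicit.
Unset Printing Implicit Defensive.

Import Order.TTheory GRing.Theory Num.Theory.
Local Open Scope ring_scope.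

(** * Quotient rings and algebraic closures *)

(** Reductivity, the maximal torus and regularity of Frobenius are given on points over
    algebraically closed fields only, while the deformations live over [W], [R] and their quotients.
    Hence the algebraic closures of arbitrary fields, used for the fraction fields of [W] and of
    k[[t]], and hence the direct treatment of root spaces: multiplicity one is an sl2-string
    argument over a closed field of characteristic 0, descended to [W] and reduced to [k]. No
    completion of [F] occurs: decomposition groups are groups of automorphisms of [algC], and the
    tame relation holds up to an element [d] whose order on every finite set is prime to [p]; a
    continuous representation that is residually trivial at [d] is trivial there. Specialness is
    tested along an element [w] whose annihilator is the maximal ideal, so that a lift near a
    special one is measured by a cocycle with values in the Lie algebra over [k]. The term p^(2D) K
    appears because root group elements u(z), with z equal to p^D times a unit, are expanded to
    first order only. *)

Lemma ex_rmorphism (A B : nzRingType) (f : A -> B) :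
  (forall x y, f (x + y) = f x + f y) -> f 1 = 1 ->
  (forall x y, f (x * y) = f x * f y) ->
  exists g : {rmorphism A -> B}, forall x, g x = f x.
Proof.
move=> fD f1 fM.
have f0 : f 0 = 0 by apply: (addrI (f 0)); rewrite -fD !addr0.
have fB : zmod_morphism f.
  move=> x y; apply/eqP; rewrite eq_sym subr_eq; apply/eqP.
  by rewrite -fD subrK.
have fMM : monoid_morphism f by split.
pose m1 := GRing.isZmodMorphism.Build A B f fB.
pose m2 := GRing.isMonoidMorphism.Build A B f fMM.
pose g : {rmorphism A -> B} := HB.pack f m1 m2.
by exists g.
Qed.

Section IdealQuotient.
Variables (A : comNzRingType) (I : A -> Prop) (hI : is_ideal I) (h1 : ~ I 1).

Let I0 : I 0. Proof. by case: hI. Qed.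
Let ID x y : I x -> I y -> I (x + y). Proof. by case: hI => _ D _; apply: D. Qed.
Let IM a x : I x -> I (a * x). Proof. by case: hI => _ _; apply. Qed.
Let IN x : I x -> I (- x). Proof. by rewrite -mulN1r; apply: IM. Qed.

Definition idl_pick (P : A -> Prop) : A :=
  if pselect (exists y, P y) is left e then sval (cid e) else 0.
Definition idl_rep (x : A) : A := idl_pick (fun y => I (y - x)).

Lemma idl_repP x : I (idl_rep x - x).
Proof.
rewrite /idl_rep /idl_pick; case: pselect => [e | []]; first exact: svalP (cid e).
by exists x; rewrite subrr.
Qed.

Lemma idl_rep_eq x y : I (x - y) -> idl_rep x = idl_rep y.
Proof.
move=> xy; congr idl_pick; apply: funext => z; apply: propext; split=> h.
  by have := ID h xy; rewrite addrA subrK.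
by have := ID h (IN xy); rewrite opprB addrA subrK.
Qed.

(** Elements are the representatives picked by [idl_rep], so that equality of classes is plain
    equality. The two proofs are phantom arguments on which the ring structure depends. *)
Definition idl_quot of is_ideal I & ~ I 1 := {x : A | idl_rep x == x}.
Local Notation B := (idl_quot hI h1).

HB.instance Definition _ := Choice.copy B {x : A | idl_rep x == x}.

Fact idl_proj_subproof x : idl_rep (idl_rep x) == idl_rep x.
Proof. by apply/eqP/idl_rep_eq/idl_repP. Qed.
Definition idl_proj (x : A) : B :=
  exist _ (idl_rep x) (idl_proj_subproof x).
Let sval_inj (u v : B) : sval u = sval v -> u = v := @val_inj _ _ {x : A | idl_rep x == x} u v.

Lemma idl_proj_eq x y : idl_proj x = idl_proj y <-> I (x - y).
Proof.
split=> [/(congr1 sval) /= e | xy]; last by apply: sval_inj; apply: idl_rep_eq.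
have := ID (IN (idl_repP x)) (idl_repP y); by rewrite e opprB addrA subrK.
Qed.

Lemma idl_val_proj (u : B) : idl_proj (sval u) = u.
Proof. by apply: sval_inj; exact: (eqP (svalP u)). Qed.

Definition idl_add (u v : B) : B := idl_proj (sval u + sval v).
Definition idl_opp (u : B) : B := idl_proj (- sval u).
Definition idl_mul (u v : B) : B := idl_proj (sval u * sval v).

Lemma idl_projD x y : idl_proj (x + y) = idl_add (idl_proj x) (idl_proj y).
Proof.
apply/idl_proj_eq; rewrite opprD addrACA -opprB -[y - _]opprB.
by apply: ID; apply: IN; apply: idl_repP.
Qed.
Lemma idl_projN x : idl_proj (- x) = idl_opp (idl_proj x).
Proof. by apply/idl_proj_eq; rewrite opprK addrC; apply: idl_repP. Qed.
Lemma idl_projM x y : idl_proj (x * y) = idl_mul (idl_proj x) (idl_proj y).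
Proof.
apply/idl_proj_eq; rewrite /= -opprB; apply: IN.
have -> : idl_rep x * idl_rep y - x * y =
  idl_rep x * (idl_rep y - y) + y * (idl_rep x - x) by ring.
by apply: ID; apply: IM; apply: idl_repP.
Qed.

Lemma idl_addA : associative idl_add.
Proof.
move=> u v w; rewrite -[u]idl_val_proj -[v]idl_val_proj -[w]idl_val_proj.
by rewrite -!idl_projD addrA.
Qed.
Lemma idl_addC : commutative idl_add.
Proof. by move=> u v; rewrite /idl_add addrC. Qed.
Lemma idl_add0 : left_id (idl_proj 0) idl_add.
Proof. by move=> u; rewrite -[u]idl_val_proj -idl_projD add0r. Qed.
Lemma idl_addN : left_inverse (idl_proj 0) idl_opp idl_add.
Proof. by move=> u; rewrite -[u]idl_val_proj -idl_projN -idl_projD addNr. Qed.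
Lemma idl_mulA : associative idl_mul.
Proof.
move=> u v w; rewrite -[u]idl_val_proj -[v]idl_val_proj -[w]idl_val_proj.
by rewrite -!idl_projM mulrA.
Qed.
Lemma idl_mulC : commutative idl_mul.
Proof. by move=> u v; rewrite /idl_mul mulrC. Qed.
Lemma idl_mul1 : left_id (idl_proj 1) idl_mul.
Proof. by move=> u; rewrite -[u]idl_val_proj -idl_projM mul1r. Qed.
Lemma idl_mulDl : left_distributive idl_mul idl_add.
Proof.
move=> u v w; rewrite -[u]idl_val_proj -[v]idl_val_proj -[w]idl_val_proj.
by rewrite -idl_projD -!idl_projM -idl_projD mulrDl.
Qed.
Lemma idl_1neq0 : idl_proj 1 != idl_proj 0.
Proof. by apply/eqP => /idl_proj_eq; rewrite subr0. Qed.

HB.instance Definition _ := GRing.isZmodule.Build B idl_addA idl_addC idl_add0 idl_addN.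
HB.instance Definition _ := GRing.Zmodule_isComNzRing.Build B
  idl_mulA idl_mulC idl_mul1 idl_mulDl idl_1neq0.

End IdealQuotient.

Lemma quotient_ring (A : comNzRingType) (I : A -> Prop) :
  is_ideal I -> ~ I 1 ->
  exists (B : comNzRingType) (f : {rmorphism A -> B}),
    (forall y, exists x, f x = y) /\ (forall x, f x = 0 <-> I x).
Proof.
move=> hI h1; exists (idl_quot hI h1).
have [||| f fE] := @ex_rmorphism A (idl_quot hI h1) (idl_proj hI h1).
- exact: idl_projD.
- by [].
- exact: idl_projM.
exists f; split=> [y | x].
  by exists (sval y); rewrite fE idl_val_proj.
rewrite fE; split=> [e | Ix].
  by have /idl_proj_eq := e; rewrite subr0.
by apply/idl_proj_eq; rewrite subr0.
Qed.

Lemma rker_ideal (A B : comNzRingType) (f : {rmorphism A -> B}) : is_ideal (rker f).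
Proof.
split=> [|x y|a x]; rewrite /rker ?rmorph0 // ?rmorphD ?rmorphM.
  by move=> -> ->; rewrite addr0.
by move=> ->; rewrite mulr0.
Qed.

Lemma factor_rmorphism (A B C : comNzRingType) (f : {rmorphism A -> B})
    (g : {rmorphism A -> C}) :
  (forall y, exists x, f x = y) -> (forall x, f x = 0 -> g x = 0) ->
  exists h : {rmorphism B -> C}, forall x, h (f x) = g x.
Proof.
move=> fs fg; pose r y := sval (cid (fs y)).
have fr y : f (r y) = y by apply: svalP (cid (fs y)).
have gf x y : f x = f y -> g x = g y.
  move=> e; apply/eqP; rewrite -subr_eq0 -rmorphB; apply/eqP/fg.
  by rewrite rmorphB e subrr.
have [||| h hE] := @ex_rmorphism B C (g \o r).
- by move=> x y /=; rewrite -rmorphD; apply: gf; rewrite rmorphD !fr.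
- by rewrite /= -(rmorph1 g); apply: gf; rewrite fr rmorph1.
- by move=> x y /=; rewrite -rmorphM; apply: gf; rewrite rmorphM !fr.
by exists h => x; rewrite hE /=; apply: gf; rewrite fr.
Qed.

(** Zorn's lemma on the sets [X] whose union with [I] is a proper ideal; adding [I] makes the union
    of the empty chain admissible. *)
Lemma ex_maximal_ideal (A : comNzRingType) (I : A -> Prop) :
  is_ideal I -> ~ I 1 ->
  exists J : A -> Prop, [/\ is_ideal J, ~ J 1, (forall x, I x -> J x) &
    forall x, ~ J x -> exists y, J (x * y - 1)].
Proof.
move=> hI h1; pose cl (X : A -> Prop) x := X x \/ I x.
pose P (X : A -> Prop) := is_ideal (cl X) /\ ~ cl X 1.
have [|X [[PX PX1] maxX]] := @classical_sets.Zorn_bigcup A P.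
  move=> C CP tot.
  have inC x y : cl (fun z => exists2 X, C X & X z) x ->
      cl (fun z => exists2 X, C X & X z) y ->
      (I x /\ I y) \/ exists X, [/\ C X, cl X x & cl X y].
    move=> [[X CX Xx]|Ix] [[Y CY Yy]|Iy]; last by left.
    - have [XY|YX] := tot X Y CX CY; right.
        by exists Y; split=> //; left=> //; apply: XY.
      by exists X; split=> //; left=> //; apply: YX.
    - by right; exists X; split=> //; [left | right].
    - by right; exists Y; split=> //; [right | left].
  split.
    split=> [|x y hx hy|a x hx]; first by right; case: hI.
      have [[Ix Iy]|[X [CX Xx Xy]]] := inC x y hx hy.
        by right; case: hI => _ D _; apply: D.
      have [[_ D _] _] := CP X CX.
      by have [?|?] := D _ _ Xx Xy; [left; exists X | right].
    have [[Ix _]|[X [CX Xx _]]] := inC x x hx hx.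
      by right; case: hI => _ _; apply.
    have [[_ _ M] _] := CP X CX.
    by have [?|?] := M a _ Xx; [left; exists X | right].
  move=> hc; have [[]//|[X [CX Xx _]]] := inC 1 1 hc hc.
  by have [_] := CP X CX; apply.
exists (cl X); split=> //; first by right.
move=> x nx; apply: contrapT => ny.
(* The ideal generated by [cl X] and [x]; if [x] is not invertible modulo [cl X] it is proper and
   contradicts maximality. *)
pose Y z := exists a m, cl X m /\ z = a * x + m.
have [X0 XD XM] := PX.
have YI z : Y z \/ I z -> Y z.
  case=> // Iz; exists 0, z; split; first by right.
  by rewrite mul0r add0r.
apply: (maxX Y); last first.
  split; last first.
    move/YI=> [a [m [Xm e]]]; apply: ny; exists a.
    by rewrite e mulrC opprD addrA subrr add0r -mulN1r; apply: XM.
  split=> [|z w /YI [a [m [Xm ->]]] /YI [b [n [Xn ->]]]|c z /YI [a [m [Xm ->]]]].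
  - by left; exists 0, 0; rewrite mul0r addr0.
  - left; exists (a + b), (m + n); split; first exact: XD.
    by rewrite mulrDl addrACA.
  - left; exists (c * a), (c * m); split; first exact: XM.
    by rewrite mulrDr mulrA.
split.
  move=> z Xz; exists 0, z; rewrite mul0r add0r; split=> //.
  by left.
move=> YX; apply: nx; left; apply: YX.
by exists 1, 0; rewrite mul1r addr0.
Qed.

Lemma ex_closed_field (B : comNzRingType) :
  (forall x : B, x <> 0 -> exists y, x * y = 1) ->
  (forall n (P : nat -> B), (0 < n)%N ->
     exists x : B, x ^+ n = \sum_(i < n) P i * x ^+ i) ->
  exists (K : closedFieldType) (f : {rmorphism B -> K}), injective f.
Proof.
move=> hinv hroot.
pose inv (x : B) := if pselect (x <> 0) is left h then sval (cid (hinv x h)) else 0.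
have mulVf (x : B) : x != 0 -> inv x * x = 1.
  move=> /eqP hx; rewrite /inv; case: pselect => // h.
  by rewrite mulrC; apply: svalP (cid (hinv x h)).
have inv0 : inv 0 = 0 by rewrite /inv; case: pselect.
pose mF := GRing.ComNzRing_isField.Build B mulVf inv0.
pose F : fieldType := HB.pack_for fieldType B mF.
pose mK := Field_isAlgClosed.Build F hroot.
pose K : closedFieldType := HB.pack_for closedFieldType B F mK.
by exists K, (GRing.RMorphism.clone B K idfun _).
Qed.

Section DependentProduct.
Variables (T : Type) (t0 : T) (K : T -> comNzRingType).

(** The phantom argument [t0] witnesses that the index type is inhabited, which makes 1 differ from
    0 in the product. *)
Definition dep_prod of T := forall i, K i.
Local Notation P := (dep_prod t0).

HB.instance Definition _ := gen_eqMixin P.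
HB.instance Definition _ := gen_choiceMixin P.

Definition dp_zero : P := fun i => 0.
Definition dp_one : P := fun i => 1.
Definition dp_opp (u : P) : P := fun i => - u i.
Definition dp_add (u v : P) : P := fun i => u i + v i.
Definition dp_mul (u v : P) : P := fun i => u i * v i.

Lemma dp_addA : associative dp_add.
Proof. by move=> u v w; apply: functional_extensionality_dep => i; rewrite /dp_add addrA. Qed.
Lemma dp_addC : commutative dp_add.
Proof. by move=> u v; apply: functional_extensionality_dep => i; rewrite /dp_add addrC. Qed.
Lemma dp_add0 : left_id dp_zero dp_add.
Proof. by move=> u; apply: functional_extensionality_dep => i; rewrite /dp_add add0r. Qed.
Lemma dp_addN : left_inverse dp_zero dp_opp dp_add.
Proof. by move=> u; apply: functional_extensionality_dep => i; rewrite /dp_add addNr. Qed.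
Lemma dp_mulA : associative dp_mul.
Proof. by move=> u v w; apply: functional_extensionality_dep => i; rewrite /dp_mul mulrA. Qed.
Lemma dp_mulC : commutative dp_mul.
Proof. by move=> u v; apply: functional_extensionality_dep => i; rewrite /dp_mul mulrC. Qed.
Lemma dp_mul1 : left_id dp_one dp_mul.
Proof. by move=> u; apply: functional_extensionality_dep => i; rewrite /dp_mul mul1r. Qed.
Lemma dp_mulDl : left_distributive dp_mul dp_add.
Proof. by move=> u v w; apply: functional_extensionality_dep => i; rewrite /dp_mul /dp_add mulrDl. Qed.
Lemma dp_1neq0 : dp_one != dp_zero.
Proof. by apply/eqP => /(congr1 (fun u : P => u t0)) /eqP; rewrite oner_eq0. Qed.

HB.instance Definition _ := GRing.isZmodule.Build P dp_addA dp_addC dp_add0 dp_addN.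
HB.instance Definition _ := GRing.Zmodule_isComNzRing.Build P
  dp_mulA dp_mulC dp_mul1 dp_mulDl dp_1neq0.

Lemma dp_exprE (u : P) n i : (u ^+ n) i = u i ^+ n.
Proof. by elim: n => [|n IH]; rewrite ?expr0 // !exprS -IH. Qed.
Lemma dp_sumE n (u : nat -> P) i : (\sum_(j < n) u j) i = \sum_(j < n) u j i.
Proof. by elim: n => [|n IH]; rewrite ?big_ord0 // !big_ord_recr /= -IH. Qed.

End DependentProduct.

Section CountableSubfield.
Variables (F : fieldType) (s : seq F).

(** Field expressions in the members of [s], coded by trees so that their values form a countable
    field, the case in which [countable_algebraic_closure] applies. *)
Fixpoint tree_val (t : GenTree.tree nat) : F :=
  match t with
  | GenTree.Leaf i => s`_i
  | GenTree.Node 0 [:: a; b] => tree_val a - tree_val b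
  | GenTree.Node 1 [:: a; b] => tree_val a / tree_val b
  | GenTree.Node 2 _ => 1
  | _ => 0
  end.

Definition gen_subfield : {pred F} := fun x => `[< exists t, x = tree_val t >].

Fact gen_subfield_divring : divring_closed gen_subfield.
Proof.
split; first by apply/asboolP; exists (GenTree.Node 2 [::]).
  move=> x y /asboolP[t ->] /asboolP[u ->]; apply/asboolP.
  by exists (GenTree.Node 0 [:: t; u]).
move=> x y /asboolP[t ->] /asboolP[u ->]; apply/asboolP.
by exists (GenTree.Node 1 [:: t; u]).
Qed.
HB.instance Definition _ := GRing.isDivringClosed.Build F gen_subfield
  gen_subfield_divring.

Record gen_field := GenField { gen_val :> F; _ : gen_val \in gen_subfield }.
HB.instance Definition _ := [isSub for gen_val].
HB.instance Definition _ := [Choice of gen_field by <:].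
HB.instance Definition _ := [SubChoice_isSubComUnitRing of gen_field by <:].
HB.instance Definition _ := [SubComUnitRing_isSubIntegralDomain of gen_field by <:].
HB.instance Definition _ := [SubIntegralDomain_isSubField of gen_field by <:].

Definition gen_code (x : gen_field) : nat :=
  pickle (sval (cid (asboolW (valP x)))).
Definition gen_decode (n : nat) : option gen_field :=
  obind (fun t => insub (tree_val t)) (unpickle n).
Fact gen_codeK : pcancel gen_code gen_decode.
Proof.
move=> x; rewrite /gen_code /gen_decode pickleK /=.
by rewrite -(svalP (cid (asboolW (valP x)))) valK.
Qed.
HB.instance Definition _ := Choice_isCountable.Build gen_field gen_codeK.

End CountableSubfield.

(** The map is total, with value 0 outside the subfield generated by [s]; it is a morphism on that
    subfield only. *)
Lemma countable_closure (F : fieldType) (s : seq F) :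
  {K : closedFieldType & {f : F -> K |
    [/\ f 1 = 1, {in gen_subfield s &, {morph f : x y / x + y}} &
        {in gen_subfield s &, {morph f : x y / x * y}}]}}.
Proof.
have [K [f _]] := countable_algebraic_closure (gen_field s).
pose g (x : F) : K := if insub x is Some u then f u else 0.
have gE (x : F) (hx : x \in gen_subfield s) : g x = f (GenField hx).
  rewrite /g insubT /=; congr (f _); exact: val_inj.
exists K, g; split.
- by rewrite gE ?rpred1 // => h; rewrite -(rmorph1 f); congr (f _); apply: val_inj.
- move=> x y hx hy; rewrite !gE ?rpredD // => h; rewrite -rmorphD.
  by congr (f _); apply: val_inj.
- move=> x y hx hy; rewrite !gE ?rpredM // => h; rewrite -rmorphM.
  by congr (f _); apply: val_inj.
Qed.

Lemma mem_gen_subfield (F : fieldType) (s : seq F) x : x \in s -> x \in gen_subfield s.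
Proof.
move=> xs; apply/asboolP; exists (GenTree.Leaf (index x s)).
by rewrite /= nth_index.
Qed.

(* The field embeds into a quotient, by a maximal ideal containing the
   eventually zero families, of the product of the algebraic closures of its
   finitely generated subfields; roots are found coordinatewise. *)
Lemma field_closure (F : fieldType) :
  exists (K : closedFieldType) (f : {rmorphism F -> K}), injective f.
Proof.
pose K_ s : closedFieldType := projT1 (countable_closure (F := F) s).
pose g s : F -> K_ s := sval (projT2 (countable_closure s)).
have gP s : [/\ g s 1 = 1, {in gen_subfield s &, {morph g s : x y / x + y}} &
    {in gen_subfield s &, {morph g s : x y / x * y}}].
  exact: svalP (projT2 (countable_closure s)).
pose P := dep_prod (fun s => K_ s : comNzRingType) [::].
pose I (u : P) := exists s0 : seq F, forall s : seq F, {subset s0 <= s} -> u s = 0.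
have hI : is_ideal I.
  split; first by exists [::].
    move=> u v [s us] [t vt]; exists (s ++ t) => r sr.
    rewrite [LHS](_ : _ = u r + v r) // us ?vt ?addr0 // => x hx; apply: sr.
      by rewrite mem_cat hx orbT.
    by rewrite mem_cat hx.
  move=> a u [s us]; exists s => r sr.
  by rewrite [LHS](_ : _ = a r * u r) // us // mulr0.
have h1 : ~ I 1.
  case=> s /(_ s (fun x h => h)) /eqP; rewrite [X in X == _](_ : _ = 1) //.
  by rewrite oner_eq0.
have [J [hJ J1 IJ maxJ]] := ex_maximal_ideal hI h1.
have [B [q [qs qJ]]] := quotient_ring hJ J1.
have qeq (u v : P) : (exists s0 : seq F, forall s : seq F, {subset s0 <= s} -> u s = v s) -> q u = q v.
  case=> s uv; apply/eqP; rewrite -subr_eq0 -rmorphB; apply/eqP/qJ/IJ.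
  by exists s => t st; rewrite [LHS](_ : _ = u t - v t) // uv // subrr.
have [||| f fE] := @ex_rmorphism F B (fun x => q (fun s => g s x : K_ s)).
- move=> x y; rewrite -rmorphD; apply: qeq; exists [:: x; y] => s xys.
  rewrite [RHS](_ : _ = g s x + g s y) //; have [_ -> //] := gP s.
    by apply/mem_gen_subfield/xys; rewrite !inE eqxx.
  by apply/mem_gen_subfield/xys; rewrite !inE eqxx orbT.
- rewrite -(rmorph1 q); apply: qeq; exists [::] => s _.
  by have [-> _ _] := gP s.
- move=> x y; rewrite -rmorphM; apply: qeq; exists [:: x; y] => s xys.
  rewrite [RHS](_ : _ = g s x * g s y) //; have [_ _ -> //] := gP s.
    by apply/mem_gen_subfield/xys; rewrite !inE eqxx.
  by apply/mem_gen_subfield/xys; rewrite !inE eqxx orbT.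
have [||K [h hinj]] := @ex_closed_field B.
- move=> x; have [u <-] := qs x => nu.
  have [|y /qJ] := maxJ u; first by move/qJ.
  by rewrite rmorphB rmorphM rmorph1 => /eqP; rewrite subr_eq0 => /eqP; exists (q y).
- move=> n p n_gt0; pose r j := sval (cid (qs (p j))).
  have rE j : q (r j) = p j by apply: svalP (cid (qs (p j))).
  pose x : P := fun s => sval (cid (@solve_monicpoly (K_ s) n (fun j => r j s) n_gt0)).
  have xE : x ^+ n = \sum_(j < n) r j * x ^+ j.
    apply: functional_extensionality_dep => s.
    rewrite dp_exprE (dp_sumE n (fun j => r j * x ^+ j)).
    rewrite (svalP (cid (@solve_monicpoly (K_ s) n (fun j => r j s) n_gt0))).
    by apply: eq_bigr => j _; rewrite [RHS](_ : _ = r j s * (x ^+ j) s) // dp_exprE.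
  exists (q x); rewrite -rmorphXn xE rmorph_sum.
  by apply: eq_bigr => j _; rewrite rmorphM rmorphXn rE.
exists K, (GRing.RMorphism.clone F K (h \o f) _); exact: fmorph_inj.
Qed.

Lemma fraction_numden (D : idomainType) (x : {fraction D}) :
  exists a b : D, b != 0 /\ x = tofrac a / tofrac b.
Proof.
elim/quotW: x => r; exists (\n_r), (\d_r).
have d0 : (\d_r) != 0 by exact: denom_ratioP.
split=> //; apply: canRL (mulfK _) _; first by rewrite tofrac_eq0.
rewrite [LHS]/= !piE; apply/eqmodP; rewrite /= FracField.equivfE /FracField.mulf.
by rewrite !numden_Ratio ?oner_eq0 ?mulf_neq0 ?oner_eq0 // !mulr1 mulrC.
Qed.

Section DomainFraction.
Variables (A : comNzRingType) (hA : forall x y : A, x * y = 0 -> x = 0 \/ y = 0).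

Definition dom_inv (x : A) : A :=
  if pselect (exists y, y * x = 1) is left h then sval (cid h) else x.
Definition dom_unit : {pred A} := fun x => `[< exists y, y * x = 1 >].

Fact dom_mulVr : {in dom_unit, left_inverse 1 dom_inv *%R}.
Proof.
move=> x /asboolP hx; rewrite /dom_inv; case: pselect => // h.
exact: svalP (cid h).
Qed.
Fact dom_unitP (x y : A) : y * x = 1 -> x \in dom_unit.
Proof. by move=> e; apply/asboolP; exists y. Qed.
Fact dom_inv_out : {in [predC dom_unit], dom_inv =1 id}.
Proof.
move=> x; rewrite inE /= => /asboolP hx; rewrite /dom_inv; case: pselect => //.
Qed.
Fact dom_mulf_eq0 (x y : A) : x * y = 0 -> (x == 0) || (y == 0).
Proof. by case/hA=> ->; rewrite eqxx ?orbT. Qed.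

End DomainFraction.

Lemma domain_closure (A : comNzRingType) :
  (forall x y : A, x * y = 0 -> x = 0 \/ y = 0) ->
  exists (F : fieldType) (i : {rmorphism A -> F}) (K : closedFieldType)
    (f : {rmorphism F -> K}),
  [/\ injective i, injective f & forall x, exists a b, b <> 0 /\ x = i a / i b].
Proof.
move=> hA.
pose m1 := GRing.ComNzRing_hasMulInverse.Build A (@dom_mulVr A) (@dom_unitP A) (@dom_inv_out A).
pose U : comUnitRingType := HB.pack_for comUnitRingType A m1.
pose m2 := GRing.ComUnitRing_isIntegral.Build U (@dom_mulf_eq0 A hA).
pose D : idomainType := HB.pack_for idomainType A U m2.
have [K [f finj]] := field_closure {fraction D}.
have [||| i iE] := @ex_rmorphism A {fraction D} (@tofrac D).
- exact: (rmorphD (@tofrac D)).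
- exact: (rmorph1 (@tofrac D)).
- exact: (rmorphM (@tofrac D)).
exists {fraction D}, i, K, f.
split=> // [x y|x]; first by rewrite !iE => /eqP; rewrite tofrac_eq => /eqP.
by have [a [b [/eqP b0 ->]]] := fraction_numden x; exists a, b; rewrite !iE.
Qed.

(** * Decomposition groups and tame inertia *)

Section AlgebraicIntegers.

Record aint := MkAint { aval :> algC; _ : aval \in Aint }.
HB.instance Definition _ := [isSub for aval].
HB.instance Definition _ := [Choice of aint by <:].
HB.instance Definition _ := [SubChoice_isSubComNzRing of aint by <:].

Lemma aval_inj (x y : aint) : aval x = aval y -> x = y.
Proof. exact: val_inj. Qed.

Definition aint_act (s : aut) (x : aint) : aint :=
  MkAint (etrans (Aint_aut s x) (valP x)).

Fact aint_act_zmod s : zmod_morphism (aint_act s).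
Proof. by move=> x y; apply: val_inj; rewrite /= !rmorphB /= -?rmorphB. Qed.
Fact aint_act_monoid s : monoid_morphism (aint_act s).
Proof.
by split=> [|x y]; apply: val_inj; rewrite /= ?rmorph1 // !rmorphM /=.
Qed.
HB.instance Definition _ s := GRing.isZmodMorphism.Build aint aint (aint_act s)
  (aint_act_zmod s).
HB.instance Definition _ s := GRing.isMonoidMorphism.Build aint aint (aint_act s)
  (aint_act_monoid s).

End AlgebraicIntegers.

(** [finite_place] asks for a prime ideal, so the quotient is a domain and the target is its
    fraction field; surjectivity of [r] is not claimed. *)
Lemma residue_field (P : algC -> Prop) : finite_place P ->
  exists (kP : fieldType) (r : {rmorphism aint -> kP}),
    forall x : aint, r x = 0 <-> P x.
Proof.
case=> Paint [P0 P1] [PD PM] Pprime _.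
have hI : is_ideal (fun x : aint => P x).
  by split=> // [x y|a x]; [apply: PD | apply: PM; apply: valP].
have [B [f [fs fI]]] := quotient_ring hI P1.
have [] := @domain_closure B.
  move=> x y; have [u <-] := fs x; have [v <-] := fs y; rewrite -rmorphM.
  by move/fI/(Pprime _ _ (valP u) (valP v)); case=> /fI; [left | right].
move=> F [i [_ [_ [iinj _ _]]]]; exists F, (GRing.RMorphism.clone _ _ (i \o f) _) => x /=.
split=> [e | /fI ->]; last by rewrite rmorph0.
by apply/fI/iinj; rewrite e rmorph0.
Qed.

Definition fixes (e : seq algC) (g : aut) := forall y, y \in e -> g y = y.

(** An automorphism permutes the roots of a minimal polynomial, so orbits are finite. *)
Lemma aut_orbit_seq (b : seq algC) :
  exists S : seq algC, forall (g : aut) x, x \in b -> g x \in S.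
Proof.
elim: b => [|x b [S hS]]; first by exists [::].
have [r Dr] := closed_field_poly_normal (minCpoly x).
exists (r ++ S) => g y; rewrite inE mem_cat => /orP[/eqP-> | /hS->]; last by rewrite orbT.
rewrite -root_prod_XsubC; suff: root (minCpoly x) (g x).
  by rewrite Dr rootZ ?lead_coef_eq0 ?monic_neq0 ?minCpoly_monic // => ->.
by rewrite -(minCpoly_aut g) root_minCpoly.
Qed.

Fixpoint words (T : eqType) (S : seq T) (n : nat) : seq (seq T) :=
  if n is n'.+1 then [seq x :: w | x <- S, w <- words S n'] else [:: [::]].

Lemma mem_words (T : eqType) (S : seq T) w :
  {subset w <= S} -> w \in words S (size w).
Proof.
elim: w => [|x w IH] wS; first by rewrite inE.
apply/allpairsP; exists (x, w); split=> //=; first by apply: wS; rewrite inE eqxx.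
by apply: IH => y yw; apply: wS; rewrite inE yw orbT.
Qed.

Definition aut_comp (g h : aut) : aut := GRing.RMorphism.clone _ _ (g \o h) _.

(* The polynomial prod_c (X - sum_i c_i t^i), over the conjugates c of the list
   b under G, has coefficients fixed by G, so phi and psi send it to the same
   polynomial. *)
Lemma conjugate_lift (G : aut -> Prop) (kP : fieldType) (phi psi : {rmorphism aint -> kP}) :
  G idfun -> (forall g h, G g -> G h -> G (aut_comp g h)) ->
  (forall x : aint, (forall g, G g -> aint_act g x = x) -> phi x = psi x) ->
  forall b : seq aint, exists2 g, G g &
    forall x, x \in b -> psi (aint_act g x) = phi x.
Proof.
move=> G1 GM fixE b.
have [S hS] := aut_orbit_seq (map aval b).
pose Sa : seq aint := pmap insub S.
have inSa g x : x \in b -> aint_act g x \in Sa.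
  by move=> xb; rewrite mem_pmap_sub; apply: hS; apply: map_f.
pose isc c := `[< exists2 g, G g & c = map (aint_act g) b >].
pose O := undup (filter isc (words Sa (size b))).
have inO c : (c \in O) = isc c.
  rewrite mem_undup mem_filter andb_idr //; case/asboolP=> g _ ->{c}.
  rewrite -(size_map (aint_act g)) mem_words // => _ /mapP[x xb ->].
  exact: inSa.
have Ouniq : uniq O by apply: undup_uniq.
pose f : {poly {poly aint}} := \prod_(c <- O) ('X - (Poly c)%:P).
have actO h : G h -> perm_eq (map (map (aint_act h)) O) O.
  move=> hh; have inj_h : injective (map (aint_act h)).
    by apply: inj_map => x y /(congr1 aval) /= /fmorph_inj /aval_inj.
  have uO : uniq (map (map (aint_act h)) O) by rewrite map_inj_uniq.
  have sO : {subset map (map (aint_act h)) O <= O}.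
    move=> _ /mapP[c cO ->]; move: cO; rewrite !inO => /asboolP[g gg ->].
    apply/asboolP; exists (aut_comp h g); first exact: GM.
    by rewrite -map_comp; apply: eq_map => x; apply: val_inj.
  apply: uniq_perm => //; apply: (uniq_min_size uO sO _).2.
  by rewrite size_map.
have actf h : G h -> map_poly (map_poly (aint_act h)) f = f.
  move=> hh; rewrite /f rmorph_prod -[RHS](perm_big _ (actO h hh)) /= big_map.
  apply: eq_bigr => c _; rewrite rmorphB /= map_polyX map_polyC /=.
  congr (_ - _%:P); apply/polyP => i; rewrite coef_map /= !coef_Poly.
  have [lt|ge] := ltnP i (size c); first by rewrite (nth_map 0).
  by rewrite !nth_default ?size_map // rmorph0.
have ff : map_poly (map_poly phi) f = map_poly (map_poly psi) f.
  apply/polyP => i; rewrite !coef_map /=; apply/polyP => j; rewrite !coef_map /=.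
  apply: fixE => g gg; have := congr1 (fun q : {poly {poly aint}} => q`_i`_j) (actf g gg).
  by rewrite !coef_map.
have PolyE (th : {rmorphism aint -> kP}) c i : (map_poly th (Poly c))`_i = th c`_i.
  by rewrite coef_map coef_Poly.
(* The tuple [b] is one of its own conjugates, so [phi (Poly b)] is a root; read on the [psi] side,
   a root is [psi] of some conjugate of [b]. *)
have : root (map_poly (map_poly phi) f) (map_poly phi (Poly b)).
  rewrite /f rmorph_prod /= rootE horner_prod prodf_seq_eq0; apply/hasP; exists b.
    rewrite inO; apply/asboolP; exists idfun => //.
    by rewrite -[LHS]map_id; apply: eq_map => x; apply: val_inj.
  by rewrite /= rmorphB /= map_polyX map_polyC /= hornerXsubC subrr.
rewrite ff /f rmorph_prod /= rootE horner_prod prodf_seq_eq0 => /hasP[c].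
rewrite inO => /asboolP[g gg ->] /=; rewrite rmorphB /= map_polyX map_polyC /=.
rewrite hornerXsubC subr_eq0 => /eqP eqg; exists g => // x xb.
have := congr1 (fun q : {poly kP} => q`_(index x b)) eqg.
rewrite /= !PolyE (nth_map 0) ?index_mem // nth_index //.
Qed.

(** Compactness of the automorphism group, as König's lemma along an enumeration [x_] of [algC]:
    every [x_ n] has finitely many possible images, so a prefix of values compatible with every
    finite set of conditions extends by one more value. *)
Lemma aut_compactness (cond : algC -> algC -> Prop) :
  (forall b : seq algC, exists g : aut, forall x, x \in b -> cond x (g x)) ->
  exists g : aut, forall x, cond x (g x).
Proof.
move=> hcond; pose x_ n : algC := odflt 0 (unpickle n).
have x_K x : x_ (pickle x) = x by rewrite /x_ pickleK.
pose Good (c : seq algC) := forall b : seq algC, exists2 g : aut,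
  (forall i, (i < size c)%N -> g (x_ i) = c`_i) & forall x, x \in b -> cond x (g x).
have G0 : Good [::] by move=> b; have [g hg] := hcond b; exists g.
have step c : Good c -> exists y, Good (rcons c y).
  move=> Gc; apply: contrapT => no.
  have [S hS] := aut_orbit_seq [:: x_ (size c)].
  (* If no value extends the prefix, every value [y] has a finite list on which it fails. One
     automorphism is good for the union of these lists over the finite orbit, and its own value lies
     in that orbit. *)
  have bad y : exists b : seq algC, ~ exists2 g : aut,
      (forall i, (i < size (rcons c y))%N -> g (x_ i) = (rcons c y)`_i) &
      forall x, x \in b -> cond x (g x).
    by apply: contrapT => h; apply: no; exists y => b; apply: contrapT => h'; apply: h; exists b.
  pose bb y := sval (cid (bad y)).
  have [g gc gb] := Gc (flatten (map bb S)).
  have gS : g (x_ (size c)) \in S by apply: hS; rewrite inE.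
  apply: (svalP (cid (bad (g (x_ (size c)))))); exists g; last first.
    by move=> x xb; apply: gb; apply/flattenP; exists (bb (g (x_ (size c)))) => //; apply: map_f.
  move=> i; rewrite size_rcons ltnS leq_eqVlt nth_rcons => /orP[/eqP->|lt].
    by rewrite ltnn eqxx.
  by rewrite lt gc.
pose nx c := if pselect (Good c) is left h then rcons c (sval (cid (step c h))) else c.
pose C n := iter n nx [::].
have CG n : Good (C n) /\ size (C n) = n.
  elim: n => [|n [IG IS]] //=; rewrite /nx; case: pselect => // h; split.
    exact: svalP (cid (step _ h)).
  by rewrite size_rcons IS.
pose v n := (C n.+1)`_n.
have Cv m i : (i < m)%N -> (C m)`_i = v i.
  elim: m => // m IH; rewrite ltnS leq_eqVlt => /orP[/eqP->//|lt].
  rewrite -IH //= /nx; case: pselect => [h|[]]; last by case: (CG m).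
  by rewrite nth_rcons (CG m).2 lt.
pose f (x : algC) : algC := v (pickle x).
have appr (l : seq algC) : exists2 g : aut, (forall x, x \in l -> g x = f x) &
    forall x, x \in l -> cond x (g x).
  pose m := (\max_(x <- l) (pickle x).+1)%N.
  have lm x : x \in l -> (pickle x < m)%N.
    by move=> xl; apply: (@leq_bigmax_seq _ l xpredT (fun x => (pickle x).+1) x).
  have [g gC gl] := (CG m).1 l; exists g => // x xl.
  by rewrite -{1}[x]x_K gC ?(CG m).2 ?lm // Cv ?lm.
have [||| g gE] := @ex_rmorphism algC algC f.
- move=> x y; have [g gf _] := appr [:: x + y; x; y].
  by rewrite -!gf ?rmorphD // !inE eqxx ?orbT.
- by have [g gf _] := appr [:: 1]; rewrite -gf ?rmorph1 // inE.
- move=> x y; have [g gf _] := appr [:: x * y; x; y].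
  by rewrite -!gf ?rmorphM // !inE eqxx ?orbT.
exists g => x; rewrite gE; have [h hf hc] := appr [:: x].
by rewrite -hf ?inE //; apply: hc; rewrite inE.
Qed.

(** [conjugate_lift] settles finite lists of integers; compactness passes to all of them at once. *)
Lemma residue_lift (e : seq algC) (kP : fieldType) (phi psi : {rmorphism aint -> kP}) :
  (forall x : aint, (forall g, fixes e g -> aint_act g x = x) -> phi x = psi x) ->
  exists2 g, fixes e g & forall x, psi (aint_act g x) = phi x.
Proof.
move=> fixE.
have [|g hg] := @aut_compactness (fun x y => (x \in e -> y = x) /\
   forall (hx : x \in Aint) (hy : y \in Aint), psi (MkAint hy) = phi (MkAint hx)).
  move=> b; have [| |g ge gb] := @conjugate_lift (fixes e) _ _ _ _ _ fixE (pmap insub b).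
  - by [].
  - by move=> g h gg hh y ye /=; rewrite hh ?gg.
  - exists g => x xb; split=> [/ge//|hx hy].
    rewrite -gb; last by rewrite mem_pmap_sub.
    by congr (psi _); apply: val_inj.
exists g => [x xe|x]; first by have [h _] := hg x; exact: h xe.
have [_ /(_ (valP x) (valP (aint_act g x)))] := hg x.
move=> h; rewrite (_ : aint_act g x = MkAint (valP (aint_act g x))); last exact: aval_inj.
by rewrite h; congr (phi _); apply: aval_inj.
Qed.

(** * Galois descent to the base field *)

Section FixedField.
Variables (F : fieldExtType rat) (iota : {rmorphism F -> algC}).

Definition base_seq : seq algC := map iota (vbasis {:F}).

Lemma absgal_fixes (g : aut) : absgal iota g <-> fixes base_seq g.
Proof.
split=> [h _ /mapP[x _ ->] //|h x].
rewrite (coord_vbasis (memvf x)) !rmorph_sum; apply: eq_bigr => i _.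
rewrite !rmorphZ_num rmorphM fmorph_rat h //.
by apply: map_f; apply: mem_nth; rewrite size_tuple.
Qed.

(** Finite Galois theory in a normal number field [S] containing [x] and the image of a basis of
    [F]: automorphisms of [S] over the subfield [K0] generated by this basis extend to [algC], so
    [x] lies in [K0], which is contained in the image of [F] in [S]. *)
Lemma absgal_fixed x : (forall g, absgal iota g -> g x = x) -> exists y, iota y = x.
Proof.
move=> fixx.
pose pz (z : algC) := sval (minCpolyP z).
have pzP z : minCpoly z = map_poly (ratr : rat -> algC) (pz z) by case: (svalP (minCpolyP z)) => -[].
have pzm z : pz z \is monic by case: (svalP (minCpolyP z)) => -[].
(* The roots of this product of rational minimal polynomials generate [S], which makes [S] normal
   over the rationals. *)
pose q := \prod_(z <- x :: base_seq) pz z.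
have [r Dr] := closed_field_poly_normal (map_poly (ratr : rat -> algC) q).
have qm : q \is monic by apply: monic_prod => z _.
rewrite lead_coef_map (monicP qm) rmorph1 scale1r in Dr.
have inr z : z \in x :: base_seq -> z \in r.
  move=> zs; rewrite -root_prod_XsubC -Dr rmorph_prod /= rootE horner_prod prodf_seq_eq0.
  apply/hasP; exists z => //=; rewrite -pzP; exact: root_minCpoly.
have [Qs [QsC [r1 Dr1 genr]]] := num_field_exists r.
have spl : SplittingField.axiom Qs.
  exists (map_poly (in_alg Qs) q).
    by apply/polyOverP => i; rewrite coef_map /= memvZ ?mem1v.
  exists r1; last by [].
  suff -> : map_poly (in_alg Qs) q = \prod_(z <- r1) ('X - z%:P) by apply: eqpxx.
  apply: (map_poly_inj QsC); rewrite [RHS]rmorph_prod -map_poly_comp /=.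
  transitivity (map_poly (ratr : rat -> algC) q).
    by apply: eq_map_poly => a /=; rewrite rmorphZ_num rmorph1 mulr1.
  rewrite Dr -Dr1 big_map; apply: eq_bigr => z _.
  by rewrite rmorphB /= map_polyX map_polyC.
pose mS := FieldExt_isSplittingField.Build rat Qs spl.
pose S : splittingFieldType rat := HB.pack_for (splittingFieldType rat) Qs mS.
have lift z : z \in x :: base_seq -> {y : S | QsC y = z}.
  by move=> /inr; rewrite -Dr1 => /mapP/sig2_eqW[y _ ->]; exists y.
have [x1 Dx] : {y : S | QsC y = x} by apply: lift; rewrite inE eqxx.
pose bl : seq S := [seq oapp (fun h => sval h) 0 (if z \in x :: base_seq =P true is ReflectT h then Some (lift z h) else None) | z <- base_seq].
have Dbl : map QsC bl = base_seq.
  rewrite -map_comp -[RHS]map_id; apply/eq_in_map => z zb /=.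
  by case: eqP => [h|[]] /=; [case: (lift z h) | rewrite inE zb orbT].
pose K0 : {subfield S} := <<1 & bl>>%AS.
have gal0 : galois K0 {:S}.
  apply/and3P; split; [exact: subvf | | exact: normalFieldf].
  by apply/separableP => y _; apply: pcharf0_separable => p; rewrite pchar_lalg; apply: pchar_num.
have x1K : x1 \in K0.
  rewrite -(galois_fixedField gal0); apply/fixedFieldP; first exact: memvf.
  move=> g gG; have [nu nuE] := extend_algC_subfield_aut QsC (g : {rmorphism S -> S}).
  apply: (fmorph_inj QsC); rewrite nuE Dx; apply: fixx; apply/absgal_fixes => z.
  rewrite -Dbl => /mapP[y yb ->]; rewrite -nuE /=; congr (QsC _).
  apply: (fixed_gal (subvf K0) gG); exact: seqv_sub_adjoin.
(* The embedding [iota] factored through [S], written in coordinates on the basis of [F]. *)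
pose io z : S := \sum_(i < \dim {:F}) coord (vbasis {:F}) i z *: bl`_i.
have szb : size bl = \dim {:F} by rewrite size_map size_map size_tuple.
have ioE z : QsC (io z) = iota z.
  rewrite [in RHS](coord_vbasis (memvf z)) !rmorph_sum; apply: eq_bigr => i _.
  rewrite !rmorphZ_num; congr (_ * _).
  by rewrite -(nth_map 0 0) ?szb // Dbl (nth_map 0) ?size_tuple.
have QI := fmorph_inj QsC.
have [||| ior iorE] := @ex_rmorphism F S io.
- by move=> y z; apply: QI; rewrite rmorphD !ioE rmorphD.
- by apply: QI; rewrite ioE !rmorph1.
- by move=> y z; apply: QI; rewrite rmorphM !ioE rmorphM.
pose mL := GRing.isScalable.Build rat F S *:%R ior (fmorph_numZ ior).
pose iol : {lrmorphism F -> S} := HB.pack_for {lrmorphism F -> S} (ior : F -> S) mL ior.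
pose ah := AHom (linfun_is_ahom iol).
have : x1 \in (ah @: {:F})%AS.
  suff /subvP : (K0 <= (ah @: {:F})%AS)%VS by apply.
  apply/Fadjoin_seqP; split=> [|y]; first exact: sub1v.
  move=> yb; have : QsC y \in base_seq by rewrite -Dbl map_f.
  case/mapP=> z _ zE; apply/memv_imgP; exists z; first exact: memvf.
  by apply: QI; rewrite zE lfunE /= iorE ioE.
by case/memv_imgP=> z _ zE; exists z; rewrite -ioE -iorE -Dx zE lfunE.
Qed.
End FixedField.

(* For a finite subfield s the polynomial X^n - X = prod_(a in s) (X - a) is
   invariant under translation by s, hence additive. *)
Lemma finite_subfield_frobenius (K : fieldType) (s : seq K) :
  uniq s -> 1 \in s -> {in s &, forall x y, x - y \in s} ->
  {in s &, forall x y, x * y \in s} ->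
  (forall x, x ^+ size s = x <-> x \in s) /\
  (forall x y : K, (x + y) ^+ size s = x ^+ size s + y ^+ size s).
Proof.
move=> us s1 sB sM; set n := size s.
have s0 : (0 : K) \in s by rewrite -(subrr 1) sB.
have n_gt1 : (1 < n)%N.
  have : (size [:: 0%R : K; 1%R] <= size s)%N.
    apply: uniq_leq_size; first by rewrite /= inE andbT eq_sym oner_eq0.
    by move=> x; rewrite !inE => /orP[]/eqP->.
  by [].
have n_gt0 := ltnW n_gt1.
have sX x : x \in s -> x ^+ n = x.
  move=> xs; have [->|x0] := eqVneq x 0; first by rewrite expr0n gtn_eqF.
  pose s' := filter (predC1 0) s.
  have us' : uniq s' by rewrite filter_uniq.
  have sz : n = (size s').+1.
    have := perm_size (perm_to_rem s0); rewrite /= => e; rewrite /n e.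
    by rewrite rem_filter.
  have ps : perm_eq (map ( *%R x) s') s'.
    have um : uniq (map ( *%R x) s') by rewrite map_inj_uniq //; exact: mulfI.
    apply: uniq_perm => //; apply: (uniq_min_size um _ _).2; rewrite ?size_map //.
    move=> z /mapP[y]; rewrite mem_filter /= => /andP[y0 ys] ->.
    by rewrite mem_filter /= mulf_neq0 ?sM.
  have p0 : \prod_(y <- s') y != 0.
    by rewrite prodf_seq_neq0; apply/allP => y; rewrite mem_filter => /andP[].
  rewrite sz exprS; suff -> : x ^+ size s' = 1 by rewrite mulr1.
  apply: (mulIf p0); rewrite mul1r -[RHS](perm_big _ ps) /= big_map big_split /=.
  by rewrite big_const_seq count_predT iter_mulr_1.
have szL : size ('X^n - 'X : {poly K}) = n.+1.
  by rewrite size_polyDl ?size_polyXn // size_polyN size_polyX.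
have LE : 'X^n - 'X = \prod_(a <- s) ('X - a%:P) :> {poly K}.
  have -> := @all_roots_prod_XsubC _ ('X^n - 'X) s szL.
  - rewrite lead_coefDl ?size_polyXn ?size_polyN ?size_polyX //.
    by rewrite lead_coefXn scale1r.
  - by apply/allP => a /sX e; rewrite rootE !hornerE e subrr.
  - by rewrite uniq_rootsE.
have LX x : x ^+ n - x = \prod_(a <- s) (x - a).
  have := congr1 (fun q : {poly K} => q.[x]) LE.
  rewrite !hornerE horner_prod => ->.
  by apply: eq_bigr => a _; rewrite hornerXsubC.
split=> [x|x y].
  split=> [e|/sX//]; have := LX x; rewrite e subrr => /esym/eqP.
  by rewrite prodf_seq_eq0 => /hasP[a as_ /=]; rewrite subr_eq0 => /eqP->.
have shift a : a \in s -> (a + y) ^+ n = a ^+ n + y ^+ n.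
  move=> as_; have pm : perm_eq (map (fun b => b - a) s) s.
    have um : uniq (map (fun b => b - a) s) by rewrite map_inj_uniq //; exact: addIr.
    apply: uniq_perm => //; apply: (uniq_min_size um _ _).2; rewrite ?size_map //.
    by move=> z /mapP[b bs ->]; apply: sB.
  have e : (a + y) ^+ n - (a + y) = y ^+ n - y.
    rewrite !LX -[RHS](perm_big _ pm) /= big_map.
    by apply: eq_bigr => b _; rewrite opprB addrCA addrA.
  by rewrite (sX a as_) -[LHS](subrK (a + y)) e addrCA subrK.
pose D : {poly K} := ('X + y%:P) ^+ n - 'X^n - (y ^+ n)%:P.
have szD : (size D <= n)%N.
  rewrite /D exprDn big_ord_recl /= subn0 expr0 mulr1 bin0 mulr1n [X in X - _]addrAC subrr add0r.
  rewrite (leq_trans (size_polyD _ _)) // geq_max size_polyN.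
  rewrite (leq_trans (size_polyC_leq1 _)) // andbT.
  apply: (leq_trans (size_sum _ _ _)); apply/bigmax_leqP => i _.
  rewrite -mulr_natr -polyC_exp -polyC_natr -mulrA -polyCM /bump /= add1n.
  rewrite mulrC mul_polyC (leq_trans (size_scale_leq _ _)) // size_polyXn.
  by have := ltn_ord i; lia.
have DE z : D.[z] = (z + y) ^+ n - z ^+ n - y ^+ n by rewrite /D !hornerE.
have D0 : D = 0.
  apply/eqP; apply: contraT => nz.
  have := max_poly_roots nz _ us; rewrite -/n ltnNge szD; apply.
  by apply/allP => a as_; rewrite rootE DE shift // [X in X - _]addrAC subrr add0r subrr.
by have := DE x; rewrite D0 horner0 => /esym/eqP; rewrite -addrA -opprD subr_eq0 => /eqP.
Qed.

Lemma avalX (x : aint) n : aval (x ^+ n) = aval x ^+ n.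
Proof. exact: (rmorphXn (val : aint -> algC)). Qed.
Lemma avalB (x y : aint) : aval (x - y) = aval x - aval y.
Proof. exact: (rmorphB (val : aint -> algC)). Qed.
Lemma avalM (x y : aint) : aval (x * y) = aval x * aval y.
Proof. exact: (rmorphM (val : aint -> algC)). Qed.
Lemma aval1 : aval 1 = 1.
Proof. exact: (rmorph1 (val : aint -> algC)). Qed.

Definition aut_inv (g : aut) : aut := GRing.RMorphism.clone _ _ (algC_invaut g) _.
Lemma aut_invK (g : aut) : cancel g (aut_inv g).
Proof. exact: algC_autK. Qed.
Lemma aut_invKV (g : aut) : cancel (aut_inv g) g.
Proof. exact: algC_invautK. Qed.

Definition aut_pow (g : aut) (j : nat) : aut := iter j (aut_comp g) idfun.
Lemma aut_powE g j x : aut_pow g j x = iter j g x.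
Proof. by elim: j => //= j ->. Qed.

(** Pigeonhole on the finite orbit of each element; the periods of the elements are multiplied
    together. *)
Lemma aut_period (g : aut) (e : seq algC) :
  exists2 R, (0 < R)%N & forall x, x \in e -> iter R g x = x.
Proof.
have iterM R j x : iter R g x = x -> iter (j * R) g x = x.
  by move=> h; elim: j => // j IH; rewrite mulSn iterD IH.
elim: e => [|x e [R R0 hR]]; first by exists 1%N.
have [S hS] := aut_orbit_seq [:: x].
have [R1 R10 hR1] : exists2 R, (0 < R)%N & iter R g x = x.
  have [|] := boolP (injectiveb (fun i : 'I_(size S).+1 => iter i g x)).
    move=> /injectiveP inj; have u : uniq [seq iter (i : nat) g x | i : 'I_(size S).+1].
      by rewrite map_inj_uniq ?enum_uniq.
    have /(uniq_leq_size u) : {subset [seq iter (i : nat) g x | i : 'I_(size S).+1] <= S}.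
      by move=> y /mapP[i _ ->]; rewrite -aut_powE; apply: hS; exact: mem_head.
    by rewrite size_map size_enum_ord ltnn.
  case/injectivePn=> i [j ij].
  wlog lt : i j ij / (i < j)%N.
    move=> h; have [/h|/h|] := ltngtP i j; first exact.
      by move=> h' /esym; apply: h'; rewrite eq_sym.
    by move/val_inj=> e'; rewrite e' eqxx in ij.
  move=> eij; exists (j - i)%N; first by rewrite subn_gt0.
  have : iter i g (iter (j - i) g x) = iter i g x by rewrite -iterD subnKC // ltnW.
  by rewrite -!aut_powE => /fmorph_inj; rewrite aut_powE.
exists (R1 * R)%N; first by rewrite muln_gt0 R10.
move=> y; rewrite inE => /orP[/eqP->|ye]; last by apply: iterM; apply: hR.
by rewrite mulnC; apply: iterM.
Qed.

Section LocalGalois.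
Local Notation iota_ := seq.iota.
Variables (F : fieldExtType rat) (iota : {rmorphism F -> algC}).
Variables (P : algC -> Prop) (hP : finite_place P).
Variables (kP : fieldType) (r : {rmorphism aint -> kP}).
Hypothesis rP : forall x : aint, r x = 0 <-> P x.
Variables (n : nat) (hn : place_norm iota P n).

Local Notation D := (dec iota (FinPlace P)).
Local Notation act := aint_act.

Lemma rB (x y : aint) : r x = r y <-> P (aval x - aval y).
Proof.
rewrite -(rP (x - y)) rmorphB; split=> [->|/eqP]; first by rewrite subrr.
by rewrite subr_eq0 => /eqP.
Qed.

Lemma P_Aint x : P x -> x \in Aint. Proof. by case: hP => h _ _ _ _; apply: h. Qed.

Lemma dec_r0 (s : aut) : D s -> forall x, r (act s x) = 0 <-> r x = 0.
Proof. by case=> _ sP x; rewrite !rP /=. Qed.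

Lemma dec_comp s t : D s -> D t -> D (aut_comp s t).
Proof.
case=> sF sP [tF tP]; split=> [x|x] /=; first by rewrite tF sF.
by rewrite sP tP.
Qed.
Lemma dec_inv s : D s -> D (aut_inv s).
Proof.
case=> sF sP; split=> x; first by rewrite -{1}(sF x) aut_invK.
by rewrite -(sP (aut_inv s x)) aut_invKV.
Qed.
Lemma dec_id : D idfun. Proof. by []. Qed.
Lemma dec_pow s j : D s -> D (aut_pow s j).
Proof. by move=> sD; elim: j => [|j IH]; [apply: dec_id | apply: dec_comp]. Qed.

Lemma inertP s : inert iota P s <-> D s /\ forall x, r (act s x) = r x.
Proof.
split=> -[sD sx]; split=> // x; first by apply/rB/sx/valP.
by move=> hx; have /rB := sx (MkAint hx).
Qed.

Lemma frobP s : frob iota P n s <-> D s /\ forall x, r (act s x) = r x ^+ n.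
Proof.
split=> -[sD sx]; split=> // x.
  by rewrite -rmorphXn; apply/rB; rewrite avalX; apply/sx/valP.
by move=> hx; have := sx (MkAint hx); rewrite -rmorphXn => /rB; rewrite avalX.
Qed.

Lemma residue_seq : exists s : seq kP, [/\ size s = n, uniq s &
  forall a, a \in s <-> exists2 y : aint, (exists z, iota z = aval y) & r y = a].
Proof.
have [t [ti tu]] := hn.
pose T i := MkAint (ti i).
exists [seq r (T i) | i : 'I_n]; split; first by rewrite size_map size_enum_ord.
  rewrite map_inj_uniq ?enum_uniq // => i j /rB /= hij.
  have [i0 [h1 h2]] := tu (t i) (ti i).
  by rewrite -(h2 j) // -(h2 i) // subrr; case: hP => _ [].
move=> a; split=> [/mapP[i _ ->]|[y [z zy] <-]]; first by exists (T i) => //; exists (t i).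
have hz : iota z \in Aint by rewrite zy; apply: valP.
have [i [hi _]] := tu z hz; apply/mapP; exists i; rewrite ?mem_enum //.
by apply/rB; rewrite -zy.
Qed.

(** The residues of the integers of [F] form a subfield with [n] elements, to which
    [finite_subfield_frobenius] applies. *)
Lemma base_residue_frob :
  (forall a, a ^+ n = a <-> exists2 y : aint, (exists z, iota z = aval y) & r y = a)
  /\ (forall x y : kP, (x + y) ^+ n = x ^+ n + y ^+ n).
Proof.
have [s [sz us sE]] := residue_seq.
have [|||h1 h2] := finite_subfield_frobenius us.
- by apply/sE; exists 1; rewrite ?rmorph1 //; exists 1; rewrite rmorph1 aval1.
- move=> _ _ /sE[y [z zy] <-] /sE[y' [z' zy'] <-]; apply/sE.
  by exists (y - y'); rewrite ?rmorphB //; exists (z - z'); rewrite rmorphB avalB zy zy'.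
- move=> _ _ /sE[y [z zy] <-] /sE[y' [z' zy'] <-]; apply/sE.
  by exists (y * y'); rewrite ?rmorphM //; exists (z * z'); rewrite rmorphM avalM zy zy'.
rewrite sz in h1 h2; split=> // a; rewrite h1; exact: sE.
Qed.

(** [x |-> r x ^+ n] is a ring morphism that agrees with [r] on the integers of [F], which are the
    integers fixed by the Galois group. [residue_lift] realizes it by an automorphism, which
    preserves [P] because a residue vanishes exactly when its [n]-th power does. *)
Lemma frob_exists : exists s, frob iota P n s.
Proof.
have [rn rD] := base_residue_frob.
have [|||phi phiE] := @ex_rmorphism aint kP (fun x => r x ^+ n).
- by move=> x y; rewrite rmorphD rD.
- by rewrite rmorph1 expr1n.
- by move=> x y; rewrite rmorphM exprMn.
have [|s sF sr] := @residue_lift (base_seq iota) kP phi r.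
  move=> x fx; rewrite phiE; apply/rn; exists x => //.
  apply: absgal_fixed => g /absgal_fixes gF.
  exact: (congr1 aval (fx g gF)).
exists s; apply/frobP; split=> [|x]; last by rewrite sr phiE.
split=> [|x]; first exact/absgal_fixes.
have [xA|xA] := boolP (x \in Aint); last first.
  by split=> /P_Aint; rewrite ?Aint_aut (negPf xA).
have [_ h] := frobP s.
rewrite -[x]/(aval (MkAint xA)) -[s _]/(aval (act s (MkAint xA))) -!rP sr phiE.
have n_gt0 : (0 < n)%N by have [t [_ /(_ 0)]] := hn; rewrite rmorph0 => /(_ Aint0)[i _]; apply: leq_ltn_trans (leq0n i) (ltn_ord i).
split=> [/eqP|->]; last by rewrite expr0n gtn_eqF.
by rewrite expf_eq0 => /andP[_ /eqP].
Qed.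

(** Modulo inertia the decomposition group is topologically generated by Frobenius. Once the
    residual action of [s] on the integers attached to [e'] is that of a power of [s0], dividing by
    this power leaves an automorphism with trivial residual action there; its action on the other
    residues is corrected by an automorphism [g] fixing [e']. *)
Lemma dec_approx s0 s (e : seq algC) : frob iota P n s0 -> D s ->
  exists j t, inert iota P t /\ forall x, x \in e -> s x = iter j s0 (t x).
Proof.
move=> /frobP[s0D s0r] sD; have [rn rD] := base_residue_frob.
pose e' := base_seq iota ++ e.
have [R R0 hR] := aut_period s0 e'.
pose Hfix (x : aint) := forall g, fixes e' g -> act g x = x.
have cl (th : {rmorphism aint -> kP}) (g : aut) :
    exists phi : {rmorphism aint -> kP}, forall x, phi x = th (act g x).
  by exists (GRing.RMorphism.clone _ _ (th \o act g) _).
have [rs rsE] := cl r s.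
have fin (b : seq aint) : exists j, forall x, x \in b -> r (act s x) = r (act (aut_pow s0 j) x).
  have [|||g [j gj] gb] := @conjugate_lift (fun g => exists j, g =1 iter j s0) kP rs r _ _ _ b.
  - by exists 0%N.
  - move=> g h [i gi] [j hj]; exists (i + j)%N => x.
    by rewrite /= hj gi iterD.
  (* An integer fixed by [s0] has a residue equal to its own [n]-th power, that is, the residue of
     an integer of [F], on which [s] is trivial. *)
  - move=> x fx; rewrite rsE.
    have [|y [z zy] ry] := (rn (r x)).1.
      by rewrite -s0r (_ : act s0 x = x) //; apply: fx; exists 1%N.
    have sy : act s y = y by apply: aval_inj; rewrite /= -zy; case: sD => ->.
    rewrite -ry -sy; apply/rB; rewrite -rmorphB /= -avalB.
    by case: sD => _ ->; rewrite avalB; apply/rB.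
  exists j => x xb; rewrite -rsE -gb //; congr (r _); apply: aval_inj.
  by rewrite /= aut_powE gj.
(* On [Hfix] a power of [s0] depends only on its exponent modulo the period [R]; if every exponent
   failed, [R] counterexamples would already contradict [fin]. *)
have [j jE] : exists j, forall x, Hfix x -> r (act s x) = r (act (aut_pow s0 j) x).
  apply: contrapT => no.
  have bad j : exists x, Hfix x /\ r (act s x) <> r (act (aut_pow s0 j) x).
    apply: contrapT => h; apply: no; exists j => x fx; apply: contrapT => h'.
    by apply: h; exists x.
  pose b j := sval (cid (bad j)).
  have [j jb] := fin [seq b i | i <- iota_ 0 R].
  have [fb nb] := svalP (cid (bad (j %% R)%N)).
  apply: nb; rewrite jb; last by apply: map_f; rewrite mem_iota /= add0n ltn_mod.
  congr (r _); apply: aval_inj; rewrite /= !aut_powE {1}(divn_eq j R) addnC iterD.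
  congr (iter _ _ _); rewrite -aut_powE.
  apply: (congr1 aval (fb (aut_pow s0 (j %/ R * R)) _)) => x xe.
  rewrite aut_powE; elim: (j %/ R)%N => // i IH.
  by rewrite mulSn iterD IH hR.
have s0jD : D (aut_pow s0 j) by apply: dec_pow.
pose s' := aut_comp (aut_inv (aut_pow s0 j)) s.
have s'D : D s' by apply: dec_comp => //; apply: dec_inv.
have s'r x : Hfix x -> r (act s' x) = r x.
  move=> fx; apply/rB; have [_ h] := dec_inv s0jD.
  rewrite /= -[X in _ - X](aut_invK (aut_pow s0 j)) -rmorphB h.
  exact/(rB (act s x) (act (aut_pow s0 j) x))/jE.
have [phi phiE] := cl r s'.
have [|g ge gr] := @residue_lift e' kP phi r.
  by move=> x fx; rewrite phiE s'r.
have gD : D g.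
  split; first by apply/absgal_fixes => x xe; apply: ge; rewrite mem_cat xe.
  move=> x; have [xA|xA] := boolP (x \in Aint); last first.
    by split=> /P_Aint; rewrite ?Aint_aut (negPf xA).
  rewrite -[x]/(aval (MkAint xA)) -[g _]/(aval (act g (MkAint xA))) -!rP gr phiE.
  exact: dec_r0.
exists j, (aut_comp s' (aut_inv g)); split.
  apply/inertP; split; first by apply: dec_comp => //; apply: dec_inv.
  move=> x; have := gr (act (aut_inv g) x).
  rewrite (_ : act g (act (aut_inv g) x) = x); last by apply: aval_inj; rewrite /= aut_invKV.
  by move=> ->; rewrite phiE; congr (r _); apply: aval_inj.
move=> x xe; rewrite /= -{2}(ge x) ?mem_cat ?xe ?orbT // aut_invK.
by rewrite -aut_powE aut_invKV.
Qed.

End LocalGalois.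

Lemma AintP x : x \in Aint <-> integralOver (intr : int -> algC) x.
Proof.
split=> [xA|[p mon_p px]]; last first.
  apply: root_monic_Aint px _ _; first exact: monic_map.
  by apply/polyOverP => i; rewrite coef_map /= intr_int.
have /floorpP[p Dp] : minCpoly x \is a polyOver Num.int := xA.
exists p; last by rewrite -Dp root_minCpoly.
have := minCpoly_monic x; rewrite Dp !monicE lead_coef_map_inj //; last exact: intr_inj.
by move=> /eqP e; apply/eqP/(@intr_inj algC).
Qed.

(** Multiplying the equation of degree m+1 by the m-th power of the leading coefficient [c] gives a
    monic equation for [c * x]. *)
Lemma lead_coef_root_Aint (q : {poly algC}) x :
  (forall i, q`_i \in Aint) -> root q x -> lead_coef q * x \in Aint.
Proof.
move=> qA qx; have [q0|nq] := eqVneq q 0; first by rewrite q0 lead_coef0 mul0r Aint0.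
have : (1 < size q)%N by apply: root_size_gt1 qx.
case sq : (size q) => [|[|m]] // _.
have lE : lead_coef q = q`_m.+1 by rewrite /lead_coef sq.
set c := lead_coef q in lE *.
have cA : c \in Aint by rewrite lE.
pose g : {poly algC} := 'X^(m.+1) + \poly_(i < m.+1) (q`_i * c ^+ (m - i)).
have szg : size g = m.+2.
  by rewrite size_polyDl size_polyXn // ltnS size_poly.
apply/AintP; apply: (@integral_root_monic _ _ _ _ g).
- by rewrite monicE lead_coefDl ?lead_coefXn // size_polyXn ltnS size_poly.
- rewrite rootE hornerD hornerXn horner_poly.
  have := qx; rewrite rootE horner_coef sq big_ord_recr /= -lE => /eqP q0.
  rewrite (_ : \sum_(i < _) _ = c ^+ m * \sum_(i < m.+1) q`_i * x ^+ i).
    by rewrite exprMn exprSr -!mulrA -mulrDr addrC q0 mulr0.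
  rewrite mulr_sumr; apply: eq_bigr => i _.
  have le : (i <= m)%N by rewrite -ltnS.
  have -> : c ^+ m = c ^+ (m - i) * c ^+ i by rewrite -exprD subnK.
  by rewrite exprMn; ring.
- apply/integral_poly => i; rewrite coefD coefXn coef_poly; apply/AintP.
  by rewrite rpredD ?rpred_nat //; case: ifP => // _; rewrite rpredM ?rpredX.
Qed.

(** * Residues in the valuation ring of a place, and the tame relation *)

Section ResidueRelation.
Variables (P : algC -> Prop) (hP : finite_place P).
Variables (kP : fieldType) (r : {rmorphism aint -> kP}).
Hypothesis rP : forall x : aint, r x = 0 <-> P x.

(** The residue map of the valuation ring at [P], kept as a relation on [algC]: [x] is a fraction
    whose denominator is a unit at [P]. *)
Definition has_res (x : algC) (c : kP) :=
  exists a b : aint, [/\ r b != 0, x * aval b = aval a & r a = c * r b].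

Lemma aint_neq0 (b : aint) : r b != 0 -> aval b != 0.
Proof.
move=> rb; apply: contraNneq rb => b0.
by rewrite (_ : b = 0) ?rmorph0 //; apply: aval_inj; rewrite b0.
Qed.

Lemma has_res_inj x c d : has_res x c -> has_res x d -> c = d.
Proof.
move=> [a [b [rb xb ra]]] [a' [b' [rb' xb' ra']]].
have e : a * b' = a' * b by apply: aval_inj; rewrite !avalM -xb -xb'; ring.
have := congr1 r e; rewrite !rmorphM ra ra' => e'.
by apply: (mulIf rb); apply: (mulIf rb'); rewrite -[RHS]mulrAC e' mulrAC.
Qed.

Lemma has_resM x y c d : has_res x c -> has_res y d -> has_res (x * y) (c * d).
Proof.
move=> [a [b [rb xb ra]]] [a' [b' [rb' xb' ra']]]; exists (a * a'), (b * b').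
by split; rewrite ?rmorphM ?mulf_neq0 // ?avalM ?ra ?ra' -?xb -?xb'; ring.
Qed.

Lemma has_resD x y c d : has_res x c -> has_res y d -> has_res (x + y) (c + d).
Proof.
move=> [a [b [rb xb ra]]] [a' [b' [rb' xb' ra']]]; exists (a * b' + a' * b), (b * b').
split; rewrite ?rmorphD ?rmorphM ?mulf_neq0 // ?ra ?ra'; last by ring.
rewrite (_ : aval (a * b' + a' * b) = aval a * aval b' + aval a' * aval b).
  by rewrite avalM -xb -xb'; ring.
by rewrite -!avalM; exact: (rmorphD (val : aint -> algC)).
Qed.

Lemma has_res_aint (x : aint) : has_res (aval x) (r x).
Proof. by exists x, 1; rewrite rmorph1 aval1 !mulr1 oner_neq0. Qed.
Lemma has_res1 : has_res 1 1.
Proof. by rewrite -aval1 -(rmorph1 r); apply: has_res_aint. Qed.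

Lemma has_resV x c : c != 0 -> has_res x c -> has_res x^-1 c^-1.
Proof.
move=> c0 [a [b [rb xb ra]]]; have ra0 : r a != 0 by rewrite ra mulf_neq0.
exists b, a; split=> //; last by rewrite ra mulKf.
have := aint_neq0 ra0; rewrite -xb mulf_eq0 negb_or => /andP[x0 b0].
by rewrite mulKf.
Qed.

(** Induction on the degree. With leading coefficient [c], the pair [c * x], [c] works unless both
    lie in [P]; in that case the top term c X^(l+1) is traded for (c x) X^l, which keeps the root,
    the integrality and a coefficient outside [P]. *)
Lemma has_res_of_root (q : {poly algC}) x :
  (forall i, q`_i \in Aint) -> root q x -> (exists i, ~ P q`_i) ->
  exists a b : aint, x * aval b = aval a /\ (r a != 0 \/ r b != 0).
Proof.
have [_ [P0 P1] [PD PM] _ _] := hP.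
have [m] := ubnP (size q); elim: m q => // m IH q; rewrite ltnS => lt qA qx [i ni].
have nq : q != 0 by apply: contra_notN ni => /eqP->; rewrite coef0.
have bA : lead_coef q \in Aint by apply: qA.
have aA := lead_coef_root_Aint qA qx.
pose a := MkAint aA; pose b := MkAint bA.
have xba : x * aval b = aval a by rewrite /= mulrC.
have [ra|ra] := eqVneq (r a) 0; last by exists a, b; split; auto.
have [rb|rb] := eqVneq (r b) 0; last by exists a, b; split; auto.
have /rP/= Pa := ra; have /rP/= Pb := rb.
have sq1 : (1 < size q)%N by apply: root_size_gt1 qx.
case sq : (size q) sq1 lt => [|[|l]] // _ lt.
have lE : lead_coef q = q`_l.+1 by rewrite /lead_coef sq.
pose q' := q - (lead_coef q)%:P * 'X^(l.+1) + (lead_coef q * x)%:P * 'X^l.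
have q'E j : q'`_j = q`_j - lead_coef q * (j == l.+1)%:R + lead_coef q * x * (j == l)%:R.
  by rewrite coefD coefB !coefCM !coefXn.
apply: (IH q').
- apply: leq_trans lt; rewrite ltnS; apply/leq_sizeP => j; rewrite leq_eqVlt q'E.
  move=> /orP[/eqP<-|lj]; first by rewrite -lE eqxx mulr1 subrr gtn_eqF // mulr0 addr0.
  rewrite (gtn_eqF lj) (gtn_eqF (ltnW lj)) !mulr0 subr0 addr0 nth_default //.
  by rewrite sq.
- move=> j; rewrite q'E; apply: rpredD; last by apply: rpredM (rpred_nat _ _).
  by apply: rpredB => //; apply: rpredM (rpred_nat _ _).
- have := qx; rewrite !rootE /q' !hornerE => /eqP->.
  by rewrite sub0r exprS; apply/eqP; ring.
- exists i; rewrite q'E; have [e|_] := eqVneq i l.+1.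
    by move: ni; rewrite e -lE.
  rewrite mulr0 subr0; have [_|_] := eqVneq i l; last by rewrite mulr0 addr0.
  rewrite mulr1 => h; apply: ni; rewrite -[q`_i](addrK (lead_coef q * x)).
  by apply: PD => //; rewrite -mulN1r; apply: PM => //; rewrite rpredN.
Qed.

(** The elements having a residue form a valuation ring. A primitive integral polynomial of [x] has
    a coefficient outside [P], for otherwise the least positive integer in [P] would divide its
    content; then [has_res_of_root] applies. *)
Lemma has_res_total x : (exists c, has_res x c) \/ has_res x^-1 0.
Proof.
have [_ [P0 P1] [PD PM] _ _] := hP.
suff [a [b [xba [ra|rb]]]] : exists a b : aint, x * aval b = aval a /\ (r a != 0 \/ r b != 0).
- have [rb|rb] := eqVneq (r b) 0; last first.
    by left; exists (r a / r b), a, b; split=> //; rewrite divfK.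
  right; exists b, a; split=> //; last by rewrite mul0r.
  have x0 : x != 0 by apply: contraNneq (aint_neq0 ra) => x0; rewrite -xba x0 mul0r.
  by rewrite -xba mulKf.
- by left; exists (r a / r b), a, b; split=> //; rewrite divfK.
have [p [Dp mon_p] pdv] := minCpolyP x.
have [q [a a0 pq]] := rat_poly_scale p.
have p0 : p != 0 by apply: monic_neq0.
have q0 : q != 0 by apply: contraNneq p0 => q0; rewrite pq q0 rmorph0 scaler0.
pose z := zprimitive q.
have zx : root (map_poly intr z) x.
  have : root (map_poly ratr p) x by rewrite pdv dvdpp.
  rewrite pq [q]zpolyEprim linearZ /= rootZ ?fmorph_eq0 ?invr_eq0 ?intr_eq0 //.
  rewrite !linearZ /= rootZ ?fmorph_eq0 ?intr_eq0 ?zcontents_eq0 //.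
  rewrite -map_poly_comp /=.
  by rewrite (eq_map_poly (g := intr)) // => u /=; rewrite ratr_int.
apply: (has_res_of_root _ zx); first by move=> i; rewrite coef_map /= Aint_int.
apply: contrapT => no.
have Pz i : P (z`_i)%:~R.
  by apply: contrapT => h; apply: no; exists i; rewrite coef_map.
have PN u : P u -> P (- u) by move=> Pu; rewrite -mulN1r; apply: PM; rewrite ?rpredN ?rpred1.
have z0 : z != 0 by rewrite zprimitive_eq0.
have [l0 l0E] : exists l0 : nat, (0 < l0)%N /\ P l0%:R.
  have nz : lead_coef z != 0 by rewrite lead_coef_eq0.
  exists `|lead_coef z|%N; rewrite absz_gt0; split=> //.
  have Pint (u : int) : P u%:~R -> P `|u|%N%:R.
    by case: u => u //=; rewrite NegzE rmorphN /= => /PN; rewrite opprK.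
  exact/Pint/(Pz (size z).-1).
have exl : exists l : nat, (0 < l)%N && `[< P l%:R >].
  by exists l0; apply/andP; case: l0E => ? ?; split=> //; apply/asboolP.
case: (ex_minnP exl) => l /andP[l_gt0 /asboolP Pl] lmin.
have ldv i : (l %| z`_i)%Z.
  have := Pz i; rewrite {1}(divz_eq z`_i l) rmorphD rmorphM /= => h.
  have : P ((z`_i %% l)%Z)%:~R.
    rewrite -[X in P X](addKr ((z`_i %/ l)%Z%:~R * l%:~R)) addrC.
    by apply: PD => //; apply: PN; apply: PM; rewrite ?Aint_int.
  have m0 : (0 <= (z`_i %% l)%Z) by rewrite modz_ge0 // -lt0n.
  have ml : ((z`_i %% l)%Z < l%:Z) by rewrite ltz_pmod // -lt0n.
  rewrite -(gez0_abs m0) in ml *; set t := `|_|%N in ml * => Pt.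
  have [t0|tp] := posnP t.
    apply/dvdz_mod0P; rewrite -(gez0_abs m0) -/t t0 //.
  by have := lmin t; rewrite tp /= leqNgt; case: asboolP => // _ /(_ isT); rewrite -ltz_nat ml.
have : (l %| zcontents z)%Z by rewrite dvdz_contents; apply/polyOverP.
rewrite zcontents_primitive q0 dvdz1 => /eqP l1.
by apply: P1; move: Pl; rewrite -[l]/(`|l%:Z|%N) l1.
Qed.
Lemma has_res_act (s : aut) (f : kP -> kP) x c :
  (forall a b, f (a * b) = f a * f b) -> (forall a, f a = 0 -> a = 0) ->
  (forall a, r (aint_act s a) = f (r a)) -> has_res x c -> has_res (s x) (f c).
Proof.
move=> fM f0 fr [a [b [rb xb ra]]]; exists (aint_act s a), (aint_act s b); split.
- by rewrite fr; apply: contraNneq rb => /f0 ->.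
- by rewrite /= -xb rmorphM.
- by rewrite !fr ra fM.
Qed.

Variables (F : fieldExtType rat) (iota : {rmorphism F -> algC}).
Local Notation D := (dec iota (FinPlace P)).

Lemma has_res0_act (s : aut) x : D s -> has_res x 0 -> has_res (s x) 0.
Proof.
move=> sD [a [b [rb xb ra]]]; exists (aint_act s a), (aint_act s b); split.
- by apply: contraNneq rb => /(dec_r0 rP sD) ->.
- by rewrite /= -xb rmorphM.
- by rewrite mul0r; apply/(dec_r0 rP sD); rewrite ra mul0r.
Qed.

(** Over a period of [x] the conjugates of [s x / x] multiply to 1; if [s x / x] or its inverse had
    residue 0, so would that product or its inverse. *)
Lemma dec_unit (s : aut) x : D s -> x != 0 ->
  exists2 c, c != 0 & has_res (s x / x) c.
Proof.
move=> sD x0; have [R R0 hR] := aut_period s [:: x].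
have prodE y j : y = s x / x -> \prod_(i < j) iter i s y = iter j s x / x.
  move=> ->; elim: j => [|j IH]; first by rewrite big_ord0 divff.
  rewrite big_ord_recr /= IH -!aut_powE fmorph_div mulrC mulrA mulfVK ?fmorph_eq0 //.
  by rewrite !aut_powE -iterSr.
have prod0 (g : aut) y : D g -> has_res y 0 -> has_res (\prod_(i < R) iter i g y) 0.
  move=> gD y0; have it i : has_res (iter i g y) 0 by elim: i => //= i; apply: has_res0_act.
  case: R R0 {hR prodE} => // R _; elim: R => [|R IH]; first by rewrite big_ord1.
  by rewrite big_ord_recr -[0](mulr0 0); apply: has_resM.
have hx : iter R s x = x by apply: hR; rewrite inE.
have [[c hc]|h0] := has_res_total (s x / x).
  have [c0|c0] := eqVneq c 0; last by exists c.
  rewrite {}c0 in hc; have := prod0 s _ sD hc.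
  by rewrite (prodE _ R erefl) hx divff // => /(has_res_inj has_res1)/eqP; rewrite oner_eq0.
have := prod0 s _ sD h0; rewrite (_ : \prod_(_ < R) _ = 1).
  by move=> /(has_res_inj has_res1)/eqP; rewrite oner_eq0.
transitivity (\prod_(i < R) iter i s (s x / x))^-1.
  by rewrite -prodfV; apply: eq_bigr => i _; rewrite -!aut_powE fmorphV.
by rewrite (prodE _ R erefl) hx divff ?invr1.
Qed.

Section Tame.
Variables (n p : nat) (hn : place_norm iota P n) (pp : prime p) (hp : ~ P p%:R).
Variables (s t : aut) (hs : frob iota P n s) (ht : inert iota P t).

(** The element s t s^-1 t^-n, which is wild: the lemmas below show that it multiplies every nonzero
    number by a unit of residue 1. *)
Definition tame_comm : aut :=
  aut_comp (aut_comp s t) (aut_inv (aut_comp (aut_pow t n) s)).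

Lemma tame_commE x : tame_comm (iter n t (s x)) = s (t x).
Proof.
rewrite /tame_comm /= -aut_powE.
by rewrite (aut_invK (aut_comp (aut_pow t n) s) x).
Qed.

Lemma inert_res x c : has_res x c -> has_res (t x) c.
Proof. by apply: (@has_res_act t id) => // a; have [_] := (inertP iota rP t).1 ht. Qed.

Lemma inert_unit_ratio u d : d != 0 -> has_res u d -> has_res (t u / u) 1.
Proof.
move=> d0 hu; rewrite -(divff d0); apply: has_resM; first exact: inert_res.
exact: has_resV.
Qed.

Lemma inert_pow_ratio w c j : has_res (t w / w) c -> w != 0 ->
  has_res (iter j t w / w) (c ^+ j).
Proof.
move=> hw w0; elim: j => [|j IH]; first by rewrite divff //; apply: has_res1.
rewrite iterS exprS (_ : _ / _ = t (iter j t w) / iter j t w * (iter j t w / w)); last first.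
  by rewrite mulrA mulfVK // -aut_powE fmorph_eq0.
apply: (has_resM _ IH); elim: j {IH} => //= j IH.
by have := inert_res IH; rewrite fmorph_div.
Qed.

Lemma tame_comm_inert : inert iota P tame_comm.
Proof.
have [sD sr] := (frobP iota rP n s).1 hs; have [tD tr] := (inertP iota rP t).1 ht.
apply/(inertP iota rP); split.
  by apply: dec_comp; [apply: dec_comp | apply: dec_inv; apply: dec_comp => //; apply: dec_pow].
move=> x; pose y := aint_act (aut_inv (aut_comp (aut_pow t n) s)) x.
have -> : x = aint_act (aut_comp (aut_pow t n) s) y.
  by apply: aval_inj; exact: (esym (aut_invKV (aut_comp (aut_pow t n) s) (aval x))).
rewrite (_ : aint_act tame_comm _ = aint_act s (aint_act t y)); last first.
  apply: aval_inj.
  exact: (congr1 (aut_comp s t) (aut_invK (aut_comp (aut_pow t n) s) (aval y))).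
rewrite sr tr (_ : aint_act _ y = aint_act (aut_pow t n) (aint_act s y)); last exact: aval_inj.
have tpr j z : r (aint_act (aut_pow t j) z) = r z.
  elim: j => [|j IH]; first by congr (r _); apply: aval_inj.
  by rewrite -[RHS]IH -[RHS]tr; congr (r _); apply: aval_inj.
by rewrite tpr sr.
Qed.

(** If [t] multiplies [x] by a unit of residue [c], it does the same to [s x], since [s x / x] is a
    unit. Frobenius raises [c] to the power [n], and so does iterating [t] [n] times, so the two
    contributions cancel. *)
Lemma tame_comm_ratio z : z != 0 -> has_res (tame_comm z / z) 1.
Proof.
move=> z0; have [sD sr] := (frobP iota rP n s).1 hs; have [tD tr] := (inertP iota rP t).1 ht.
pose x := aut_inv (aut_comp (aut_pow t n) s) z.
have zE : z = iter n t (s x).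
  by rewrite -aut_powE -[RHS]/(aut_comp (aut_pow t n) s x) aut_invKV.
have x0 : x != 0 by rewrite fmorph_eq0.
have sx0 : s x != 0 by rewrite fmorph_eq0.
have [c c0 hc] := dec_unit tD x0.
have [d d0 hd] := dec_unit sD x0.
have hsx : has_res (t (s x) / s x) c.
  rewrite (_ : _ / _ = t (s x / x) / (s x / x) * (t x / x)).
    by rewrite -[c]mul1r; apply: has_resM => //; apply: inert_unit_ratio d0 hd.
  by rewrite fmorph_div; field; rewrite ?fmorph_eq0 ?z0.
have h1 : has_res (s (t x) / s x) (c ^+ n).
  rewrite -fmorph_div; apply: (@has_res_act s (fun a => a ^+ n)) hc => // [a b|a /eqP].
    by rewrite exprMn.
  by rewrite expf_eq0 => /andP[_ /eqP].
have h2 := inert_pow_ratio n hsx sx0.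
rewrite -(divff (expf_neq0 n c0)) (_ : _ / _ = s (t x) / s x * (iter n t (s x) / s x)^-1).
  by apply: has_resM => //; apply: has_resV => //; apply: expf_neq0.
by rewrite zE tame_commE invf_div mulrA divfK.
Qed.

(* An element of order p of the inertia group acting trivially on all ratios
   would make sum_(i < p) g^i y = 0 congruent to p y for y = g z - z. *)
Lemma tame_order (e : seq algC) :
  exists M, ~~ (p %| M)%N /\ forall x, x \in e -> iter M tame_comm x = x.
Proof.
have rp0 : r p%:R != 0.
  apply/eqP => /rP; rewrite (_ : aval p%:R = p%:R) //.
  exact: (rmorph_nat (val : aint -> algC)).
have ratio j z : z != 0 -> has_res (iter j tame_comm z / z) 1.
  move=> z0; elim: j => [|j IH]; first by rewrite divff //; apply: has_res1.
  rewrite iterS (_ : _ / _ = tame_comm (iter j tame_comm z) / iter j tame_comm z *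
     (iter j tame_comm z / z)); last first.
    by rewrite mulrA mulfVK // -aut_powE fmorph_eq0.
  by rewrite -[1]mulr1; apply: has_resM => //; apply: tame_comm_ratio; rewrite -aut_powE fmorph_eq0.
have noporder g x j : (forall z, g z = iter j tame_comm z) -> iter p g x = x -> g x = x.
  move=> gE gx; apply/eqP; rewrite -subr_eq0; apply: contraT => y0.
  have gM i z : iter i g z = iter (i * j) tame_comm z.
    by elim: i => //= i ->; rewrite gE mulSn iterD.
  set y := g x - x in y0.
  have s0 : \sum_(i < p) iter i g y = 0.
    have : forall l, \sum_(i < l) iter i g y = iter l g x - x.
      elim=> [|l IH]; first by rewrite big_ord0 subrr.
      rewrite big_ord_recr /= IH !gM /y -!aut_powE rmorphB !aut_powE -!gM -iterSr.
      by rewrite addrC subrKA.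
    by move=> ->; rewrite gx subrr.
  have : has_res ((\sum_(i < p) iter i g y) / y) (r p%:R).
    rewrite mulr_suml (_ : r p%:R = \sum_(i < p) 1); last by rewrite rmorph_nat sumr_const card_ord.
    apply: (big_ind2 has_res) => [|a b c d|i _]; last by rewrite gM; apply: ratio.
      by rewrite -(rmorph0 r) -[0]/(aval 0); apply: has_res_aint.
    exact: has_resD.
  rewrite s0 mul0r; have := has_res_aint 0; rewrite rmorph0 => h /(has_res_inj h)/esym e0.
  by rewrite e0 eqxx in rp0.
have [R R0 hR] := aut_period tame_comm e.
(* The prime-to-[p] part of a period; the [p]-part is then removed one factor at a time by
   [noporder]. *)
exists (R`_p^')%N; split; first by rewrite -p'natE // part_pnat.
move=> x xe; pose g := iter (R`_p^')%N tame_comm.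
have it a b z : iter a (iter b tame_comm) z = iter (a * b) tame_comm z.
  by elim: a => //= a ->; rewrite -iterD mulSn.
have gp : iter (p ^ logn p R) g x = x by rewrite /g it -p_part partnC // hR.
elim: (logn p R) gp => [//|l IH]; rewrite expnS /g it -mulnA -it => h.
apply: IH; rewrite /g it; exact: noporder (fun z => erefl) h.
Qed.

End Tame.
End ResidueRelation.

(** * Lie algebras and split tori *)

Lemma mpoly_hom_ext (B A : comNzRingType) (n : nat) (g h : {rmorphism {mpoly B[n]} -> A}) :
  (forall c, g c%:MP = h c%:MP) -> (forall i, g 'X_i = h 'X_i) -> g =1 h.
Proof.
move=> gC gX p; rewrite [p]mpolyE !rmorph_sum; apply: eq_bigr => m _.
rewrite -mul_mpolyC !rmorphM gC; congr (_ * _); rewrite mpolyXE_id !rmorph_prod.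
by apply: eq_bigr => i _; rewrite !rmorphXn gX.
Qed.

Section DualNumbers.
Variable A : comNzRingType.
Implicit Types (x y : dualnum A).

Lemma dual_sum1 I (r : seq I) (P : pred I) (F : I -> dualnum A) :
  (\sum_(i <- r | P i) F i).1 = \sum_(i <- r | P i) (F i).1.
Proof. exact: (rmorph_sum (@dual_red A)). Qed.
Lemma dual_sum2 I (r : seq I) (P : pred I) (F : I -> dualnum A) :
  (\sum_(i <- r | P i) F i).2 = \sum_(i <- r | P i) (F i).2.
Proof. by elim/big_rec2: _ => // i a b _ <-. Qed.

Lemma dual_mxM m n p (g X : 'M[A]_(m, n)) (h Y : 'M[A]_(n, p)) (a b : 'M[A]_(m, p)) :
  a = g *m h -> b = g *m Y + X *m h ->
  \matrix_(i, j) ((a i j, b i j) : dualnum A) =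
  \matrix_(i, j) ((g i j, X i j) : dualnum A) *m \matrix_(i, j) ((h i j, Y i j) : dualnum A).
Proof.
move=> -> ->; apply/matrixP => i j; rewrite !mxE; apply: injective_projections.
  by rewrite dual_sum1 /=; apply: eq_bigr => l _; rewrite !mxE.
rewrite dual_sum2 /= -big_split /=; apply: eq_bigr => l _.
by rewrite !mxE.
Qed.

Lemma dual_mxMM n (g X h Y : 'M[A]_n) :
  dual_mx g X *m dual_mx h Y = dual_mx (g *m h) (g *m Y + X *m h).
Proof. by rewrite /dual_mx -(@dual_mxM _ _ _ g X h Y _ _ erefl erefl). Qed.

Lemma dual_mx10 n : dual_mx (1%:M : 'M[A]_n) 0 = 1%:M.
Proof.
by apply/matrixP => i j; rewrite !mxE; case: (i == j); apply: injective_projections.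
Qed.

Lemma dual_hom (R : comNzRingType) (s : {rmorphism A -> R}) (w : R) : w * w = 0 ->
  exists f : {rmorphism dualnum A -> R}, forall x, f x = s x.1 + w * s x.2.
Proof.
move=> w2; apply: ex_rmorphism => [x y||x y] /=.
- by rewrite !rmorphD mulrDr addrACA.
- by rewrite rmorph1 rmorph0 mulr0 addr0.
- rewrite rmorphD !rmorphM.
  have -> : (s x.1 + w * s x.2) * (s y.1 + w * s y.2) = s x.1 * s y.1 +
    w * (s x.1 * s y.2 + s x.2 * s y.1) + (w * w) * (s x.2 * s y.2) by ring.
  by rewrite w2 mul0r addr0.
Qed.

End DualNumbers.

Lemma inverses_small (A : comNzRingType) n (w : A) (X : 'M[A]_n) :
  w * w = 0 -> inverses (1%:M + w *: X) (1%:M - w *: X).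
Proof.
move=> w2; have YY : (w *: X) *m (w *: X) = 0.
  by rewrite -scalemxAl -scalemxAr scalerA w2 scale0r.
split; first by rewrite mulmxDl mul1mx mulmxBr mulmx1 YY subr0 subrK.
by rewrite mulmxBl mul1mx mulmxDr mulmx1 YY addr0 addrK.
Qed.

Section PointsAndLie.
Variables (B : comNzRingType) (N : nat).

Definition pev (A : comNzRingType) (s : {rmorphism B -> A}) (g : 'M[A]_N) :
  {mpoly B[N * N]} -> A := mmap s (fun i => mxvec g 0 i).

Lemma pev_nat (A A' : comNzRingType) (s : {rmorphism B -> A}) (s' : {rmorphism B -> A'})
    (f : {rmorphism A -> A'}) g q :
  is_alg_hom s s' f -> pev s' (map_mx f g) q = f (pev s g q).
Proof.
move=> fs; pose h : {rmorphism {mpoly B[N * N]} -> A'} :=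
  GRing.RMorphism.clone _ _ (f \o mmap s (fun i => mxvec g 0 i)) _.
apply: (@mpoly_hom_ext _ _ _ (mmap s' (fun i => mxvec (map_mx f g) 0 i)) h) => [c|i] /=.
  by rewrite !mmapC fs.
by rewrite !mmapX !mmap1U -map_mxvec mxE.
Qed.

Definition dpev (A : comNzRingType) (s : {rmorphism B -> A}) (g X : 'M[A]_N) q :=
  \sum_(i < N * N) mxvec X 0 i * pev s g (q^`M(i)).

Lemma pev_dual (A : comNzRingType) (s : {rmorphism B -> A}) g X q :
  pev (dual_str s) (dual_mx g X) q = (pev s g q, dpev s g X q).
Proof.
have [|||h hE] := @ex_rmorphism {mpoly B[N * N]} (dualnum A)
   (fun q => (pev s g q, dpev s g X q)).
- move=> x y; apply: injective_projections; rewrite /= ?[pev _ _ _]mmapD //.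
  rewrite -big_split; apply: eq_bigr => i _ /=.
  by rewrite mderivD [pev _ _ _]mmapD mulrDr.
- apply: injective_projections; rewrite /= /pev ?rmorph1 //.
  by apply: big1 => i _; rewrite -mpolyC1 mderivC /pev rmorph0 mulr0.
- move=> x y; apply: injective_projections; rewrite /= /pev ?rmorphM //.
  rewrite mulr_sumr mulr_suml -big_split; apply: eq_bigr => i _ /=.
  by rewrite mderivM /pev rmorphD !rmorphM /=; ring.
rewrite -hE; apply: (@mpoly_hom_ext _ _ _ (mmap (dual_str s) (fun i => mxvec (dual_mx g X) 0 i)) h) => [c|i] /=.
  rewrite mmapC hE; apply: injective_projections; rewrite /= /pev ?mmapC //.
  by apply/esym/big1 => i _; rewrite mderivC /pev rmorph0 mulr0.
rewrite mmapX mmap1U hE; apply: injective_projections; rewrite /= /pev ?mmapX ?mmap1U.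
  by case/mxvec_indexP: i => a b; rewrite !mxvecE mxE.
rewrite /dpev (bigD1 i) //= mderivX mnmE eqxx scale1r big1 => [|j ji].
  rewrite addr0 (_ : (U_(i) - U_(i))%MM = 0%MM); last by apply/mnmP => l; rewrite !mnmE subnn.
  rewrite mpolyX0 /pev rmorph1 mulr1.
  by case/mxvec_indexP: i => a b; rewrite !mxvecE mxE.
by rewrite mderivX mnmE eq_sym (negPf ji) scale0r /pev rmorph0 mulr0.
Qed.

Lemma pev_taylor (A : comNzRingType) (s : {rmorphism B -> A}) g X (w : A) q :
  w * w = 0 -> pev s (g + w *: X) q = pev s g q + w * dpev s g X q.
Proof.
move=> w2; have [f fE] := dual_hom (idfun : {rmorphism A -> A}) w2.
have fs : is_alg_hom (dual_str s) s f by move=> b; rewrite fE /= mulr0 addr0.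
have -> : g + w *: X = map_mx f (dual_mx g X) by apply/matrixP => i j; rewrite !mxE fE.
by rewrite (pev_nat _ _ fs) pev_dual fE.
Qed.

Variable G : lingroup B N.

Lemma pts_nat (A A' : comNzRingType) (s : {rmorphism B -> A}) (s' : {rmorphism B -> A'})
    (f : {rmorphism A -> A'}) g :
  is_alg_hom s s' f -> pts G s g -> pts G s' (map_mx f g).
Proof.
move=> fs [[h [gh hg]] ge]; split.
  by exists (map_mx f h); split; rewrite -map_mxM ?gh ?hg map_mx1.
by move=> q qG; rewrite -/(pev _ _ _) (pev_nat _ _ fs) [pev _ _ _]ge ?rmorph0.
Qed.

Lemma pts_inj (A A' : comNzRingType) (s : {rmorphism B -> A}) (s' : {rmorphism B -> A'})
    (f : {rmorphism A -> A'}) g h :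
  is_alg_hom s s' f -> injective f -> inverses g h -> pts G s' (map_mx f g) -> pts G s g.
Proof.
move=> fs finj gh [_ ge]; split; first by exists h.
move=> q qG; apply: finj; rewrite rmorph0 -[mmap _ _ _]/(pev s g q) -(pev_nat _ _ fs).
exact: ge.
Qed.

(** Partial derivatives of the equations at the identity, computed once over [B]: over every base
    the Lie algebra is the solution space of this one linear system. *)
Definition lie_coef q i : B := pev (idfun : {rmorphism B -> B}) 1%:M (q^`M(i)).

Lemma dpev1 (A : comNzRingType) (s : {rmorphism B -> A}) X q :
  dpev s 1%:M X q = \sum_i mxvec X 0 i * s (lie_coef q i).
Proof.
apply: eq_bigr => i _; congr (_ * _); rewrite -(@pev_nat B A idfun s s) ?map_mx1 //.
Qed.

Lemma pev1 (A : comNzRingType) (s : {rmorphism B -> A}) q :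
  q \in lg_eqs G -> pev s 1%:M q = 0.
Proof. by move=> qG; have [_] := lg_one G s; apply. Qed.

Lemma lieP (A : comNzRingType) (s : {rmorphism B -> A}) X :
  lie G s X <-> forall q, q \in lg_eqs G -> \sum_i mxvec X 0 i * s (lie_coef q i) = 0.
Proof.
split=> [[_ h] q qG|h].
  by have := h q qG; rewrite -[mmap _ _ _]/(pev _ _ _) pev_dual dpev1 => -[].
split=> [|q qG].
  exists (dual_mx 1%:M (- X)); split; rewrite dual_mxMM !mul1mx !mulmx1 -?dual_mx10;
    by rewrite ?addNr ?subrr.
by rewrite -[mmap _ _ _]/(pev _ _ _) pev_dual dpev1 pev1 ?h.
Qed.

Lemma lie_small (A : comNzRingType) (s : {rmorphism B -> A}) (w : A) X :
  w * w = 0 ->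
  pts G s (1%:M + w *: X) <->
  forall q, q \in lg_eqs G -> w * (\sum_i mxvec X 0 i * s (lie_coef q i)) = 0.
Proof.
move=> w2; split=> [[_ h] q qG|h].
  by have := h q qG; rewrite -[mmap _ _ _]/(pev _ _ _) pev_taylor // dpev1 pev1 // add0r.
split=> [|q qG].
  by exists (1%:M - w *: X); apply: inverses_small.
by rewrite -[mmap _ _ _]/(pev _ _ _) pev_taylor // dpev1 pev1 // add0r h.
Qed.

Lemma lie0 (A : comNzRingType) (s : {rmorphism B -> A}) : lie G s 0.
Proof. by apply/lieP => q _; apply: big1 => i _; rewrite linear0 mxE mul0r. Qed.
Lemma lieD (A : comNzRingType) (s : {rmorphism B -> A}) X Y :
  lie G s X -> lie G s Y -> lie G s (X + Y).
Proof.
move=> /lieP hX /lieP hY; apply/lieP => q qG.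
transitivity (\sum_i (mxvec X 0 i * s (lie_coef q i) + mxvec Y 0 i * s (lie_coef q i))).
  by apply: eq_bigr => i _; rewrite linearD mxE mulrDl.
by rewrite big_split /= hX ?hY ?addr0.
Qed.
Lemma lieZ (A : comNzRingType) (s : {rmorphism B -> A}) a X :
  lie G s X -> lie G s (a *: X).
Proof.
move=> /lieP hX; apply/lieP => q qG.
transitivity (a * \sum_i mxvec X 0 i * s (lie_coef q i)); last by rewrite hX ?mulr0.
by rewrite mulr_sumr; apply: eq_bigr => i _; rewrite linearZ mxE mulrA.
Qed.
Lemma lieB (A : comNzRingType) (s : {rmorphism B -> A}) X Y :
  lie G s X -> lie G s Y -> lie G s (X - Y).
Proof.
move=> hX hY; have -> : X - Y = X + (-1) *: Y by rewrite scaleN1r.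
exact: (lieD hX (lieZ (-1) hY)).
Qed.
Lemma lie_sum (A : comNzRingType) (s : {rmorphism B -> A}) (I : Type) (r : seq I)
    (P : pred I) (X : I -> 'M[A]_N) :
  (forall i, P i -> lie G s (X i)) -> lie G s (\sum_(i <- r | P i) X i).
Proof. by move=> h; apply: (big_ind (lie G s)) h; [exact: lie0 | exact: lieD]. Qed.

Lemma lie_nat (A A' : comNzRingType) (s : {rmorphism B -> A}) (s' : {rmorphism B -> A'})
    (f : {rmorphism A -> A'}) X :
  is_alg_hom s s' f -> lie G s X -> lie G s' (map_mx f X).
Proof.
move=> fs /lieP h; apply/lieP => q qG.
transitivity (f (\sum_i mxvec X 0 i * s (lie_coef q i))); last by rewrite h ?rmorph0.
by rewrite rmorph_sum; apply: eq_bigr => i _; rewrite rmorphM fs -map_mxvec mxE.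
Qed.

Lemma lie_ad (A : comNzRingType) (s : {rmorphism B -> A}) g g' X :
  pts G s g -> inverses g g' -> lie G s X -> lie G s (g *m X *m g').
Proof.
move=> gG gg' hX.
have sA : is_alg_hom s (dual_str s) (dual_str (idfun : {rmorphism A -> A})) by [].
have E h : map_mx (dual_str (idfun : {rmorphism A -> A})) h = dual_mx h 0.
  by apply/matrixP => i j; rewrite !mxE.
have := lg_mul (lg_mul (pts_nat sA gG) hX) (pts_nat sA (lg_inv gG gg')).
rewrite !E !dual_mxMM ?mulmx1 ?mulmx0 ?mul0mx ?add0r ?addr0.
by case: gg' => -> _.
Qed.

(** Over the dual numbers the adjoint action of 1 + eps X sends Y to Y + eps [X, Y], and the
    eps-component of a solution of the linear system is again a solution. *)
Lemma lie_bracket (A : comNzRingType) (s : {rmorphism B -> A}) X Y :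
  lie G s X -> lie G s Y -> lie G s (X *m Y - Y *m X).
Proof.
move=> hX hY.
have sA : is_alg_hom s (dual_str s) (dual_str (idfun : {rmorphism A -> A})) by [].
have E h : map_mx (dual_str (idfun : {rmorphism A -> A})) h = dual_mx h 0.
  by apply/matrixP => i j; rewrite !mxE.
have XX : inverses (dual_mx 1%:M X) (dual_mx 1%:M (- X)).
  by split; rewrite dual_mxMM !mul1mx !mulmx1 -?dual_mx10 ?addNr ?subrr.
have /lieP h := lie_ad hX XX (lie_nat sA hY); apply/lieP => q qG.
have := h q qG; rewrite E !dual_mxMM ?mul1mx ?mulmx1 ?mulmx0 ?mul0mx ?add0r ?addr0 mulmxN addrC.
move=> /(congr1 snd) /=; rewrite dual_sum2 => e; rewrite -[RHS]e.
apply: eq_bigr => i _; case/mxvec_indexP: i => a b; rewrite !mxvecE !mxE /=.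
by rewrite mulr0 add0r.
Qed.

End PointsAndLie.

Definition hev (A R : comNzRingType) (s : {rmorphism A -> R}) (u : R) (f : {poly A}) : R :=
  (map_poly s f).[u].

(** This is A[X, Y] / (XY - 1), where generic points of split tori live. A nonzero multiple of XY -
    1 has positive degree in Y, so A[X] embeds. *)
Lemma laurent_ring (A : comNzRingType) :
  exists (L : comNzRingType) (c : {rmorphism A -> L}) (x y : L),
  [/\ x * y = 1,
      (forall z, exists m f, x ^+ m * z = hev c x f),
      (forall f, hev c x f = 0 -> f = 0) &
      (forall (R : comNzRingType) (s : {rmorphism A -> R}) (u v : R), u * v = 1 ->
         exists h : {rmorphism L -> R}, is_alg_hom c s h /\ h x = u)].
Proof.
pose w : {poly {poly A}} := 'X%:P * 'X - 1.
have wE (g : {poly {poly A}}) : g != 0 -> size (g * w) = (size g).+1.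
  move=> g0; have sw : w = 'X%:P * 'X + (-1)%:P by rewrite /w polyCN.
  have szw : size w = 2.
    by rewrite sw size_MXaddC polyC_eq0 polyX_eq0 /= size_polyC polyX_eq0.
  have lw : lead_coef w = 'X by rewrite lead_coefE szw sw coefD coefC coefMX coefC /= addr0.
  have nz : lead_coef g * lead_coef w != 0.
    rewrite lw; apply: contra_neq g0 => /(congr1 (fun q : {poly A} => q)) e.
    apply/eqP; rewrite -lead_coef_eq0; apply/eqP/polyP => i.
    by have := congr1 (fun q : {poly A} => q`_i.+1) e; rewrite coefMX coef0 /= => ->; rewrite coef0.
  by rewrite size_proper_mul // szw addn2.
pose I (f : {poly {poly A}}) := exists g, f = g * w.
have hI : is_ideal I.
  split=> [|_ _ [g ->] [h ->]|a _ [g ->]]; first by exists 0; rewrite mul0r.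
    by exists (g + h); rewrite mulrDl.
  by exists (a * g); rewrite mulrA.
have IC (f : {poly A}) : I f%:P -> f = 0.
  case=> g fg; have [g0|g0] := eqVneq g 0.
    by apply/eqP; rewrite -polyC_eq0 fg g0 mul0r.
  have := wE g g0; rewrite -fg => e; have := size_polyC_leq1 f; rewrite e ltnS.
  by rewrite leqn0 size_poly_eq0 (negPf g0).
have h1 : ~ I 1 by rewrite -polyC1 => /IC /eqP; rewrite oner_eq0.
have [L [pr [prs prI]]] := quotient_ring hI h1.
pose c : {rmorphism A -> L} := GRing.RMorphism.clone _ _ (pr \o (polyC \o polyC)) _.
pose x := pr ('X%:P); pose y := pr 'X.
have xy : x * y = 1.
  apply/eqP; rewrite -rmorphM -(rmorph1 pr) -subr_eq0 -rmorphB; apply/eqP/prI.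
  by exists 1; rewrite mul1r.
have hevE f : hev c x f = pr f%:P.
  elim/poly_ind: f => [|f a IH]; first by rewrite /hev !rmorph0 horner0.
  rewrite /hev rmorphD rmorphM /= map_polyX map_polyC hornerMXaddC -/(hev c x f) IH.
  by rewrite polyCD polyCM rmorphD rmorphM.
exists L, c, x, y; split=> //.
- move=> z; have [f <-] := prs z; exists (size f).
  exists (\sum_(i < size f) f`_i * 'X ^+ (size f - i)).
  rewrite hevE !rmorph_sum /= -[X in pr X]coefK poly_def rmorph_sum mulr_sumr.
  apply: eq_bigr => i _; rewrite -mul_polyC !rmorphM !rmorphXn /= -/x -/y.
  have le : (i <= size f)%N by apply: ltnW.
  have -> : x ^+ size f = x ^+ (size f - i) * x ^+ i by rewrite -exprD subnK.
  have : x ^+ i * y ^+ i = 1 by rewrite -exprMn xy expr1n.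
  move: (x ^+ i) (y ^+ i) => a b ab; transitivity (pr (f`_i)%:P * (x ^+ (size f - i) * (a * b))).
    by ring.
  by rewrite ab mulr1.
- by move=> f; rewrite hevE => /prI; apply: IC.
move=> R s u v uv.
pose e1 : {rmorphism {poly A} -> R} := horner_morph (fun a => mulrC u (s a)).
pose e2 : {rmorphism {poly {poly A}} -> R} := horner_morph (fun a => mulrC v (e1 a)).
have [f|h hE] := @factor_rmorphism _ _ R pr e2 prs.
  move=> /prI[g ->]; rewrite rmorphM (_ : e2 w = 0) ?mulr0 //.
  rewrite rmorphB rmorphM rmorph1 /e2 /= horner_morphX horner_morphC /= horner_morphX.
  by rewrite uv subrr.
exists h; split=> [a|]; first by rewrite /c /= hE /e2 /= horner_morphC /= horner_morphC.
by rewrite hE /e2 /= horner_morphC /= horner_morphX.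
Qed.

Lemma hev_sum (A R : comNzRingType) (s : {rmorphism A -> R}) (u : R) (I : Type)
    (l : seq I) (P : pred I) (f : I -> A) (e : I -> nat) :
  hev s u (\sum_(i <- l | P i) f i *: 'X^(e i)) = \sum_(i <- l | P i) s (f i) * u ^+ e i.
Proof.
rewrite /hev rmorph_sum horner_sum; apply: eq_bigr => i _.
by rewrite /= map_polyZ map_polyXn hornerZ hornerXn.
Qed.

Lemma scale_prodmx (A : comNzRingType) N (I : Type) (l : seq I) (c : I -> A) (X : I -> 'M[A]_N) :
  \prod_(i <- l) (c i *: X i) = (\prod_(i <- l) c i) *: \prod_(i <- l) X i.
Proof.
elim: l => [|i l IH]; first by rewrite !big_nil scale1r.
by rewrite !big_cons IH -!mulmxE -scalemxAl -scalemxAr scalerA.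
Qed.

Lemma prod_comm_split (R : pzRingType) (I : Type) (l : seq I) (X Y : I -> R) :
  (forall i j, X i * Y j = Y j * X i) ->
  (\prod_(i <- l) X i) * (\prod_(i <- l) Y i) = \prod_(i <- l) (X i * Y i).
Proof.
move=> XY; elim: l => [|i l IH]; first by rewrite !big_nil mulr1.
rewrite !big_cons -IH -!mulrA; congr (_ * _); rewrite !mulrA; congr (_ * _).
by apply: commr_sym; apply: commr_prod => j _; apply/esym/XY.
Qed.

Lemma prod_eq0 (R : pzRingType) (I : eqType) (l : seq I) (X : I -> R) i :
  i \in l -> X i = 0 -> \prod_(j <- l) X j = 0.
Proof.
move=> il X0; elim: l il => // j l IH; rewrite inE big_cons => /orP[/eqP<-|/IH->].
  by rewrite X0 mul0r.
by rewrite mulr0.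
Qed.

(** * Weight decomposition for a split torus *)

Section TorusWeights.
Variables (B : comNzRingType) (N : nat) (T : lingroup B N) (r : nat) (chi : 'I_r -> lgchar T).
Hypothesis hchi : forall (A : comNzRingType) (s : {rmorphism B -> A}) (a : 'I_r -> A),
    (forall i, exists b, a i * b = 1) ->
    exists! t, pts T s t /\ forall i, chr_at (chi i) s t = a i.

Lemma torus_eq (A : comNzRingType) (s : {rmorphism B -> A}) t t' :
  pts T s t -> pts T s t' -> (forall i, chr_at (chi i) s t = chr_at (chi i) s t') -> t = t'.
Proof.
move=> ht ht' e; have [i|t0 [_ h]] := hchi s (a := fun i => chr_at (chi i) s t).
  exact: chr_unit ht.
by transitivity t0; [apply/esym|]; apply: h; split=> // i; rewrite e.
Qed.

Lemma torus_ex (A : comNzRingType) (s : {rmorphism B -> A}) (a : 'I_r -> A) :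
  (forall i, exists b, a i * b = 1) ->
  exists t, pts T s t /\ forall i, chr_at (chi i) s t = a i.
Proof. by move=> /hchi-/(_ s)[t [h _]]; exists t. Qed.

Lemma torus_comm (A : comNzRingType) (s : {rmorphism B -> A}) t t' :
  pts T s t -> pts T s t' -> t *m t' = t' *m t.
Proof.
move=> ht ht'; apply: (@torus_eq _ s); try exact: lg_mul.
by move=> i; rewrite !chr_mul // mulrC.
Qed.

Lemma chr1 (A : comNzRingType) (s : {rmorphism B -> A}) (a : lgchar T) : chr_at a s 1%:M = 1.
Proof.
have h1 := lg_one T s; have [b hb] := chr_unit a h1.
have := chr_mul a h1 h1; rewrite mul1mx => e.
by rewrite -[LHS]mulr1 -[X in _ * X]hb mulrA -e hb.
Qed.

Definition one_at (A : comNzRingType) (u : A) (j i : 'I_r) : A := if i == j then u else 1.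

Lemma one_at_unit (A : comNzRingType) (u v : A) j i : u * v = 1 -> exists b, one_at u j i * b = 1.
Proof. by move=> uv; rewrite /one_at; case: eqP => _; [exists v | exists 1; rewrite mulr1]. Qed.

(** The [j]-th cocharacter as a Laurent polynomial in [u] with matrix coefficients; the factor
    [u ^+ m] clears the negative exponents. *)
Definition is_cochar (j : 'I_r) m C (E : nat -> 'M[B]_N) :=
  forall (A : comNzRingType) (s : {rmorphism B -> A}) (u v : A) t, u * v = 1 ->
    pts T s t -> (forall i, chr_at (chi i) s t = one_at u j i) ->
    u ^+ m *: t = \sum_(a < C) u ^+ a *: map_mx s (E a).

(** The expansion is read at the universal unit of B[x, 1/x]; any other unit is a specialization of
    it. *)
Lemma cochar_exists j : exists m C E, (forall a, (C <= a)%N -> E a = 0) /\ is_cochar j m C E.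
Proof.
have [L [c [x [y [xy L1 L2 L3]]]]] := laurent_ring B.
have [t [ht tE]] := torus_ex c (fun i => one_at_unit j i xy).
have h a b : exists mf : nat * {poly B}, x ^+ mf.1 * t a b = hev c x mf.2.
  by have [m [f e]] := L1 (t a b); exists (m, f).
pose mf a b := sval (cid (h a b)); have mfE a b := svalP (cid (h a b)).
pose m := (\max_(ab : 'I_N * 'I_N) (mf ab.1 ab.2).1)%N.
pose F a b := (mf a b).2 * 'X^(m - (mf a b).1).
pose C := (\max_(ab : 'I_N * 'I_N) size (F ab.1 ab.2))%N.
exists m, C, (fun i => \matrix_(a, b) (F a b)`_i).
have Fsz a b : (size (F a b) <= C)%N by apply: (leq_bigmax (a, b)).
split=> [i Ci|A s u v t' uv ht' t'E].
  by apply/matrixP => a b; rewrite !mxE nth_default // (leq_trans (Fsz a b)).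
have [f [fc fx]] := L3 A s u v uv.
have -> : t' = map_mx f t.
  apply: (@torus_eq _ s) => //; first exact: pts_nat fc ht.
  by move=> i; rewrite (chr_nat (chi i) fc ht) t'E tE /one_at; case: eqP; rewrite ?rmorph1.
apply/matrixP => a b; rewrite !mxE summxE.
have le : ((mf a b).1 <= m)%N by apply: (@leq_bigmax _ (fun ab => (mf ab.1 ab.2).1) (a, b)).
have -> : u ^+ m * f (t a b) = f (hev c x (F a b)).
  have -> : hev c x (F a b) = x ^+ m * t a b.
    rewrite /hev rmorphM /= map_polyXn hornerM hornerXn -/(hev c x _) -mfE mulrAC -exprD.
    by rewrite subnKC.
  by rewrite rmorphM rmorphXn fx.
rewrite -[F a b]coefK poly_def hev_sum rmorph_sum (big_ord_widen _ (fun i => f (c (F a b)`_i * x ^+ i)) (Fsz a b)).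
rewrite big_mkcond; apply: eq_bigr => i _; rewrite !mxE; case: ltnP => [_|ge].
  by rewrite rmorphM fc rmorphXn fx mulrC.
by rewrite nth_default // rmorph0 mulr0.
Qed.

(** Two independent parameters are encoded as [x] and [x ^+ C] in one Laurent ring: for digits below
    [C] the exponents [a + C * b] are distinct. *)
Lemma laurent_digits C (M : nat -> nat -> 'M[B]_N) :
  (forall (L : comNzRingType) (c : {rmorphism B -> L}) (x y : L), x * y = 1 ->
   (forall f, hev c x f = 0 -> f = 0) ->
   \sum_(a < C) \sum_(b < C) x ^+ (a + C * b) *: map_mx c (M a b) = 0) ->
  forall a b, (a < C)%N -> (b < C)%N -> M a b = 0.
Proof.
move=> h; have [L [c [x [y [xy _ L2 _]]]]] := laurent_ring B.
have {}h := h L c x y xy L2.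
move=> a b aC bC; apply/matrixP => i j; rewrite !mxE.
pose p : {poly B} := \sum_(ab : 'I_C * 'I_C) M ab.1 ab.2 i j *: 'X^(ab.1 + C * ab.2).
have p0 : p = 0.
  apply: L2; rewrite hev_sum; have := congr1 (fun X : 'M[L]_N => X i j) h.
  rewrite summxE mxE (eq_bigr (fun a : 'I_C => \sum_(b < C) x ^+ (a + C * b) * c (M a b i j))).
    by rewrite pair_big => e; rewrite -[RHS]e; apply: eq_bigr => ab _; rewrite mulrC.
  by move=> a' _; rewrite summxE; apply: eq_bigr => b' _; rewrite !mxE.
have : p`_(a + C * b) = M a b i j.
  rewrite /p coef_sum (bigD1 (Ordinal aC, Ordinal bC)) //= coefZ coefXn eqxx mulr1.
  rewrite big1 ?addr0 // => -[a' b'] ne; rewrite coefZ coefXn.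
  case: eqP => [/= e|]; last by rewrite mulr0.
  case/eqP: ne; apply/eqP; rewrite xpair_eqE -!val_eqE /=.
  have C0 : (0 < C)%N by apply: leq_ltn_trans aC.
  have key u v : (u < C)%N -> ((u + C * v) %% C = u)%N /\ ((u + C * v) %/ C = v)%N.
    by move=> uC; rewrite addnC mulnC modnMDl modn_small // divnMDl // divn_small // addn0.
  have [ea eb] := key a b aC; have [ea' eb'] := key a' b' (ltn_ord a').
  have Ea : a' = a :> nat by rewrite -[RHS]ea e ea'.
  have Eb : b' = b :> nat by rewrite -[RHS]eb e eb'.
  by rewrite Ea Eb !eqxx.
by move=> <-; rewrite p0 coef0.
Qed.

(** Multiplicativity of the cocharacter at the parameters x, x^C and x^(C+1), compared coefficient
    by coefficient, says that the coefficients are orthogonal idempotents; its value at 1 gives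
    their sum. *)
Lemma cochar_orth j m C E : is_cochar j m C E ->
  (forall a b, (a < C)%N -> (b < C)%N -> E a *m E b = if a == b then E a else 0) /\
  \sum_(a < C) E a = 1%:M.
Proof.
move=> hE; split; last first.
  have h := hE B idfun 1 1 1%:M (mul1r 1) (lg_one T _).
  rewrite expr1n scale1r in h; rewrite h => [|i]; last by rewrite chr1 /one_at; case: eqP.
  by apply: eq_bigr => a _; rewrite expr1n scale1r map_mx_id.
move=> a b aC bC; apply/eqP; rewrite -subr_eq0; apply/eqP.
apply: (@laurent_digits C (fun a b => E a *m E b - if a == b then E a else 0)) => // L c x y xy L2.
have xyn i : x ^+ i * y ^+ i = 1 by rewrite -exprMn xy expr1n.
have [t1 [h1 e1]] := torus_ex c (fun i => one_at_unit j i xy).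
have [t2 [h2 e2]] := torus_ex c (fun i => one_at_unit j i (xyn C)).
have [t3 [h3 e3]] := torus_ex c (fun i => one_at_unit j i (xyn C.+1)).
have t3E : t3 = t1 *m t2.
  apply: (@torus_eq _ c) => //; first exact: lg_mul.
  by move=> i; rewrite chr_mul // e1 e2 e3 /one_at; case: eqP; rewrite ?mulr1 // -exprS.
have := hE L c _ _ t3 (xyn C.+1) h3 e3; rewrite t3E -exprM.
have -> : x ^+ (C.+1 * m) *: (t1 *m t2) = (x ^+ m *: t1) *m (x ^+ C ^+ m *: t2).
  by rewrite -scalemxAl -scalemxAr scalerA -exprM -exprD mulSn.
rewrite (hE L c _ _ t1 xy h1 e1) (hE L c _ _ t2 (xyn C) h2 e2) mulmx_suml => e.
rewrite -[RHS](subrr (\sum_(i < C) x ^+ C.+1 ^+ i *: map_mx c (E i))) -{1}e -sumrB.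
apply: eq_bigr => i _; rewrite mulmx_sumr.
have -> : x ^+ C.+1 ^+ i *: map_mx c (E i) = \sum_(l < C) x ^+ (i + C * l) *:
    map_mx c (if i == l :> nat then E i else 0).
  rewrite (bigD1 i) //= eqxx big1 ?addr0 => [|l li].
    by rewrite -exprM mulSn.
  by rewrite eq_sym -[(_ == _) as X in if X then _ else _]/(l == i) (negPf li) map_mx0 scaler0.
rewrite -sumrB; apply: eq_bigr => l _.
by rewrite map_mxB scalerBr map_mxM -scalemxAl -scalemxAr scalerA -exprM -exprD.
Qed.

Lemma cochar_comm j j' m m' C E E' : is_cochar j m C E -> is_cochar j' m' C E' ->
  forall a b, (a < C)%N -> (b < C)%N -> E a *m E' b = E' b *m E a.
Proof.
move=> hE hE' a b aC bC; apply/eqP; rewrite -subr_eq0; apply/eqP.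
apply: (@laurent_digits C (fun a b => E a *m E' b - E' b *m E a)) => // L c x y xy L2.
have xyn i : x ^+ i * y ^+ i = 1 by rewrite -exprMn xy expr1n.
have [t1 [h1 e1]] := torus_ex c (fun i => one_at_unit j i xy).
have [t2 [h2 e2]] := torus_ex c (fun i => one_at_unit j' i (xyn C)).
have e12 : (x ^+ m *: t1) *m (x ^+ C ^+ m' *: t2) = (x ^+ C ^+ m' *: t2) *m (x ^+ m *: t1).
  by rewrite -!scalemxAl -!scalemxAr !scalerA (torus_comm h1 h2) mulrC.
rewrite (hE L c _ _ t1 xy h1 e1) (hE' L c _ _ t2 (xyn C) h2 e2) in e12.
apply/eqP; move/eqP: e12; rewrite -subr_eq0 mulmx_suml (mulmx_sumr _ _ _ (fun i : 'I_C => x ^+ i *: map_mx c (E i))).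
rewrite -sumrB; congr (_ == _); apply: eq_bigr => i _.
rewrite mulmx_sumr mulmx_suml -sumrB; apply: eq_bigr => l _.
rewrite map_mxB !map_mxM scalerBr -!scalemxAl -!scalemxAr !scalerA -exprM.
by rewrite [x ^+ (C * l) * _]mulrC -exprD.
Qed.

Lemma cochar_uniform : exists C (m : 'I_r -> nat) (E : 'I_r -> nat -> 'M[B]_N),
  forall j, is_cochar j (m j) C (E j).
Proof.
pose ex j := cochar_exists j.
pose m j := sval (cid (ex j)); have ex1 j := svalP (cid (ex j)).
pose C j := sval (cid (ex1 j)); have ex2 j := svalP (cid (ex1 j)).
pose E j := sval (cid (ex2 j)); have ex3 j := svalP (cid (ex2 j)).
exists (\max_j C j)%N, m, E => j A s u v t uv ht tE.
have [E0 hE] := ex3 j; rewrite (hE A s u v t uv ht tE).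
have le : (C j <= \max_j C j)%N := leq_bigmax j.
rewrite [LHS](big_ord_widen _ (fun a => u ^+ a *: map_mx s (E j a)) le).
rewrite [LHS]big_mkcond; apply: eq_bigr => a _; case: ltnP => // ge.
by rewrite /E E0 // map_mx0 scaler0.
Qed.

Definition coch_w C (A : comNzRingType) (u : 'I_r -> A) (mu : {ffun 'I_r -> 'I_C}) : A :=
  \prod_j u j ^+ mu j.

(** [E mu] projects onto the weight space of the character with exponents mu_j - m_j: the weights
    stay in ['I_C] and the shift [m] carries the signs. A point of [T] is the product of its
    components along the cocharacters, whose projectors commute. *)
Lemma torus_weights : exists C (m : 'I_r -> nat) (E : {ffun 'I_r -> 'I_C} -> 'M[B]_N),
  [/\ \sum_mu E mu = 1%:M,
     (forall mu nu, E mu *m E nu = if mu == nu then E mu else 0) &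
     forall (A : comNzRingType) (s : {rmorphism B -> A}) t, pts T s t ->
       (\prod_j chr_at (chi j) s t ^+ m j) *: t =
       \sum_mu coch_w (fun j => chr_at (chi j) s t) mu *: map_mx s (E mu)].
Proof.
have [C [m [F hF]]] := cochar_uniform.
pose E (mu : {ffun 'I_r -> 'I_C}) : 'M[B]_N := \prod_j F j (mu j).
exists C, m, E; split.
- transitivity (\prod_j \sum_(a < C) F j a); first by rewrite bigA_distr_bigA.
  by rewrite big1 // => j _; case: (cochar_orth (hF j)).
- move=> mu nu; have := @prod_comm_split _ _ (index_enum _) (fun j => F j (mu j)) (fun j => F j (nu j)).
  rewrite -/(E mu) -/(E nu) mulmxE => -> => [|i j]; last first.
    exact: (cochar_comm (hF i) (hF j)).
  case: eqP => [->|ne].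
    by apply: eq_bigr => j _; rewrite -mulmxE (cochar_orth (hF j)).1 // eqxx.
  have /existsP[j ne_j] : [exists j, mu j != nu j].
    by apply: contra_notT ne; rewrite negb_exists => /forallP h; apply/ffunP => j; apply/eqP/negPn/h.
  apply: (@prod_eq0 _ _ _ _ j); first exact: mem_index_enum.
  by rewrite -mulmxE (cochar_orth (hF j)).1 // -val_eqE in ne_j *; rewrite (negPf ne_j).
move=> A s t ht; pose u j := chr_at (chi j) s t.
have hu j : exists v, u j * v = 1 by apply: chr_unit ht.
pose v j := sval (cid (hu j)); have uv j : u j * v j = 1 := svalP (cid (hu j)).
have ext j := torus_ex s (fun i => one_at_unit j i (uv j)).
pose tt j := sval (cid (ext j)).
have [ttP ttE] : (forall j, pts T s (tt j)) /\ (forall j i, chr_at (chi i) s (tt j) = one_at (u j) j i).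
  by split=> j; case: (svalP (cid (ext j))).
have prodP (l : seq 'I_r) : pts T s (\prod_(j <- l) tt j) /\
    forall i, chr_at (chi i) s (\prod_(j <- l) tt j) = \prod_(j <- l) one_at (u j) j i.
  elim: l => [|j l [IH1 IH2]].
    by rewrite big_nil; split=> [|i]; rewrite ?big_nil ?chr1 //; apply: lg_one.
  rewrite big_cons; split=> [|i]; first exact: lg_mul (ttP j) IH1.
  by rewrite (chr_mul _ (ttP j) IH1) IH2 ttE big_cons.
have tE : t = \prod_j tt j.
  have [p1 p2] := prodP (index_enum _); apply: (@torus_eq _ s) => // i.
  rewrite p2 (bigD1 i) //= {1}/one_at eqxx big1 ?mulr1 // => j ji.
  by rewrite /one_at eq_sym (negPf ji).
rewrite [X in _ *: X = _]tE -scale_prodmx.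
transitivity (\prod_j \sum_(a < C) u j ^+ a *: map_mx s (F j a)).
  by apply: eq_bigr => j _; exact: (hF j A s (u j) (v j) (tt j) (uv j) (ttP j) (ttE j)).
rewrite bigA_distr_bigA; apply: eq_bigr => mu _.
by rewrite scale_prodmx; congr (_ *: _); rewrite rmorph_prod.
Qed.

End TorusWeights.

(** * Arcs in the centralizer of a regular element *)

Section PowerSeries.
Variable A : comNzRingType.

Definition pser : Type := nat -> A.
Implicit Types f g h : pser.

HB.instance Definition _ := gen_eqMixin pser.
HB.instance Definition _ := gen_choiceMixin pser.

Lemma pser_eq f g : (forall n, f n = g n) -> f = g.
Proof. by move=> e; apply: functional_extensionality_dep. Qed.

Definition pstrunc n f : {poly A} := \poly_(i < n) f i.
Definition ps_add f g : pser := fun n => f n + g n.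
Definition ps_opp f : pser := fun n => - f n.
Definition ps_const (a : A) : pser := fun n => if n == 0%N then a else 0.
Definition ps_mul f g : pser := fun n => \sum_(i < n.+1) f i * g (n - i)%N.

(** A coefficient of a product depends on truncations only, so the ring laws come from those of
    polynomials. *)
Lemma ps_mulE m n f g : (n < m)%N -> ps_mul f g n = (pstrunc m f * pstrunc m g)`_n.
Proof.
move=> nm; rewrite coefM; apply: eq_bigr => i _; rewrite !coef_poly.
by rewrite !(leq_ltn_trans _ nm) ?leq_subr // -ltnS.
Qed.

Lemma pstrunc_mul m n f g : (n < m)%N -> (pstrunc m (ps_mul f g))`_n = (pstrunc m f * pstrunc m g)`_n.
Proof. by move=> nm; rewrite -ps_mulE // coef_poly nm. Qed.

Lemma coefM_eq n (p q p' q' : {poly A}) : (forall i, (i <= n)%N -> p`_i = p'`_i) ->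
  (forall i, (i <= n)%N -> q`_i = q'`_i) -> (p * q)`_n = (p' * q')`_n.
Proof.
move=> hp hq; rewrite !coefM; apply: eq_bigr => i _.
by rewrite hp ?hq ?leq_subr // -ltnS.
Qed.

Lemma ps_addA : associative ps_add.
Proof. by move=> f g h; apply: pser_eq => n; rewrite /ps_add addrA. Qed.
Lemma ps_addC : commutative ps_add.
Proof. by move=> f g; apply: pser_eq => n; rewrite /ps_add addrC. Qed.
Lemma ps_add0 : left_id (ps_const 0) ps_add.
Proof. by move=> f; apply: pser_eq => n; rewrite /ps_add /ps_const if_same add0r. Qed.
Lemma ps_addN : left_inverse (ps_const 0) ps_opp ps_add.
Proof. by move=> f; apply: pser_eq => n; rewrite /ps_add /ps_const if_same addNr. Qed.
Lemma ps_mulA : associative ps_mul.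
Proof.
move=> f g h; apply: pser_eq => n; rewrite !(@ps_mulE n.+1) //.
transitivity (pstrunc n.+1 f * (pstrunc n.+1 g * pstrunc n.+1 h))`_n.
  by apply: coefM_eq => // i le; rewrite pstrunc_mul.
by rewrite mulrA; apply/esym/coefM_eq => // i le; rewrite pstrunc_mul.
Qed.
Lemma ps_mulC : commutative ps_mul.
Proof. by move=> f g; apply: pser_eq => n; rewrite !(@ps_mulE n.+1) // mulrC. Qed.
Lemma ps_mulC_const a f n : ps_mul (ps_const a) f n = a * f n.
Proof.
rewrite /ps_mul big_ord_recl big1 ?addr0 ?subn0 // => i _.
by rewrite /ps_const /= mul0r.
Qed.
Lemma ps_mul1 : left_id (ps_const 1) ps_mul.
Proof. by move=> f; apply: pser_eq => n; rewrite ps_mulC_const mul1r. Qed.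
Lemma ps_mulDl : left_distributive ps_mul ps_add.
Proof.
move=> f g h; apply: pser_eq => n; rewrite /ps_mul /ps_add -big_split.
by apply: eq_bigr => i _; rewrite mulrDl.
Qed.
Lemma ps_1neq0 : ps_const 1 != ps_const 0.
Proof. by apply/eqP => /(congr1 (fun f : pser => f 0%N)) /eqP; rewrite /ps_const oner_eq0. Qed.

HB.instance Definition _ := GRing.isZmodule.Build pser ps_addA ps_addC ps_add0 ps_addN.
HB.instance Definition _ := GRing.Zmodule_isComNzRing.Build pser
  ps_mulA ps_mulC ps_mul1 ps_mulDl ps_1neq0.

Lemma psD f g n : (f + g) n = f n + g n. Proof. by []. Qed.
Lemma psN f n : (- f) n = - f n. Proof. by []. Qed.
Lemma ps0 n : (0 : pser) n = 0. Proof. by rewrite [LHS]/(ps_const 0 n) /ps_const if_same. Qed.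
Lemma ps1 n : (1 : pser) n = (n == 0)%:R.
Proof. by rewrite [LHS]/(ps_const 1 n) /ps_const; case: eqP. Qed.
Lemma psM f g n : (f * g) n = \sum_(i < n.+1) f i * g (n - i)%N. Proof. by []. Qed.
Lemma ps_sum I (r : seq I) P (F : I -> pser) n :
  (\sum_(i <- r | P i) F i) n = \sum_(i <- r | P i) F i n.
Proof. by elim/big_rec2: _ => [|i a b _ <-]; rewrite ?ps0. Qed.

Fact ps_const_zmod : zmod_morphism ps_const.
Proof. by move=> a b; apply: pser_eq => n; rewrite psD psN /ps_const; case: eqP; rewrite ?subr0. Qed.
Fact ps_const_monoid : monoid_morphism ps_const.
Proof.
split=> // a b; apply: pser_eq => n; rewrite [RHS]ps_mulC_const /ps_const.
by case: eqP; rewrite ?mulr0.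
Qed.
HB.instance Definition _ := GRing.isZmodMorphism.Build A pser ps_const ps_const_zmod.
HB.instance Definition _ := GRing.isMonoidMorphism.Build A pser ps_const ps_const_monoid.

Lemma ps_constM a f n : (ps_const a * f) n = a * f n. Proof. exact: ps_mulC_const. Qed.

Definition ps_X n : pser := fun i => (i == n)%:R.
Lemma ps_XM n f m : (ps_X n * f) m = if (n <= m)%N then f (m - n)%N else 0.
Proof.
rewrite psM; case: leqP => nm.
  have nm1 : (n < m.+1)%N by [].
  rewrite (bigD1 (Ordinal nm1)) //= /ps_X eqxx mul1r big1 ?addr0 // => i.
  by rewrite -val_eqE /= => /negPf->; rewrite mul0r.
apply: big1 => i _; rewrite /ps_X ltn_eqF ?mul0r //.
by apply: leq_ltn_trans nm; rewrite -ltnS.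
Qed.

Lemma ps_low_mul f g m n : (forall i, (i < m)%N -> f i = 0) -> (forall i, (i < n)%N -> g i = 0) ->
  (forall i, (i < m + n)%N -> (f * g) i = 0) /\ (f * g) (m + n)%N = f m * g n.
Proof.
move=> hf hg; split=> [i lt|].
  rewrite psM; apply: big1 => j _; have [jm|mj] := ltnP j m; first by rewrite hf ?mul0r.
  by rewrite (hg (i - j)%N) ?mulr0 //; have := ltn_ord j; lia.
have mn : (m < (m + n).+1)%N by rewrite ltnS leq_addr.
rewrite psM (bigD1 (Ordinal mn)) //= addKn big1 ?addr0 // => j.
rewrite -val_eqE /= => jm; have [lt|le] := ltnP j m; first by rewrite hf ?mul0r.
by rewrite (hg _) ?mulr0 //; have := ltn_ord j; move/eqP in jm; lia.
Qed.

Lemma ps_order f : f != 0 -> exists m, (forall i, (i < m)%N -> f i = 0) /\ f m <> 0.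
Proof.
move=> f0; have ex : exists m, f m != 0.
  apply: contrapT => no; case/eqP: f0; apply: pser_eq => n; rewrite ps0.
  by apply/eqP; apply: contraT => nz; case: no; exists n.
exists (ex_minn ex); case: ex_minnP => m /eqP fm hm; split=> // i im.
by apply/eqP; apply: contraLR im => /hm; rewrite -leqNgt.
Qed.

(** Substitution of t^i for t. For [i = 0] only the index 0 is divisible by 0, so this is the
    constant series with the value at t = 0. *)
Definition ps_subst i f : pser := fun n => if (i %| n)%N then f (n %/ i)%N else 0.

Lemma ps_subst_hom i : (0 < i)%N -> exists h : {rmorphism pser -> pser}, forall f, h f = ps_subst i f.
Proof.
move=> i0; apply: ex_rmorphism => [f g||f g]; apply: pser_eq => n; rewrite /ps_subst.
- by rewrite [RHS]psD /=; case: ifP => _; rewrite ?psD ?addr0.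
- rewrite !ps1; case: n => [|n]; first by rewrite dvdn0 div0n.
  by case: ifP => // /dvdnP[q e]; rewrite e mulnK // muln_eq0 (gtn_eqF i0) orbF.
have trE f' m' : (m' < n.+1)%N -> (pstrunc n.+1 f' \Po 'X^i)`_m' = (pstrunc n.+1 (ps_subst i f'))`_m'.
  move=> lt; rewrite coef_comp_poly_Xn // !coef_poly lt /ps_subst.
  by case: ifP => // _; rewrite (leq_ltn_trans (leq_div _ _) lt).
transitivity ((pstrunc n.+1 f * pstrunc n.+1 g) \Po 'X^i)`_n.
  rewrite coef_comp_poly_Xn //; case: ifP => // _.
  by rewrite -ps_mulE // ltnS leq_div.
rewrite comp_polyM [RHS](@ps_mulE n.+1) //.
by apply: coefM_eq => j le; rewrite trE.
Qed.

Lemma ps_dual_hom : exists h : {rmorphism pser -> dualnum A}, forall f, h f = (f 0%N, f 1%N).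
Proof.
apply: ex_rmorphism => [f g||f g] //.
by apply: injective_projections; rewrite /= psM !big_ord_recr big_ord0 /= add0r.
Qed.

Lemma ps_eval0_hom : exists h : {rmorphism pser -> A}, forall f, h f = f 0%N.
Proof.
by apply: ex_rmorphism => [f g||f g] //; rewrite psM big_ord_recr big_ord0 /= add0r.
Qed.

Lemma ps_inv f : f 0%N = 1 -> exists g, f * g = 1.
Proof.
move=> f0; pose h := 1 - f.
have hlow m i : (i < m)%N -> (h ^+ m) i = 0.
  elim: m i => // m IH i lt; rewrite exprS.
  have [|h0 _] := @ps_low_mul h (h ^+ m) 1 m _ IH; last exact: h0.
  by case=> // _; rewrite /h psD psN ps1 f0 subrr.
exists (fun n => (\sum_(m < n.+1) h ^+ m) n); apply: pser_eq => n.
have -> : f = 1 - h by rewrite opprB addrC subrK.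
transitivity (((1 - h) * \sum_(m < n.+1) h ^+ m) n).
  rewrite !psM; apply: eq_bigr => i _; congr (_ * _); rewrite !ps_sum.
  have le : ((n - i).+1 <= n.+1)%N by rewrite ltnS leq_subr.
  rewrite (big_ord_widen _ (fun m => (h ^+ m) (n - i)%N) le) big_mkcond.
  by apply: eq_bigr => m _; case: ltnP => // ge; rewrite hlow.
by rewrite -opprB mulNr -subrX1 opprB psD psN hlow // subr0.
Qed.

End PowerSeries.

Lemma ps_domain (k : fieldType) (f g : pser k) : f * g = 0 -> f = 0 \/ g = 0.
Proof.
move=> fg; have [->|f0] := eqVneq f 0; first by left.
have [->|g0] := eqVneq g 0; first by right.
have [m [fl fm]] := ps_order f0; have [n [gl gn]] := ps_order g0.
have [_] := ps_low_mul fl gl; rewrite fg ps0 => /esym/eqP.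
by rewrite mulf_eq0 => /orP[]/eqP.
Qed.

(** * Smoothness produces arcs fixed by conjugation *)

Section SmoothArcs.
Variables (k : fieldType) (W : comNzRingType) (res : {rmorphism W -> k}) (N : nat).
Variables (G : lingroup W N) (Gsm : lg_smooth G).
Variables (sg sg' : 'M[k]_N) (hsg : inverses sg sg') (sgG : pts G res sg).
Variables (e : nat) (sge : sg ^+ e = 1) (e0 : e%:R != 0 :> k).

Local Notation S := (pser k).

Definition low_ideal n (f : S) := forall i, (i < n)%N -> f i = 0.

Lemma low_ideal_ideal n : is_ideal (low_ideal n).
Proof.
split=> [i _|f g hf hg i lt|a f hf i lt]; first by rewrite ps0.
  by rewrite psD hf ?hg ?addr0.
rewrite psM; apply: big1 => j _; rewrite (hf (i - j)%N) ?mulr0 //.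
exact: leq_ltn_trans (leq_subr _ _) lt.
Qed.

Lemma low_ideal1 n : (0 < n)%N -> ~ low_ideal n 1.
Proof. by move=> n0 /(_ _ n0) /eqP; rewrite ps1 oner_eq0. Qed.

Definition cs : {rmorphism W -> S} := GRing.RMorphism.clone _ _ (@ps_const k \o res) _.
Definition gs (a : nat -> 'M[k]_N) : 'M[S]_N := \matrix_(i, j) ((fun m => a m i j) : S).

Lemma ps_mx_inv (g : 'M[S]_N) : (forall i j, g i j 0%N = (i == j)%:R) -> exists h, inverses g h.
Proof.
move=> g0; have [ev evE] := ps_eval0_hom k.
have [u hu] : exists u, \det g * u = 1.
  apply: ps_inv; rewrite -evE -det_map_mx -[RHS](det1 k N); congr (\det _).
  by apply/matrixP => i j; rewrite !mxE evE g0.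
exists (u *: \adj g); split.
  by rewrite -scalemxAr mul_mx_adj -[u *: _]mul_scalar_mx -scalar_mxM mulrC hu.
by rewrite -scalemxAl mul_adj_mx -[u *: _]mul_scalar_mx -scalar_mxM mulrC hu.
Qed.

Definition arc n (a : nat -> 'M[k]_N) :=
  forall q, q \in lg_eqs G -> low_ideal n (pev cs (gs a) q).

Section Quotient.
Variables (n : nat) (A : comNzRingType) (pr : {rmorphism S -> A}).
Hypothesis (prI : forall x, pr x = 0 <-> low_ideal n x).
Let sA : {rmorphism W -> A} := GRing.RMorphism.clone _ _ (pr \o cs) _.

Lemma arc_pts a : a 0%N = 1%:M -> arc n a <-> pts G sA (map_mx pr (gs a)).
Proof.
move=> a0; split=> [h|[_ h] q qG].
  have [|b [gb bg]] := @ps_mx_inv (gs a); first by move=> i j; rewrite mxE a0 mxE.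
  split; first by exists (map_mx pr b); split; rewrite -map_mxM ?gb ?bg map_mx1.
  by move=> q qG; rewrite -[mmap _ _ _]/(pev sA _ _) (@pev_nat _ _ _ _ cs sA pr) //; apply/prI/h.
apply/prI; rewrite -(@pev_nat _ _ _ _ cs sA pr) //.
exact: h.
Qed.

Lemma lie_const_sum (X : 'M[k]_N) (q : {mpoly W[N * N]}) :
  \sum_i mxvec (map_mx (pr \o @ps_const k) X) 0 i * sA (lie_coef q i) =
  pr (ps_const (\sum_i mxvec X 0 i * res (lie_coef q i))).
Proof.
rewrite (rmorph_sum (@ps_const k)) rmorph_sum; apply: eq_bigr => i _.
rewrite (rmorphM (@ps_const k)) rmorphM.
by congr (_ * _); case/mxvec_indexP: i => x y; rewrite !mxvecE mxE.
Qed.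
End Quotient.

Definition conj_sg (Y : 'M[k]_N) := sg *m Y *m sg'.

Lemma conj_sg_fix Y : conj_sg Y = Y <-> sg *m Y = Y *m sg.
Proof.
case: hsg => h1 h2; rewrite /conj_sg; split=> [E|->]; last by rewrite -mulmxA h1 mulmx1.
by rewrite -[in RHS]E -mulmxA h2 mulmx1.
Qed.

Lemma conj_sg_iter i Y : iter i conj_sg Y = sg ^+ i *m Y *m sg' ^+ i.
Proof.
elim: i => [|i IH]; first by rewrite !expr0 mul1mx mulmx1.
by rewrite iterS IH /conj_sg exprS exprSr -!mulmxE !mulmxA.
Qed.

Lemma conj_sg_e Y : iter e conj_sg Y = Y.
Proof.
have h : sg' ^+ e = 1.
  have : forall i, sg ^+ i *m sg' ^+ i = 1%:M.
    elim=> [|i IH]; first by rewrite !expr0 mulmx1.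
    rewrite exprSr exprS -!mulmxE -mulmxA (mulmxA sg) hsg.1 mul1mx; exact: IH.
  by move=> /(_ e); rewrite sge mul1mx.
by rewrite conj_sg_iter sge h mul1mx mulmx1.
Qed.

Definition avg_sg Y := e%:R^-1 *: \sum_(i < e) iter i conj_sg Y.

Lemma avg_sg_fix Y : conj_sg (avg_sg Y) = avg_sg Y.
Proof.
have e_gt0 : (0 < e)%N by case: (e) e0; rewrite ?eqxx.
rewrite /avg_sg /conj_sg -scalemxAr -scalemxAl mulmx_sumr mulmx_suml; congr (_ *: _).
rewrite (eq_bigr (fun i : 'I_e => iter i.+1 conj_sg Y)) //.
have E := conj_sg_e Y; case: (e) e_gt0 E => // m _ E.
by rewrite big_ord_recr big_ord_recl addrC; congr (_ + _); first exact: E.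
Qed.

(** Smoothness extends the arc by some coefficient of t^n. The admissible coefficients form a torsor
    under [Lie G] that is stable under conjugation by [sg]; as the order [e] is invertible, the
    average of a conjugation orbit is an admissible fixed coefficient. *)
Lemma arc_step n a : (0 < n)%N -> a 0%N = 1%:M -> (forall m, conj_sg (a m) = a m) ->
  arc n a -> exists Y, conj_sg Y = Y /\ arc n.+1 (fun m => if m == n then Y else a m).
Proof.
move=> n0 a0 ac an.
have [A [pr [prs prI]]] := quotient_ring (low_ideal_ideal n.+1) (low_ideal1 (ltn0Sn n)).
have [A' [pr' [prs' prI']]] := quotient_ring (low_ideal_ideal n) (low_ideal1 n0).
have [|f fE] := @factor_rmorphism _ _ _ pr pr' prs.
  by move=> x /prI h; apply/prI' => i lt; apply: h; apply: ltnW.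
pose sA : {rmorphism W -> A} := GRing.RMorphism.clone _ _ (pr \o cs) _.
pose sA' : {rmorphism W -> A'} := GRing.RMorphism.clone _ _ (pr' \o cs) _.
pose upd Y m := if m == n then Y else a m.
have upd0 Y : upd Y 0%N = 1%:M by rewrite /upd ltn_eqF.
pose V Y := pts G sA (map_mx pr (gs (upd Y))).
have VE Y : V Y <-> arc n.+1 (upd Y) by rewrite (arc_pts prI (upd0 Y)).
have [Y0 VY0] : exists Y, V Y.
  have [|||g0 g0G fg0] := Gsm (s := sA) (s' := sA') (f := f) _ _ _ ((arc_pts prI' a0).1 an).
  - by move=> w; rewrite /= fE.
  - by move=> y; have [x <-] := prs' y; exists (pr x); rewrite fE.
  - move=> x y; have [u <-] := prs x; have [v <-] := prs y; rewrite !fE => /prI' hu /prI' hv.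
    rewrite -rmorphM; apply/prI => i lt; have [h _] := ps_low_mul hu hv; apply: h.
    by apply: leq_trans lt _; rewrite -addn1 leq_add2l.
  pose h i j := sval (cid (prs (g0 i j))); have hE i j : pr (h i j) = g0 i j := svalP (cid (prs _)).
  exists (\matrix_(i, j) h i j n); rewrite /V (_ : map_mx _ _ = g0) //.
  apply/matrixP => i j; rewrite !mxE -hE; apply/eqP; rewrite -subr_eq0 -rmorphB; apply/eqP/prI => l lt.
  rewrite psD psN /upd; have [->|ne] := eqVneq l n; first by rewrite !mxE subrr.
  have ln : (l < n)%N by rewrite ltn_neqAle ne -ltnS.
  have /prI'/(_ l ln) : pr' (gs a i j - h i j) = 0.
    by rewrite rmorphB -[pr' (h i j)]fE hE; have := congr1 (fun M : 'M_N => M i j) fg0; rewrite !mxE => ->; rewrite subrr.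
  by rewrite psD psN mxE.
pose w := pr (ps_X k n).
have wf (u : S) : w * pr u = w * pr (ps_const (u 0%N)).
  apply/eqP; rewrite -subr_eq0 -mulrBr -rmorphB -rmorphM; apply/eqP/prI => i.
  rewrite ps_XM ltnS leq_eqVlt => /orP[/eqP->|lt]; last by rewrite leqNgt lt.
  by rewrite leqnn subnn psD psN /ps_const subrr.
have c0 : ps_const (0 : k) = 0 by apply: pser_eq => i; rewrite ps0 /ps_const if_same.
have ww : w * w = 0 by rewrite wf /ps_X ltn_eqF // c0 rmorph0 mulr0.
have wc c : w * pr (ps_const c) = 0 -> c = 0.
  by rewrite -rmorphM => /prI/(_ n (ltnSn n)); rewrite ps_XM leqnn subnn.
have c1 : ps_const (1 : k) = 1 by apply: pser_eq => i; rewrite ps1 /ps_const; case: eqP.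
have gv Y i l : gs (upd Y) i l 0%N = (i == l)%:R by rewrite mxE upd0 mxE.
have wE (H : 'M[S]_N) D : (forall i l, H i l 0%N = (i == l)%:R) ->
    w *: (map_mx pr H *m map_mx (pr \o @ps_const k) D) = w *: map_mx (pr \o @ps_const k) D.
  move=> H0; apply/matrixP => i j; rewrite !mxE mulr_sumr (bigD1 i) //= big1 ?addr0 => [|l li].
    by rewrite !mxE mulrA wf H0 eqxx c1 rmorph1 mulr1.
  by rewrite !mxE mulrA wf H0 eq_sym (negPf li) c0 rmorph0 mulr0 mul0r.
(* Changing the top coefficient amounts to a factor [1 + w Z], with [w] the class of t^n; this is
   the torsor structure. *)
have gE Y Y' : map_mx pr (gs (upd Y')) =
    map_mx pr (gs (upd Y)) *m (1%:M + w *: map_mx (pr \o @ps_const k) (Y' - Y)).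
  rewrite mulmxDr mulmx1 -scalemxAr wE; last exact: gv.
  apply/matrixP => i j; rewrite !mxE /= -rmorphM -rmorphD.
  apply/eqP; rewrite -subr_eq0 -rmorphB; apply/eqP/prI => m lt.
  rewrite psD psN psD ps_XM; rewrite ltnS in lt.
  rewrite /upd; have [->|ne] := eqVneq m n.
    by rewrite leqnn subnn /ps_const /= ?mxE subrKC subrr.
  by rewrite leqNgt ltn_neqAle ne lt addr0 subrr.
have lieV Z : lie G res Z -> pts G sA (1%:M + w *: map_mx (pr \o @ps_const k) Z).
  move=> /lieP hZ; apply: (@lie_small _ _ G _ sA _ _ ww).2 => q qG.
  by rewrite lie_const_sum hZ // c0 rmorph0 mulr0.
have Vlie Y Y' : V Y -> V Y' -> lie G res (Y' - Y).
  move=> VY VY'; apply/lieP => q qG; apply: wc.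
  have [[b gb] _] := VY; have := lg_mul (lg_inv VY gb) VY'.
  rewrite (gE Y Y') mulmxA gb.2 mul1mx => /(@lie_small _ _ G _ sA _ _ ww).1/(_ q qG) <-.
  by rewrite lie_const_sum.
have Vadd Y Z : V Y -> lie G res Z -> V (Y + Z).
  by move=> VY hZ; rewrite /V (gE Y) (addrC Y) addrK; apply: lg_mul VY (lieV Z hZ).
have Vconj Y : V Y -> V (conj_sg Y).
  move=> VY; pose c M := map_mx (pr \o @ps_const k) M : 'M[A]_N.
  have cG : pts G sA (c sg) by apply: (pts_nat (s := res)) sgG.
  have ci : inverses (c sg) (c sg') by split; rewrite -map_mxM ?hsg.1 ?hsg.2 map_mx1.
  rewrite /V (_ : map_mx _ _ = c sg *m map_mx pr (gs (upd Y)) *m c sg').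
    exact: lg_mul (lg_mul cG VY) (lg_inv cG ci).
  rewrite [c sg]map_mx_comp [c sg']map_mx_comp -!map_mxM; congr (map_mx pr _).
  apply/matrixP => i j; apply: pser_eq => m.
  have -> : gs (upd (conj_sg Y)) i j m = conj_sg (upd Y m) i j.
    by rewrite mxE /upd; case: eqP => // _; rewrite ac.
  rewrite /conj_sg !mxE ps_sum; apply: eq_bigr => l _; rewrite !mxE.
  rewrite [in RHS]mulrC ps_constM ps_sum mulr_suml mulr_sumr; apply: eq_bigr => l' _.
  by rewrite !mxE ps_constM mulrC.
exists (avg_sg Y0); split; first exact: avg_sg_fix.
apply/VE; have -> : avg_sg Y0 = Y0 + (avg_sg Y0 - Y0) by rewrite subrKC.
apply: Vadd => //; have -> : avg_sg Y0 - Y0 = e%:R^-1 *: \sum_(i < e) (iter i conj_sg Y0 - Y0).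
  by rewrite sumrB scalerBr sumr_const card_ord -scaler_nat scalerA mulVf // scale1r.
apply/lieZ/lie_sum => i _; apply: Vlie => //; elim: {i}(i : nat) => // i IH; exact: Vconj.
Qed.

(** The start is 1 + tX modulo t^2. Stage [n] is an arc modulo t^(n+2) whose coefficients of index
    below n+2 are never changed again, so the diagonal sequence is the limit arc. *)
Lemma arc_exists X : lie G res X -> conj_sg X = X ->
  exists a, [/\ a 0%N = 1%:M, a 1%N = X, (forall m, sg *m a m = a m *m sg) & pts G cs (gs a)].
Proof.
move=> hX cX.
pose ok n a := [/\ a 0%N = 1%:M, a 1%N = X, (forall m, conj_sg (a m) = a m) & arc n.+2 a].
pose a0 m : 'M[k]_N := if m == 0%N then 1%:M else if m == 1%N then X else 0.
have ok0 : ok 0%N a0.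
  have c1 : conj_sg 1%:M = 1%:M by rewrite /conj_sg mulmx1 hsg.1.
  split; [by [] | by [] | |].
    by case=> [|[|m]]; [exact: c1 | exact: cX | rewrite /a0 /conj_sg /= mulmx0 mul0mx].
  have [A [pr [prs prI]]] := quotient_ring (low_ideal_ideal 2) (low_ideal1 (ltn0Sn 1)).
  apply/(arc_pts prI) => //.
  pose sA : {rmorphism W -> A} := GRing.RMorphism.clone _ _ (pr \o cs) _.
  pose w := pr (ps_X k 1).
  have ww : w * w = 0.
    by rewrite -rmorphM; apply/prI => i lt; rewrite ps_XM; case: ltnP => // h; rewrite /ps_X ltn_eqF //; lia.
  rewrite (_ : map_mx _ _ = 1%:M + w *: map_mx (pr \o @ps_const k) X).
    apply: (@lie_small _ _ G _ sA _ _ ww).2 => q qG; move/lieP: hX => hX.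
    by rewrite lie_const_sum hX // [ps_const 0](rmorph0 (@ps_const k)) rmorph0 mulr0.
  apply/matrixP => i j; rewrite !mxE -(rmorph_nat pr) -rmorphM -rmorphD.
  apply/eqP; rewrite -subr_eq0 -rmorphB; apply/eqP/prI => m lt.
  rewrite psD psN psD ps_XM (_ : (i == j)%:R = ps_const (i == j)%:R); last by rewrite rmorph_nat.
  case: m lt => [|[|m]] // _; rewrite /a0 /ps_const /= ?mxE ?addr0 ?add0r subrr //.
have step n a : exists b, ok n a -> ok n.+1 b /\ forall m, (m < n.+2)%N -> b m = a m.
  case: (pselect (ok n a)) => [[h0 h1 hc han]|]; last by exists a.
  have [Y [cY hY]] := arc_step (ltn0Sn n.+1) h0 hc han.
  exists (fun m => if m == n.+2 then Y else a m) => _; split; last by move=> m lt; rewrite ltn_eqF.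
  by split=> // m; case: eqP.
have [nx nxP] : exists nx : nat -> (nat -> 'M[k]_N) -> nat -> 'M[k]_N, forall n a, ok n a ->
    ok n.+1 (nx n a) /\ forall m, (m < n.+2)%N -> nx n a m = a m.
  by exists (fun n a => sval (cid (step n a))) => n a; apply: (svalP (cid (step n a))).
pose seqa := fix sa n := if n is n'.+1 then nx n' (sa n') else a0.
have okn n : ok n (seqa n) by elim: n => [|n /nxP[]].
have stab n m : (m < n.+2)%N -> seqa n.+1 m = seqa n m by have [_ h] := nxP _ _ (okn n); exact: h.
pose a m := seqa m m.
have aE n m : (m < n.+2)%N -> seqa n m = a m.
  elim: n => [|n IH] lt.
    by case: m lt => [|[|m]] // _; rewrite /a stab.
  have [lt'|ge] := ltnP m n.+2; first by rewrite stab // IH.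
  have -> : m = n.+2 by apply/eqP; rewrite eqn_leq ge -ltnS lt.
  by rewrite /a [in RHS]stab // ltnW.
have fixa m : conj_sg (a m) = a m by have [_ _ h _] := okn m; exact: h.
have a00 : a 0%N = 1%:M by [].
exists a; split; [exact: a00 | by have [_ h _ _] := okn 1%N | by move=> m; apply/conj_sg_fix | ].
split; first by apply: ps_mx_inv => i j; rewrite mxE a00 mxE.
move=> q qG; apply: pser_eq => n; rewrite ps0.
have [h0 _ _ han] := okn n.
have [A [pr [prs prI]]] := quotient_ring (low_ideal_ideal n.+2) (low_ideal1 (ltn0Sn n.+1)).
suff : arc n.+2 a by move=> /(_ q qG n); apply; rewrite ltnS leqW.
apply/(arc_pts prI) => //.
rewrite (_ : map_mx pr (gs a) = map_mx pr (gs (seqa n))); first exact/(arc_pts prI).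
apply/matrixP => i j; rewrite !mxE; apply/eqP; rewrite -subr_eq0 -rmorphB; apply/eqP/prI => m lt.
by rewrite psD psN aE // subrr.
Qed.

End SmoothArcs.

(** A maximal family independent over the domain [S] is extracted from [l]; expanding the other
    members requires denominators, which are collected in [d]. *)
Lemma domain_span (S : comNzRingType) (K : fieldType) (c : {rmorphism S -> K}) (l : seq K) :
  injective c ->
  exists (e : seq K) (d : S) (b : nat -> nat -> S),
  [/\ d <> 0,
      (forall m, (m < size l)%N -> c d * l`_m = \sum_(i < size e) e`_i * c (b m i)) &
      (forall x : nat -> S, \sum_(i < size e) e`_i * c (x i) = 0 ->
         forall i, (i < size e)%N -> x i = 0)].
Proof.
move=> cI; have c0 s : c s = 0 -> s = 0 by move=> h; apply: cI; rewrite rmorph0.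
elim: l => [|z l [e [d [b [d0 h1 h2]]]]].
  by exists [::], 1, (fun _ _ => 0); split=> //; apply/eqP/oner_neq0.
case: (pselect (exists s (x : nat -> S), s <> 0 /\ c s * z = \sum_(i < size e) e`_i * c (x i))) => [|no].
  case=> s [x [s0 hx]]; exists e, (d * s).
  exists (fun m i => if m is m'.+1 then s * b m' i else d * x i); split=> //.
    by move=> /(congr1 c); rewrite rmorphM rmorph0 => /eqP; rewrite mulf_eq0 => /orP[]/eqP/c0.
  case=> [_|m lt] /=.
    rewrite rmorphM -mulrA hx mulr_sumr; apply: eq_bigr => i _.
    by rewrite rmorphM mulrCA.
  rewrite rmorphM [c d * _]mulrC -mulrA h1 // mulr_sumr; apply: eq_bigr => i _.
  by rewrite rmorphM mulrCA.
exists (z :: e), d, (fun m i => if m is m'.+1 then (if i is i'.+1 then b m' i' else 0)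
                                else (if i is i'.+1 then 0 else d)); split=> //.
  case=> [_|m lt] /=; rewrite big_ord_recl /=.
    by rewrite big1 ?addr0 1?mulrC // => i _; rewrite rmorph0 mulr0.
  by rewrite rmorph0 mulr0 add0r h1.
move=> x; rewrite big_ord_recl /= => hx.
have x0 : x 0%N = 0.
  apply: contrapT => nz; apply: no; exists (x 0%N), (fun i => - x i.+1); split=> //.
  move/eqP: hx; rewrite addr_eq0 mulrC => /eqP ->; rewrite -sumrN; apply: eq_bigr => i _.
  by rewrite rmorphN mulrN.
case=> [_|i lt]; first exact: x0.
apply: (h2 (fun i => x i.+1)) => //.
by move: hx; rewrite x0 rmorph0 mulr0 add0r.
Qed.

Lemma ps_subst_rmorphism (A : comNzRingType) i :
  exists h : {rmorphism pser A -> pser A}, forall f, h f = ps_subst i f.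
Proof.
case: i => [|i]; last exact: ps_subst_hom.
have [ev evE] := ps_eval0_hom A.
exists (GRing.RMorphism.clone _ _ (@ps_const A \o ev) _) => f; apply: pser_eq => n.
by rewrite /= evE /ps_const /ps_subst dvd0n; case: eqP => // ->.
Qed.

Lemma ps_subst_const (A : comNzRingType) i (c : A) : ps_subst i (ps_const c) = ps_const c.
Proof.
apply: pser_eq => n; rewrite /ps_subst /ps_const; have [->|n0] := posnP n.
  by rewrite dvdn0 div0n.
case: ifP => // d; have i0 : (0 < i)%N by apply: dvdn_gt0 d.
by rewrite eqn0Ngt divn_gt0 // dvdn_leq.
Qed.

(* The coefficient of [t^(i l + o)], where [l] is minimal with [\sum_m b_m v_(m, l) <> 0]
   and [o] is the order of this series, comes from no other term once [i > o]. *)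
Lemma ps_subst_relation (k : fieldType) (r : nat) (b v : nat -> pser k) :
  (forall n, exists2 i, (n < i)%N & \sum_(m < r) b m * ps_subst i (v m) = 0) ->
  forall j, \sum_(m < r) b m * ps_subst j (v m) = 0.
Proof.
(* [Bl l] is the coefficient of u^l in the sum when the [v m] are read as series in a separate
   variable u; all of them will be shown to vanish. *)
move=> hinf; pose Bl l : pser k := \sum_(m < r) ps_const (v m l) * b m.
have BlE l n : Bl l n = \sum_(m < r) v m l * b m n.
  by rewrite /Bl ps_sum; apply: eq_bigr => m _; rewrite ps_constM.
have sE i n : (0 < i)%N -> (\sum_(m < r) b m * ps_subst i (v m)) n =
    \sum_(l < n.+1 | (i * l <= n)%N) Bl l (n - i * l)%N.
  move=> i0; rewrite ps_sum; under [RHS]eq_bigr do rewrite BlE.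
  rewrite [RHS]exchange_big; apply: eq_bigr => m _.
  rewrite mulrC psM (bigID (fun u : 'I_n.+1 => (i %| u)%N)) /= [X in _ + X]big1 ?addr0; last first.
    by move=> u /negPf ni; rewrite /ps_subst ni mul0r.
  rewrite (reindex_onto (fun l : 'I_n.+1 => inord (i * l)%N) (fun u : 'I_n.+1 => inord (u %/ i)%N)) /=.
    have out (l : 'I_n.+1) : (n < i * l)%N ->
        @inord n (@inord n (i * l)%N %/ i)%N = l -> False.
      move=> gt; have -> : @inord n (i * l)%N = ord0.
        by apply: val_inj; rewrite /inord /insubd insubN // -leqNgt.
      by rewrite div0n => /(congr1 val); rewrite /= inordK // => h; rewrite -h muln0 in gt.
    apply: eq_big => [l|l].
      have [le|gt] := leqP (i * l)%N n.
        by rewrite inordK // dvdn_mulr //= mulKn // inord_val eqxx.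
      by apply/negP => /andP[_ /eqP/(out _ gt)].
    move=> /andP[d /eqP h]; have [le|gt] := leqP (i * l)%N n; last by case: (out _ gt h).
    by rewrite inordK // /ps_subst dvdn_mulr // mulKn.
  move=> u d; have ul : (u %/ i < n.+1)%N by rewrite (leq_ltn_trans (leq_div _ _)).
  by rewrite (inordK ul) mulnC divnK // inord_val.
have B0 l : Bl l = 0.
  elim/ltn_ind: l => l IH; apply: contrapT => /eqP/ps_order[o [lo nz]].
  have [i lti hi] := hinf o; have i0 : (0 < i)%N by apply: leq_ltn_trans lti.
  have := sE i (i * l + o)%N i0; rewrite hi ps0.
  have lb : (l < (i * l + o).+1)%N by rewrite ltnS (leq_trans _ (leq_addr _ _)) ?leq_pmull.
  rewrite (bigD1 (Ordinal lb)) ?leq_addr //= addKn big1 ?addr0; first by move/esym.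
  move=> u /andP[le ne]; have [lt|ge] := ltnP u l; first by rewrite IH ?ps0.
  have lu : (l < u)%N by rewrite ltn_neqAle ge andbT eq_sym -(inj_eq val_inj) in ne *.
  have : (i * l.+1 <= i * u)%N by rewrite leq_pmul2l.
  rewrite mulnS => h; have := leq_trans h le.
  by rewrite addnC leq_add2l leqNgt lti.
move=> [|j]; apply: pser_eq => n; rewrite ps0; last first.
  by rewrite sE // big1 // => l _; rewrite B0 ps0.
transitivity (Bl 0%N n); last by rewrite B0 ps0.
rewrite BlE ps_sum; apply: eq_bigr => m _.
have -> : ps_subst 0 (v m) = ps_const (v m 0%N).
  by apply: pser_eq => u; rewrite /ps_const /ps_subst dvd0n; case: eqP => // ->.
by rewrite mulrC ps_constM.
Qed.

Section RegularCentralizer.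
Variables (k : fieldType) (W : comNzRingType) (res : {rmorphism W -> k}) (N : nat).

Section Connected.
Variables (K : closedFieldType) (c : {rmorphism pser k -> K}) (cI : injective c).
Variables (g g' : 'M[pser k]_N) (gg' : inverses g g').

(** The points g(t^j). For an arc starting at 1 they contain 1 ([j = 0]) and [g] ([j = 1]). This
    countable set suffices because [identity_component] asks for a connected set, closed or not. *)
Definition arc_points (y : 'M[K]_N) :=
  exists j, y = map_mx c (map_mx (ps_subst j) g).

Lemma arc_points_unit y : arc_points y -> y \in unitmx.
Proof.
case=> j ->; have [h hE] := ps_subst_rmorphism k j.
have -> : map_mx (ps_subst j) g = map_mx h g by apply/matrixP => a b; rewrite !mxE hE.
have := mulmx1_unit (_ : map_mx c (map_mx h g) *m map_mx c (map_mx h g') = 1%:M).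
by rewrite -!map_mxM gg'.1 !map_mx1 => /(_ erefl)[].
Qed.

(** The coefficients of [f] are expanded along elements independent over the power series, which
    turns each vanishing into a relation among series; [ps_subst_relation] then passes from
    infinitely many exponents to all. *)
Lemma arc_vanish (f : {mpoly K[N * N]}) :
  (forall n, exists2 i, (n < i)%N &
     f.@[fun u => mxvec (map_mx c (map_mx (ps_subst i) g)) 0 u] = 0) ->
  forall j, f.@[fun u => mxvec (map_mx c (map_mx (ps_subst j) g)) 0 u] = 0.
Proof.
pose l := msupp f; have [e [d [b [d0 h1 h2]]]] := domain_span [seq f@_m | m <- l] cI.
pose v n : pser k := \prod_u mxvec g 0 u ^+ (nth 0%MM l n) u.
have sz : size [seq f@_m | m <- l] = size l by rewrite size_map.
have E j : c d * f.@[fun u => mxvec (map_mx c (map_mx (ps_subst j) g)) 0 u] =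
    \sum_(i < size e) e`_i * c (\sum_(n < size l) b n i * ps_subst j (v n)).
  have [h hE] := ps_subst_rmorphism k j.
  rewrite mevalE (big_nth 0%MM) big_mkord mulr_sumr.
  transitivity (\sum_(n < size l) \sum_(i < size e) e`_i * c (b n i) * c (ps_subst j (v n))).
    apply: eq_bigr => n _; rewrite -mulr_suml -h1; last by rewrite sz.
    rewrite (nth_map 0%MM) // mulrA.
    congr (_ * _); rewrite -hE !rmorph_prod; apply: eq_bigr => u _.
    rewrite !rmorphXn; congr (_ ^+ _); case/mxvec_indexP: u => x y.
    by rewrite !mxvecE !mxE hE.
  rewrite exchange_big; apply: eq_bigr => i _; rewrite rmorph_sum mulr_sumr.
  by apply: eq_bigr => n _; rewrite rmorphM mulrA.
move=> hinf j; have cd : c d != 0.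
  by apply/eqP => h; apply: d0; apply: cI; rewrite rmorph0.
apply: (mulfI cd); rewrite mulr0 E big1 // => i _.
rewrite (ps_subst_relation (b := fun n => b n i)) ?rmorph0 ?mulr0 // => n.
have [i' lt hi'] := hinf n; exists i' => //.
have := E i'; rewrite hi' mulr0 => /esym/(h2 (fun i => \sum_(n < size l) b n i * ps_subst i' (v n))).
exact.
Qed.

(** Of two closed sets covering the points, one contains g(t^j) for arbitrarily large j, hence for
    every j. *)
Lemma arc_connected : zconnected arc_points.
Proof.
pose y j := map_mx c (map_mx (ps_subst j) g).
have yY j : arc_points (y j) by exists j.
have full Z : zclosed Z -> (forall n, exists2 i, (n < i)%N & Z (y i)) ->
    forall x, arc_points x -> Z x.
  move=> [E hE] hinf x xY; apply/(hE _ (arc_points_unit xY)) => f Ef.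
  case: xY => j ->; apply: arc_vanish => n; have [i lt /hE h] := hinf n.
  by exists i => //; apply: h; rewrite ?arc_points_unit.
move=> Z1 Z2 c1 c2 cov _; have [hinf|] := pselect (forall n, exists2 i, (n < i)%N & Z1 (y i)).
  by left; apply: full.
move=> /existsNP[n hn]; right; apply: full => // n'.
exists (maxn n n').+1; first by rewrite ltnS leq_maxr.
have [h1|//] := cov _ (yY (maxn n n').+1); case: hn.
by exists (maxn n n').+1; rewrite // ltnS leq_maxl.
Qed.
End Connected.

Variables (G T : lingroup W N) (Gsm : lg_smooth G).
Variables (sg sg' : 'M[k]_N) (hsg : inverses sg sg') (sgG : pts G res sg).
Variables (e : nat) (sge : sg ^+ e = 1) (e0 : e%:R != 0 :> k).
Hypothesis hreg : forall (K : closedFieldType) (j : {rmorphism k -> K}) x,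
  identity_component
    (centralizer (pts G (j \o res : {rmorphism W -> K})) (map_mx j sg)) x ->
  pts T (j \o res : {rmorphism W -> K}) x.

(* An arc through 1 in the centralizer of [sg] with tangent vector [X] stays in the
   identity component. *)
Lemma regular_lie X : lie G res X -> sg *m X *m sg' = X -> lie T res X.
Proof.
move=> hX cX; have [a [a0 a1 ac aG]] := arc_exists Gsm hsg sgG sge e0 hX cX.
have [F [i [K [f [iI fI _]]]]] := domain_closure (@ps_domain k).
pose c : {rmorphism pser k -> K} := GRing.RMorphism.clone _ _ (f \o i) _.
have cI : injective c by apply: inj_comp.
pose j : {rmorphism k -> K} := GRing.RMorphism.clone _ _ (c \o @ps_const k) _.
have [[g' gg'] _] := aG; pose g := gs a.
have cj : is_alg_hom (cs res) (j \o res : {rmorphism W -> K}) c by [].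
have s1 : map_mx (ps_subst 1) g = g.
  by apply/matrixP => x y; rewrite mxE; apply: pser_eq => n; rewrite /ps_subst dvd1n divn1.
have s0 : map_mx c (map_mx (ps_subst 0) g) = 1%:M.
  rewrite -(map_mx1 c); congr map_mx; apply/matrixP => x y; rewrite !mxE.
  apply: pser_eq => n; rewrite /ps_subst dvd0n; have [->|nz] := eqVneq n 0%N.
    by rewrite div0n a0 mxE; case: (x == y); rewrite ?mulr1n ?mulr0n ?ps1 ?ps0.
  by case: (x == y); rewrite ?mulr1n ?mulr0n ?ps1 ?ps0 ?(negPf nz).
(* [T] is cut out by equations, so membership of [g] may be tested over [K]; reducing modulo t^2
   then puts [X] in [Lie T]. *)
have gT : pts T (cs res) g.
  apply: (pts_inj cj cI gg'); apply: hreg; exists (arc_points c g); split.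
  - move=> _ [l ->]; have [h hE] := ps_subst_rmorphism k l.
    have hg : map_mx (ps_subst l) g = map_mx h g by apply/matrixP => u v; rewrite !mxE hE.
    have hc w : h (cs res w) = cs res w.
      by rewrite hE; apply: ps_subst_const.
    rewrite hg; split; first by apply: (pts_nat cj); apply: (pts_nat hc).
    have E : map_mx j sg = map_mx c (map_mx h (map_mx (@ps_const k) sg)).
      by apply/matrixP => u v; rewrite !mxE /= hE ps_subst_const.
    rewrite E -!map_mxM; congr (map_mx c (map_mx h _)).
    apply/matrixP => u v; apply: pser_eq => n; have := congr1 (fun M : 'M_N => M u v) (ac n).
    rewrite !mxE !ps_sum => ae.
    transitivity (\sum_l a n u l * sg l v).
      by apply: eq_bigr => l' _; rewrite !mxE mulrC ps_constM mulrC.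
    by rewrite -ae; apply: eq_bigr => l' _; rewrite !mxE ps_constM.
  - exact: arc_connected cI _ _ gg'.
  - by exists 0%N.
  - by exists 1%N; rewrite s1.
have [dh dhE] := ps_dual_hom k.
have dhs : is_alg_hom (cs res) (dual_str res) dh by move=> w; rewrite dhE.
have := pts_nat dhs gT; rewrite (_ : map_mx dh g = dual_mx 1%:M X) //.
by apply/matrixP => u v; rewrite !mxE dhE a0 a1 mxE.
Qed.
End RegularCentralizer.

(** * Witt vectors and coefficient rings *)

Lemma idmul_sub (A : comNzRingType) (I J L : A -> Prop) : is_ideal L ->
  (forall x y, I x -> J y -> L (x * y)) -> forall z, idmul I J z -> L z.
Proof.
move=> [L0 LD _] h z [r [hr ->]]; elim: r hr => [|u r IH] hr; first by rewrite big_nil.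
rewrite big_cons; have [h1 h2] := hr u (mem_head _ _).
by apply: LD (h _ _ h1 h2) (IH _) => v hv; apply: hr; rewrite inE hv orbT.
Qed.

Lemma idmul_in (A : comNzRingType) (I J : A -> Prop) x y : I x -> J y -> idmul I J (x * y).
Proof. by move=> hx hy; exists [:: (x, y)]; rewrite big_seq1; split=> // u; rewrite inE => /eqP ->. Qed.

Lemma idmul_ideal (A : comNzRingType) (I J : A -> Prop) : is_ideal I -> is_ideal J ->
  is_ideal (idmul I J).
Proof.
move=> [_ _ IM] [_ _ JM]; split.
- by exists [::]; rewrite big_nil.
- move=> _ _ [r [hr ->]] [s [hs ->]]; exists (r ++ s); rewrite big_cat; split=> // u.
  by rewrite mem_cat => /orP[/hr|/hs].
- move=> a _ [r [hr ->]]; exists [seq (a * u.1, u.2) | u <- r]; split.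
    by move=> _ /mapP[u /hr[h1 h2] ->]; split=> //; apply: IM.
  by rewrite big_map mulr_sumr; apply: eq_bigr => u _; rewrite mulrA.
Qed.

Lemma idpow_ideal (A : comNzRingType) (I : A -> Prop) n : is_ideal I -> is_ideal (idpow I n).
Proof. by move=> hI; elim: n => [|n IH] //=; apply: idmul_ideal. Qed.

Lemma idpow_le (A : comNzRingType) (I : A -> Prop) m n : is_ideal I -> (m <= n)%N ->
  forall x, idpow I n x -> idpow I m x.
Proof.
move=> hI; have step k x : idpow I k.+1 x -> idpow I k x.
  have [_ _ M] := idpow_ideal k hI.
  by apply: idmul_sub (idpow_ideal k hI) _ x => y z _; apply: M.
move/subnK <-; elim: (n - m)%N => // k IH x; rewrite addSn => /step; exact: IH.
Qed.

Lemma idpow_telescope (A : comNzRingType) (I : A -> Prop) (u : nat -> A) m n : is_ideal I ->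
  (forall n, idpow I n (u n.+1 - u n)) -> (m <= n)%N -> idpow I m (u n - u m).
Proof.
move=> hI hu; have [I0 ID _] := idpow_ideal m hI; move/subnK <-.
elim: (n - m)%N => [|k IH]; first by rewrite subrr.
rewrite addSn -(subrKA (u (k + m)%N)); apply: ID IH.
by apply: idpow_le (hu _); rewrite ?leq_addl.
Qed.

Lemma nilpotent_complete (A : comNzRingType) (I : A -> Prop) n : is_ideal I ->
  (forall x, idpow I n x -> x = 0) -> adically_complete I.
Proof.
move=> hI h; split=> [x hx|u hu]; first exact: h.
exists (u n) => m; have [mn|nm] := leqP m n; first exact: idpow_telescope.
have [I0 _ _] := idpow_ideal m hI; suff -> : u m = u n by rewrite subrr.
by apply/eqP; rewrite -subr_eq0; apply/eqP/h/idpow_telescope => //; apply: ltnW.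
Qed.

Lemma finite_noetherian (A : comNzRingType) (s : seq A) : (forall x, x \in s) -> noetherian A.
Proof.
move=> hs I [I0 ID IM]; pose t := [seq x <- s | `[< I x >]].
have tI i : (i < size t)%N -> I t`_i.
  by move=> lt; have := mem_nth 0 lt; rewrite mem_filter => /andP[/asboolP].
exists (size t), (fun i => t`_i) => x; split=> [Ix|[c ->]].
  have xt : x \in t by rewrite mem_filter hs andbT; apply/asboolP.
  have lt : (index x t < size t)%N by rewrite index_mem.
  exists (fun i => (i == Ordinal lt)%:R); rewrite (bigD1 (Ordinal lt)) //= eqxx mul1r nth_index //.
  by rewrite big1 ?addr0 // => i /negPf ->; rewrite mul0r.
apply: (big_ind I) => // i _; apply: IM; exact: tI.
Qed.

Lemma pdiv_powD (W : comNzRingType) p n (x y : W) :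
  pdiv_pow p n x -> pdiv_pow p n y -> pdiv_pow p n (x + y).
Proof. by move=> [a ->] [b ->]; exists (a + b); rewrite mulrDr. Qed.
Lemma pdiv_powMl (W : comNzRingType) p n (a x : W) : pdiv_pow p n x -> pdiv_pow p n (a * x).
Proof. by move=> [b ->]; exists (a * b); rewrite mulrCA. Qed.
Lemma pdiv_powN (W : comNzRingType) p n (x : W) : pdiv_pow p n x -> pdiv_pow p n (- x).
Proof. by rewrite -mulN1r; apply: pdiv_powMl. Qed.
Lemma pdiv_powB (W : comNzRingType) p n (x y : W) :
  pdiv_pow p n x -> pdiv_pow p n y -> pdiv_pow p n (x - y).
Proof. by move=> hx hy; apply: pdiv_powD hx (pdiv_powN hy). Qed.
Lemma pdiv_pow_0 (W : comNzRingType) p n : pdiv_pow p n (0 : W).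
Proof. by exists 0; rewrite mulr0. Qed.
Lemma pdiv_pow0 (W : comNzRingType) p (x : W) : pdiv_pow p 0 x.
Proof. by exists x; rewrite expn0 mul1r. Qed.
Lemma pdiv_powM (W : comNzRingType) p m n (x y : W) :
  pdiv_pow p m x -> pdiv_pow p n y -> pdiv_pow p (m + n) (x * y).
Proof. by move=> [a ->] [b ->]; exists (a * b); rewrite expnD natrM mulrACA. Qed.
Lemma pdiv_pow_le (W : comNzRingType) p m n (x : W) : (m <= n)%N ->
  pdiv_pow p n x -> pdiv_pow p m x.
Proof.
move/subnK <-; case=> y ->; exists ((p ^ (n - m))%:R * y).
by rewrite addnC expnD natrM mulrA.
Qed.
Lemma pdiv_pow_ideal (W : comNzRingType) p n : is_ideal (fun x : W => pdiv_pow p n x).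
Proof. by split; [exact: pdiv_pow_0 | exact: pdiv_powD | exact: pdiv_powMl]. Qed.

Lemma pdiv_idpow (W : comNzRingType) p n (x : W) :
  idpow (fun w : W => pdiv_pow p 1 w) n x <-> pdiv_pow p n x.
Proof.
elim: n x => [|n IH] x /=; first by split=> // _; apply: pdiv_pow0.
split=> [|[y ->]].
  apply: idmul_sub; first exact: pdiv_pow_ideal.
  by move=> a b ha /IH hb; apply: (@pdiv_powM _ _ 1 n).
rewrite expnS natrM -mulrA; apply: idmul_in; first by exists 1; rewrite expn1 mulr1.
by apply/IH; exists y.
Qed.

Section Witt.
Variables (p : nat) (k : finFieldType) (W : comNzRingType) (res : {rmorphism W -> k}).
Hypothesis hW : is_witt_ring p res.

Lemma witt_pchar : p \in [pchar k]. Proof. by case: hW. Qed.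
Lemma witt_prime : prime p. Proof. exact: pcharf_prime witt_pchar. Qed.
Lemma witt_surj a : exists w, res w = a. Proof. by case: hW => _ h _ _ _. Qed.
Lemma witt_res0 w : res w = 0 <-> pdiv_pow p 1 w. Proof. by case: hW => _ _ h _ _. Qed.
Lemma witt_p0 : res (p%:R : W) = 0.
Proof. by rewrite rmorph_nat; apply: pcharf0 witt_pchar. Qed.

Lemma witt_sep (x : W) : (forall n, pdiv_pow p n x) -> x = 0.
Proof. by case: hW => _ _ _ _ [h _] hx; apply: h => n; apply/pdiv_idpow. Qed.

Lemma witt_lim (u : nat -> W) : (forall n, pdiv_pow p n (u n.+1 - u n)) ->
  exists l, forall n, pdiv_pow p n (l - u n).
Proof.
case: hW => _ _ _ _ [_ h] hu; have [|l hl] := h u; first by move=> n; apply/pdiv_idpow.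
by exists l => n; apply/pdiv_idpow.
Qed.

Lemma witt_ptorsion n (w : W) : (p ^ n)%:R * w = 0 -> w = 0.
Proof.
case: hW => _ _ _ h _; elim: n => [|n IH]; first by rewrite mul1r.
by rewrite expnS natrM -mulrA => /h/IH.
Qed.

Lemma witt_pdivK m n (w : W) : pdiv_pow p (m + n) ((p ^ m)%:R * w) -> pdiv_pow p n w.
Proof.
case=> y e; exists y; apply/eqP; rewrite -subr_eq0; apply/eqP/(@witt_ptorsion m).
by rewrite mulrBr e expnD natrM mulrA subrr.
Qed.

Lemma witt_unit u : res u <> 0 -> exists v, u * v = 1.
Proof.
move=> u0; have [v hv] := witt_surj (res u)^-1.
have [z hz] : pdiv_pow p 1 (1 - u * v).
  apply/witt_res0; rewrite rmorphB rmorph1 rmorphM hv divff ?subrr //; exact/eqP.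
pose y := (p ^ 1)%:R * z; pose s n := \sum_(i < n) y ^+ i.
have yn n : pdiv_pow p n (y ^+ n).
  by exists (z ^+ n); rewrite exprMn expn1 natrX.
have [|l hl] := @witt_lim s.
  by move=> n; rewrite /s big_ord_recr /= (addrC (\sum_(i < n) _)) addrK; apply: yn.
exists (v * l); apply/eqP; rewrite -subr_eq0; apply/eqP/witt_sep => n.
have uv : u * v = 1 - y by rewrite /y -hz opprB addrC subrK.
rewrite mulrA uv.
have -> : (1 - y) * l - 1 = (1 - y) * (l - s n) - y ^+ n.
  rewrite mulrBr; have -> : (1 - y) * s n = 1 - y ^+ n.
    by rewrite -[in RHS](expr1n W n) subrXX; congr (_ * _); apply: eq_bigr => i _; rewrite expr1n mul1r.
  by rewrite opprB addrA addrAC addrK.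
by apply: pdiv_powB; [apply: pdiv_powMl | apply: yn].
Qed.

Lemma witt_val (w : W) : w <> 0 -> exists n u, w = (p ^ n)%:R * u /\ res u <> 0.
Proof.
move=> w0; apply: contrapT => no; apply: w0; apply: witt_sep.
elim=> [|n [u e]]; first exact: pdiv_pow0.
have [/witt_res0[y hy]|nz] := pselect (res u = 0).
  by exists y; rewrite e hy mulrA -natrM expn1 expnSr.
by case: no; exists n, u.
Qed.

Lemma witt_domain (x y : W) : x * y = 0 -> x = 0 \/ y = 0.
Proof.
move=> xy; apply: contrapT => /not_orP[/witt_val[m [u [xe hu]]] /witt_val[n [v [ye hv]]]].
move: xy; rewrite xe ye mulrACA -natrM -expnD => /witt_ptorsion/(congr1 res)/eqP.
by rewrite rmorphM rmorph0 mulf_eq0 => /orP[]/eqP.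
Qed.

Lemma witt_nat n : n%:R = 0 :> W -> n = 0%N.
Proof.
case: n => // n.
have [m cm ->] := pfactor_coprime witt_prime (ltn0Sn n).
rewrite mulnC natrM => /witt_ptorsion/(congr1 res); rewrite rmorph_nat rmorph0 => /eqP h.
by move: cm; rewrite prime_coprime ?witt_prime // (dvdn_pcharf witt_pchar) h.
Qed.

Lemma witt_reps m : exists s : seq W, forall w : W, exists2 y, y \in s & pdiv_pow p m (w - y).
Proof.
pose t a := sval (cid (witt_surj a)); have tE a : res (t a) = a := svalP (cid (witt_surj a)).
elim: m => [|m [s hs]].
  by exists [:: 0] => w; exists 0; rewrite ?mem_head //; apply: pdiv_pow0.
exists [seq y + (p ^ m)%:R * t a | y <- s, a <- enum k] => w.
have [y ys [z e]] := hs w; exists (y + (p ^ m)%:R * t (res z)).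
  by apply: allpairs_f => //; rewrite mem_enum.
rewrite opprD addrA e -mulrBr -addn1; apply: pdiv_powM; first by exists 1; rewrite mulr1.
by apply/witt_res0; rewrite rmorphB tE subrr.
Qed.

Lemma trunc_ring d : (0 < d)%N -> exists (A : comNzRingType) (str : {rmorphism W -> A})
  (red : {rmorphism A -> k}), is_trunc p d res str red.
Proof.
move=> d0; have [|A [str [h1 h2]]] := quotient_ring (@pdiv_pow_ideal W p d).
  move=> /(pdiv_pow_le d0)/witt_res0/eqP; by rewrite rmorph1 oner_eq0.
have [|red hred] := @factor_rmorphism _ _ _ str res h1.
  by move=> x /h2 /(pdiv_pow_le d0)/witt_res0.
by exists A, str, red; split.
Qed.

Section Trunc.
Variables (d : nat) (d0 : (0 < d)%N) (A : comNzRingType) (str : {rmorphism W -> A})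
  (red : {rmorphism A -> k}) (hA : is_trunc p d res str red).

Lemma trunc_ker_pow n x : idpow (rker red) n x -> exists w, x = (p ^ n)%:R * str w.
Proof.
have [h1 h2 h3] := hA; elim: n x => [|n IH] x /=; first by have [w <-] := h1 x; exists w; rewrite mul1r.
have hI : is_ideal (fun x => exists w, x = (p ^ n.+1)%:R * str w).
  split=> [|_ _ [u ->] [v ->]|a _ [u ->]]; first by exists 0; rewrite rmorph0 mulr0.
    by exists (u + v); rewrite rmorphD mulrDr.
  by have [w <-] := h1 a; exists (w * u); rewrite rmorphM mulrCA.
apply: idmul_sub hI _ _ => a b ha /IH[w ->]; have [v av] := h1 a.
have /witt_res0[u ue] : res v = 0 by rewrite -h3 av.
exists (u * w); rewrite -av ue !rmorphM rmorph_nat expnS natrM mulrACA.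
by rewrite expn0 mulr1 -natrM -expnS.
Qed.

Lemma trunc_nilp x : idpow (rker red) d x -> x = 0.
Proof.
move=> /trunc_ker_pow[w ->]; have [_ h2 _] := hA.
by rewrite -(rmorph_nat str) -rmorphM; apply/h2; exists w.
Qed.

Lemma trunc_coef : is_coef res str red.
Proof.
have [h1 h2 h3] := hA; split=> //.
- by move=> a; have [w hw] := witt_surj a; exists (str w); rewrite h3.
- move=> x; have [w <-] := h1 x; rewrite h3 => /witt_unit[v wv].
  by exists (str v); rewrite -rmorphM wv rmorph1.
- have [s hs] := witt_reps d; apply: (@finite_noetherian _ [seq str y | y <- s]) => x.
  have [w <-] := h1 x; have [y ys hy] := hs w; rewrite (_ : str w = str y) ?map_f //.
  by apply/eqP; rewrite -subr_eq0 -rmorphB; apply/eqP/h2.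
apply: (@nilpotent_complete _ _ d); [exact: rker_ideal | exact: trunc_nilp].
Qed.
End Trunc.
End Witt.

(** Over a finite field the matrix has a finite order [o]. Its eigenvalues lie in a field of
    characteristic [p], where 1 is the only root of unity of [p]-power order, so for a
    diagonalizable matrix the prime-to-[p] part of [o] is enough. *)
Lemma semisimple_order (k : finFieldType) (p : nat) (K : closedFieldType) (j : {rmorphism k -> K})
  (N : nat) (sg sg' : 'M[k]_N) : p \in [pchar k] -> inverses sg sg' ->
  is_semisimple_mx (map_mx j sg) -> exists e, sg ^+ e = 1 /\ e%:R != 0 :> k.
Proof.
move=> pk [gg g'g] [c cu]; set D := c *m _ *m _ => hD.
have [o o0 ho] : exists2 o, (0 < o)%N & sg ^+ o = 1.
  have [/injectiveP inj|] := boolP (injectiveb (fun i : 'I_(#|'M[k]_N|).+1 => sg ^+ i)).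
    by have := leq_card _ inj; rewrite card_ord ltnn.
  case/injectivePn => a [b ab e].
  have can m n : sg ^+ (m + n) = sg ^+ m -> sg ^+ n = 1.
    elim: m n => [|m IH] n; first by rewrite expr0.
    rewrite addSn !exprS => /(congr1 (fun M => sg' *m M)).
    by rewrite -!mulmxE !mulmxA g'g !mul1mx => /IH.
  wlog lt : a b ab e / (a < b)%N.
    by move=> h; case: (ltngtP a b) (ab) => [l _|l _|/val_inj ->]; [apply: (h a b)|apply: (h b a); rewrite 1?eq_sym|rewrite eqxx].
  exists (b - a)%N; first by rewrite subn_gt0.
  by apply: (can a); rewrite subnKC // ltnW.
have pp := pcharf_prime pk.
have [e ce oe] := pfactor_coprime pp o0.
exists e; split; last first.
  by rewrite -(dvdn_pcharf pk) -prime_coprime.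
have pK : p \in [pchar K] by rewrite (fmorph_pchar j).
have DE n : c *m map_mx j (sg ^+ n) *m invmx c = D ^+ n.
  elim: n => [|n IH]; first by rewrite !expr0 map_mx1 mulmx1 mulmxV.
  rewrite !exprS -IH /D -!mulmxE map_mxM !mulmxA; congr (_ *m _ *m _).
  by rewrite mulmxKV.
have /diag_mxP[dg De] := hD.
have Dn n : D ^+ n = diag_mx (\row_i dg 0 i ^+ n).
  elim: n => [|n IH].
    by apply/matrixP => a b; rewrite !mxE; case: (a == b).
  rewrite exprS IH De -mulmxE mul_diag_mx; apply/matrixP => a b; rewrite !mxE.
  by rewrite exprS mulrnAr.
have Do : D ^+ o = 1 by rewrite -DE ho map_mx1 mulmx1 mulmxV.
have d1 i : dg 0 i ^+ e = 1.
  have := congr1 (fun M : 'M_N => M i i) Do; rewrite Dn !mxE eqxx !mulr1n oe exprM => h.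
  have q : [pchar K].-nat (p ^ logn p o)%N by rewrite (eq_pnat _ (pcharf_eq pK)) pnatX pnat_id.
  have := exprDn_pchar (dg 0 i ^+ e - 1) 1 q; rewrite subrK h expr1n => /eqP.
  by rewrite eq_sym -subr_eq0 addrK expf_eq0 subr_eq0 => /andP[_ /eqP].
have h : c *m map_mx j (sg ^+ e) *m invmx c = 1%:M.
  rewrite DE Dn; apply/matrixP => a b; rewrite !mxE d1; by case: (a == b).
have {}h : map_mx j (sg ^+ e) = 1%:M.
  have := congr1 (fun M => invmx c *m M *m c) h.
  by rewrite !mulmxA mulVmx // mul1mx mulmxKV // mulmx1 mulVmx.
by apply: (@map_mx_inj _ _ j); rewrite h -(map_mx1 j).
Qed.

(** * Weights, radicals and root vectors *)

Section Grading.
Variables (A : comNzRingType) (N r C : nat) (E : {ffun 'I_r -> 'I_C} -> 'M[A]_N).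
Local Notation I := {ffun 'I_r -> 'I_C}.
Hypotheses (E1 : \sum_mu E mu = 1%:M) (EE : forall mu nu, E mu *m E nu = if mu == nu then E mu else 0).

(** Homogeneity of weight [b] for the adjoint grading. Weights are arbitrary integer vectors, so
    they add and scale freely, and 0 is homogeneous of every weight. *)
Definition hw (b : 'I_r -> int) (Z : 'M[A]_N) :=
  forall mu nu : I, E mu *m Z *m E nu <> 0 -> forall j, (mu j)%:Z - (nu j)%:Z = b j.

Lemma grading_dec (Z : 'M[A]_N) : Z = \sum_mu \sum_nu E mu *m Z *m E nu.
Proof.
rewrite -[LHS]mul1mx -E1 mulmx_suml; apply: eq_bigr => mu _.
by rewrite -[LHS]mulmx1 -E1 mulmx_sumr.
Qed.

Lemma grading_eq0 (Z : 'M[A]_N) : (forall mu nu, E mu *m Z *m E nu = 0) -> Z = 0.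
Proof. by move=> h; rewrite (grading_dec Z) big1 // => mu _; rewrite big1. Qed.

Lemma hw0 b : hw b 0.
Proof. by move=> mu nu; rewrite mulmx0 mul0mx. Qed.
Lemma hwD b Y Z : hw b Y -> hw b Z -> hw b (Y + Z).
Proof.
move=> hY hZ mu nu; rewrite mulmxDr mulmxDl => nz.
have [y0|/hY //] := pselect (E mu *m Y *m E nu = 0).
by apply: hZ => z0; apply: nz; rewrite y0 z0 addr0.
Qed.
Lemma hwZ b a Z : hw b Z -> hw b (a *: Z).
Proof.
move=> hZ mu nu; rewrite -scalemxAr -scalemxAl => nz; apply: hZ => z0.
by apply: nz; rewrite z0 scaler0.
Qed.
Lemma hwN b Z : hw b Z -> hw b (- Z).
Proof. by rewrite -scaleN1r; apply: hwZ. Qed.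

Lemma hw_eq b c Z : hw b Z -> (forall j, b j = c j) -> hw c Z.
Proof. by move=> h e mu nu /h hj j; rewrite -e. Qed.

Lemma hwM b c Y Z : hw b Y -> hw c Z -> hw (fun j => b j + c j) (Y *m Z).
Proof.
move=> hY hZ mu nu nz j.
have [rho [n1 n2]] : exists rho, E mu *m Y *m E rho <> 0 /\ E rho *m Z *m E nu <> 0.
  apply: contrapT => no; apply: nz.
  have -> : Y *m Z = \sum_rho (Y *m E rho) *m (E rho *m Z).
    rewrite -[Y in LHS]mulmx1 -E1 mulmx_sumr mulmx_suml; apply: eq_bigr => rho _.
    by rewrite !mulmxA -(mulmxA Y (E rho) (E rho)) EE eqxx.
  rewrite mulmx_sumr mulmx_suml big1 // => rho _.
  have -> : E mu *m (Y *m E rho *m (E rho *m Z)) *m E nu = (E mu *m Y *m E rho) *m (E rho *m Z *m E nu) by rewrite !mulmxA.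
  have [e|n1] := pselect (E mu *m Y *m E rho = 0); first by rewrite e mul0mx.
  have [e|n2] := pselect (E rho *m Z *m E nu = 0); first by rewrite e mulmx0.
  by case: no; exists rho.
by rewrite -(hY _ _ n1) -(hZ _ _ n2) subrKA.
Qed.

Lemma hw_bracket b c Y Z : hw b Y -> hw c Z -> hw (fun j => b j + c j) (Y *m Z - Z *m Y).
Proof.
move=> hY hZ; apply: hwD (hwM hY hZ) (hwN _).
by apply: hw_eq (hwM hZ hY) _ => j; rewrite addrC.
Qed.

Lemma hw_trace b Z j : hw b Z -> b j <> 0 -> \tr Z = 0.
Proof.
move=> hZ bj; rewrite -[Z]mul1mx -E1 mulmx_suml raddf_sum; apply: big1 => mu _ /=.
have -> : E mu *m Z = E mu *m (E mu *m Z) by rewrite mulmxA EE eqxx.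
rewrite mxtrace_mulC.
rewrite (_ : _ *m _ = 0) ?raddf0 //; apply: contrapT => nz.
by apply: bj; rewrite -(hZ _ _ nz) subrr.
Qed.

Lemma hw_iter b Z i : hw b Z -> hw (fun j => b j *+ i) (iter i (mulmx Z) 1%:M).
Proof.
move=> hZ; elim: i => [|i IH] /=.
  move=> mu nu; rewrite mulmx1 EE; case: eqP => // -> _ j.
  by rewrite subrr mulr0n.
by apply: hw_eq (hwM hZ IH) _ => j; rewrite mulrS.
Qed.

Lemma hw_big b Z j : hw b Z -> (C <= `|b j|)%N -> Z = 0.
Proof.
move=> hZ le; apply: grading_eq0 => mu nu; apply: contrapT => nz.
move: le; rewrite -(hZ _ _ nz j) leqNgt => /negP[].
have := ltn_ord (mu j); have := ltn_ord (nu j); lia.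
Qed.

(** The [C]-th power has weight [C] times [b], while differences of indices in ['I_C] stay below [C]
    in absolute value. *)
Lemma hw_nil b Z j : hw b Z -> b j <> 0 -> iter C (mulmx Z) 1%:M = 0.
Proof.
move=> hZ bj; refine (hw_big (j := j) (hw_iter (i := C) hZ) _).
rewrite -mulr_natr natz abszM absz_nat leq_pmull // absz_gt0; exact/eqP.
Qed.

Lemma grading_wt_lt (mu nu : I) j : (mu j + (C - nu j) < C + C)%N.
Proof. have := ltn_ord (mu j); have := ltn_ord (nu j); lia. Qed.
(** The weight mu - nu of a block, shifted by [C] to become a natural number; [wt_int] undoes the
    shift. *)
Definition grading_wt (mu nu : I) : {ffun 'I_r -> 'I_(C + C)} :=
  [ffun j => Ordinal (grading_wt_lt mu nu j)].
Definition wproj b (Z : 'M[A]_N) :=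
  \sum_mu \sum_(nu | grading_wt mu nu == b) E mu *m Z *m E nu.

Lemma wproj_sum Z : \sum_b wproj b Z = Z.
Proof.
rewrite exchange_big [RHS]grading_dec; apply: eq_bigr => mu _ /=.
rewrite (exchange_big_dep predT) //=; apply: eq_bigr => nu _.
by rewrite (big_pred1 (grading_wt mu nu)) // => b; rewrite eq_sym.
Qed.

Lemma wprojE b Z mu nu : E mu *m wproj b Z *m E nu = if grading_wt mu nu == b then E mu *m Z *m E nu else 0.
Proof.
rewrite mulmx_sumr mulmx_suml (bigD1 mu) //= [X in _ + X]big1 ?addr0; last first.
  move=> i ne; rewrite mulmx_sumr mulmx_suml big1 // => l _.
  by rewrite !mulmxA EE eq_sym (negPf ne) !mul0mx.
rewrite mulmx_sumr mulmx_suml.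
have h l : E mu *m (E mu *m Z *m E l) *m E nu = if l == nu then E mu *m Z *m E nu else 0.
  rewrite !mulmxA EE eqxx -!mulmxA EE; case: eqP => [->//|_]; by rewrite !mulmx0.
rewrite (eq_bigr _ (fun l _ => h l)) -big_mkcondr /=; case: ifP => e.
  by rewrite (big_pred1 nu) // => l /=; have [->|_] := eqVneq l nu; rewrite ?e ?andbF ?andbT ?eqxx.
by rewrite big_pred0 // => l /=; have [->|_] := eqVneq l nu; rewrite ?e ?andbF ?andbT ?eqxx.
Qed.

Definition wt_int (b : {ffun 'I_r -> 'I_(C + C)}) j : int := (b j)%:Z - C%:Z.

Lemma grading_wtE mu nu b : grading_wt mu nu = b <-> forall j, (mu j)%:Z - (nu j)%:Z = wt_int b j.
Proof.
split=> [<- j|h].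
  by rewrite /wt_int ffunE /=; have := ltn_ord (mu j); have := ltn_ord (nu j); lia.
apply/ffunP => j; apply: val_inj; rewrite ffunE /=; have := h j; rewrite /wt_int.
have := ltn_ord (mu j); have := ltn_ord (nu j); lia.
Qed.

Lemma wproj_hw b Z : hw (wt_int b) (wproj b Z).
Proof. by move=> mu nu; rewrite wprojE; case: eqP => // /grading_wtE. Qed.

Lemma wproj_id b Z : hw (wt_int b) Z -> wproj b Z = Z.
Proof.
move=> hZ; apply/eqP; rewrite -subr_eq0; apply/eqP/grading_eq0 => mu nu.
rewrite mulmxBr mulmxBl wprojE; case: eqP => [_|ne]; first by rewrite subrr.
rewrite sub0r (_ : _ *m _ = 0) ?oppr0 //; apply: contrapT => /hZ nz; apply: ne; exact/grading_wtE.
Qed.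

Lemma wproj_eq0 b c Z : hw (wt_int c) Z -> b != c -> wproj b Z = 0.
Proof.
move=> hZ bc; apply: grading_eq0 => mu nu; rewrite wprojE; case: eqP => // e.
apply: contrapT => /hZ /grading_wtE e'; by case/eqP: bc; rewrite -e -e'.
Qed.

Lemma wprojD b Y Z : wproj b (Y + Z) = wproj b Y + wproj b Z.
Proof.
rewrite -big_split; apply: eq_bigr => mu _ /=; rewrite -big_split; apply: eq_bigr => nu _ /=.
by rewrite mulmxDr mulmxDl.
Qed.
Lemma wprojZ b a Z : wproj b (a *: Z) = a *: wproj b Z.
Proof.
rewrite scaler_sumr; apply: eq_bigr => mu _; rewrite scaler_sumr; apply: eq_bigr => nu _.
by rewrite -scalemxAr -scalemxAl.
Qed.
Lemma wproj_bigsum b (L : Type) (s : seq L) (F : L -> 'M[A]_N) :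
  wproj b (\sum_(l <- s) F l) = \sum_(l <- s) wproj b (F l).
Proof.
elim: s => [|l s IH]; last by rewrite !big_cons wprojD IH.
by rewrite !big_nil -[X in wproj b X](scale0r 0) wprojZ scale0r.
Qed.
End Grading.

Lemma wproj_nat (A A' : comNzRingType) (f : {rmorphism A -> A'}) N r C
    (E : {ffun 'I_r -> 'I_C} -> 'M[A]_N) b Z :
  map_mx f (wproj E b Z) = wproj (fun mu => map_mx f (E mu)) b (map_mx f Z).
Proof.
rewrite map_mx_sum; apply: eq_bigr => mu _; rewrite map_mx_sum; apply: eq_bigr => nu _.
by rewrite !map_mxM.
Qed.

Lemma digits_inj r n (b c : 'I_r -> 'I_n) :
  (\sum_j b j * n ^ j = \sum_j c j * n ^ j)%N -> forall j, b j = c j.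
Proof.
elim: r b c => [|r IH] b c; first by move=> _ [].
rewrite !big_ord_recl /= expn0 !muln1.
have S (d : 'I_r.+1 -> 'I_n) : (\sum_(i < r) d (lift ord0 i) * n ^ lift ord0 i = n * \sum_(i < r) d (lift ord0 i) * n ^ i)%N.
  by rewrite big_distrr; apply: eq_bigr => i _ /=; rewrite /bump /= add1n expnS mulnCA.
rewrite !S => e.
have e0 : b ord0 = c ord0.
  apply: val_inj; have := congr1 (modn^~ n) e.
  by rewrite /= ![(n * _)%N]mulnC ![(_ + _ * n)%N]addnC !modnMDl !modn_small.
have e1 : (\sum_(i < r) b (lift ord0 i) * n ^ i = \sum_(i < r) c (lift ord0 i) * n ^ i)%N.
  move: e; rewrite e0 => /addnI/eqP; rewrite eqn_pmul2l; first by move/eqP.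
  exact: leq_ltn_trans (ltn_ord (b ord0)).
move=> j; have [i ->|->] := unliftP ord0 j; last exact: e0.
exact: (IH (fun i => b (lift ord0 i)) (fun i => c (lift ord0 i)) e1).
Qed.

Definition cinv (A : comNzRingType) (a : A) : A :=
  if pselect (exists b, a * b = 1) is left h then sval (cid h) else 0.

Lemma cinvE (A : comNzRingType) (a b : A) : a * b = 1 -> cinv a = b.
Proof.
move=> ab; rewrite /cinv; case: pselect => [h|]; last by case; exists b.
by case: cid => c /= ac; rewrite -[c]mul1r -ab mulrC mulrA [c * a]mulrC ac mul1r.
Qed.

Section TorusGrading.
Variables (B : comNzRingType) (N r : nat) (T : lingroup B N) (chi : 'I_r -> lgchar T).
Hypothesis hchi : forall (A : comNzRingType) (s : {rmorphism B -> A}) (a : 'I_r -> A),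
    (forall i, exists b, a i * b = 1) ->
    exists! t, pts T s t /\ forall i, chr_at (chi i) s t = a i.
Variables (C : nat) (m : 'I_r -> nat) (E : {ffun 'I_r -> 'I_C} -> 'M[B]_N).
Hypotheses (E1 : \sum_mu E mu = 1%:M) (EE : forall mu nu, E mu *m E nu = if mu == nu then E mu else 0)
  (TE : forall (A : comNzRingType) (s : {rmorphism B -> A}) t, pts T s t ->
       (\prod_j chr_at (chi j) s t ^+ m j) *: t =
       \sum_mu coch_w (fun j => chr_at (chi j) s t) mu *: map_mx s (E mu)).
Local Notation I := {ffun 'I_r -> 'I_C}.
Local Notation J := {ffun 'I_r -> 'I_(C + C)}.

Section Base.
Variables (A : comNzRingType) (s : {rmorphism B -> A}).
Definition sE (mu : I) := map_mx s (E mu).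
Lemma sE1 : \sum_mu sE mu = 1%:M. Proof. by rewrite -map_mx_sum E1 map_mx1. Qed.
Lemma sEE mu nu : sE mu *m sE nu = if mu == nu then sE mu else 0.
Proof. by rewrite -map_mxM EE; case: eqP => // _; rewrite map_mx0. Qed.

(** The value, at the torus point with coordinates [u], of the character with exponents b_j - C; the
    inverse is a total function so that no unit proofs occur. *)
Definition wval (u : 'I_r -> A) (b : J) : A := \prod_j (u j ^+ b j * cinv (u j) ^+ C).

Lemma conj_wproj t t' Z : pts T s t -> inverses t t' ->
  t *m Z *m t' = \sum_b wval (fun j => chr_at (chi j) s t) b *: wproj sE b Z.
Proof.
move=> tT tt'; have t'T := lg_inv tT tt'.
set u := fun j => chr_at (chi j) s t; pose v j := chr_at (chi j) s t'.
have uv j : u j * v j = 1.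
  by rewrite /u /v -chr_mul // tt'.1 (chr1 s).
have vE j : cinv (u j) = v j by apply: cinvE.
pose c := \prod_j u j ^+ m j; pose c' := \prod_j v j ^+ m j.
have cc' : c * c' = 1.
  by rewrite -big_split big1 // => j _ /=; rewrite -exprMn uv expr1n.
transitivity ((c *: t) *m Z *m (c' *: t')).
  by rewrite -!scalemxAl -scalemxAr scalerA cc' scale1r.
rewrite /c /c' !TE // -/u -/v !mulmx_suml.
transitivity (\sum_mu \sum_nu wval u (grading_wt mu nu) *: (sE mu *m Z *m sE nu)).
  apply: eq_bigr => mu _; rewrite mulmx_sumr; apply: eq_bigr => nu _.
  rewrite -!scalemxAl -scalemxAr scalerA; congr (_ *: _).
  rewrite /coch_w /wval -big_split; apply: eq_bigr => j _ /=.
  rewrite vE ffunE /= exprD -mulrA; congr (_ * _).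
  have le : (nu j <= C)%N by rewrite ltnW.
  have -> : v j ^+ C = v j ^+ (C - nu j) * v j ^+ nu j by rewrite -exprD subnK.
  by rewrite mulrA -exprMn uv expr1n mul1r.
under [RHS]eq_bigr do rewrite scaler_sumr.
rewrite [RHS]exchange_big; apply: eq_bigr => mu _ /=.
under [RHS]eq_bigr do rewrite scaler_sumr.
rewrite (exchange_big_dep predT) //=; apply: eq_bigr => nu _.
by rewrite (big_pred1 (grading_wt mu nu)) // => b; rewrite eq_sym.
Qed.
End Base.

Definition wcode (b : J) : nat := (\sum_j b j * (C + C) ^ j)%N.

Lemma laurent_code (A : comNzRingType) (L : comNzRingType) (c : {rmorphism A -> L}) (x : L)
    (f : J -> A) : (forall g, hev c x g = 0 -> g = 0) ->
  \sum_b x ^+ wcode b * c (f b) = 0 -> forall b, f b = 0.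
Proof.
move=> inj h b; have /inj/(congr1 (fun g : {poly A} => g`_(wcode b))) :
    hev c x (\sum_b f b *: 'X^(wcode b)) = 0.
  rewrite -[RHS]h /hev raddf_sum horner_sum; apply: eq_bigr => d _ /=.
  by rewrite map_polyZ map_polyXn hornerZ hornerXn mulrC.
rewrite coef0 coef_sum (bigD1 b) //= coefZ coefXn eqxx mulr1 big1 ?addr0 // => d db.
rewrite coefZ coefXn; case: eqP => [/digits_inj e|_]; last by rewrite mulr0.
by case/eqP: db; apply/ffunP => j; rewrite e.
Qed.

(** Giving the [j]-th coordinate the value x^((2C)^j) turns a weight into the number with those
    digits in base 2C, so this one-parameter point separates all weights. *)
Lemma generic_point (A : comNzRingType) (s : {rmorphism B -> A}) :
  exists (L : comNzRingType) (c : {rmorphism A -> L}) (x y : L) n (t t' : 'M[L]_N),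
  [/\ x * y = 1, (forall g, hev c x g = 0 -> g = 0),
      pts T (c \o s : {rmorphism B -> L}) t, inverses t t' &
      forall b, wval (fun j => chr_at (chi j) (c \o s : {rmorphism B -> L}) t) b = x ^+ wcode b * y ^+ n].
Proof.
have [L [c [x [y [xy _ inj _]]]]] := laurent_ring A.
have xyn i : x ^+ i * y ^+ i = 1 by rewrite -exprMn xy expr1n.
have [|t [tT te]] := torus_ex hchi (c \o s : {rmorphism B -> L}) (a := fun j => x ^+ ((C + C) ^ j)).
  by move=> j; exists (y ^+ ((C + C) ^ j)); apply: xyn.
have [[t' tt'] _] := tT.
exists L, c, x, y, (\sum_(j < r) (C + C) ^ j * C)%N, t, t'; split=> // b.
rewrite /wval big_split -!prodrXr /=; congr (_ * _).
  by apply: eq_bigr => j _; rewrite te -exprM mulnC.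
by apply: eq_bigr => j _; rewrite te (cinvE (xyn _)) -exprM.
Qed.

(** [Lie G] is stable under the adjoint action of the generic point, on which distinct weights
    become distinct powers of [x]; comparing coefficients isolates each weight component. *)
Lemma lie_wproj (G : lingroup B N) (A : comNzRingType) (s : {rmorphism B -> A}) b Z :
  lgsub T G -> lie G s Z -> lie G s (wproj (sE s) b Z).
Proof.
move=> TG hZ; have [L [c [x [y [n [t [t' [xy inj tT tt' tw]]]]]]]] := generic_point s.
have cs : is_alg_hom s (c \o s : {rmorphism B -> L}) c by [].
have := lie_ad (TG _ _ _ tT) tt' (lie_nat cs hZ).
rewrite (conj_wproj _ tT tt') => /(lieZ (x ^+ n)); rewrite scaler_sumr => /lieP h.
apply/lieP => q qG.
apply: (laurent_code (f := fun b => \sum_i mxvec (wproj (sE s) b Z) 0 i * s (lie_coef q i)) inj).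
rewrite -[RHS](h q qG).
under eq_bigr do rewrite rmorph_sum mulr_sumr.
rewrite exchange_big; apply: eq_bigr => i _; case/mxvec_indexP: i => u v.
rewrite mxvecE summxE mulr_suml; apply: eq_bigr => d _.
have e k : x ^+ n * (x ^+ k * y ^+ n) = x ^+ k by rewrite mulrCA -exprMn xy expr1n mulr1.
rewrite mxvecE scalerA tw e mxE rmorphM mulrA; congr (_ * _ * _).
rewrite (_ : sE (c \o s) = fun mu => map_mx c (sE s mu)).
  by rewrite -wproj_nat mxE.
by apply: functional_extensionality_dep => mu; rewrite /sE map_mx_comp.
Qed.

Definition wchar_at (b : J) (A : comNzRingType) (s : {rmorphism B -> A}) (t : 'M[A]_N) :=
  wval (fun j => chr_at (chi j) s t) b.

Lemma wchar_ex b : exists a : lgchar T, forall (A : comNzRingType) (s : {rmorphism B -> A}) t,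
  chr_at a s t = wval (fun j => chr_at (chi j) s t) b.
Proof.
have un (A : comNzRingType) (s : {rmorphism B -> A}) g : pts T s g ->
   forall j, chr_at (chi j) s g * cinv (chr_at (chi j) s g) = 1.
  by move=> hg j; have [v uv] := chr_unit (chi j) hg; rewrite (cinvE uv).
unshelve eexists (@LGChar B N T (wchar_at b) _ _ _); last by [].
- move=> A s g hg; exists (\prod_j (cinv (chr_at (chi j) s g) ^+ b j * chr_at (chi j) s g ^+ C)).
  rewrite /wchar_at /wval -big_split big1 // => j _ /=.
  by rewrite mulrACA [cinv _ ^+ C * _]mulrC -!exprMn un // !expr1n mulr1.
- move=> A s g h hg hh; rewrite /wchar_at /wval -big_split; apply: eq_bigr => j _ /=.
  rewrite chr_mul // (@cinvE _ _ (cinv (chr_at (chi j) s g) * cinv (chr_at (chi j) s h))).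
    by rewrite !exprMn mulrACA.
  by rewrite mulrACA !un ?mulr1.
- move=> A A' s s' f g fs hg; rewrite /wchar_at /wval rmorph_prod; apply: eq_bigr => j _ /=.
  rewrite (chr_nat _ fs hg) rmorphM !rmorphXn (@cinvE _ _ (f (cinv (chr_at (chi j) s g)))) //.
  by rewrite -rmorphM un // rmorph1.
Qed.

Lemma wchar_inj (b b' : J) : (forall (A : comNzRingType) (s : {rmorphism B -> A}) t, pts T s t ->
    wval (fun j => chr_at (chi j) s t) b = wval (fun j => chr_at (chi j) s t) b') -> b = b'.
Proof.
move=> h; have [L [c [x [y [n [t [t' [xy inj tT tt' tw]]]]]]]] := generic_point (idfun : {rmorphism B -> B}).
have := h _ _ _ tT; rewrite !tw => /(congr1 (fun z => z * x ^+ n)).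
rewrite -!mulrA [y ^+ n * _]mulrC -exprMn xy expr1n !mulr1 => e.
apply: contrapT => /eqP bb'.
pose f d : B := if d == b then 1 else if d == b' then -1 else 0.
have hs : \sum_d x ^+ wcode d * c (f d) = 0.
  rewrite (bigD1 b) //= (bigD1 b') 1?eq_sym //= /f !eqxx.
  have -> : (b' == b) = false by rewrite eq_sym (negPf bb').
  rewrite big1 => [|d /andP[/negPf -> /negPf ->]]; last by rewrite rmorph0 mulr0.
  by rewrite addr0 rmorphN rmorph1 mulrN !mulr1 e subrr.
have := laurent_code inj hs b; rewrite /f eqxx => /eqP; by rewrite oner_eq0.
Qed.

(** The differential at 1, in the direction [x], of the weight expansion of a torus point. *)
Definition lie_diag (A : comNzRingType) (s : {rmorphism B -> A}) (x : 'I_r -> A) : 'M[A]_N :=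
  \sum_(mu : I) (\sum_j ((mu j)%:R - (m j)%:R) * x j) *: sE s mu.

Lemma lie_diag_hw (A : comNzRingType) (s : {rmorphism B -> A}) x : hw (sE s) (fun _ => 0) (lie_diag s x).
Proof.
move=> mu nu; rewrite /lie_diag mulmx_sumr mulmx_suml (bigD1 mu) //= [X in _ + X]big1 ?addr0.
  rewrite -scalemxAr -scalemxAl sEE eqxx sEE; case: eqP => [-> _ j|_]; last by rewrite scaler0.
  by rewrite subrr.
by move=> d dmu; rewrite -scalemxAr -scalemxAl sEE eq_sym (negPf dmu) mul0mx scaler0.
Qed.

Lemma dual_wprod (A : comNzRingType) (c : 'I_r -> nat) (x : 'I_r -> A) :
  \prod_j (((1, x j) : dualnum A) ^+ c j) = (1, \sum_j (c j)%:R * x j).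
Proof.
have X a n : ((1, a) : dualnum A) ^+ n = (1, n%:R * a).
  elim: n => [|n IH]; first by rewrite expr0 mul0r.
  by rewrite exprS IH; apply: injective_projections; rewrite /= ?mul1r // mulr1 -[n.+1]add1n natrD mulrDl mul1r addrC.
elim/big_rec2: _ => // j z w _ ->; rewrite X.
by apply: injective_projections; rewrite /= ?mul1r // mulr1 addrC.
Qed.

Lemma lie_torusP (A : comNzRingType) (s : {rmorphism B -> A}) X : lie T s X <-> exists x, X = lie_diag s x.
Proof.
have dr : is_alg_hom (dual_str s) s (@dual_red A) by [].
have key Y x : lie T s Y -> (forall j, chr_at (chi j) (dual_str s) (dual_mx 1%:M Y) = (1, x j)) -> Y = lie_diag s x.
  move=> hY hx; have := TE hY.
  rewrite (eq_bigr (fun j => ((1, x j) : dualnum A) ^+ m j)) => [|j _]; last by rewrite hx.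
  rewrite dual_wprod => e.
  have {}e a b : \sum_j (m j)%:R * x j * (a == b)%:R + Y a b =
      \sum_(mu : I) (\sum_j (mu j)%:R * x j) * sE s mu a b.
    have := congr1 (fun M : 'M[dualnum A]_N => (M a b).2) e; rewrite !mxE summxE dual_sum2 /= mul1r addrC.
    rewrite -mulr_suml => ->; apply: eq_bigr => mu _; rewrite !mxE /coch_w.
    rewrite (eq_bigr (fun j => ((1, x j) : dualnum A) ^+ mu j)) => [|j _]; last by rewrite hx.
    by rewrite dual_wprod /= mulr0 add0r.
  apply/matrixP => a b; rewrite /lie_diag summxE.
  have -> : Y a b = \sum_(mu : I) (\sum_j (mu j)%:R * x j) * sE s mu a b - \sum_j (m j)%:R * x j * (a == b)%:R.
    by rewrite -e addrC addKr.
  have -> : \sum_j (m j)%:R * x j * (a == b)%:R = \sum_(mu : I) (\sum_j (m j)%:R * x j) * sE s mu a b.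
    have e1 : \sum_mu sE s mu a b = (a == b)%:R.
      by have := congr1 (fun M : 'M_N => M a b) (sE1 s); rewrite summxE mxE.
    by rewrite -mulr_suml -e1 mulr_sumr.
  rewrite -sumrB; apply: eq_bigr => mu _; rewrite [RHS]mxE -mulrBl; congr (_ * _).
  by rewrite -sumrB; apply: eq_bigr => j _; rewrite mulrBl.
have mapd Y : map_mx (@dual_red A) (dual_mx 1%:M Y) = 1%:M.
  by apply/matrixP => a b; rewrite !mxE.
split=> [hX|[x ->]].
  exists (fun j => (chr_at (chi j) (dual_str s) (dual_mx 1%:M X)).2); apply: key => // j.
  apply: injective_projections => //=.
  by have := chr_nat (chi j) dr hX; rewrite mapd (chr1 s) => /esym.
have [|t [tT te]] := torus_ex hchi (dual_str s) (a := fun j => (1, x j)).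
  by move=> j; exists (1, - x j); apply: injective_projections; rewrite /= ?mul1r // mulr1 addNr.
have t1 : map_mx (@dual_red A) t = 1%:M.
  apply: (torus_eq hchi (pts_nat dr tT) (lg_one T s)) => j.
  by rewrite (chr_nat _ dr tT) te (chr1 s).
have tE : t = dual_mx 1%:M (\matrix_(a, b) (t a b).2).
  apply/matrixP => a b; rewrite !mxE; apply: injective_projections => //=.
  by have := congr1 (fun M : 'M_N => M a b) t1; rewrite !mxE.
have hY : lie T s (\matrix_(a, b) (t a b).2) by rewrite /lie -tE.
by rewrite -(key _ x hY) // => j; rewrite -tE te.
Qed.
End TorusGrading.

(* Jacobson's theorem on weakly closed sets of nilpotent matrices. *)
Section WeaklyClosed.
Variables (K : fieldType) (N : nat).
Local Notation M := 'M[K]_N.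

Definition mxword (l : seq M) : M := foldr (fun A B => A *m B) 1%:M l.

Lemma mxword_cat l l' : mxword (l ++ l') = mxword l *m mxword l'.
Proof. by elim: l => [|A l IH] /=; rewrite ?mul1mx // IH mulmxA. Qed.

(** All words of length [n] in [V] kill [X] by left multiplication; associative nilpotency of [V] is
    [ann V n 1%:M]. *)
Fixpoint ann (V : {vspace M}) n (X : M) : Prop :=
  if n is n'.+1 then forall A, A \in V -> ann V n' (A *m X) else X = 0.

Lemma annD V n X Y : ann V n X -> ann V n Y -> ann V n (X + Y).
Proof.
elim: n X Y => [|n IH] X Y /=; first by move=> -> ->; rewrite addr0.
by move=> hX hY A AV; rewrite mulmxDr; apply: IH; [apply: hX | apply: hY].
Qed.
Lemma annZ V n a X : ann V n X -> ann V n (a *: X).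
Proof.
elim: n X => [|n IH] X /=; first by move=> ->; rewrite scaler0.
by move=> hX A AV; rewrite -scalemxAr; apply: IH; apply: hX.
Qed.
Lemma ann0 V n : ann V n 0.
Proof. by elim: n => [//|n IH] A _; rewrite mulmx0. Qed.
Lemma annS V n X : ann V n X -> ann V n.+1 X.
Proof.
elim: n X => [|n IH] X /= h A AV; first by rewrite h mulmx0.
by apply: IH; apply: h.
Qed.

Lemma ann_word (V : {vspace M}) (l : seq M) (X : M) : (forall A, A \in l -> A \in V) -> ann V (size l) X -> mxword l *m X = 0.
Proof.
elim/last_ind: l X => [|l A IH] X hl; first by rewrite mul1mx.
rewrite size_rcons -cats1 mxword_cat /= mulmx1 -mulmxA => h; apply: IH => [B Bl|].
  by apply: hl; rewrite mem_rcons inE Bl orbT.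
by apply: h; apply: hl; rewrite mem_rcons mem_head.
Qed.

Variable S : M -> Prop.
Hypotheses (Snil : forall A, S A -> exists n, iter n (mulmx A) 1%:M = 0)
  (Sbr : forall A B, S A -> S B -> S (A *m B - B *m A)).

(** The invariant of the induction: a Lie subalgebra spanned by members of [S], nilpotent as a set
    of operators. *)
Definition good (V : {vspace M}) :=
  [/\ (forall A B, A \in V -> B \in V -> A *m B - B *m A \in V),
      (exists l, (forall A, A \in l -> S A) /\ V = <<l>>%VS) & exists n, ann V n 1%:M].

(* Iterated brackets of [B] with [V] expand into words with many letters from [V] on one side. *)
Lemma good_normalizer V B : good V -> S B -> B \notin V ->
  exists C, [/\ S C, C \notin V & forall A, A \in V -> A *m C - C *m A \in V].
Proof.
case=> hbr [l [lS Vl]] [n hn] SB BV; apply: contrapT => no.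
pose brs (s : seq M) (C : M) : M := foldr (fun A X => A *m X - X *m A) C s.
have ex k : exists s : seq M, [/\ size s = k, (forall A, A \in s -> A \in l) & S (brs s B) /\ brs s B \notin V].
  elim: k => [|k [s [sk sl [Ss nV]]]]; first by exists [::].
  have [A [Al AV]] : exists A, A \in l /\ A *m brs s B - brs s B *m A \notin V.
    apply: contrapT => no'; apply: no; exists (brs s B); split=> // A; rewrite {1}Vl => /(@coord_span _ _ _ (in_tuple l)) ->.
    rewrite mulmx_suml mulmx_sumr -sumrB; apply: rpred_sum => i _.
    rewrite -scalemxAl -scalemxAr -scalerBr; apply: rpredZ.
    by apply: contrapT => /negP h; apply: no'; exists (in_tuple l)`_i; rewrite mem_nth.
  exists (A :: s); split=> /=; [by rewrite sk | | by split=> //; apply: Sbr => //; apply: lS].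
  by move=> C; rewrite inE => /predU1P[-> //|/sl].
(* With 2n letters spread over the two sides of [B], one side has at least [n] of them and
   vanishes. *)
have [s [sk sl [_ /negP[]]]] := ex (n + n)%N.
have key : forall s, (forall A, A \in s -> A \in V) -> exists r : seq (K * (seq M * seq M)),
   (forall u, u \in r -> (size u.2.1 + size u.2.2 = size s)%N /\
       (forall A, A \in u.2.1 ++ u.2.2 -> A \in V)) /\
   brs s B = \sum_(u <- r) u.1 *: (mxword u.2.1 *m B *m mxword u.2.2).
  elim=> [|A {sk sl}s IH] hs.
    exists [:: (1, ([::], [::]))]; rewrite big_seq1 /= scale1r mul1mx mulmx1; split=> // u.
    by rewrite inE => /eqP ->.
  have [|r [hr e]] := IH; first by move=> C Cs; apply: hs; rewrite inE Cs orbT.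
  exists ([seq (u.1, (A :: u.2.1, u.2.2)) | u <- r] ++ [seq (- u.1, (u.2.1, rcons u.2.2 A)) | u <- r]).
  have AV : A \in V by apply: hs; rewrite mem_head.
  split.
    move=> u; rewrite mem_cat => /orP[]/mapP[v /hr[h1 h2] ->] /=; split.
    - by rewrite addSn h1.
    - by move=> C; rewrite inE => /predU1P[->//|/h2].
    - by rewrite size_rcons addnS h1.
    - move=> C; rewrite mem_cat mem_rcons inE => /or3P[Cu|/eqP->//|Cu]; apply: h2; by rewrite mem_cat Cu ?orbT.
  rewrite /= e big_cat !big_map /= mulmx_sumr mulmx_suml -sumrN; congr (_ + _).
    by apply: eq_bigr => u _; rewrite -scalemxAr !mulmxA.
  by apply: eq_bigr => u _; rewrite -scalemxAl scaleNr -cats1 mxword_cat /= mulmx1 !mulmxA.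
have kill s' : (forall A, A \in s' -> A \in V) -> (n <= size s')%N -> mxword s' = 0.
  move=> hs' le; rewrite -(cat_take_drop n s') mxword_cat.
  suff e : mxword (take n s') = 0 by rewrite e mul0mx.
  rewrite -[LHS]mulmx1; apply: (@ann_word V); last by rewrite size_takel.
  by move=> A /mem_take; apply: hs'.
have [|r [hr ->]] := key s; first by move=> A /sl Al; rewrite Vl memv_span.
rewrite big_seq big1 ?mem0v // => u /hr[h1 h2].
have [le|gt] := leqP n (size u.2.1).
  by rewrite (kill _ _ le) ?mul0mx ?scaler0 // => A Au; apply: h2; rewrite mem_cat Au.
have le : (n <= size u.2.2)%N.
  by rewrite -(leq_add2l (size u.2.1)) h1 sk leq_add2r ltnW.
by rewrite (kill _ _ le) ?mulmx0 ?scaler0 // => A Au; apply: h2; rewrite mem_cat Au orbT.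
Qed.

(** [C] normalizes [V], so it preserves the matrices killed by all [V]-words of a given length.
    Modulo the next smaller such space, a word in [C] and [V] is a multiple of a power of [C]; words
    of length [m], with C^m = 0, thus lower the level by one, and length [m * n] suffices. *)
Lemma good_extend V C : good V -> S C ->
  (forall A, A \in V -> A *m C - C *m A \in V) -> good (<[C]> + V)%VS.
Proof.
case=> hbr [l [lS Vl]] [n hn] SC hC.
have dec A : A \in (<[C]> + V)%VS -> exists a B, B \in V /\ A = a *: C + B.
  by case/memv_addP => _ /vlineP[a ->] [B BV ->]; exists a, B.
split.
- move=> _ _ /dec[a [A [AV ->]]] /dec[b [B [BV ->]]].
  apply: (subvP (addvSr _ _)).
  have -> : (a *: C + A) *m (b *: C + B) - (b *: C + B) *m (a *: C + A)
    = b *: (A *m C - C *m A) - a *: (B *m C - C *m B) + (A *m B - B *m A).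
    rewrite !mulmxDl !mulmxDr -!scalemxAl -!scalemxAr !scalerA (mulrC b a).
    move: (C *m C) (C *m A) (C *m B) (A *m C) (B *m C) (A *m B) (B *m A) => m1 m2 m3 m4 m5 m6 m7.
    by apply/matrixP => i j; rewrite !mxE; ring.
  by apply: rpredD; [apply: rpredB; apply: rpredZ; apply: hC | apply: hbr].
- exists (C :: l); split; last by rewrite span_cons Vl.
  by move=> A; rewrite inE => /predU1P[->|/lS].
have [m hm] := Snil SC.
have annC i X : ann V i X -> ann V i (C *m X).
  elim: i X => [|i IH] X /=; first by move=> ->; rewrite mulmx0.
  move=> h A AV; have -> : A *m (C *m X) = C *m (A *m X) + (A *m C - C *m A) *m X.
    by rewrite mulmxBl !mulmxA addrC subrK.
  by apply: annD; [apply/IH/h | apply/h/hC].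
have annV i X A : A \in V -> ann V i X -> ann V i (A *m X) by move=> AV /annS; apply.
pose W := (<[C]> + V)%VS.
have step w i X : (forall A, A \in w -> A \in W) -> ann V i.+1 X ->
    exists c, ann V i (mxword w *m X - c *: (iter (size w) (mulmx C) 1%:M *m X)).
  move=> + hX; elim: w => [|A w IH] hw.
    by exists 1; rewrite scale1r subrr; apply: ann0.
  have [|c hc] := IH; first by move=> D Dw; apply: hw; rewrite inE Dw orbT.
  have [a [B [BV eA]]] := dec A (hw A (mem_head _ _)); exists (a * c) => /=.
  set Y := iter _ _ _ in hc *; set w' := mxword w in hc *.
  have -> : A *m w' *m X - a * c *: (C *m Y *m X) = A *m (w' *m X - c *: (Y *m X)) + c *: (B *m (Y *m X)).
    rewrite eA !mulmxDl !mulmxBr -!scalemxAr -!scalemxAl scalerA !mulmxA.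
    move: (C *m w' *m X) (C *m Y *m X) (B *m w' *m X) (B *m Y *m X) => m1 m2 m3 m4.
    by apply/matrixP => u v; rewrite !mxE; ring.
  apply: annD.
    by rewrite eA mulmxDl -scalemxAl; apply: annD; [apply/annZ/annC | apply: annV].
  apply: annZ; have : ann V i.+1 (Y *m X); last exact.
  rewrite /Y; elim: (size w) => [|j IHj]; first by rewrite mul1mx.
  by rewrite iterS -mulmxA; apply: (annC i.+1 _ IHj).
have wkill i X : ann V i X -> forall w, (size w = m * i)%N -> (forall A, A \in w -> A \in W) -> mxword w *m X = 0.
  elim: i X => [|i IH] X /= hX w sw hw; first by rewrite hX mulmx0.
  rewrite mulnS addnC in sw; rewrite -(cat_take_drop (m * i) w) mxword_cat -mulmxA.
  apply: IH; last 2 first.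
  - by rewrite size_takel // sw leq_addr.
  - by move=> A /mem_take; apply: hw.
  have [|c] := step (drop (m * i) w) i X _ hX; first by move=> A /mem_drop; apply: hw.
  by rewrite size_drop sw addKn hm mul0mx scaler0 subr0.
exists (m * n)%N.
have back t X : (forall w, size w = t -> (forall A, A \in w -> A \in W) -> mxword w *m X = 0) -> ann W t X.
  elim: t X => [|t IH] X h /=; first by have := h [::] erefl; rewrite mul1mx; apply.
  move=> A AW; apply: IH => w sw hw; rewrite mulmxA.
  have := h (rcons w A); rewrite size_rcons sw -cats1 mxword_cat /= mulmx1; apply=> // B.
  by rewrite mem_cat inE => /orP[/hw|/eqP->].
by apply: back => w sw hw; apply: wkill hn w sw hw.
Qed.

Lemma weakly_closed_nilpotent : exists (V : {vspace M}) n,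
  [/\ (exists l, (forall A, A \in l -> S A) /\ V = <<l>>%VS), (forall A, S A -> A \in V) & ann V n 1%:M].
Proof.
have ind t : forall V, good V -> (\dim {:M} <= t + \dim V)%N ->
    exists V, good V /\ forall A, S A -> A \in V.
  elim: t => [|t IH] V gV le.
    exists V; split=> // A _; have /eqP -> : V == fullv by rewrite eqEdim subvf.
    exact: memvf.
  have [|] := pselect (forall A, S A -> A \in V); first by exists V.
  move=> /existsNP[B /not_implyP[SB /negP BV]].
  have [C [SC CV hC]] := good_normalizer gV SB BV.
  apply: (IH _ (good_extend gV SC hC)); apply: leq_trans le _; rewrite addSnnS leq_add2l.
  rewrite ltn_neqAle dimvS ?addvSr // andbT; apply: contra CV => /eqP e.
  have /eqP -> : V == (<[C]> + V)%VS by rewrite eqEdim addvSr e leqnn.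
  by rewrite (subvP (addvSl _ _)) // memv_line.
have g0 : good 0%VS.
  split; first by move=> A B; rewrite !memv0 => /eqP -> /eqP ->; rewrite mulmx0 subrr.
    by exists [::]; rewrite span_nil.
  by exists 1%N => A /=; rewrite memv0 => /eqP ->; rewrite mul0mx.
have [V [[_ hl [n hn]] hS]] := ind _ 0%VS g0 (leq_addr _ _).
by exists V, n.
Qed.
End WeaklyClosed.

Lemma idempotent_trace (K : fieldType) N (E : 'M[K]_N) : E *m E = E ->
  \tr E = (\rank E)%:R.
Proof.
move=> EE; have key n (C : 'M[K]_(N, n)) (R : 'M[K]_(n, N)) u v :
    C *m R = E -> v *m C = 1%:M -> R *m u = 1%:M -> R *m C = 1%:M.
  move=> CR vC Ru; have := congr1 (fun X => v *m X *m u) EE.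
  by rewrite -CR !mulmxA vC !mul1mx -!mulmxA Ru mulmx1.
have [u hu] := row_freeP (row_base_free E); have [v hv] := row_fullP (col_base_full E).
by rewrite -{1}(mulmx_base E) mxtrace_mulC (key _ _ _ u v) ?mulmx_base // mxtrace1.
Qed.

(* Expanding vectors along elements independent over the integers reduces nondegeneracy to
   positivity over the integers. *)
Section IntegralForm.
Variables (K : fieldType) (ch0 : injective (intr : int -> K)) (I : finType) (r : nat).
Variables (w : I -> nat) (l : I -> 'I_r -> int).

Definition pairing (A : pzRingType) mu (x : 'I_r -> A) : A := \sum_j (l mu j)%:~R * x j.
(** The trace form on the diagonal subalgebra when [w] is the multiplicity of each weight and [l]
    its differential; over the integers it is positive semidefinite. *)
Definition wform (A : comNzRingType) (x y : 'I_r -> A) : A :=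
  \sum_mu (w mu)%:R * (pairing mu x * pairing mu y).

Lemma wform_int (x : 'I_r -> int) : wform x x = 0 -> forall mu, w mu <> 0%N -> pairing mu x = 0.
Proof.
move=> h mu wmu; apply/eqP.
have ge nu : 0 <= (w nu)%:R * (pairing nu x * pairing nu x) by rewrite mulr_ge0 ?ler0n // -expr2 sqr_ge0.
have /eqP := h; rewrite /wform psumr_eq0 // => /allP/(_ mu); rewrite mem_index_enum => /(_ isT)/=.
by rewrite mulf_eq0 pnatr_eq0 -expr2 sqrf_eq0 => /orP[/eqP//|].
Qed.

Lemma wform_sum (A : comNzRingType) (x y : 'I_r -> A) :
  wform x y = \sum_j (\sum_mu (w mu)%:R * (pairing mu x * (l mu j)%:~R)) * y j.
Proof.
under [RHS]eq_bigr do rewrite mulr_suml.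
rewrite exchange_big; apply: eq_bigr => mu _ /=.
rewrite {2}/pairing !mulr_sumr; apply: eq_bigr => j _.
by rewrite !mulrA.
Qed.

(** Clearing denominators, [x] and [z] are expanded along elements [e] independent over the
    integers; independence splits the linear equation into one integral equation for each of them.
    It is used with [z = 0] for the kernel and with [z = 1] for a represented form. *)
Lemma wform_span (x : 'I_r -> K) (a : 'I_r -> int) (z : K) :
  (forall j, \sum_mu (w mu)%:R * (pairing mu x * (l mu j)%:~R) = (a j)%:~R * z) ->
  exists (n : nat) (e : 'I_n -> K) (d : int) (b' : 'I_n -> int) (b : 'I_n -> 'I_r -> int),
  [/\ d <> 0, d%:~R * z = \sum_i e i * (b' i)%:~R, (forall j, d%:~R * x j = \sum_i e i * (b i j)%:~R),
      (forall c : 'I_n -> int, \sum_i e i * (c i)%:~R = 0 -> forall i, c i = 0) &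
      forall i j, \sum_mu (w mu)%:R * (pairing mu (b i) * (l mu j)%:~R) = a j * b' i].
Proof.
move=> h; have [e [d [b [d0 h1 h2]]]] := domain_span (z :: [seq x j | j <- enum 'I_r]) ch0.
have ind (c : 'I_(size e) -> int) : \sum_(i < size e) e`_i * (c i)%:~R = 0 -> forall i, c i = 0.
  move=> hc i; pose f m := if insub m is Some u then c u else 0.
  have hf : \sum_(u < size e) e`_u * (f u)%:~R = 0.
    by rewrite -[RHS]hc; apply: eq_bigr => u _; rewrite /f valK.
  by have := h2 f hf i (ltn_ord i); rewrite /f valK.
have xE j : d%:~R * x j = \sum_(i < size e) e`_i * (b j.+1 i)%:~R.
  have := h1 j.+1; rewrite /= size_map size_enum_ord ltnS => /(_ (ltn_ord j)) <-.
  by rewrite (nth_map j) ?size_enum_ord // nth_ord_enum.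
exists (size e), (fun i => e`_i), d, (fun i => b 0%N i), (fun i j => b j.+1 i); split=> //.
  exact: (h1 0%N).
move=> i j; apply/eqP; rewrite -subr_eq0; apply/eqP.
apply: (ind (fun i => \sum_mu (w mu)%:R * (pairing mu (fun j : 'I_r => b j.+1 i) * (l mu j)%:~R) - a j * b 0%N i)).
transitivity (d%:~R * (\sum_mu (w mu)%:R * (pairing mu x * (l mu j)%:~R) - (a j)%:~R * z)); last first.
  by rewrite h subrr mulr0.
under eq_bigr do rewrite rmorphB mulrBr.
rewrite sumrB mulrBr; congr (_ - _).
  rewrite mulr_sumr; under eq_bigr do rewrite rmorph_sum mulr_sumr.
  rewrite exchange_big; apply: eq_bigr => mu _ /=.
  have -> : d%:~R * ((w mu)%:R * (pairing mu x * (l mu j)%:~R)) = (w mu)%:R * ((d%:~R * pairing mu x) * (l mu j)%:~R).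
    by rewrite mulrCA !mulrA.
  have -> : d%:~R * pairing mu x = \sum_(i < size e) e`_i * (pairing mu (fun j : 'I_r => b j.+1 i))%:~R.
    rewrite /pairing mulr_sumr; under [RHS]eq_bigr do rewrite rmorph_sum mulr_sumr.
    rewrite exchange_big; apply: eq_bigr => j' _ /=.
    rewrite mulrCA xE mulr_sumr; apply: eq_bigr => u _.
    by rewrite rmorphM /= mulrCA intz.
  rewrite mulr_suml mulr_sumr; apply: eq_bigr => u _.
  by rewrite !rmorphM /= !intz /= mulrCA !mulrA natz.
rewrite mulrCA (h1 0%N) // mulr_sumr; apply: eq_bigr => u _.
by rewrite rmorphM /= mulrCA.
Qed.

Lemma wform_nondeg (x : 'I_r -> K) : (forall y, wform x y = 0) ->
  forall mu, w mu <> 0%N -> pairing mu x = 0.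
Proof.
move=> h mu wmu; have hj j : \sum_mu (w mu)%:R * (pairing mu x * (l mu j)%:~R) = ((fun _ => 0) j)%:~R * 0.
  have := h (fun i => (i == j)%:R); rewrite wform_sum (bigD1 j) //= eqxx mulr1 [X in _ + X]big1 ?addr0.
    by move->; rewrite mulr0.
  by move=> i /negPf ->; rewrite mulr0.
have [n [e [d [b' [b [d0 _ hx _ hG]]]]]] := wform_span hj.
have b0 i : pairing mu (b i) = 0.
  apply: wform_int => //; rewrite wform_sum big1 // => j _; by rewrite hG mul0r mul0r.
apply/eqP; rewrite -(mulrI_eq0 _ (@mulfI _ d%:~R _)); last first.
  by apply/eqP => /(@ch0 _ 0).
rewrite /pairing mulr_sumr.
have -> : \sum_j d%:~R * ((l mu j)%:~R * x j) = \sum_i e i * (pairing mu (b i))%:~R.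
  rewrite /pairing; under [RHS]eq_bigr do rewrite rmorph_sum mulr_sumr.
  rewrite exchange_big; apply: eq_bigr => j' _ /=.
  rewrite mulrCA hx mulr_sumr; apply: eq_bigr => u _.
  by rewrite rmorphM /= mulrCA intz.
by rewrite big1 // => i _; rewrite b0 mulr0.
Qed.

(** The value of [a] at the vector [x] representing it is the norm of [x]. If it vanished, so would
    the norm of an integral coordinate vector representing a nonzero multiple of [a]; by positivity
    that vector lies in the kernel of the form, and [a] would be 0. *)
Lemma wform_dual (x : 'I_r -> K) (a : 'I_r -> int) j0 :
  (forall y, wform x y = \sum_j (a j)%:~R * y j) -> a j0 <> 0 -> \sum_j (a j)%:~R * x j <> 0.
Proof.
move=> h a0 ax; have hj j : \sum_mu (w mu)%:R * (pairing mu x * (l mu j)%:~R) = (a j)%:~R * 1.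
  have := h (fun i => (i == j)%:R); rewrite wform_sum (bigD1 j) //= eqxx !mulr1 [X in _ + X]big1 ?addr0.
    move=> ->; rewrite (bigD1 j) //= eqxx mulr1 [X in _ + X]big1 ?addr0 // => i /negPf ->.
    by rewrite mulr0.
  by move=> i /negPf ->; rewrite mulr0.
have [n [e [d [b' [b [d0 h1 hx ind hG]]]]]] := wform_span hj.
have [i bi] : exists i, b' i <> 0.
  apply: contrapT => no; apply: d0; apply: ch0; rewrite -[LHS]mulr1 h1 big1 // => i _.
  suff -> : b' i = 0 by rewrite mulr0.
  by apply: contrapT => nz; apply: no; exists i.
have ab : \sum_j a j * b i j = 0.
  apply: (ind (fun i => \sum_j a j * b i j)).
  transitivity (d%:~R * \sum_j (a j)%:~R * x j); last by rewrite ax mulr0.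
  under eq_bigr do rewrite rmorph_sum mulr_sumr.
  rewrite exchange_big mulr_sumr; apply: eq_bigr => j _ /=.
  by rewrite mulrCA hx mulr_sumr; apply: eq_bigr => u _; rewrite rmorphM /= mulrCA.
have p0 : forall mu, w mu <> 0%N -> pairing mu (b i) = 0.
  apply: wform_int; rewrite wform_sum; under eq_bigr do rewrite hG mulrAC.
  by rewrite -mulr_suml ab mul0r.
apply: a0; apply/eqP; have /eqP := hG i j0; rewrite big1 => [|mu _].
  by rewrite eq_sym mulf_eq0 => /orP[//|/eqP].
have [->|/eqP wmu] := eqVneq (w mu) 0%N; first by rewrite mul0r.
by rewrite p0 ?mul0r ?mulr0.
Qed.
End IntegralForm.

Lemma subspace_vspace (K : fieldType) (vT : vectType K) (P : vT -> Prop) :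
  P 0 -> (forall u v, P u -> P v -> P (u + v)) -> (forall a v, P v -> P (a *: v)) ->
  exists V : {vspace vT}, forall v, P v <-> v \in V.
Proof.
move=> P0 PD PZ.
have ind t : forall V : {vspace vT}, (forall v, v \in V -> P v) -> (\dim {:vT} <= t + \dim V)%N ->
    exists V : {vspace vT}, forall v, P v <-> v \in V.
  elim: t => [|t IH] V hV le.
    exists V => v; split=> [_|/hV//]; have /eqP -> : V == fullv by rewrite eqEdim subvf.
    exact: memvf.
  have [h|] := pselect (forall v, P v -> v \in V); first by exists V => v; split; [apply: h|apply: hV].
  move=> /existsNP[v /not_implyP[Pv /negP vV]].
  apply: (IH (<[v]> + V)%VS).
    by move=> _ /memv_addP[_ /vlineP[a ->] [u uV ->]]; apply: PD; [apply: PZ | apply: hV].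
  apply: leq_trans le _; rewrite addSnnS leq_add2l.
  rewrite ltn_neqAle dimvS ?addvSr // andbT; apply: contra vV => /eqP e.
  have /eqP -> : V == (<[v]> + V)%VS by rewrite eqEdim addvSr e leqnn.
  by rewrite (subvP (addvSl _ _)) // memv_line.
by apply: (ind (\dim {:vT}) 0%VS); [move=> v; rewrite memv0 => /eqP -> | rewrite leq_addr].
Qed.

(** * Nil ideals and the unipotent radical in characteristic 0 *)

Section GeometricGroups.
Variables (K : closedFieldType) (N : nat).
Local Notation M := 'M[K]_N.

Lemma inverses_invmx (g g' : M) : inverses g g' -> g \in unitmx /\ invmx g = g'.
Proof.
case=> gg' g'g; have [gu _] := mulmx1_unit gg'; split=> //.
by rewrite -[LHS]mul1mx -g'g mulmxK.
Qed.

Lemma unitmx_inverses (g : M) : g \in unitmx -> inverses g (invmx g).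
Proof. by move=> gu; split; [apply: mulmxV | apply: mulVmx]. Qed.

Lemma pts_subgroup (B : comNzRingType) (G : lingroup B N) (s : {rmorphism B -> K}) :
  is_subgroup (pts G s).
Proof.
split; [|exact: lg_one|exact: lg_mul|].
  by move=> g [[h /inverses_invmx[]]].
move=> g gG; have [[h /inverses_invmx[gu _]] _] := gG.
exact: lg_inv gG (unitmx_inverses gu).
Qed.

Lemma pts_zclosed (B : comNzRingType) (G : lingroup B N) (s : {rmorphism B -> K}) :
  zclosed (pts G s).
Proof.
have E q (g : M) : (map_mpoly s q).@[fun i => mxvec g 0 i] = pev s g q.
  pose h : {rmorphism {mpoly B[N * N]} -> K} :=
    GRing.RMorphism.clone _ _ (meval (fun i => mxvec g 0 i) \o map_mpoly s) _.
  apply: (@mpoly_hom_ext _ _ _ h (mmap s (fun i => mxvec g 0 i))) => [c|i] /=.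
    by rewrite map_mpolyC mevalC mmapC.
  by rewrite map_mpolyX mevalXU mmapX mmap1U.
exists (fun f => exists2 q, q \in lg_eqs G & f = map_mpoly s q) => g gu; split.
  by move=> [_ h] _ [q qG ->]; rewrite E; apply: h.
move=> h; split; first by exists (invmx g); apply: unitmx_inverses.
by move=> q qG; rewrite -[LHS]/(pev s g q) -E; apply: h; exists q.
Qed.

Lemma vspace_zclosed (V : {vspace M}) : zclosed (fun g => g - 1%:M \in V).
Proof.
pose f (X : M) := X - projv V X.
have fV X : X \in V <-> f X = 0.
  split=> [XV|/eqP]; first by rewrite /f projv_id ?subrr.
  by rewrite subr_eq0 => /eqP ->; apply: memv_proj.
pose q (ab : 'I_N * 'I_N) : {mpoly K[N * N]} :=
  \sum_i \sum_j (f (delta_mx i j)) ab.1 ab.2 *: 'X_(mxvec_index i j) - ((f 1%:M) ab.1 ab.2)%:MP.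
have qE g a b : (q (a, b)).@[fun i => mxvec g 0 i] = (f (g - 1%:M)) a b.
  have fB X Y : f (X - Y) = f X - f Y.
    have e : projv V (X - Y) = projv V X - projv V Y by rewrite linearB.
    rewrite /f e; move: (projv V X) (projv V Y) => u v.
    by rewrite !opprD !opprK addrACA.
  rewrite fB mxE [X in _ = _ + X]mxE /q mevalB mevalC; congr (_ - _).
  have -> : f g = \sum_i \sum_j g i j *: f (delta_mx i j).
    rewrite {1}/f {1 2}(matrix_sum_delta g) linear_sum -sumrB; apply: eq_bigr => i _.
    rewrite linear_sum -sumrB; apply: eq_bigr => j _.
    by rewrite linearZ -scalerBr.
  rewrite raddf_sum summxE; apply: eq_bigr => i _; rewrite /= raddf_sum summxE; apply: eq_bigr => j _ /=.
  by rewrite mevalZ mevalXU mxvecE [RHS]mxE mulrC.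
exists (fun h => exists ab, h = q ab) => g _; split.
  by move=> /fV h _ [[a b] ->]; rewrite qE h mxE.
by move=> h; apply/fV/matrixP => a b; rewrite -qE h ?mxE //; exists (a, b).
Qed.

Lemma zclosedI Z1 Z2 : @zclosed K N Z1 -> zclosed Z2 -> zclosed (fun g => Z1 g /\ Z2 g).
Proof.
move=> [E1 h1] [E2 h2]; exists (fun f => E1 f \/ E2 f) => g gu; split.
  by move=> [/(h1 _ gu) a /(h2 _ gu) b] f []; [apply: a | apply: b].
by move=> h; split; [apply/(h1 _ gu) | apply/(h2 _ gu)] => f Ef; apply: h; [left | right].
Qed.

Hypothesis ch0 : forall n, n%:R = 0 :> K -> n = 0%N.

Lemma poly_nat_vanish (q : {poly K}) : (forall n, exists2 i, (n < i)%N & q.[i%:R] = 0) -> q = 0.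
Proof.
move=> h; apply/eqP; apply: contraT => q0.
have inj i j : i%:R = j%:R :> K -> i = j.
  wlog le : i j / (i <= j)%N by case: (leqP i j) => [l W|/ltnW l W] e; [|symmetry]; apply: W.
  move=> e; have /ch0/eqP : (j - i)%:R = 0 :> K by rewrite natrB // e subrr.
  by rewrite subn_eq0 => le'; apply/eqP; rewrite eqn_leq le.
have ex t : exists s : seq nat, [/\ size s = t, uniq s & all (fun i => root q i%:R) s].
  elim: t => [|t [s [sz us al]]]; first by exists [::].
  have [i lt qi] := h (\max_(j <- s) j); exists (i :: s); rewrite /= sz us al /root qi eqxx; split=> //.
  rewrite andbT; apply: contraL lt => is_; rewrite -leqNgt.
  by rewrite (big_rem i) //= leq_maxl.
have [s [sz us al]] := ex (size q).
have := max_poly_roots q0 (_ : all (root q) [seq i%:R | i <- s]) _.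
rewrite size_map sz ltnn all_map => /(_ al); rewrite map_inj_uniq // us => /(_ isT).
exact.
Qed.

(* The powers of a unipotent matrix depend polynomially on the exponent. *)
Lemma unipotent_curve (a : M) n : iter n (mulmx a) 1%:M = 0 -> forall f : {mpoly K[N * N]},
  exists q : {poly K}, forall m, q.[m%:R] = f.@[fun i => mxvec (iter m (mulmx (1%:M + a)) 1%:M) 0 i].
Proof.
move=> an f.
(* Falling factorials; divided by the factorials, which characteristic 0 permits, they are the
   binomial polynomials of the expansion of (1 + a)^m. *)
pose ff i : {poly K} := \prod_(l < i) ('X - l%:R%:P).
have ffE i m : (ff i).[m%:R] = (m ^_ i)%:R.
  elim: i => [|i IH]; first by rewrite /ff big_ord0 hornerC.
  rewrite /ff big_ord_recr hornerM -/(ff i) IH /= hornerXsubC ffactnSr natrM.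
  have [le|lt] := leqP i m; first by rewrite natrB.
  by rewrite ffact_small // !mul0r.
have fac i : i`!%:R != 0 :> K by apply/eqP => /ch0 h; have := fact_gt0 i; rewrite h.
pose P i := i`!%:R^-1 *: ff i.
have PE i m : (P i).[m%:R] = 'C(m, i)%:R.
  by rewrite hornerZ ffE -bin_ffact mulnC natrM mulKf.
pose Cm : 'M[{poly K}]_N := \sum_(i < n) P i *: map_mx polyC (iter i (mulmx a) 1%:M).
have CE m : map_mx (fun q => q.[m%:R]) Cm = iter m (mulmx (1%:M + a)) 1%:M.
  have [ev evE] : exists ev : {rmorphism {poly K} -> K}, forall q, q.[m%:R] = ev q by exists (horner_eval m%:R).
  have -> : map_mx (fun q => q.[m%:R]) Cm = \sum_(i < n) 'C(m, i)%:R *: iter i (mulmx a) 1%:M.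
    apply/matrixP => x y; rewrite mxE !summxE evE rmorph_sum; apply: eq_bigr => i _.
    by rewrite -evE mxE hornerM PE mxE hornerC [RHS]mxE.
  elim: m {ev evE} => [|m IH].
    case: n an @Cm => [|n] an _; first by rewrite big_ord0 -an.
    by rewrite big_ord_recl bin0 scale1r big1 ?addr0 // => i _; rewrite bin0n scale0r.
  rewrite iterS -IH mulmxDl mul1mx mulmx_sumr.
  case: n an @Cm {IH} => [|n] an _.
    by rewrite !big_ord0 addr0.
  rewrite [in RHS]big_ord_recl [X in _ = _ + X]big_ord_recr /= -[a *m (_ *: iter n _ _)]scalemxAr.
  rewrite -[a *m iter n _ _]/(iter n.+1 (mulmx a) 1%:M) an scaler0 addr0 -addrA -big_split big_ord_recl /=.
  rewrite !bin0; congr (_ + _); apply: eq_bigr => i _.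
  by rewrite /bump /= add1n binS natrD scalerDl -scalemxAr.
have hm (v : 'I_(N * N) -> {poly K}) c : (mmap (@polyC K) v f).[c] = f.@[fun i => (v i).[c]].
  pose h : {rmorphism {mpoly K[N * N]} -> K} :=
    GRing.RMorphism.clone _ _ (horner_eval c \o mmap (@polyC K) v) _.
  apply: (@mpoly_hom_ext _ _ _ h (meval (fun i => (v i).[c]))) => [d|i] /=.
    by rewrite mmapC mevalC /horner_eval hornerC.
  by rewrite mmapX mmap1U mevalXU.
exists (mmap (@polyC K) (fun i => mxvec Cm 0 i) f) => m; rewrite hm; apply: meval_eq => i.
by rewrite -CE; case/mxvec_indexP: i => u v; rewrite !mxvecE mxE.
Qed.

Section UnipotentIdeal.
Variables (H A : M -> Prop).
Hypotheses (Hg : is_subgroup H) (Hc : zclosed H) (Hr : is_reductive H).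
Hypotheses (A0 : A 0) (AD : forall x y, A x -> A y -> A (x + y)) (AZ : forall c x, A x -> A (c *: x))
  (AM : forall x y, A x -> A y -> A (x *m y))
  (Anil : forall x, A x -> exists n, iter n (mulmx x) 1%:M = 0)
  (AH : forall g x, H g -> A x -> A (g *m x *m invmx g)).

(** [H] meets 1 + A in a closed normal unipotent subgroup. It is connected because the powers of
    each element lie on a polynomial curve through 1, so reductivity makes it trivial. *)
Lemma unipotent_ideal_trivial g : H g -> A (g - 1%:M) -> g = 1%:M.
Proof.
move=> hg ag; have [Hu H1 HM HV] := Hg.
pose U g := H g /\ A (g - 1%:M).
have [V hV] := subspace_vspace A0 AD AZ.
have AN x : A x -> A (- x) by rewrite -scaleN1r; apply: AZ.
have Ainv x : H x -> A (x - 1%:M) -> A (invmx x - 1%:M).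
  move=> hx ax; set a := x - 1%:M in ax; have xa : x = 1%:M + a by rewrite addrC subrK.
  have [n an] := Anil ax.
  (* [A] has no unit, so the geometric series for the inverse is built with its remainder: [c] is a
     scalar multiple of the power of [a] of exponent i+1. *)
  have ind i : exists b c, [/\ A b, A c, x *m (1%:M + b) = 1%:M + c &
      exists sgn, c = sgn *: iter i.+1 (mulmx a) 1%:M].
    elim: i => [|i [b [c [hb hc e [sgn ce]]]]].
      exists 0, a; split=> //; first by rewrite addr0 mulmx1.
      by exists 1; rewrite scale1r /= mulmx1.
    exists (b - c), (- (a *m c)); split.
    - exact: AD hb (AN _ hc).
    - exact/AN/AM.
    - rewrite addrA mulmxBr e xa mulmxDl mul1mx opprD addrA addrK.
      by [].
    - by exists (- sgn); rewrite ce -scalemxAr scaleNr.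
  have [b [c [hb _ e [sgn ce]]]] := ind n.
  have xb : x *m (1%:M + b) = 1%:M by rewrite e ce /= an mulmx0 scaler0 addr0.
  have -> : invmx x = 1%:M + b by rewrite -[LHS]mulmx1 -[in LHS]xb mulmxA mulVmx ?mul1mx ?Hu.
  by rewrite addrC addKr.
have Upow x m : U x -> U (iter m (mulmx x) 1%:M).
  move=> [hx ax]; elim: m => [|m [IH1 IH2]] /=; first by split; rewrite ?subrr.
  split; first exact: HM.
  set y := iter _ _ _ in IH1 IH2 *.
  have -> : x *m y - 1%:M = (x - 1%:M) *m (y - 1%:M) + (x - 1%:M) + (y - 1%:M).
    rewrite mulmxBr mulmx1 subrK mulmxBl mul1mx addrA subrK //.
  by apply: AD => //; apply: AD => //; apply: AM.
apply: (Hr (U := U)) => //.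
- split.
  + by move=> x [/Hu].
  + by split; rewrite ?subrr.
  + move=> x y [hx ax] [hy ay]; split; first exact: HM.
    have -> : x *m y - 1%:M = (x - 1%:M) *m (y - 1%:M) + (x - 1%:M) + (y - 1%:M).
      by rewrite mulmxBr mulmx1 subrK mulmxBl mul1mx addrA subrK.
    by apply: AD => //; apply: AD => //; apply: AM.
  + by move=> x [hx ax]; split; [apply: HV | apply: Ainv].
- have [E hE] := zclosedI Hc (vspace_zclosed V); exists E => x xu; split.
    by move=> [hx /hV ax]; apply/(hE _ xu).
  by move=> /(hE _ xu)[hx /hV].
- move=> Z1 Z2 c1 c2 cov dis.
  (* A closed set containing arbitrarily high powers of [x] contains all of them, by polynomiality
     of the powers. *)
  have all_ Z x : zclosed Z -> U x -> (forall n, exists2 i, (n < i)%N & Z (iter i (mulmx x) 1%:M)) ->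
      Z 1%:M /\ Z x.
    move=> [E hE] Ux hinf; have [n an] := Anil Ux.2.
    have key m : Z (iter m (mulmx x) 1%:M).
      apply/hE; first by have [/Hu] := Upow x m Ux.
      move=> f Ef; have [q qE] := unipotent_curve an f.
      have xE : 1%:M + (x - 1%:M) = x by rewrite addrC subrK.
      rewrite xE in qE; rewrite -qE (poly_nat_vanish (q := q)) ?horner0 // => i.
      have [l lt /hE h] := hinf i; exists l => //; rewrite qE; apply: h => //.
      by have [/Hu] := Upow x l Ux.
    by split; [apply: (key 0%N) | have := key 1%N; rewrite /= mulmx1].
  have one Z Z' : zclosed Z -> zclosed Z' -> (forall g, U g -> Z g \/ Z' g) ->
      (forall g, ~ [/\ U g, Z g & Z' g]) -> Z 1%:M -> forall x, U x -> Z x.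
    move=> cZ cZ' cov' dis' z1 x Ux.
    have [h|/existsNP[n hn]] := pselect (forall n, exists2 i, (n < i)%N & Z (iter i (mulmx x) 1%:M)).
      by have [] := all_ Z x cZ Ux h.
    have [|z'1 _] := all_ Z' x cZ' Ux.
      move=> n'; exists (maxn n n').+1; first by rewrite ltnS leq_maxr.
      have [h|//] := cov' _ (Upow x (maxn n n').+1 Ux); case: hn.
      by exists (maxn n n').+1; rewrite // ltnS leq_maxl.
    by case: (dis' 1%:M); split=> //; split; rewrite ?subrr.
  have U1 : U 1%:M by split; rewrite ?subrr.
  have [z1|z1] := cov _ U1; [left | right]; first exact: one c1 c2 cov dis z1.
  apply: (one Z2 Z1 c2 c1) => // [x /cov[]|x [h1 h2 h3]]; [by right | by left | exact: (dis x)].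
- split; first by move=> x [].
  move=> y x hy [hx ax]; split; first exact: HM _ _ (HM _ _ hy hx) (HV _ hy).
  have -> : y *m x *m invmx y - 1%:M = y *m (x - 1%:M) *m invmx y.
    by rewrite mulmxBr mulmxBl mulmx1 mulmxV ?Hu.
  exact: AH.
move=> x [_ /Anil[n an]].
have [l el] := closed_field_poly_normal (char_poly x).
rewrite (monicP (char_poly_monic x)) scale1r in el; rewrite el.
have sl : size l = N.
  by have := size_char_poly x; rewrite el size_prod_XsubC => -[].
(* On an eigenvector the nilpotent [x - 1] acts by [z - 1], which is therefore 0. *)
have l1 z : z \in l -> z = 1.
  move=> zl; have : root (char_poly x) z by rewrite el root_prod_XsubC.
  rewrite -eigenvalue_root_char => /eigenvalueP[v vx v0].
  have vn i : v *m iter i (mulmx (x - 1%:M)) 1%:M = (z - 1) ^+ i *: v.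
    elim: i => [|i IH]; first by rewrite mulmx1 scale1r.
    rewrite iterS mulmxA mulmxBr mulmx1 vx -[v in _ - v]scale1r -scalerBl -scalemxAl IH scalerA.
    by rewrite exprS.
  have /eqP := vn n; rewrite an mulmx0 eq_sym scaler_eq0 (negPf v0) orbF expf_eq0.
  by rewrite subr_eq0 => /andP[_ /eqP].
rewrite -[in RHS]sl; elim: l l1 {el sl} => [|z l IH] l1; first by rewrite big_nil.
rewrite big_cons IH => [|y yl]; last by apply: l1; rewrite inE yl orbT.
by rewrite (l1 z) ?mem_head // exprS.
Qed.
End UnipotentIdeal.
End GeometricGroups.

(** * The root group as a polynomial curve and its tangent vector *)

Section RootVector.
Variables (B : comNzRingType) (N : nat) (G T : lingroup B N) (alpha : lgchar T).
Variable x : root_subgroup G alpha.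
Hypothesis TG : lgsub T G.

Let cB : {rmorphism B -> {poly B}} := GRing.RMorphism.clone _ _ (@polyC B) _.
(** The value at the universal parameter of B[X]; by naturality every value of the parametrization
    is a specialization of this polynomial matrix. *)
Definition ru_gen : 'M[{poly B}]_N := ru_at x cB 'X.
Definition ru_coef i : 'M[B]_N := \matrix_(a, b) (ru_gen a b)`_i.
Definition ru_deg : nat := (\max_a \max_b size (ru_gen a b))%N.

Lemma ru_genE : ru_gen = \sum_(i < ru_deg) 'X^i *: map_mx cB (ru_coef i).
Proof.
apply/matrixP => a b; rewrite summxE.
have le : (size (ru_gen a b) <= ru_deg)%N.
  by apply: leq_trans (leq_bigmax a); apply: (leq_bigmax b).
rewrite -[LHS](coefK (ru_gen a b)) poly_def (big_ord_widen _ (fun i => (ru_gen a b)`_i *: 'X^i) le) big_mkcond.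
apply: eq_bigr => i _; rewrite !mxE /= mulrC mul_polyC; case: ltnP => // h.
by rewrite nth_default ?scale0r.
Qed.

Lemma ru_expand (A : comNzRingType) (s : {rmorphism B -> A}) u :
  ru_at x s u = \sum_(i < ru_deg) u ^+ i *: map_mx s (ru_coef i).
Proof.
have [h [fs hX]] : exists h : {rmorphism {poly B} -> A}, is_alg_hom cB s h /\ h 'X = u.
  exists (horner_morph (fun b => mulrC u (s b))); split; last exact: horner_morphX.
  by move=> b; rewrite /= horner_morphC.
rewrite -[in LHS]hX (ru_nat x 'X fs) -/ru_gen ru_genE map_mx_sum.
apply: eq_bigr => i _; apply/matrixP => a b; rewrite [RHS]mxE [X in _ = _ * X]mxE.
transitivity (h ('X^i * cB (ru_coef i a b))); first by rewrite [LHS]mxE; congr (h _); rewrite !mxE.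
by rewrite rmorphM rmorphXn hX fs.
Qed.

Lemma ru_zero (A : comNzRingType) (s : {rmorphism B -> A}) : ru_at x s 0 = 1%:M.
Proof.
have := ru_add x s 0 0; rewrite addr0 => e.
have [[h [gh hg]] _] := ru_pts x s 0.
by rewrite -gh {2}e -mulmxA gh mulmx1.
Qed.

(** The root vector e_alpha, derivative at 0 of the root group. *)
Definition root_vec := ru_coef 1.

Lemma ru_coef_big i : (ru_deg <= i)%N -> ru_coef i = 0.
Proof.
move=> le; apply/matrixP => a b; rewrite !mxE nth_default //.
apply: leq_trans le; apply: leq_trans (leq_bigmax a); exact: (leq_bigmax b).
Qed.

Lemma ru_expand_le (A : comNzRingType) (s : {rmorphism B -> A}) u n : (ru_deg <= n)%N ->
  ru_at x s u = \sum_(i < n) u ^+ i *: map_mx s (ru_coef i).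
Proof.
move=> le; rewrite ru_expand (big_ord_widen _ (fun i => u ^+ i *: map_mx s (ru_coef i)) le) big_mkcond.
by apply: eq_bigr => i _; case: ltnP => // /ru_coef_big ->; rewrite map_mx0 scaler0.
Qed.

Lemma ru_coef0 : ru_coef 0 = 1%:M.
Proof.
have := ru_zero (idfun : {rmorphism B -> B}); rewrite (ru_expand_le _ _ (leqnSn ru_deg)).
rewrite big_ord_recl expr0 scale1r big1 => [<-|i _]; last by rewrite expr0n scale0r.
by rewrite addr0; apply/matrixP => a b; rewrite [RHS]mxE.
Qed.

Lemma ru_small (A : comNzRingType) (s : {rmorphism B -> A}) w : w * w = 0 ->
  ru_at x s w = 1%:M + w *: map_mx s root_vec.
Proof.
move=> w2; rewrite (ru_expand_le _ _ (leq_trans (leqnSn _) (leqnSn _))).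
rewrite !big_ord_recl big1 ?addr0 => [|i _]; first by rewrite expr0 scale1r expr1 ru_coef0 map_mx1.
by rewrite !exprS mulrA w2 mul0r scale0r.
Qed.

Lemma ru_dual (A : comNzRingType) (s : {rmorphism B -> A}) (u v : A) :
  ru_at x (dual_str s) ((u, v) : dualnum A) =
  dual_mx (ru_at x s u) (v *: ru_at x s u *m map_mx s root_vec).
Proof.
have -> : ((u, v) : dualnum A) = ((u, 0) : dualnum A) + ((0, v) : dualnum A).
  by apply: injective_projections; rewrite /= ?addr0 ?add0r.
have ss : is_alg_hom s (dual_str s) (dual_str (idfun : {rmorphism A -> A})) by [].
rewrite ru_add (ru_nat x u ss) (@ru_small _ _ ((0, v) : dualnum A)); last first.
  by rewrite -[LHS]/(dual_mul _ _) /dual_mul /= !mul0r mulr0 addr0.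
have -> : map_mx (dual_str idfun) (ru_at x s u) = dual_mx (ru_at x s u) 0.
  by apply/matrixP => a b; rewrite !mxE.
have -> : 1%:M + ((0, v) : dualnum A) *: map_mx (dual_str s) root_vec = dual_mx 1%:M (v *: map_mx s root_vec).
  apply/matrixP => a b; rewrite !mxE; apply: injective_projections.
    by rewrite /= mul0r addr0; case: (a == b).
  by rewrite /= mul0r add0r; case: (a == b); rewrite /= add0r.
by rewrite dual_mxMM mulmx1 mul0mx addr0 -scalemxAr -scalemxAl.
Qed.

Lemma root_vec_lie (A : comNzRingType) (s : {rmorphism B -> A}) : lie G s (map_mx s root_vec).
Proof.
have := ru_pts x (dual_str s) ((0, 1) : dualnum A); rewrite ru_dual ru_zero scale1r mul1mx.
by [].
Qed.

Lemma root_vec_conj (A : comNzRingType) (s : {rmorphism B -> A}) t t' : pts T s t -> inverses t t' ->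
  t *m map_mx s root_vec *m t' = chr_at alpha s t *: map_mx s root_vec.
Proof.
move=> tT tt'; have ss : is_alg_hom s (dual_str s) (dual_str (idfun : {rmorphism A -> A})) by [].
have E h : map_mx (dual_str (idfun : {rmorphism A -> A})) h = dual_mx h 0.
  by apply/matrixP => a b; rewrite !mxE.
have ii : inverses (dual_mx t 0) (dual_mx t' 0).
  by split; rewrite dual_mxMM mulmx0 mul0mx addr0 ?tt'.1 ?tt'.2 dual_mx10.
have tT' : pts T (dual_str s) (dual_mx t 0) by rewrite -E; apply: pts_nat tT.
have := ru_conj x ((0, 1) : dualnum A) tT' ii; rewrite ru_dual ru_zero scale1r mul1mx.
have -> : chr_at alpha (dual_str s) (dual_mx t 0) = (chr_at alpha s t, 0) by rewrite -E (chr_nat alpha ss tT).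
have -> : ((chr_at alpha s t, 0) : dualnum A) * ((0, 1) : dualnum A) = ((0, chr_at alpha s t) : dualnum A).
  by rewrite -[LHS]/(dual_mul _ _) /dual_mul /= mulr0 mulr1 mul0r addr0.
rewrite ru_dual ru_zero !dual_mxMM ?mulmx0 ?mul0mx ?add0r ?addr0 ?mulmx1 => e.
apply/matrixP => a b; have := congr1 (fun M : 'M[dualnum A]_N => (M a b).2) e; rewrite !mxE /= => ->.
rewrite (bigD1 a) //= big1 ?addr0; first by rewrite !mxE eqxx mulr1.
by move=> i ne; rewrite !mxE eq_sym (negPf ne) mulr0 mul0r.
Qed.

(** Injectivity of the parametrization is applied over the dual numbers: if the derivative vanished,
    eps and 0 would have the same image. *)
Lemma root_vec_neq0 (A : comNzRingType) (s : {rmorphism B -> A}) : map_mx s root_vec <> 0.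
Proof.
move=> e; have : ru_at x (dual_str s) ((0, 1) : dualnum A) = ru_at x (dual_str s) 0.
  rewrite ru_dual ru_zero e mulmx0 dual_mx10; exact/esym/ru_zero.
by move/(@ru_inj _ _ _ _ _ x _ _) => /(congr1 snd) /eqP; rewrite oner_eq0.
Qed.

(* Derivative of [u(X + eps) = u(X) u(eps)]. *)
Lemma ru_coefS i : i.+1%:R *: ru_coef i.+1 = ru_coef i *m root_vec.
Proof.
have := ru_dual cB 'X 1; rewrite scale1r -/ru_gen => e.
have hX n : (('X, 1) : dualnum {poly B}) ^+ n = ('X^n, n%:R * 'X^(n.-1)).
  elim: n => [|n IH]; first by rewrite !expr0 mul0r.
  rewrite exprS IH; apply: injective_projections; rewrite /= ?exprS // mul1r.
  case: n {IH} => [|n] /=; first by rewrite expr0 mul0r mulr0 add0r mul1r.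
  by rewrite mulrCA -exprS -[n.+2]addn1 natrD mulrDl mul1r.
have e2 a b : \sum_(j < ru_deg) (j%:R * 'X^(j.-1)) * cB (ru_coef j a b) = (ru_gen *m map_mx cB root_vec) a b.
  have := congr1 (fun M : 'M[dualnum {poly B}]_N => (M a b).2) e; rewrite [in RHS]mxE /= => <-.
  rewrite ru_expand summxE dual_sum2; apply: eq_bigr => j _; rewrite !mxE hX /=.
  by rewrite mulr0 add0r.
apply/matrixP => a b; have := congr1 (fun q : {poly B} => q`_i) (e2 a b).
have -> : ((ru_gen *m map_mx cB root_vec) a b)`_i = (ru_coef i *m root_vec) a b.
  rewrite !mxE coef_sum; apply: eq_bigr => l _; by rewrite !mxE /= coefMC.
move=> <-; rewrite [LHS]mxE coef_sum.
have cE (j : nat) : ((j%:R * 'X^(j.-1) : {poly B}) * cB (ru_coef j a b))`_i =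
    (if j == i.+1 then j%:R else 0) * ru_coef j a b.
  rewrite /= coefMC -polyC_natr coefCM coefXn; congr (_ * _).
  case: j => [|j] /=; first by rewrite mul0r.
  by rewrite eqSS eq_sym; case: eqP; rewrite ?mulr1 ?mulr0.
rewrite (eq_bigr _ (fun (j : 'I_ru_deg) _ => cE j)).
have [lt|le] := ltnP i.+1 ru_deg.
  rewrite (bigD1 (Ordinal lt)) //= eqxx big1 ?addr0 // => j ne.
  by rewrite -(inj_eq val_inj) /= in ne; rewrite (negPf ne) mul0r.
rewrite ru_coef_big // mxE mulr0 big1 // => j _.
by rewrite ltn_eqF ?mul0r // (leq_trans (ltn_ord j)).
Qed.
End RootVector.

(** * The radical of the trace form in characteristic 0 *)

Section MultiplicityOne.
Variables (p : nat) (k : finFieldType) (W : comNzRingType) (res : {rmorphism W -> k}).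
Hypothesis hW : is_witt_ring p res.
Variables (N : nat) (G T : lingroup W N) (Gred : lg_reductive G) (TG : lgsub T G).
Variables (alpha : lgchar T) (x : root_subgroup G alpha).
Variables (r : nat) (chi : 'I_r -> lgchar T).
Hypothesis hchi : forall (A : comNzRingType) (s : {rmorphism W -> A}) (a : 'I_r -> A),
    (forall i, exists b, a i * b = 1) ->
    exists! t, pts T s t /\ forall i, chr_at (chi i) s t = a i.
Variables (C : nat) (m : 'I_r -> nat) (E : {ffun 'I_r -> 'I_C} -> 'M[W]_N).
Hypotheses (E1 : \sum_mu E mu = 1%:M) (EE : forall mu nu, E mu *m E nu = if mu == nu then E mu else 0)
  (TE : forall (A : comNzRingType) (s : {rmorphism W -> A}) t, pts T s t ->
       (\prod_j chr_at (chi j) s t ^+ m j) *: t =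
       \sum_mu coch_w (fun j => chr_at (chi j) s t) mu *: map_mx s (E mu)).
Hypothesis hz : forall X, lie G res X -> hw (sE E res) (fun _ => 0) X -> lie T res X.
Local Notation zero_wt := (fun _ : 'I_r => 0 : int).
Local Notation id_W := (idfun : {rmorphism W -> W}).

Lemma lieT_G (A : comNzRingType) (s : {rmorphism W -> A}) X : lie T s X -> lie G s X.
Proof. exact: TG. Qed.

Lemma lie_diag_lie (A : comNzRingType) (s : {rmorphism W -> A}) y : lie G s (lie_diag m E s y).
Proof. by apply: lieT_G; apply/(lie_torusP hchi E1 TE); exists y. Qed.

(** Over [k] the weight 0 part of [Lie G] is [Lie T] by hypothesis. Lifting coordinates leaves a
    multiple of [p], and since [W] has no [p]-torsion the quotient still satisfies the linear
    equations; the next lemma iterates this to the [p]-adic limit. *)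
Lemma lie_zero_step Z : lie G id_W Z -> hw (sE E id_W) zero_wt Z ->
  exists y Z', [/\ Z = lie_diag m E id_W y + p%:R *: Z', lie G id_W Z' & hw (sE E id_W) zero_wt Z'].
Proof.
move=> hZ h0; have rs : is_alg_hom id_W res res by [].
have h1 : lie G res (map_mx res Z) by apply: lie_nat hZ.
have h2 : hw (sE E res) zero_wt (map_mx res Z).
  move=> mu nu nz; apply: h0 => e; apply: nz.
  have : map_mx res (sE E id_W mu *m Z *m sE E id_W nu) = 0 by rewrite e map_mx0.
  by rewrite !map_mxM /sE -!map_mx_comp.
have [yb yE] := (lie_torusP hchi E1 TE res _).1 (hz h1 h2).
pose y i := sval (cid (witt_surj hW (yb i))); have ye i : res (y i) = yb i := svalP (cid (witt_surj hW (yb i))).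
have hd a b : exists z, (Z - lie_diag m E id_W y) a b = p%:R * z.
  have /(witt_res0 hW)[z ->] : res ((Z - lie_diag m E id_W y) a b) = 0; last by exists z; rewrite expn1.
  have : map_mx res (Z - lie_diag m E id_W y) = 0.
    rewrite map_mxB yE map_mx_sum -sumrB big1 // => mu _.
    rewrite map_mxZ /sE -map_mx_comp rmorph_sum; apply/eqP; rewrite subr_eq0; apply/eqP; congr (_ *: _).
    by apply: eq_bigr => i _; rewrite rmorphM rmorphB !rmorph_nat ye.
  by move=> /(congr1 (fun M : 'M_N => M a b)); rewrite mxE => ->; rewrite mxE.
pose Z' : 'M[W]_N := \matrix_(a, b) sval (cid (hd a b)).
have Z'E : Z - lie_diag m E id_W y = p%:R *: Z'.
  by apply/matrixP => a b; rewrite [RHS]mxE [Z' a b]mxE; apply: (svalP (cid (hd a b))).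
have tors (w : W) : p%:R * w = 0 -> w = 0.
  by move=> h; apply: (@witt_ptorsion _ _ _ _ hW 1); rewrite expn1.
exists y, Z'; split.
- by rewrite -Z'E addrC subrK.
- have /lieP h : lie G id_W (p%:R *: Z') by rewrite -Z'E; apply: lieB hZ (lie_diag_lie _ _).
  apply/lieP => q qG; apply: tors; rewrite -[RHS](h q qG) mulr_sumr; apply: eq_bigr => i _.
  by rewrite linearZ mxE mulrA.
have h3 : hw (sE E id_W) zero_wt (p%:R *: Z').
  rewrite -Z'E; apply: (hwD h0); rewrite -scaleN1r; apply: hwZ; exact: lie_diag_hw.
move=> mu nu nz; apply: h3; rewrite -scalemxAr -scalemxAl => e; apply: nz.
apply/matrixP => a b; rewrite [RHS]mxE; apply: tors.
by have := congr1 (fun M : 'M_N => M a b) e; rewrite [X in X = _ -> _]mxE [X in _ = X -> _]mxE.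
Qed.

Lemma lie_zero_W Z : lie G id_W Z -> hw (sE E id_W) zero_wt Z -> exists y, Z = lie_diag m E id_W y.
Proof.
move=> hZ h0; pose ok Z := lie G id_W Z /\ hw (sE E id_W) zero_wt Z.
have [f fP] : exists f : 'M[W]_N -> ('I_r -> W) * 'M[W]_N, forall Z, ok Z ->
    Z = lie_diag m E id_W (f Z).1 + p%:R *: (f Z).2 /\ ok (f Z).2.
  have ex Z0 : exists u : ('I_r -> W) * 'M[W]_N, ok Z0 -> Z0 = lie_diag m E id_W u.1 + p%:R *: u.2 /\ ok u.2.
    have [[h1 h2]|no] := pselect (ok Z0); last by exists (fun _ => 0, 0).
    by have [y [Z' [e h3 h4]]] := lie_zero_step h1 h2; exists (y, Z').
  by exists (fun Z0 => sval (cid (ex Z0))) => Z0; apply: (svalP (cid (ex Z0))).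
pose Zn n := iter n (fun Z => (f Z).2) Z.
have okn n : ok (Zn n) by elim: n => [|n IH] //; have [_] := fP _ IH.
pose yn n i := \sum_(l < n) (p ^ l)%:R * (f (Zn l)).1 i.
have diagD y y' : lie_diag m E id_W (fun i => y i + y' i) = lie_diag m E id_W y + lie_diag m E id_W y'.
  rewrite -big_split; apply: eq_bigr => mu _ /=; rewrite -scalerDl; congr (_ *: _).
  by rewrite -big_split; apply: eq_bigr => i _ /=; rewrite mulrDr.
have diagZ c y : lie_diag m E id_W (fun i => c * y i) = c *: lie_diag m E id_W y.
  rewrite scaler_sumr; apply: eq_bigr => mu _; rewrite scalerA; congr (_ *: _).
  by rewrite mulr_sumr; apply: eq_bigr => i _; rewrite mulrCA.
have Ze n : Z = lie_diag m E id_W (yn n) + (p ^ n)%:R *: Zn n.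
  elim: n => [|n IH].
    have -> : lie_diag m E id_W (yn 0%N) = 0.
      rewrite /lie_diag big1 // => mu _; rewrite big1 ?scale0r // => i _.
      by rewrite /yn big_ord0 mulr0.
    by rewrite add0r scale1r.
  have [e _] := fP _ (okn n); rewrite {1}IH {1}e scalerDr scalerA addrA -natrM -expnSr; congr (_ + _).
  rewrite -diagZ -diagD; congr (lie_diag _ _ _ _); apply: functional_extensionality_dep => i.
  by rewrite /yn big_ord_recr.
have lim i : exists l, forall n, pdiv_pow p n (l - yn n i).
  apply: (witt_lim hW) => n; rewrite /yn big_ord_recr /= (addrC (\sum_(l < n) _)) addrK.
  by exists ((f (Zn n)).1 i).
pose y i := sval (cid (lim i)); have yP i n : pdiv_pow p n (y i - yn n i) := svalP (cid (lim i)) n.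
exists y; apply/matrixP => a b; apply/eqP; rewrite -subr_eq0; apply/eqP/(witt_sep hW) => n.
rewrite {1}(Ze n) [X in X - _]mxE addrAC; apply: pdiv_powD; last by rewrite mxE; exists (Zn n a b).
rewrite /lie_diag !summxE -sumrB; apply: (big_ind (pdiv_pow p n)).
- exact: pdiv_pow_0.
- by move=> u v; apply: pdiv_powD.
move=> mu _; rewrite [X in X - _]mxE [X in _ - X]mxE -mulrBl mulrC; apply: pdiv_powMl.
rewrite -sumrB; apply: (big_ind (pdiv_pow p n)).
- exact: pdiv_pow_0.
- by move=> u v; apply: pdiv_powD.
by move=> i _; rewrite -mulrBr; apply: pdiv_powMl; rewrite -opprB; apply: pdiv_powN.
Qed.

Section Field.
Variables (K : closedFieldType) (j : {rmorphism W -> K}) (jI : injective j).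
Local Notation EK := (sE E j).
Local Notation e := (map_mx j (root_vec x)).
Let EK1 := sE1 E1 j.
Let EKK := sEE EE j.

Lemma ch0 n : n%:R = 0 :> K -> n = 0%N.
Proof. by rewrite -(rmorph_nat j) -(rmorph0 j) => /jI/(witt_nat hW). Qed.
Lemma ch0i : injective (intr : int -> K).
Proof.
move=> a b h; apply/eqP; rewrite -subr_eq0 -absz_eq0; apply/eqP/ch0.
have : (a - b)%:~R = 0 :> K by rewrite rmorphB /= h subrr.
by case: (a - b) => // n /eqP; rewrite NegzE rmorphN oppr_eq0 => /eqP.
Qed.

(** The entries of [Z] are expanded along elements independent over [W]; the equations have
    coefficients in [W], so each coordinate matrix satisfies them. *)
Lemma lie_span Z : lie G j Z -> exists n (c : 'I_n -> K) (Zi : 'I_n -> 'M[W]_N),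
  (forall i, lie G id_W (Zi i)) /\ Z = \sum_i c i *: map_mx j (Zi i).
Proof.
move=> /lieP hZ; pose l := [seq mxvec Z 0 i | i <- enum 'I_(N * N)].
have [es [d [b [d0 h1 h2]]]] := domain_span l jI.
have dK : j d != 0 by apply/eqP => h; apply: d0; apply: jI; rewrite rmorph0.
have ZE i : j d * mxvec Z 0 i = \sum_(u < size es) es`_u * j (b i u).
  have := h1 i; rewrite size_map size_enum_ord => /(_ (ltn_ord i)) <-.
  by rewrite (nth_map i) ?size_enum_ord // nth_ord_enum.
pose Zi (u : 'I_(size es)) : 'M[W]_N := vec_mx (\row_i b i u).
exists (size es), (fun u => (j d)^-1 * es`_u), Zi; split.
  move=> u; apply/lieP => q qG.
  pose f v := \sum_(i < N * N) b i v * lie_coef q i.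
  have hs : \sum_(v < size es) es`_v * j (f v) = 0.
    transitivity (j d * \sum_i mxvec Z 0 i * j (lie_coef q i)); last by rewrite hZ ?mulr0.
    under eq_bigr do rewrite rmorph_sum mulr_sumr.
    rewrite exchange_big mulr_sumr; apply: eq_bigr => i _; rewrite mulrA ZE mulr_suml.
    by apply: eq_bigr => v _; rewrite rmorphM mulrA.
  rewrite -[RHS](h2 f hs u (ltn_ord u)).
  by apply: eq_bigr => i _; rewrite vec_mxK mxE.
apply/matrixP => u v; rewrite -mxvecE -[LHS](mulKf dK) ZE mulr_sumr summxE; apply: eq_bigr => w _.
by rewrite !mxE mulrA.
Qed.

Lemma wprojK b Z : map_mx j (wproj (sE E id_W) b Z) = wproj EK b (map_mx j Z).
Proof.
rewrite wproj_nat; congr (wproj _ _ _); apply: functional_extensionality_dep => mu.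
by rewrite /sE -map_mx_comp.
Qed.

Lemma lie_zero_K Z : lie G j Z -> hw EK zero_wt Z -> exists y, Z = lie_diag m E j y.
Proof.
move=> /lie_span[n [c [Zi [hZi ZE]]]] h0.
(* With no weight index at all the sum of projectors gives 1 = 0, and every matrix vanishes;
   otherwise [grading_wt mu mu] encodes the weight 0. *)
have [[mu _]|noI] := pselect (exists mu : {ffun 'I_r -> 'I_C}, True); last first.
  have z0 (Y : 'M[K]_N) : Y = 0 by apply: (grading_eq0 EK1) => mu; case: noI; exists mu.
  by exists (fun _ => 0); rewrite (z0 Z) [RHS]z0.
pose b0 := grading_wt mu mu.
have w0 i : wt_int b0 i = 0 by have /grading_wtE/(_ i) := erefl b0; rewrite subrr => <-.
have hY i : exists y, wproj (sE E id_W) b0 (Zi i) = lie_diag m E id_W y.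
  apply: lie_zero_W; first by apply: (lie_wproj hchi TE b0 TG (hZi i)).
  exact: (hw_eq (wproj_hw (sEE EE id_W) (b := b0) (Z := Zi i)) w0).
pose y i := sval (cid (hY i)); have yE i := svalP (cid (hY i)) : wproj _ b0 (Zi i) = lie_diag m E id_W (y i).
exists (fun l => \sum_i c i * j (y i l)).
have hb : hw EK (wt_int b0) Z by apply: (hw_eq h0) => i; rewrite w0.
rewrite -[LHS](wproj_id EK1 EKK hb) ZE wproj_bigsum.
have dE i : map_mx j (lie_diag m E id_W (y i)) = lie_diag m E j (fun l => j (y i l)).
  rewrite map_mx_sum; apply: eq_bigr => nu _; rewrite map_mxZ /sE -map_mx_comp; congr (_ *: _).
  by rewrite rmorph_sum; apply: eq_bigr => l _; rewrite rmorphM rmorphB !rmorph_nat.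
under eq_bigr do rewrite wprojZ -wprojK yE dE /lie_diag scaler_sumr.
rewrite exchange_big; apply: eq_bigr => nu _; under eq_bigr do rewrite scalerA.
rewrite -scaler_suml; congr (_ *: _); under eq_bigr do rewrite mulr_sumr.
rewrite exchange_big; apply: eq_bigr => l _; rewrite mulr_sumr; apply: eq_bigr => i _.
by rewrite mulrCA.
Qed.

Definition wt_mult (mu : {ffun 'I_r -> 'I_C}) : nat := \rank (EK mu).
Definition wt_lin (mu : {ffun 'I_r -> 'I_C}) l : int := (mu l)%:Z - (m l)%:Z.

Lemma lie_diagE y : lie_diag m E j y = \sum_mu pairing wt_lin mu y *: EK mu.
Proof.
apply: eq_bigr => mu _; congr (_ *: _); apply: eq_bigr => l _.
by rewrite /wt_lin intrB -!pmulrn.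
Qed.

(** Traces of the weight projectors are their ranks, so on [Lie T] the trace form is the integral
    form [wform] and positivity applies. *)
Lemma diag_trace y z : \tr (lie_diag m E j y *m lie_diag m E j z) = wform wt_mult wt_lin y z.
Proof.
rewrite !lie_diagE mulmx_suml raddf_sum; apply: eq_bigr => mu _ /=.
rewrite mulmx_sumr raddf_sum (bigD1 mu) //= big1 ?addr0 => [|nu ne].
  rewrite -scalemxAl -scalemxAr EKK eqxx !mxtraceZ idempotent_trace ?EKK ?eqxx //.
  by rewrite -/(wt_mult mu); ring.
by rewrite -scalemxAl -scalemxAr EKK eq_sym (negPf ne) !scaler0 mxtrace0.
Qed.

Lemma diag_nondeg y : (forall z, \tr (lie_diag m E j y *m lie_diag m E j z) = 0) -> lie_diag m E j y = 0.
Proof.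
move=> h; rewrite lie_diagE big1 // => mu _.
have [/eqP|nz] := eqVneq (wt_mult mu) 0%N; first by rewrite mxrank_eq0 => /eqP ->; rewrite scaler0.
rewrite (wform_nondeg ch0i (w := wt_mult) (l := wt_lin)) ?scale0r // => [z|]; last exact/eqP.
by rewrite -diag_trace.
Qed.

Lemma diag_bracket b Z y : hw EK b Z ->
  lie_diag m E j y *m Z - Z *m lie_diag m E j y = (\sum_l (b l)%:~R * y l) *: Z.
Proof.
move=> hZ; apply/eqP; rewrite -subr_eq0; apply/eqP/(grading_eq0 EK1) => mu nu.
have dl : EK mu *m lie_diag m E j y = pairing wt_lin mu y *: EK mu.
  rewrite lie_diagE mulmx_sumr (bigD1 mu) //= big1 ?addr0 => [|l ne].
    by rewrite -scalemxAr EKK eqxx.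
  by rewrite -scalemxAr EKK eq_sym (negPf ne) scaler0.
have dr : lie_diag m E j y *m EK nu = pairing wt_lin nu y *: EK nu.
  rewrite lie_diagE mulmx_suml (bigD1 nu) //= big1 ?addr0 => [|l ne].
    by rewrite -scalemxAl EKK eqxx.
  by rewrite -scalemxAl EKK (negPf ne) scaler0.
have -> : EK mu *m (lie_diag m E j y *m Z - Z *m lie_diag m E j y - (\sum_l (b l)%:~R * y l) *: Z) *m EK nu =
   (pairing wt_lin mu y - pairing wt_lin nu y - \sum_l (b l)%:~R * y l) *: (EK mu *m Z *m EK nu).
  rewrite !mulmxBr !mulmxBl !mulmxA dl -!scalemxAl -(mulmxA (EK mu *m Z) (lie_diag m E j y)) dr -!scalemxAr -!scalemxAl.
  by rewrite !scalerBl.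
have [->|nz] := pselect (EK mu *m Z *m EK nu = 0); first by rewrite scaler0.
rewrite (_ : _ - _ = 0) ?scale0r //; apply/eqP; rewrite subr_eq0; apply/eqP.
rewrite -sumrB; apply: eq_bigr => l _; rewrite -mulrBl -intrB; congr (_%:~R * _).
by rewrite /wt_lin -(hZ _ _ nz) opprB addrA subrK.
Qed.

Definition rad Y := lie G j Y /\ forall Z, lie G j Z -> \tr (Y *m Z) = 0.

Lemma rad_zero Y : rad Y -> hw EK zero_wt Y -> Y = 0.
Proof.
move=> [hY hr] h0; have [y ye] := lie_zero_K hY h0; rewrite ye; apply: diag_nondeg => z.
by rewrite -ye; apply: hr; apply: lie_diag_lie.
Qed.

Lemma rad_bracket Y Z : rad Y -> rad Z -> rad (Y *m Z - Z *m Y).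
Proof.
move=> [hY hr] [hZ _]; split; first exact: lie_bracket.
move=> V hV; have := hr _ (lie_bracket hZ hV).
move=> <-; rewrite mulmxBr mulmxBl !raddfB /= !mulmxA; congr (_ - _).
by rewrite [RHS]mxtrace_mulC mulmxA.
Qed.

Lemma trace_wproj d c Y Z : (exists l, wt_int d l + wt_int c l <> 0) -> \tr (wproj EK d Y *m wproj EK c Z) = 0.
Proof.
move=> [l nz]; apply: (hw_trace EK1 EKK (j := l)
  (hwM EK1 EKK (wproj_hw EKK (b := d) (Z := Y)) (wproj_hw EKK (b := c) (Z := Z)))).
exact: nz.
Qed.

Lemma rad_wproj d Y : rad Y -> rad (wproj EK d Y).
Proof.
move=> [hY hr]; split; first exact: (lie_wproj hchi TE d TG hY).
move=> Z hZ; rewrite -(wproj_sum EK1 Z) mulmx_sumr raddf_sum; apply: big1 => c _ /=.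
have [op|] := pselect (exists l, wt_int d l + wt_int c l <> 0); first exact: trace_wproj.
move=> nop; have := hr _ (lie_wproj hchi TE c TG hZ).
rewrite -{1}(wproj_sum EK1 Y) mulmx_suml raddf_sum (bigD1 d) //= big1 ?addr0 // => d' ne.
apply: trace_wproj; apply: contrapT => nop'; case/eqP: ne; apply/ffunP => l; apply: val_inj.
have h1 : wt_int d l + wt_int c l = 0 by apply: contrapT => h; apply: nop; exists l.
have h2 : wt_int d' l + wt_int c l = 0 by apply: contrapT => h; apply: nop'; exists l.
by have := h1; rewrite -h2 => /addIr/addIr[].
Qed.

Lemma rad_conj g Y : pts G j g -> rad Y -> rad (g *m Y *m invmx g).
Proof.
move=> gG [hY hr]; have [gu _ _ _] := pts_subgroup G j; have gg := unitmx_inverses (gu _ gG).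
have gg' : inverses (invmx g) g by case: gg.
split; first exact: lie_ad gG gg hY.
move=> Z hZ; rewrite -[RHS](hr _ (lie_ad (lg_inv gG gg) gg' hZ)).
by rewrite -!mulmxA [LHS]mxtrace_mulC -!mulmxA.
Qed.

(** The associative algebra without unit generated by the radical of the trace form. *)
Inductive rad_alg : 'M[K]_N -> Prop :=
| ra_in Y of rad Y : rad_alg Y
| ra_0 : rad_alg 0
| ra_D Y Z of rad_alg Y & rad_alg Z : rad_alg (Y + Z)
| ra_Z c Y of rad_alg Y : rad_alg (c *: Y)
| ra_M Y Z of rad_alg Y & rad_alg Z : rad_alg (Y *m Z).

(** The members of the radical of nonzero weight are nilpotent and weakly closed, and its weight 0
    part is 0 because the trace form is nondegenerate on [Lie T]. Jacobson's theorem thus bounds the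
    length of nonzero words in the radical. *)
Lemma rad_alg_nil Y : rad_alg Y -> exists n, iter n (mulmx Y) 1%:M = 0.
Proof.
pose S Z := rad Z /\ exists b, hw EK b Z /\ exists l, b l <> 0.
have rad0 : rad 0 by split=> [|Z _]; [exact: lie0 | rewrite mul0mx mxtrace0].
have [|A B [hA [b [hb [l bl]]]] [hB [c [hc [l' cl]]]]|V [n [_ SV hn]]] := @weakly_closed_nilpotent _ _ S.
- by move=> A [_ [b [hb [l bl]]]]; exists C; apply: (hw_nil EK1 EKK hb bl).
- split; first exact: rad_bracket.
  (* A bracket of total weight 0 lies in the zero weight part of the radical, so it is 0 and counts
     as homogeneous of the nonzero weight [b]. *)
  have [[l'' nz]|z] := pselect (exists l, b l + c l <> 0).
    by exists (fun l => b l + c l); split; [exact: hw_bracket | exists l''].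
  exists b; split; last by exists l.
  rewrite (rad_zero (rad_bracket hA hB)); first exact: hw0.
  apply: (hw_eq (hw_bracket EK1 EKK hb hc)) => i; apply: contrapT => nz; apply: z; by exists i.
have rV Z : rad Z -> Z \in V.
  move=> hZ; rewrite -(wproj_sum EK1 Z); apply: rpred_sum => d _.
  have hd := rad_wproj d hZ; have hwd : hw EK (wt_int d) (wproj EK d Z) := wproj_hw EKK (b := d) (Z := Z).
  have [[l nz]|z] := pselect (exists l, wt_int d l <> 0).
    by apply: SV; split=> //; exists (wt_int d); split=> //; exists l.
  rewrite (rad_zero hd) ?mem0v //; apply: (hw_eq hwd) => i.
  by apply: contrapT => nz; apply: z; exists i.
have key Z : rad_alg Z -> forall i X, ann V i.+1 X -> ann V i (Z *m X).
  elim=> [{}Z hZ|  |{}Z Z' _ h1 _ h2|c {}Z _ h1|{}Z Z' _ h1 _ h2] i X hX.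
  - by apply: hX; apply: rV.
  - by rewrite mul0mx; apply: ann0.
  - by rewrite mulmxDl; apply: annD; [apply: h1 | apply: h2].
  - by rewrite -scalemxAl; apply/annZ/h1.
  - by rewrite -mulmxA; apply: h1; apply: annS; apply: h2.
move=> /key hY; exists n.
have : forall i, (i <= n)%N -> ann V (n - i) (iter i (mulmx Y) 1%:M).
  elim=> [_|i IH lt]; first by rewrite subn0.
  by apply: hY; rewrite -subSn // subSS; apply: IH; apply: ltnW.
by move=> /(_ n (leqnn n)); rewrite subnn.
Qed.

(* Otherwise the algebra generated by the radical of the trace form cuts out a connected
   normal unipotent subgroup containing the root group. *)
Lemma root_vec_not_rad : ~ rad e.
Proof.
move=> he; have [_ hred] := Gred; have [_ Kred] := hred K j.
have conj g Y : pts G j g -> rad_alg Y -> rad_alg (g *m Y *m invmx g).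
  move=> gG; have [gu _ _ _] := pts_subgroup G j; have [gg1 gg2] := unitmx_inverses (gu _ gG).
  elim=> [{}Y hY|  |{}Y Z _ h1 _ h2|c {}Y _ h1|{}Y Z _ h1 _ h2].
  - exact/ra_in/rad_conj.
  - by rewrite mulmx0 mul0mx; apply: ra_0.
  - by rewrite mulmxDr mulmxDl; apply: ra_D.
  - by rewrite -scalemxAr -scalemxAl; apply: ra_Z.
  - have -> : g *m (Y *m Z) *m invmx g = (g *m Y *m invmx g) *m (g *m Z *m invmx g).
      by rewrite !mulmxA -(mulmxA (g *m Y) (invmx g) g) gg2 mulmx1.
    exact: ra_M.
(* By [ru_coefS] the Taylor coefficients of the root group are the divided powers of [e], so they
   stay in the algebra generated by [e]. *)
have coef i : rad_alg (map_mx j (ru_coef x i.+1)).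
  elim: i => [|i IH]; first exact: ra_in.
  have nz : i.+2%:R != 0 :> K by apply/eqP => /ch0.
  have := congr1 (map_mx j) (ru_coefS x i.+1); rewrite map_mxZ rmorph_nat map_mxM => h.
  have -> : map_mx j (ru_coef x i.+2) = i.+2%:R^-1 *: (map_mx j (ru_coef x i.+1) *m e).
    by rewrite -h scalerA mulVf ?scale1r.
  by apply: ra_Z; apply: ra_M => //; apply: ra_in.
have g1 : ru_at x j 1 = 1%:M.
  apply: (unipotent_ideal_trivial ch0 (pts_subgroup G j) (pts_zclosed G j) Kred ra_0 ra_D ra_Z ra_M rad_alg_nil conj).
    exact: ru_pts.
  rewrite (ru_expand_le _ _ (leqnSn _)) big_ord_recl expr0 scale1r ru_coef0 map_mx1 addrC addKr.
  by apply: (big_ind rad_alg) => [||i _]; [exact: ra_0 | exact: ra_D | apply/ra_Z/coef].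
have := ru_zero x j; rewrite -g1 => /(@ru_inj _ _ _ _ _ x _ j)/eqP.
by rewrite eq_sym oner_eq0.
Qed.
End Field.
End MultiplicityOne.

(** * Multiplicity one of the root and eigenspaces of Frobenius *)

Section RootSpaces.
Variables (p : nat) (k : finFieldType) (W : comNzRingType) (res : {rmorphism W -> k}).
Hypothesis hW : is_witt_ring p res.
Variables (N : nat) (G T : lingroup W N) (Gred : lg_reductive G) (TG : lgsub T G).
Variables (alpha : lgchar T) (x : root_subgroup G alpha).
Variables (r : nat) (chi : 'I_r -> lgchar T).
Hypothesis hchi : forall (A : comNzRingType) (s : {rmorphism W -> A}) (a : 'I_r -> A),
    (forall i, exists b, a i * b = 1) ->
    exists! t, pts T s t /\ forall i, chr_at (chi i) s t = a i.
Variables (C : nat) (m : 'I_r -> nat) (E : {ffun 'I_r -> 'I_C} -> 'M[W]_N).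
Hypotheses (E1 : \sum_mu E mu = 1%:M) (EE : forall mu nu, E mu *m E nu = if mu == nu then E mu else 0)
  (TE : forall (A : comNzRingType) (s : {rmorphism W -> A}) t, pts T s t ->
       (\prod_j chr_at (chi j) s t ^+ m j) *: t =
       \sum_mu coch_w (fun j => chr_at (chi j) s t) mu *: map_mx s (E mu)).
Hypothesis hz : forall X, lie G res X -> hw (sE E res) (fun _ => 0) X -> lie T res X.
Local Notation zero_wt := (fun _ : 'I_r => 0 : int).
Local Notation id_W := (idfun : {rmorphism W -> W}).

(** Smoothness is applied to the square-zero surjections from W[eps]/(p^(n+1)) to W[eps]/(p^(n+1),
    p^n eps). The lifted point is again of the form 1 + eps X', and the successive X' converge
    [p]-adically to a solution over [W]. *)
Lemma lie_lift Z : lie G res Z -> exists X, lie G id_W X /\ map_mx res X = Z.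
Proof.
move=> /lieP hZ; have [Gsm _] := Gred.
pose l q (X : 'M[W]_N) := \sum_i mxvec X 0 i * lie_coef q i.
(* An ideal only for b <= a, since multiplication by eps moves the first component into the
   second. *)
pose I a b (u : dualnum W) := pdiv_pow p a u.1 /\ pdiv_pow p b u.2.
have II a b : (b <= a)%N -> is_ideal (I a b).
  move=> le; split=> [|u v [h1 h2] [h3 h4]|c u [h1 h2]]; first by split; apply: pdiv_pow_0.
    by split; apply: pdiv_powD.
  split=> /=; first exact: pdiv_powMl.
  by apply: pdiv_powD; [apply: pdiv_powMl | apply/pdiv_powMl/(pdiv_pow_le le)].
have I1 a b : (0 < a)%N -> ~ I a b 1.
  by move=> a0 [/(pdiv_pow_le a0)/(witt_res0 hW)/eqP]; rewrite rmorph1 oner_eq0.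
have ptsI a b (A : comNzRingType) (pr : {rmorphism dualnum W -> A}) X :
    (forall u, pr u = 0 <-> I a b u) ->
    pts G (pr \o dual_str id_W : {rmorphism W -> A}) (map_mx pr (dual_mx 1%:M X)) <->
    forall q, q \in lg_eqs G -> pdiv_pow p b (l q X).
  move=> prI; have E0 q : q \in lg_eqs G -> pev (pr \o dual_str id_W : {rmorphism W -> A}) (map_mx pr (dual_mx 1%:M X)) q
      = pr (0, l q X).
    by move=> qG; rewrite (@pev_nat _ _ _ _ (dual_str id_W)) // pev_dual (pev1 id_W qG) dpev1.
  split=> [[_ h] q qG|h].
    by have /prI[] : pr (0, l q X) = 0 by rewrite -E0 //; apply: h.
  split=> [|q qG]; last by rewrite -[LHS]/(pev _ _ _) E0 //; apply/prI; split; [apply: pdiv_pow_0 | apply: h].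
  exists (map_mx pr (dual_mx 1%:M (- X))).
  by split; rewrite -map_mxM dual_mxMM !mul1mx !mulmx1 ?addNr ?subrr dual_mx10 map_mx1.
have step n (X : 'M[W]_N) : (0 < n)%N -> (forall q, q \in lg_eqs G -> pdiv_pow p n (l q X)) ->
    exists X' : 'M[W]_N, (forall a b, pdiv_pow p n (X' a b - X a b)) /\
      forall q, q \in lg_eqs G -> pdiv_pow p n.+1 (l q X').
  move=> n0 hX.
  have [A [pr [prs prI]]] := quotient_ring (II n.+1 n.+1 (leqnn _)) (I1 n.+1 n.+1 isT).
  have [A' [pr' [prs' prI']]] := quotient_ring (II n.+1 n (leqnSn _)) (I1 n.+1 n isT).
  have [|f fE] := @factor_rmorphism _ _ _ pr pr' prs.
    by move=> u /prI[h1 h2]; apply/prI'; split=> //; apply: (pdiv_pow_le (leqnSn n)).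
  have [||x0 y h1 h2|g gG fg] := Gsm _ _ (pr \o dual_str id_W : {rmorphism W -> A}) (pr' \o dual_str id_W : {rmorphism W -> A'}) f _ _ _ _ ((ptsI _ _ _ _ _ prI').2 hX).
  - by move=> w; rewrite /= fE.
  - by move=> y; have [u <-] := prs' y; exists (pr u); rewrite fE.
  - move: h1 h2; have [u <-] := prs x0; have [v <-] := prs y; rewrite !fE => /prI'[u1 u2] /prI'[v1 v2].
    rewrite -rmorphM; apply/prI; split=> /=.
      by apply: pdiv_powMl.
    apply: pdiv_powD; last by apply: pdiv_powMl.
    by rewrite mulrC; apply: pdiv_powMl.
  pose u a b := sval (cid (prs (g a b))); have uE a b : pr (u a b) = g a b := svalP (cid (prs (g a b))).
  have hu a b : I n.+1 n (u a b - dual_mx 1%:M X a b).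
    apply/prI'; rewrite rmorphB -fE uE; have := congr1 (fun M : 'M_N => M a b) fg; rewrite !mxE => ->.
    by rewrite subrr.
  pose X' : 'M[W]_N := \matrix_(a, b) (u a b).2.
  exists X'; split=> [a b|]; first by have [_] := hu a b; rewrite !mxE.
  apply/(ptsI _ _ _ _ _ prI); rewrite (_ : map_mx _ _ = g) //.
  apply/matrixP => a b; rewrite mxE -uE; apply/eqP; rewrite -subr_eq0 -rmorphB; apply/eqP/prI.
  have [h _] := hu a b; split; last by rewrite !mxE /= subrr; apply: pdiv_pow_0.
  by rewrite -opprB; apply: pdiv_powN; move: h; rewrite !mxE.
pose X0 : 'M[W]_N := \matrix_(a, b) sval (cid (witt_surj hW (Z a b))).
have X0E : map_mx res X0 = Z by apply/matrixP => a b; rewrite !mxE; apply: (svalP (cid (witt_surj hW (Z a b)))).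
have h0 q : q \in lg_eqs G -> pdiv_pow p 1 (l q X0).
  move=> qG; apply/(witt_res0 hW); rewrite -[RHS](hZ q qG) rmorph_sum; apply: eq_bigr => i _.
  by rewrite rmorphM -X0E -map_mxvec mxE.
have [nx nxP] : exists nx : nat -> 'M[W]_N -> 'M[W]_N, forall n X,
    (forall q, q \in lg_eqs G -> pdiv_pow p n.+1 (l q X)) ->
    (forall a b, pdiv_pow p n.+1 (nx n X a b - X a b)) /\
      forall q, q \in lg_eqs G -> pdiv_pow p n.+2 (l q (nx n X)).
  have ex n (X : 'M[W]_N) : exists X' : 'M[W]_N, (forall q, q \in lg_eqs G -> pdiv_pow p n.+1 (l q X)) ->
    (forall a b, pdiv_pow p n.+1 (X' a b - X a b)) /\ forall q, q \in lg_eqs G -> pdiv_pow p n.+2 (l q X').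
    have [h|no] := pselect (forall q, q \in lg_eqs G -> pdiv_pow p n.+1 (l q X)); last by exists 0.
    by have [X' hX'] := step n.+1 X isT h; exists X'.
  by exists (fun n X => sval (cid (ex n X))) => n X; apply: (svalP (cid (ex n X))).
pose Xn := fix Xn n := if n is n'.+1 then nx n' (Xn n') else X0.
have okn n : forall q, q \in lg_eqs G -> pdiv_pow p n.+1 (l q (Xn n)).
  by elim: n => [//|n IH]; have [_] := nxP _ _ IH.
have dn n a b : pdiv_pow p n.+1 (Xn n.+1 a b - Xn n a b) by have [] := nxP _ _ (okn n).
have lim a b : exists y, forall n, pdiv_pow p n (y - Xn n a b).
  by apply: (witt_lim hW) => n; exact: (pdiv_pow_le (leqnSn n) (dn n a b)).
pose X : 'M[W]_N := \matrix_(a, b) sval (cid (lim a b)).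
have XP a b n : pdiv_pow p n (X a b - Xn n a b) by rewrite mxE; apply: (svalP (cid (lim a b)) n).
exists X; split.
  apply/lieP => q qG; apply: (witt_sep hW) => n.
  rewrite (_ : \sum_i _ = l q (Xn n) + \sum_i (mxvec X 0 i - mxvec (Xn n) 0 i) * lie_coef q i).
    apply: pdiv_powD; first exact: (pdiv_pow_le (leqnSn n) (okn n q qG)).
    apply: (big_ind (pdiv_pow p n)) => [|u v|i _]; [exact: pdiv_pow_0 | exact: pdiv_powD |].
    by rewrite mulrC; apply: pdiv_powMl; case/mxvec_indexP: i => a b; rewrite !mxvecE; apply: XP.
  by rewrite -big_split; apply: eq_bigr => i _ /=; rewrite -mulrDl addrC subrK.
apply/matrixP => a b; have := XP a b 1%N; have := dn 0%N a b.
move=> h1 h2; have : pdiv_pow p 1 (X a b - X0 a b).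
  have -> : X a b - X0 a b = (X a b - Xn 1%N a b) + (Xn 1%N a b - Xn 0%N a b) by rewrite addrA subrK.
  exact: pdiv_powD.
move=> /(witt_res0 hW)/eqP; rewrite rmorphB subr_eq0 => /eqP e.
rewrite [LHS]mxE e; have := congr1 (fun M : 'M_N => M a b) X0E.
by rewrite [X in X = _ -> _]mxE.
Qed.

Lemma root_vec_unit : exists i0 j0 einv, root_vec x i0 j0 * einv = 1.
Proof.
apply: contrapT => no; apply: (root_vec_neq0 (x := x) (s := res)); apply/matrixP => a b; rewrite !mxE.
by apply: contrapT => /(witt_unit hW)[v hv]; apply: no; exists a, b, v; rewrite -hv !mxE.
Qed.

(** The root vector has a unit entry and [W] is local, so some weight component has a unit at the
    same place. On this component the torus acts both by [alpha] and by the weight, so these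
    characters agree; at the generic point the other components must then vanish. *)
Lemma root_weight : ~ chr_trivial alpha -> exists b : {ffun 'I_r -> 'I_(C + C)},
  [/\ forall (A : comNzRingType) (s : {rmorphism W -> A}) t, pts T s t ->
        chr_at alpha s t = wval (fun l => chr_at (chi l) s t) b,
      (forall (A : comNzRingType) (s : {rmorphism W -> A}), hw (sE E s) (wt_int b) (map_mx s (root_vec x))) &
      exists l, wt_int b l <> 0].
Proof.
move=> nt; have [i0 [j0 [einv hu]]] := root_vec_unit.
pose f d := wproj (sE E id_W) d (root_vec x).
have wpn (A : comNzRingType) (s : {rmorphism W -> A}) d Y : map_mx s (wproj (sE E id_W) d Y) = wproj (sE E s) d (map_mx s Y).
  rewrite wproj_nat; congr (wproj _ _ _); apply: functional_extensionality_dep => mu.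
  by rewrite /sE -map_mx_comp.
have key (A : comNzRingType) (s : {rmorphism W -> A}) t d : pts T s t ->
    chr_at alpha s t *: map_mx s (f d) = wval (fun l => chr_at (chi l) s t) d *: map_mx s (f d).
  move=> tT; have [[t' tt'] _] := tT; have := root_vec_conj x tT tt'.
  rewrite (conj_wproj TE _ tT tt') => /(congr1 (wproj (sE E s) d)); rewrite wprojZ wproj_bigsum.
  rewrite (bigD1 d) //= wprojZ big1 ?addr0 => [|c ne].
    rewrite (wproj_id (sE1 E1 s) (sEE EE s) (wproj_hw (sEE EE s) (b := d) (Z := map_mx s (root_vec x)))).
    by rewrite wpn => ->.
  rewrite wprojZ (wproj_eq0 (sE1 E1 s) (sEE EE s) (wproj_hw (sEE EE s) (b := c) (Z := map_mx s (root_vec x)))) ?scaler0 //.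
  by rewrite eq_sym.
have [b [v hv]] : exists b v, f b i0 j0 * v = 1.
  apply: contrapT => no; have : res (root_vec x i0 j0) = 0.
    rewrite -(wproj_sum (sE1 E1 id_W) (root_vec x)) summxE rmorph_sum big1 // => d _.
    by apply: contrapT => /(witt_unit hW)[v hv]; apply: no; exists d, v.
  by move=> h; have := congr1 res hu; rewrite rmorphM h mul0r rmorph1 => /esym/eqP; rewrite oner_eq0.
have ab (A : comNzRingType) (s : {rmorphism W -> A}) t : pts T s t ->
    chr_at alpha s t = wval (fun l => chr_at (chi l) s t) b.
  move=> tT; have := congr1 (fun M : 'M_N => M i0 j0 * s v) (key _ s t b tT).
  rewrite [X in X * _ = _ -> _]mxE [X in _ = X * _ -> _]mxE ![map_mx _ _ _ _]mxE -!mulrA -rmorphM hv rmorph1 !mulr1.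
  by [].
have fd d : d != b -> f d = 0.
  move=> db; have [L [c [u [y [n [t [t' [xy inj tT tt' tw]]]]]]]] := generic_point hchi C id_W.
  have := key _ _ _ d tT; rewrite (ab _ _ _ tT) !tw => e.
  apply/matrixP => i j; pose g d' := if d' == b then f d i j else if d' == d then - f d i j else 0.
  have := laurent_code (f := g) inj _ b; rewrite /g eqxx mxE; apply.
  have := congr1 (fun M : 'M_N => u ^+ n * M i j) e; rewrite [X in _ * X = _ -> _]mxE [X in _ = _ * X -> _]mxE !mxE !mulrA.
  have S k0 : u ^+ n * u ^+ k0 * y ^+ n = u ^+ k0 by rewrite mulrAC -exprMn xy expr1n mul1r.
  rewrite !S => e'; rewrite (bigD1 b) //= (bigD1 d) //= /g !eqxx (negPf db) big1 ?addr0 => [|d' /andP[/negPf -> /negPf ->]].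
    by rewrite rmorphN mulrN; apply/eqP; rewrite subr_eq0; apply/eqP.
  by rewrite rmorph0 mulr0.
exists b; split=> [//|A s|].
  have -> : root_vec x = f b.
    rewrite -[LHS](wproj_sum (sE1 E1 id_W)) (bigD1 b) //= big1 ?addr0 // => d db; exact: fd.
  by rewrite wpn; apply: wproj_hw; apply: sEE.
apply: contrapT => no; apply: nt => A s t tT; rewrite ab // /wval big1 // => l _.
have -> : (b l : nat) = C.
  have : wt_int b l = 0 by apply: contrapT => h; apply: no; exists l.
  by rewrite /wt_int => /eqP; rewrite subr_eq0 => /eqP[].
by have [w hw1] := chr_unit (chi l) tT; rewrite (cinvE hw1) -exprMn hw1 expr1n.
Qed.

Section Field.
Variables (K : closedFieldType) (j : {rmorphism W -> K}) (jI : injective j).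
Local Notation EK := (sE E j).
Local Notation e := (map_mx j (root_vec x)).
Let EK1 := sE1 E1 j.
Let EKK := sEE EE j.
Variables (b : {ffun 'I_r -> 'I_(C + C)}) (l0 : 'I_r).
Hypotheses (he : hw EK (wt_int b) e) (bl0 : wt_int b l0 <> 0).
Let eL : lie G j e := root_vec_lie x j.

(** The root vector is outside the radical of the trace form, and only the component of opposite
    weight can pair with it. *)
Lemma opposite_vec : exists f : 'M[K]_N, [/\ lie G j f, \tr (e *m f) = 1 &
  exists c, hw EK c f /\ forall l, wt_int b l + c l = 0].
Proof.
have [Z [hZ nz]] : exists Z, lie G j Z /\ \tr (e *m Z) <> 0.
  apply: contrapT => no; apply: (root_vec_not_rad hW Gred TG hchi E1 EE TE hz jI (x := x)).
  by split=> // Z hZ; apply: contrapT => nz; apply: no; exists Z.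
have [c nc] : exists c, \tr (e *m wproj EK c Z) <> 0.
  apply: contrapT => no; apply: nz; rewrite -(wproj_sum EK1 Z) mulmx_sumr raddf_sum big1 // => c _ /=.
  by apply: contrapT => nc; apply: no; exists c.
have hwc : hw EK (wt_int c) (wproj EK c Z) := wproj_hw EKK (b := c) (Z := Z).
set tau := \tr _ in nc; exists (tau^-1 *: wproj EK c Z); split.
- by apply: lieZ; apply: (lie_wproj hchi TE c TG hZ).
- by rewrite -scalemxAr mxtraceZ mulVf //; apply/eqP.
exists (wt_int c); split; first exact: (hwZ hwc).
by move=> l; apply: contrapT => nl; apply: nc; apply: (hw_trace EK1 EKK (hwM EK1 EKK he hwc) nl).
Qed.

(** Subtracting a multiple of [e] makes X' orthogonal to [f]; then [X', f] lies in [Lie T] and is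
    orthogonal to it, hence 0. So X' is a lowest vector of an sl2-string: [f] carries ad(e)^(n+1) X'
    to a nonzero multiple of ad(e)^n X'. If X' were nonzero no such vector would vanish, against the
    bound on weights. *)
Lemma mult_one X : lie G j X -> hw EK (wt_int b) X -> exists c, X = c *: e.
Proof.
move=> hX hwX; have [f [fL ef [c [fc bc]]]] := opposite_vec.
pose X' := X - \tr (X *m f) *: e.
suff X0 : X' = 0 by exists (\tr (X *m f)); apply/eqP; rewrite -subr_eq0; apply/eqP.
have X'L : lie G j X' by apply: lieB hX (lieZ _ eL).
have wX' : hw EK (wt_int b) X' by apply: (hwD hwX); rewrite -scaleNr; apply: hwZ.
have X'f : \tr (X' *m f) = 0 by rewrite mulmxBl raddfB /= -scalemxAl mxtraceZ ef mulr1 subrr.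
have brz Y : hw EK (wt_int b) Y -> hw EK zero_wt (Y *m f - f *m Y).
  by move=> hY; apply: (hw_eq (hw_bracket EK1 EKK hY fc)).
have trb Y y : hw EK (wt_int b) Y -> \tr ((Y *m f - f *m Y) *m lie_diag m E j y) =
    (\sum_l (wt_int b l)%:~R * y l) * \tr (Y *m f).
  move=> hY; have := congr1 (fun M => \tr (M *m f)) (diag_bracket m E1 EE (j := j) y hY).
  rewrite -scalemxAl mxtraceZ => <-; rewrite !mulmxBl !raddfB /=; congr (_ - _).
    by rewrite [LHS]mxtrace_mulC mulmxA.
  by rewrite -mulmxA [LHS]mxtrace_mulC.
have [y ye] := lie_zero_K hW TG hchi E1 EE TE hz jI (lie_bracket eL fL) (brz _ he).
set cc := \sum_l (wt_int b l)%:~R * y l.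
(* By [trb], [y] represents the linear form given by the weight [b] in the trace form, so this is
   the value of that form on its representing vector. *)
have cc0 : cc <> 0.
  apply: (wform_dual (ch0i hW jI) (w := wt_mult E j) (l := wt_lin m) _ bl0) => z.
  by rewrite -(diag_trace m EE) -ye trb // ef mulr1.
have Xf0 : X' *m f - f *m X' = 0.
  have [z ze] := lie_zero_K hW TG hchi E1 EE TE hz jI (lie_bracket X'L fL) (brz _ wX').
  rewrite ze; apply: (diag_nondeg hW EE jI) => z'; by rewrite -ze trb // X'f mulr0.
pose Y n := iter n (fun Z => e *m Z - Z *m e) X'.
have wY n : hw EK (fun l => wt_int b l *+ n.+1) (Y n).
  elim: n => [|n IH]; first exact: (hw_eq wX').
  by apply: (hw_eq (hw_bracket EK1 EKK he IH)) => l; rewrite [RHS]mulrS.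
have hY n : (e *m f - f *m e) *m Y n - Y n *m (e *m f - f *m e) = (cc *+ n.+1) *: Y n.
  rewrite ye (diag_bracket m E1 EE y (wY n)); congr (_ *: _).
  rewrite /cc -sumrMnl; apply: eq_bigr => l _; by rewrite rmorphMn /= mulrnAl.
(* The triangular number comes from adding up the eigenvalues cc, 2 cc, ... of [e, f] along the
   string. *)
have fY n : f *m Y n.+1 - Y n.+1 *m f = - (cc *+ (\sum_(i < n.+1) i.+1)) *: Y n.
  have br n' : f *m Y n'.+1 - Y n'.+1 *m f =
     - ((e *m f - f *m e) *m Y n' - Y n' *m (e *m f - f *m e)) +
      (e *m (f *m Y n' - Y n' *m f) - (f *m Y n' - Y n' *m f) *m e).
    rewrite [Y n'.+1]/(e *m Y n' - Y n' *m e); move: (Y n') e => V d.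
    rewrite !(mulmxBl, mulmxBr) !mulmxA.
    move: (f *m d *m V) (f *m V *m d) (d *m V *m f) (V *m d *m f) (d *m f *m V) (V *m f *m d) => m1 m2 m3 m4 m5 m6.
    by apply/matrixP => u v; rewrite !mxE; ring.
  elim: n => [|n IH]; rewrite br hY.
    have -> : f *m Y 0%N - Y 0%N *m f = 0 by apply/eqP; rewrite -oppr_eq0 opprB; apply/eqP.
    by rewrite mulmx0 mul0mx subrr addr0 big_ord_recl big_ord0 addn0 scaleNr.
  rewrite IH -scalemxAr -scalemxAl -scalerBr -[e *m Y n - _]/(Y n.+1) -scaleNr -scalerDl.
  by congr (_ *: _); rewrite addrC [in RHS]big_ord_recr mulrnDr [RHS]opprD.
apply: contrapT => X'0; have Yn n : Y n <> 0.
  elim: n => [|n IH] // Y0; apply: IH; have := fY n; rewrite Y0 mulmx0 mul0mx subrr => /esym/eqP.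
  rewrite scaler_eq0 oppr_eq0 -mulr_natr mulf_eq0 => /orP[/orP[/eqP//|]|/eqP//].
  by move=> /eqP/(ch0 hW jI)/eqP; rewrite big_ord_recr /= addn_eq0 andbF.
apply: (Yn C); apply: (hw_big EK1 (wY C) (j := l0)).
rewrite -mulr_natr natz abszM absz_nat; apply: leq_trans (leqnSn C) _.
by rewrite leq_pmull // absz_gt0; apply/eqP.
Qed.
End Field.

Variables (b : {ffun 'I_r -> 'I_(C + C)}) (l0 : 'I_r).
Hypotheses (he : forall (A : comNzRingType) (s : {rmorphism W -> A}), hw (sE E s) (wt_int b) (map_mx s (root_vec x)))
  (bl0 : wt_int b l0 <> 0).

(** The scalar is read off at a unit entry of the root vector. After subtraction this entry is 0, so
    proportionality over the field forces the remainder to vanish. *)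
Lemma mult_one_W X : lie G id_W X -> hw (sE E id_W) (wt_int b) X -> exists c, X = c *: root_vec x.
Proof.
move=> hX wX; have [F [i [K [f [iI fI _]]]]] := domain_closure (witt_domain hW).
pose j : {rmorphism W -> K} := GRing.RMorphism.clone _ _ (f \o i) _.
have jI : injective j by apply: inj_comp.
have [i0 [j0 [einv hu]]] := root_vec_unit.
pose X' := X - (X i0 j0 * einv) *: root_vec x.
have X'0 : X' i0 j0 = 0.
  by rewrite /X' mxE [X in _ + X]mxE [X in - X]mxE -mulrA [einv * _]mulrC hu mulr1 subrr.
exists (X i0 j0 * einv); apply/eqP; rewrite -subr_eq0 -/X'; apply/eqP.
have idm Z : map_mx id_W Z = Z :> 'M[W]_N by apply/matrixP => u v; rewrite mxE.
have eW : lie G id_W (root_vec x) by have := root_vec_lie x id_W; rewrite idm.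
have wE : hw (sE E id_W) (wt_int b) (root_vec x) by have := @he W id_W; rewrite idm.
have X'L : lie G id_W X' by apply: lieB hX (lieZ _ eW).
have wX' : hw (sE E id_W) (wt_int b) X' by apply: (hwD wX); rewrite -scaleNr; apply: hwZ.
have js : is_alg_hom id_W j j by [].
have wj : hw (sE E j) (wt_int b) (map_mx j X').
  move=> mu nu nz; apply: wX' => e0; apply: nz; have : map_mx j (sE E id_W mu *m X' *m sE E id_W nu) = 0 by rewrite e0 map_mx0.
  by rewrite !map_mxM /sE -!map_mx_comp.
have [c cE] := mult_one jI (@he K j) bl0 (lie_nat js X'L) wj.
have := congr1 (fun M : 'M_N => M i0 j0) cE; rewrite mxE X'0 rmorph0 mxE => /esym/eqP.
rewrite mulf_eq0 => /orP[/eqP c0|]; last first.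
  rewrite mxE => /eqP h; have := congr1 j hu; rewrite rmorphM h mul0r rmorph1 => /esym/eqP.
  by rewrite oner_eq0.
apply/matrixP => u v; apply: jI; have := congr1 (fun M : 'M_N => M u v) cE.
by rewrite c0 scale0r [X in X = _ -> _]mxE => ->; rewrite !mxE rmorph0.
Qed.

(** A nonzero weight component of [Z] lifts to [W], so its weight is a root on which [t] acts by
    [u]; by uniqueness it is [alpha]. A lift of [Z] to [W] then has an [alpha]-component
    proportional to the root vector, and this is reduced modulo [p]. *)
Lemma eigenspace_root (t t' : 'M[k]_N) (u : k) Z : pts T res t -> inverses t t' -> u <> 1 ->
  (forall (A : comNzRingType) (s : {rmorphism W -> A}) t, pts T s t ->
        chr_at alpha s t = wval (fun l => chr_at (chi l) s t) b) ->
  (forall a, is_root G a -> (forall X, root_space G a X -> t *m map_mx res X *m t' = u *: map_mx res X) ->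
     chr_eq a alpha) ->
  lie G res Z -> t *m Z *m t' = u *: Z -> exists c, Z = c *: map_mx res (root_vec x).
Proof.
move=> tT tt' u1 ab huniq hZ tZ.
have E1r := sE1 E1 res; have EEr := sEE EE res.
have wd d : wproj (sE E res) d Z <> 0 -> d = b.
  move=> nz; have hwd : hw (sE E res) (wt_int d) (wproj (sE E res) d Z) := wproj_hw EEr (b := d) (Z := Z).
  have wu : wval (fun l => chr_at (chi l) res t) d = u.
    have := congr1 (wproj (sE E res) d) tZ; rewrite (conj_wproj TE _ tT tt') wprojZ wproj_bigsum.
    rewrite (bigD1 d) //= wprojZ big1 ?addr0 => [|c ne]; last first.
      rewrite wprojZ (wproj_eq0 E1r EEr (wproj_hw EEr (b := c) (Z := Z))) ?scaler0 //.
      by rewrite eq_sym.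
    rewrite (wproj_id E1r EEr hwd) => /eqP; rewrite -subr_eq0 -scalerBl scaler_eq0 subr_eq0.
    by move=> /orP[/eqP//|/eqP].
  have [X [hX XE]] := lie_lift (lie_wproj hchi TE d TG hZ).
  pose X' := wproj (sE E id_W) d X.
  have X'L : lie G id_W X' by apply: (lie_wproj hchi TE d TG hX).
  have wpn (A : comNzRingType) (s : {rmorphism W -> A}) Y : map_mx s (wproj (sE E id_W) d Y) = wproj (sE E s) d (map_mx s Y).
    rewrite wproj_nat; congr (wproj _ _ _); apply: functional_extensionality_dep => mu.
    by rewrite /sE -map_mx_comp.
  have X'r : map_mx res X' = wproj (sE E res) d Z by rewrite /X' wpn XE (wproj_id E1r EEr hwd).
  have [a aE] := wchar_ex chi d.
  have aX : root_space G a X'.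
    split=> // A s t0 t0' t0T tt0; rewrite (conj_wproj TE _ t0T tt0) aE (bigD1 d) //= big1 ?addr0.
      by rewrite /X' wpn (wproj_id (sE1 E1 s) (sEE EE s) (wproj_hw (sEE EE s) (b := d) (Z := map_mx s X))).
    move=> c ne; rewrite /X' wpn (wproj_eq0 (sE1 E1 s) (sEE EE s) (wproj_hw (sEE EE s) (b := d) (Z := map_mx s X))) //.
    by rewrite scaler0.
  have ar : is_root G a.
    split; first by move=> tr; apply: u1; rewrite -wu -aE tr.
    by exists X' => // X'0; apply: nz; rewrite -X'r X'0 map_mx0.
  apply: (wchar_inj hchi) => A s t0 t0T; rewrite -ab // -aE; apply: huniq ar _ _ _ _ t0T.
  by move=> Y [_ hY]; rewrite hY // aE wu.
have Zb : hw (sE E res) (wt_int b) Z.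
  rewrite -(wproj_sum E1r Z) (bigD1 b) //= big1 ?addr0.
    exact: (wproj_hw EEr (b := b) (Z := Z)).
  move=> d db; apply: contrapT => /wd e; by rewrite e eqxx in db.
have [X [hX XE]] := lie_lift hZ.
have [|c cE] := @mult_one_W (wproj (sE E id_W) b X) (lie_wproj hchi TE b TG hX).
  by apply: wproj_hw; apply: sEE.
exists (res c); rewrite -[LHS](wproj_id E1r EEr Zb) -XE.
have <- : map_mx res (wproj (sE E id_W) b X) = wproj (sE E res) b (map_mx res X).
  rewrite wproj_nat; congr (wproj _ _ _); apply: functional_extensionality_dep => mu.
  by rewrite /sE -map_mx_comp.
by rewrite cE map_mxZ.
Qed.
End RootSpaces.

(* The group theory behind a nice prime: a linear form [phi] reading off the coordinate
   along the root vector, and the eigenspaces of eigenvalues 1 and [u] of the residual Frobenius. *)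
Lemma nice_package (p : nat) (k : finFieldType) (W : comNzRingType) (res : {rmorphism W -> k})
  (N : nat) (G T : lingroup W N) (alpha : lgchar T) (x : root_subgroup G alpha)
  (sg sg' : 'M[k]_N) (u : k) :
  is_witt_ring p res -> lg_reductive G -> split_maximal_torus G T -> ~ chr_trivial alpha ->
  pts T res sg -> inverses sg sg' -> u <> 1 ->
  (forall (K : closedFieldType) (j : {rmorphism k -> K}), is_semisimple_mx (map_mx j sg) /\
     forall y, pts T (j \o res : {rmorphism W -> K}) y <->
       identity_component (centralizer (pts G (j \o res : {rmorphism W -> K})) (map_mx j sg)) y) ->
  (forall a, is_root G a -> (forall X, root_space G a X -> sg *m map_mx res X *m sg' = u *: map_mx res X) ->
     chr_eq a alpha) ->
  (exists phi : forall A : comNzRingType, {rmorphism W -> A} -> 'M[A]_N -> A,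
   [/\ (forall (A : comNzRingType) (s : {rmorphism W -> A}) Y Z, phi A s (Y + Z) = phi A s Y + phi A s Z),
       (forall (A : comNzRingType) (s : {rmorphism W -> A}) c Z, phi A s (c *: Z) = c * phi A s Z),
       (forall (A : comNzRingType) (s : {rmorphism W -> A}) t t' Z, pts T s t -> inverses t t' ->
          phi A s (t *m Z *m t') = chr_at alpha s t * phi A s Z),
       (forall (A : comNzRingType) (s : {rmorphism W -> A}), phi A s (map_mx s (root_vec x)) = 1) &
       (forall (A A' : comNzRingType) (s : {rmorphism W -> A}) (s' : {rmorphism W -> A'})
          (f : {rmorphism A -> A'}) Z, is_alg_hom s s' f -> phi A' s' (map_mx f Z) = f (phi A s Z))]) /\
  [/\ (forall Z, lie G res Z -> sg *m Z *m sg' = Z -> lie T res Z),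
      (forall Z, lie G res Z -> sg *m Z *m sg' = u *: Z -> exists c, Z = c *: map_mx res (root_vec x)) &
      exists e, sg ^+ e = 1 /\ e%:R != 0 :> k].
Proof.
move=> hW Gred [TG [r [chi hchi]] _] nt sgT ss u1 hreg huniq; have [Gsm _] := Gred.
have [C [m [E [E1 EE TE]]]] := torus_weights hchi.
have [e [se e0]] : exists e, sg ^+ e = 1 /\ e%:R != 0 :> k.
  have [K [j jI]] := field_closure k.
  exact: (semisimple_order (witt_pchar hW) ss (hreg K j).1).
have sgG := TG _ _ _ sgT.
have Q1 Z : lie G res Z -> sg *m Z *m sg' = Z -> lie T res Z.
  apply: (regular_lie Gsm ss sgG se e0) => K j y; exact: ((hreg K j).2 y).2.
have hz X : lie G res X -> hw (sE E res) (fun _ => 0) X -> lie T res X.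
  move=> hX h0; apply: Q1 => //; rewrite (conj_wproj TE _ sgT ss).
  rewrite -[RHS](wproj_sum (sE1 E1 res)); apply: eq_bigr => d _.
  have [[l nz]|z] := pselect (exists l, wt_int d l <> 0).
    have -> : wproj (sE E res) d X = 0; last by rewrite scaler0.
    apply: (grading_eq0 (sE1 E1 res)) => mu nu; rewrite wprojE; last exact: sEE.
    case: eqP => // /grading_wtE hd; apply: contrapT => /h0 h; by case: nz; rewrite -hd h.
  rewrite (_ : wval _ _ = 1) ?scale1r // /wval big1 // => l _.
  have -> : (d l : nat) = C.
    have : wt_int d l = 0 by apply: contrapT => h; apply: z; exists l.
    by rewrite /wt_int => /eqP; rewrite subr_eq0 => /eqP[].
  by have [w hw1] := chr_unit (chi l) sgT; rewrite (cinvE hw1) -exprMn hw1 expr1n.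
have [b [ab he [l0 bl0]]] := root_weight hW x hchi E1 EE TE nt.
have [i0 [j0 [einv hu]]] := root_vec_unit hW x.
have wpn (A A' : comNzRingType) (s : {rmorphism W -> A}) (s' : {rmorphism W -> A'}) (f : {rmorphism A -> A'}) Y :
    is_alg_hom s s' f -> map_mx f (wproj (sE E s) b Y) = wproj (sE E s') b (map_mx f Y).
  move=> fs; rewrite wproj_nat; congr (wproj _ _ _); apply: functional_extensionality_dep => mu.
  by rewrite /sE -map_mx_comp; apply/matrixP => c d; rewrite !mxE /= fs.
split; last first.
  split=> //; last by exists e.
  by move=> Z hZ tZ; apply: (eigenspace_root hW Gred TG hchi E1 EE TE hz he bl0 sgT ss u1 ab huniq hZ tZ).
(* The form takes the [alpha]-component and reads it at an entry where the root vector is a unit,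
   normalized by the inverse of that unit. *)
exists (fun A s Z => wproj (sE E s) b Z i0 j0 * s einv); split.
- by move=> A s Y Z; rewrite wprojD mxE mulrDl.
- by move=> A s c Z; rewrite wprojZ mxE mulrA.
- move=> A s t t' Z tT tt'; rewrite (conj_wproj TE _ tT tt') wproj_bigsum summxE (bigD1 b) //= big1 ?addr0.
    rewrite wprojZ (wproj_id (sE1 E1 s) (sEE EE s) (wproj_hw (sEE EE s) (b := b) (Z := Z))).
    by rewrite mxE mulrA -ab.
  move=> d db; rewrite wprojZ (wproj_eq0 (sE1 E1 s) (sEE EE s) (wproj_hw (sEE EE s) (b := d) (Z := Z))).
    by rewrite scaler0 mxE.
  by rewrite eq_sym.
- move=> A s; rewrite (wproj_id (sE1 E1 s) (sEE EE s) (@he A s)) mxE -rmorphM hu rmorph1 //.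
- move=> A A' s s' f Z fs; rewrite -(wpn _ _ _ _ _ _ fs) mxE rmorphM fs //.
Qed.

(** * Special lifts *)

Section BorelLike.
Variables (B : comNzRingType) (N : nat) (G T : lingroup B N) (alpha : lgchar T).
Variable x : root_subgroup G alpha.

Lemma lgchar1 (A : comNzRingType) (s : {rmorphism B -> A}) (a : lgchar T) : chr_at a s 1%:M = 1.
Proof.
have h1 := lg_one T s; have [b hb] := chr_unit a h1.
have := chr_mul a h1 h1; rewrite mul1mx => e.
by rewrite -[LHS]mulr1 -[X in _ * X]hb mulrA -e hb.
Qed.

Lemma in_Halpha_mul (A : comNzRingType) (s : {rmorphism B -> A}) y y' c c' :
  in_Halpha x s y c -> in_Halpha x s y' c' -> in_Halpha x s (y *m y') (c * c').
Proof.
move=> [t [u [tT -> <-]]] [t1 [u1 [tT1 -> <-]]]; have [[t1' tt] _] := tT1.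
have tt' : inverses t1' t1 by case: tt.
exists (t *m t1), (chr_at alpha s t1' * u + u1); split; [exact: lg_mul | | by rewrite chr_mul].
rewrite ru_add -(ru_conj x u (lg_inv tT1 tt) tt') !mulmxA -(mulmxA t t1) tt.1 mulmx1 //.
Qed.

Lemma in_Halpha_torus (A : comNzRingType) (s : {rmorphism B -> A}) t :
  pts T s t -> in_Halpha x s t (chr_at alpha s t).
Proof. by move=> tT; exists t, 0; rewrite ru_zero mulmx1. Qed.

Lemma in_Halpha_unip (A : comNzRingType) (s : {rmorphism B -> A}) z : in_Halpha x s (ru_at x s z) 1.
Proof. by exists 1%:M, z; rewrite mul1mx lgchar1; split=> //; apply: lg_one. Qed.

Lemma in_Halpha_nat (A A' : comNzRingType) (s : {rmorphism B -> A}) (s' : {rmorphism B -> A'})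
    (f : {rmorphism A -> A'}) y c : is_alg_hom s s' f -> in_Halpha x s y c ->
  in_Halpha x s' (map_mx f y) (f c).
Proof.
move=> fs [t [u [tT -> <-]]]; exists (map_mx f t), (f u); split.
- exact: pts_nat tT.
- by rewrite map_mxM (ru_nat x u fs).
- by rewrite (chr_nat alpha fs tT).
Qed.
End BorelLike.

(** * The cyclotomic character on decomposition groups *)

Section Cyclotomic.
Variables (p : nat) (k : finFieldType) (W : comNzRingType) (res : {rmorphism W -> k}).
Hypothesis hW : is_witt_ring p res.
Variables (F : fieldExtType rat) (iota : {rmorphism F -> algC}).
Variables (kap : elt (absgal iota) -> W) (hkap : is_cyclotomic p kap).

Lemma root_power (s : aut) n z : (p ^ n)%N.-primitive_root z -> exists a, s z = z ^+ a.
Proof.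
move=> pz; have := prim_rootP pz (x := s z); case; first by rewrite -rmorphXn (prim_expr_order pz) rmorph1.
by move=> a ->; exists a.
Qed.

Lemma prim_root_ex n : exists z : algC, (p ^ n)%N.-primitive_root z.
Proof.
have [|z pz] := C_prim_root_exists (n := (p ^ n)%N); last by exists z.
by rewrite expn_gt0 prime_gt0 // (witt_prime hW).
Qed.

Lemma kap_mul u s t : is_comp u s t -> kap u = kap s * kap t.
Proof.
move=> c; apply/eqP; rewrite -subr_eq0; apply/eqP/(witt_sep hW) => n.
have [z pz] := prim_root_ex n; have [a sa] := root_power (sval s) pz; have [b tb] := root_power (sval t) pz.
have ua : sval u z = z ^+ (a * b) by rewrite c tb rmorphXn sa exprM.
have h1 := hkap pz ua; have h2 := hkap pz sa; have h3 := hkap pz tb.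
have -> : kap u - kap s * kap t = (kap u - (a * b)%:R) - (kap s * (kap t - b%:R) + b%:R * (kap s - a%:R)).
  by rewrite natrM; ring.
by apply: pdiv_powB => //; apply: pdiv_powD; apply: pdiv_powMl.
Qed.

Lemma kap_agree n : exists z : algC, forall s t : elt (absgal iota), sval s z = sval t z -> pdiv_pow p n (kap s - kap t).
Proof.
have [z pz] := prim_root_ex n; exists z => s t e; have [a sa] := root_power (sval s) pz.
have h1 := hkap pz sa; rewrite e in sa; have h2 := hkap pz sa.
by rewrite -(subrKA a%:R) -[a%:R - _]opprB; apply: pdiv_powB.
Qed.

Variables (P : algC -> Prop) (hP : finite_place P) (Pp : ~ P p%:R).

(** If z is not 1 its powers sum to 0, so p^n is minus the sum of the z^i - 1, a multiple of z - 1;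
    then p^n, hence p, would lie in [P]. *)
Lemma unity_root_mod n (z : algC) : z ^+ (p ^ n) = 1 -> P (z - 1) -> z = 1.
Proof.
move=> z1 Pz; apply: contrapT => nz; have [PA [P0 P1] [PD PM] PP _] := hP.
have zA : z \in Aint by apply: (@Aint_unity_root (p ^ n)); [rewrite expn_gt0 prime_gt0 // (witt_prime hW) | apply/unity_rootP].
have S0 : \sum_(i < p ^ n) z ^+ i = 0.
  have /eqP := subrX1 z (p ^ n); rewrite z1 subrr eq_sym mulf_eq0 subr_eq0 => /orP[/eqP//|/eqP//].
have pn : P (p ^ n)%:R.
  have -> : (p ^ n)%:R = - (\sum_(i < p ^ n) (z ^+ i - 1)) :> algC.
    by rewrite sumrB S0 sumr_const card_ord sub0r opprK.
  rewrite -[X in P X]mulN1r; apply: (PM (-1)); first by rewrite rpredN rpred1.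
  apply: (big_ind P) => // i _; rewrite subrX1 mulrC; apply: (PM _ (z - 1)) => //.
  by apply: rpred_sum => l _; apply: rpredX.
elim: n pn {z1 S0} => [|n IH]; first by rewrite expn0.
rewrite expnS natrM => /PP[||//|//]; by rewrite ?rpred_nat ?Aint_nat // ?(rpred_nat Aint).
Qed.

(** Reduction modulo [P] is injective on [p]-power roots of unity, so the residual action determines
    the character: [c] will be the norm for Frobenius and 1 for inertia. *)
Lemma kap_mod (s : elt (absgal iota)) c : (forall x, x \in Aint -> P (sval s x - x ^+ c)) -> kap s = c%:R.
Proof.
move=> hs; apply/eqP; rewrite -subr_eq0; apply/eqP/(witt_sep hW) => n.
have [z pz] := prim_root_ex n; apply: hkap (pz) _; have [a sa] := root_power (sval s) pz; rewrite sa.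
have [PA [P0 P1] [PD PM] PP _] := hP.
have zA : z \in Aint.
  by apply: (@Aint_unity_root (p ^ n)); [rewrite expn_gt0 prime_gt0 // (witt_prime hW) | apply/unity_rootP/prim_expr_order].
have z0 : z != 0.
  apply/eqP => z0; have := prim_expr_order pz; rewrite z0 expr0n expn_eq0 => /eqP.
  by rewrite (gtn_eqF (prime_gt0 (witt_prime hW))) eq_sym oner_eq0.
have ziA : z^-1 \in Aint.
  have -> : z^-1 = z ^+ (p ^ n).-1.
    apply: (mulfI z0); rewrite divff // -exprS prednK ?(prim_expr_order pz) //.
    by rewrite expn_gt0 prime_gt0 // (witt_prime hW).
  exact: rpredX.
have : P (z^-1 ^+ c * (sval s z - z ^+ c)) by apply: PM; [apply: rpredX | apply: hs].
rewrite sa mulrBr -exprMn mulVf // expr1n => /(@unity_root_mod n) h.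
have e : z^-1 ^+ c * z ^+ a = 1.
  apply: h; rewrite exprMn -!exprM mulnC exprM exprVn (prim_expr_order pz) invr1 expr1n mul1r.
  by rewrite mulnC exprM (prim_expr_order pz) expr1n.
have zc : z ^+ c != 0 by rewrite expf_neq0.
by apply: (mulfI (invr_neq0 zc)); rewrite mulVf // -exprVn e.
Qed.
End Cyclotomic.

Section LocalElements.
Variables (F : fieldExtType rat) (iota : {rmorphism F -> algC}).
Variables (P : algC -> Prop) (hP : finite_place P) (n : nat) (hn : place_norm iota P n).
Local Notation D := (dec iota (FinPlace P)).

Definition loc_one : elt D := exist _ (idfun : aut) (dec_id iota P).
Definition loc_comp (s t : elt D) : elt D := exist _ _ (dec_comp (svalP s) (svalP t)).
Definition loc_pow (s : elt D) m : elt D := exist _ _ (dec_pow m (svalP s)).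

Definition loc_multiplicative (A : comNzRingType) N (f : elt D -> 'M[A]_N) :=
  f loc_one = 1%:M /\ forall u s t, is_comp u s t -> f u = f s *m f t.

Lemma loc_pow_mul (A : comNzRingType) N (f : elt D -> 'M[A]_N) s m : loc_multiplicative f ->
  f (loc_pow s m) = iter m (mulmx (f s)) 1%:M.
Proof.
move=> [f1 fM]; elim: m => [|m IH].
  by rewrite -f1 -[LHS]mul1mx -{1}f1 -(fM (loc_pow s 0)) ?f1 // (fM (loc_pow s 0) loc_one loc_one) // f1 mul1mx.
by rewrite /= -IH; apply: fM => y.
Qed.

(** [tame_comm] as an element of the decomposition group; [d] is the error in the tame relation. *)
Lemma tame_elt p (s t : elt D) : prime p -> ~ P p%:R -> frob iota P n (sval s) -> inert iota P (sval t) ->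
  exists d : elt D, [/\ inert iota P (sval d),
    (forall (A : comNzRingType) N (f : elt D -> 'M[A]_N), loc_multiplicative f ->
       f s *m f t = f d *m iter n (mulmx (f t)) 1%:M *m f s) &
    forall e, exists M, ~~ (p %| M)%N /\ agree_on e loc_one (loc_pow d M)].
Proof.
move=> pp hp hs ht; have [kP [r rP]] := residue_field hP.
have di := tame_comm_inert rP hs ht.
exists (exist _ _ (di.1)); split=> //.
- move=> A N f fm; have [f1 fM] := fm.
  rewrite -(loc_pow_mul t n fm) -(fM (loc_comp s t) s t) // -mulmxA -(fM (loc_comp (loc_pow t n) s) (loc_pow t n) s) //.
  apply: fM => y; have := tame_commE n (sval s) (sval t) y; rewrite /= aut_powE.
  by move=> ->.
move=> e; have [M [hM hMe]] := tame_order hP rP pp hp hs ht e.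
by exists M; split=> // y ye; rewrite /= aut_powE hMe.
Qed.

(** Density of the group generated by Frobenius and inertia, in the form needed for locally constant
    conclusions. *)
Lemma loc_generated (Q : elt D -> Prop) (s0 s : elt D) e : frob iota P n (sval s0) ->
  (forall u v w, is_comp u v w -> Q v -> Q w -> Q u) -> Q s0 ->
  (forall t : elt D, inert iota P (sval t) -> Q t) ->
  exists s', Q s' /\ agree_on e s s'.
Proof.
move=> hs0 QM Q0 QI; have [kP [r rP]] := residue_field hP.
have [j [t [ti te]]] := dec_approx hP rP hn e hs0 (svalP s).
pose t' : elt D := exist _ t ti.1.
exists (loc_comp (loc_pow s0 j) t'); split; last first.
  by move=> y ye; rewrite te //= aut_powE.
elim: j {te} => [|j IH]; first by apply: QI; exact: ti.
by apply: (QM _ s0 (loc_comp (loc_pow s0 j) t')) => // y.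
Qed.
End LocalElements.

(** * First-order deformations of a special lift *)

Section SpecialSmall.
Variables (p : nat) (k : finFieldType) (W : comNzRingType) (res : {rmorphism W -> k}).
Hypothesis hW : is_witt_ring p res.
Variables (F : fieldExtType rat) (iota : {rmorphism F -> algC}).
Variables (P : algC -> Prop) (hP : finite_place P) (n : nat) (hn : place_norm iota P n) (Pp : ~ P p%:R).
Local Notation D := (dec iota (FinPlace P)).
Variables (s0 : elt D) (hs0 : frob iota P n (sval s0)).
Variables (kp : elt D -> W) (kpM : forall u s t, is_comp u s t -> kp u = kp s * kp t)
  (kpA : forall m, exists z : algC, forall s t : elt D, sval s z = sval t z -> pdiv_pow p m (kp s - kp t))
  (kpI : forall t : elt D, inert iota P (sval t) -> kp t = 1).
Variables (N : nat) (G T : lingroup W N) (TG : lgsub T G) (alpha : lgchar T) (x : root_subgroup G alpha).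
Variables (rb : elt D -> 'M[k]_N) (rbI : forall t : elt D, inert iota P (sval t) -> rb t = 1%:M).
Variables (sg' : 'M[k]_N) (hsg : inverses (rb s0) sg') (sgT : pts T res (rb s0)).
Variable phi : forall A : comNzRingType, {rmorphism W -> A} -> 'M[A]_N -> A.
Hypotheses (phiD : forall (A : comNzRingType) (s : {rmorphism W -> A}) Y Z, phi s (Y + Z) = phi s Y + phi s Z)
  (phiZ : forall (A : comNzRingType) (s : {rmorphism W -> A}) c Z, phi s (c *: Z) = c * phi s Z)
  (phiC : forall (A : comNzRingType) (s : {rmorphism W -> A}) t t' Z, pts T s t -> inverses t t' ->
          phi s (t *m Z *m t') = chr_at alpha s t * phi s Z)
  (phi1 : forall (A : comNzRingType) (s : {rmorphism W -> A}), phi s (map_mx s (root_vec x)) = 1)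
  (phiN : forall (A A' : comNzRingType) (s : {rmorphism W -> A}) (s' : {rmorphism W -> A'})
          (f : {rmorphism A -> A'}) Z, is_alg_hom s s' f -> phi s' (map_mx f Z) = f (phi s Z)).
Hypotheses (Q1 : forall Z, lie G res Z -> rb s0 *m Z *m sg' = Z -> lie T res Z)
  (Q2 : forall Z, lie G res Z -> rb s0 *m Z *m sg' = n%:R *: Z -> exists c, Z = c *: map_mx res (root_vec x)).
Variables (e : nat) (sge : rb s0 ^+ e = 1) (e0 : e%:R != 0 :> k).
Variables (A : comNzRingType) (str : {rmorphism W -> A}) (red : {rmorphism A -> k}).
Hypotheses (sr : is_alg_hom str res red) (redS : forall a, exists y, red y = a).
Variable pA : exists m, forall y, pdiv_pow p m y -> str y = 0.
Variables (w : A) (hw0 : red w = 0) (hw : forall a, w * a = 0 <-> red a = 0).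
Variables (rho rho0 : elt D -> 'M[A]_N).
Hypotheses (rhoM : loc_multiplicative rho) (rho0M : loc_multiplicative rho0)
  (rhoG : forall s, pts G str (rho s)) (rho0G : forall s, pts G str (rho0 s))
  (rhoL : locally_constant rho) (rho0L : locally_constant rho0)
  (rho0r : forall s, map_mx red (rho0 s) = rb s).
Hypotheses (rho0H : forall s, in_Halpha x str (rho0 s) (str (kp s)))
  (t0T : pts T str (rho0 s0)) (t0a : chr_at alpha str (rho0 s0) = str (kp s0)).
Hypotheses (small : forall s, exists C, rho s = (1%:M + w *: C) *m rho0 s)
  (smallphi : exists C, rho s0 = (1%:M + w *: C) *m rho0 s0 /\
     red (phi str (C *m map_mx str (root_vec x) - map_mx str (root_vec x) *m C)) = 0).

Let ww : w * w = 0. Proof. exact/hw. Qed.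
Local Notation ev A s := (@map_mx W A s N N (root_vec x)).

Lemma w_red (C C' : 'M[A]_N) : map_mx red C = map_mx red C' <-> w *: C = w *: C'.
Proof.
split=> h; apply/matrixP => a b; have := congr1 (fun M : 'M_N => M a b) h; rewrite !mxE => e1.
  by apply/eqP; rewrite -subr_eq0 -mulrBr; apply/eqP/hw; rewrite rmorphB e1 subrr.
by apply/eqP; rewrite -subr_eq0 -rmorphB; apply/eqP/hw; rewrite mulrBr e1 subrr.
Qed.

Definition klift (Z : 'M[k]_N) : 'M[A]_N := \matrix_(a, b) sval (cid (redS (Z a b))).
Lemma kliftE Z : map_mx red (klift Z) = Z.
Proof. by apply/matrixP => a b; rewrite !mxE; apply: (svalP (cid (redS (Z a b)))). Qed.

Lemma klift_pts (H : lingroup W N) (C : 'M[A]_N) :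
  pts H str (1%:M + w *: C) <-> lie H res (map_mx red C).
Proof.
have E q : \sum_i mxvec (map_mx red C) 0 i * res (lie_coef q i) = red (\sum_i mxvec C 0 i * str (lie_coef q i)).
  by rewrite rmorph_sum; apply: eq_bigr => i _; rewrite rmorphM sr -map_mxvec mxE.
split=> [/(@lie_small _ _ H _ str _ _ ww).1 h|/lieP h].
  by apply/lieP => q qG; rewrite E; apply/hw/h.
by apply: (@lie_small _ _ H _ str _ _ ww).2 => q qG; apply/hw; rewrite -E h.
Qed.

Lemma w1M (C C' : 'M[A]_N) : (1%:M + w *: C) *m (1%:M + w *: C') = 1%:M + w *: (C + C').
Proof.
rewrite mulmxDl mul1mx mulmxDr mulmx1 -scalemxAl -scalemxAr scalerA ww scale0r addr0.
by rewrite scalerDr -addrA [w *: C' + _]addrC.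
Qed.

Lemma w1_inj C C' (r : 'M[A]_N) : (exists r', inverses r r') ->
  (1%:M + w *: C) *m r = (1%:M + w *: C') *m r -> map_mx red C = map_mx red C'.
Proof.
move=> [r' [rr' _]] /(congr1 (fun M => M *m r')); rewrite -!mulmxA rr' !mulmx1 => /addrI.
by move/w_red.
Qed.

Lemma w1_conj C (r r' : 'M[A]_N) : inverses r r' ->
  r *m (1%:M + w *: C) = (1%:M + w *: (r *m C *m r')) *m r.
Proof.
move=> [_ r'r]; rewrite mulmxDr mulmx1 mulmxDl mul1mx -scalemxAr -scalemxAl.
by rewrite -!mulmxA r'r mulmx1.
Qed.

Definition inv0 s : 'M[A]_N := sval (cid (rho0G s).1).
Lemma inv0P s : inverses (rho0 s) (inv0 s). Proof. exact: (svalP (cid (rho0G s).1)). Qed.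
Lemma inv0r s : inverses (rb s) (map_mx red (inv0 s)).
Proof. by have [h1 h2] := inv0P s; rewrite -rho0r; split; rewrite -map_mxM ?h1 ?h2 map_mx1. Qed.

(** The cocycle comparing [rho] with [rho0]. It takes values over [k] because [w *: C] depends only
    on the reduction of [C], the annihilator of [w] being the maximal ideal. *)
Definition cc s : 'M[k]_N := map_mx red (sval (cid (small s))).
Lemma cc_ex s : exists C, map_mx red C = cc s /\ rho s = (1%:M + w *: C) *m rho0 s.
Proof. by exists (sval (cid (small s))); split=> //; apply: (svalP (cid (small s))). Qed.
Lemma ccE s C : map_mx red C = cc s <-> rho s = (1%:M + w *: C) *m rho0 s.
Proof.
have [C0 [<- h]] := cc_ex s; split=> [/w_red ->|h']; first exact: h.
by apply: (w1_inj (r := rho0 s)); [exists (inv0 s); exact: inv0P | rewrite -h -h'].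
Qed.

Lemma cc_lie s : lie G res (cc s).
Proof.
have [C0 [<- h]] := cc_ex s; apply/klift_pts.
have -> : 1%:M + w *: C0 = rho s *m inv0 s by rewrite h -mulmxA (inv0P s).1 mulmx1.
exact: lg_mul (rhoG s) (lg_inv (rho0G s) (inv0P s)).
Qed.

Lemma cc_inert0 (s : elt D) : inert iota P (sval s) -> map_mx red (rho0 s) = 1%:M.
Proof. by move=> /rbI <-; apply: rho0r. Qed.

Lemma inert_iter (s : elt D) m : inert iota P (sval s) ->
  iter m (mulmx (rho s)) 1%:M = (1%:M + w *: (m%:R *: klift (cc s))) *m iter m (mulmx (rho0 s)) 1%:M.
Proof.
move=> si; have hs := (ccE s (klift (cc s))).1 (kliftE _).
elim: m => [|m IH]; first by rewrite scale0r scaler0 addr0 mul1mx.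
rewrite !iterS IH {1}hs -!mulmxA (mulmxA (rho0 s)) (w1_conj _ (inv0P s)) !mulmxA w1M; congr (_ *m _ *m _).
congr (_ + _); apply/w_red; rewrite map_mxD !map_mxM map_mxZ cc_inert0 // mul1mx.
have [_ h2] := inv0r s; rewrite rbI // mulmx1 in h2.
by rewrite h2 mulmx1 map_mxZ !rmorph_nat kliftE -add1n natrD scalerDl scale1r.
Qed.

(** On inertia the cocycle is additive on powers, and some power of [d] with exponent prime to [p]
    is trivial for both lifts. *)
Lemma cc_tame (d : elt D) : inert iota P (sval d) ->
  (forall e, exists M, ~~ (p %| M)%N /\ agree_on e (loc_one iota P) (loc_pow d M)) -> cc d = 0.
Proof.
move=> di hd; have [e1 h1] := rhoL (loc_one iota P); have [e2 h2] := rho0L (loc_one iota P).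
have [M [pM ag]] := hd (e1 ++ e2).
have a1 : rho (loc_pow d M) = 1%:M.
  by rewrite h1 ?rhoM.1 // => y ye; apply: ag; rewrite mem_cat ye.
have a2 : rho0 (loc_pow d M) = 1%:M.
  by rewrite h2 ?rho0M.1 // => y ye; apply: ag; rewrite mem_cat ye orbT.
have := inert_iter M di; rewrite -(loc_pow_mul d M rhoM) -(loc_pow_mul d M rho0M) a1 a2 mulmx1.
move=> /esym/eqP; rewrite -subr_eq0 addrC addKr => /eqP h.
have : map_mx red (M%:R *: klift (cc d)) = map_mx red 0 by apply/w_red; rewrite scaler0.
rewrite map_mxZ rmorph_nat kliftE map_mx0 => /eqP; rewrite scaler_eq0 => /orP[|/eqP//].
by rewrite -(dvdn_pcharf (witt_pchar hW)) (negPf pM).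
Qed.

(** The first-order parts of the two sides of the tame relation: [d] contributes nothing, the [n]-th
    power of [t] contributes [n] times its value, and conjugation by Frobenius gives the left
    side. *)
Lemma cc_eigen (t : elt D) : inert iota P (sval t) -> rb s0 *m cc t *m sg' = n%:R *: cc t.
Proof.
move=> ti; have [d [di hd hM]] := tame_elt hP (witt_prime hW) Pp hs0 ti.
have d0 := cc_tame di hM.
have hdr := hd _ _ _ rhoM; have hd0 := hd _ _ _ rho0M.
have E1 : rho d = rho0 d.
  have := (ccE d 0).1; rewrite map_mx0 d0 => /(_ erefl) ->.
  by rewrite scaler0 addr0 mul1mx.
have hs := (ccE s0 (klift (cc s0))).1 (kliftE _); have ht := (ccE t (klift (cc t))).1 (kliftE _).
have triv (r r' X : 'M[A]_N) : inverses r r' -> map_mx red r = 1%:M -> r *m (1%:M + w *: X) = (1%:M + w *: X) *m r.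
  move=> rr' r1; rewrite (w1_conj _ rr'); congr (_ *m _); congr (_ + _); apply/w_red.
  have r'1 : map_mx red r' = 1%:M.
    by have := congr1 (map_mx red) rr'.1; rewrite map_mxM r1 mul1mx map_mx1.
  by rewrite !map_mxM r1 r'1 mul1mx mulmx1.
set It := iter n (mulmx (rho0 t)) 1%:M in hd0.
have [It' ItI] : exists It', inverses It It'.
  have [h1 h2] := inv0P t; rewrite /It; elim: (n) => [|i [I' [IH1 IH2]]]; first by exists 1%:M; split; rewrite mulmx1.
  exists (I' *m inv0 t); split; rewrite /= !mulmxA.
    by rewrite -(mulmxA (rho0 t)) IH1 mulmx1.
  by rewrite -(mulmxA I') h2 mulmx1.
have It1 : map_mx red It = 1%:M.
  rewrite /It; elim: (n) => [|i IH]; first by rewrite map_mx1.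
  by rewrite iterS map_mxM IH cc_inert0 // mulmx1.
have EL : rho s0 *m rho t = (1%:M + w *: (klift (cc s0) + rho0 s0 *m klift (cc t) *m inv0 s0)) *m (rho0 s0 *m rho0 t).
  by rewrite hs ht -(mulmxA _ (rho0 s0)) (mulmxA (rho0 s0)) (w1_conj _ (inv0P s0)) !mulmxA w1M.
have ER : rho s0 *m rho t = (1%:M + w *: (n%:R *: klift (cc t) + klift (cc s0))) *m (rho0 s0 *m rho0 t).
  rewrite hdr E1 (inert_iter n ti) -/It hs hd0 -w1M.
  rewrite (mulmxA (rho0 d)) (triv _ _ _ (inv0P d)) ?cc_inert0 // -!mulmxA; congr (_ *m _).
  rewrite (mulmxA It) (triv _ _ _ ItI It1) -!mulmxA (mulmxA (rho0 d)) (triv _ _ _ (inv0P d)) ?cc_inert0 //.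
  by rewrite -!mulmxA.
have inv : exists r', inverses (rho0 s0 *m rho0 t) r'.
  have [a1 a2] := inv0P s0; have [b1 b2] := inv0P t; exists (inv0 t *m inv0 s0); split; rewrite !mulmxA.
    by rewrite -(mulmxA (rho0 s0)) b1 mulmx1.
  by rewrite -(mulmxA (inv0 t)) a2 mulmx1.
have := w1_inj inv (etrans (esym EL) ER); rewrite !map_mxD !map_mxM map_mxZ rmorph_nat !kliftE rho0r.
have -> : map_mx red (inv0 s0) = sg'.
  have [h1 h2] := inv0r s0; have [h3 h4] := hsg.
  by rewrite -[LHS]mul1mx -h4 -mulmxA h1 mulmx1.
by rewrite addrC => /addIr.
Qed.

Lemma red_conj_inv : map_mx red (inv0 s0) = sg'.
Proof.
have [h1 h2] := inv0r s0; have [h3 h4] := hsg.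
by rewrite -[LHS]mul1mx -h4 -mulmxA h1 mulmx1.
Qed.

(* Averaging over the finite group generated by [rb s0] moves the cocycle at [s0] into
   the Lie algebra of [T]; on inertia it takes values in the root space. *)
Lemma special_small : exists g g', Ghat G str red g g' /\
  forall s, in_Halpha x str (g *m rho s *m g') (str (kp s)).
Proof.
pose th := conj_sg (rb s0) sg'; pose c0 := cc s0.
have sgG := TG sgT.
have thL Z : lie G res Z -> lie G res (th Z) by apply: lie_ad.
(* A telescoping sum: th^i c0 - c0 is of the form Y - th Y with Y in the Lie algebra. *)
have thi i : exists Y, lie G res Y /\ iter i th c0 - c0 = Y - th Y.
  elim: i => [|i [Y [hY eY]]].
    by exists 0; split; [exact: lie0 | rewrite /th /conj_sg mulmx0 mul0mx !subrr].
  exists (Y - iter i th c0); split.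
    apply: (lieB hY); elim: (i) => [|l IH]; [exact: (cc_lie s0) | rewrite iterS; exact: (thL _ IH)].
  have thB U V : th (U - V) = th U - th V by rewrite /th /conj_sg mulmxBr mulmxBl.
  have E' (a b c d' f : 'M[k]_N) : a - b = c - d' -> f - b = c - a - (d' - f).
    move=> h; have -> : c - a - (d' - f) = (c - d') - a + f by apply/matrixP => u v; rewrite !mxE; ring.
    by rewrite -h; apply/matrixP => u v; rewrite !mxE; ring.
  by rewrite thB iterS; apply: E'.
pose Yi i := sval (cid (thi i)); have YiP i := svalP (cid (thi i)) : lie G res (Yi i) /\ iter i th c0 - c0 = Yi i - th (Yi i).
(* With this choice the change of the cocycle by the coboundary of [X1] replaces [c0] by its average
   over the conjugation orbit. *)
pose X1 := e%:R^-1 *: \sum_(i < e) Yi i.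
have X1L : lie G res X1 by apply/lieZ/lie_sum => i _; have [] := YiP i.
pose c1 := avg_sg (rb s0) sg' e c0.
have c1E : c0 + X1 - th X1 = c1.
  have -> : th X1 = e%:R^-1 *: \sum_(i < e) th (Yi i).
    by rewrite /th /conj_sg -scalemxAr -scalemxAl mulmx_sumr mulmx_suml.
  rewrite -addrA -scalerBr -sumrB (eq_bigr (fun i : 'I_e => iter i th c0 - c0)) => [|i _]; last by have [_ ->] := YiP i.
  by rewrite sumrB scalerBr sumr_const card_ord -scaler_nat scalerA mulVf // scale1r addrC subrK.
have c1fix : rb s0 *m c1 *m sg' = c1 by apply: (avg_sg_fix hsg sge e0).
have c1L : lie G res c1 by rewrite -c1E; apply: lieB (thL _ X1L); apply: lieD (cc_lie _) X1L.
have c1T := Q1 c1L c1fix.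
pose X := klift X1; pose g := 1%:M + w *: X; pose g' := 1%:M - w *: X.
have gg : inverses g g' := inverses_small X ww.
have gG : pts G str g by apply/klift_pts; rewrite kliftE.
have g'E : g' = 1%:M + w *: (- X) by rewrite /g' scalerN.
have newE s C : map_mx red C = cc s -> g *m rho s *m g' = (1%:M + w *: (C + X - rho0 s *m X *m inv0 s)) *m rho0 s.
  move=> /ccE ->; rewrite g'E -!mulmxA (w1_conj _ (inv0P s)) !mulmxA w1M.
  by rewrite w1M mulmxN mulNmx [X + C]addrC.
exists g, g'; split.
  by split=> //; rewrite /g map_mxD map_mx1 map_mxZ hw0 scale0r addr0.
have QM u s t : is_comp u s t -> in_Halpha x str (g *m rho s *m g') (str (kp s)) ->
    in_Halpha x str (g *m rho t *m g') (str (kp t)) -> in_Halpha x str (g *m rho u *m g') (str (kp u)).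
  move=> c h1 h2; rewrite (kpM c) rmorphM (rhoM.2 _ _ _ c).
  have -> : g *m (rho s *m rho t) *m g' = (g *m rho s *m g') *m (g *m rho t *m g').
    by rewrite !mulmxA -(mulmxA (g *m rho s) g' g) gg.2 mulmx1.
  exact: in_Halpha_mul.
have Q0 : in_Halpha x str (g *m rho s0 *m g') (str (kp s0)).
  rewrite (newE s0 (klift (cc s0)) (kliftE _)); set C := _ - _.
  have Cr : map_mx red C = c1 by rewrite map_mxB map_mxD !map_mxM !kliftE rho0r red_conj_inv.
  have tT : pts T str (1%:M + w *: C) by apply/klift_pts; rewrite Cr.
  (* The value of [alpha] at 1 + wC is read from its action on the root vector: it is 1 plus [w]
     times the coordinate of [C, e]. This coordinate vanishes for [c0] by assumption and is
     unchanged by a coboundary, since Frobenius scales both [e] and the coordinate form by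
     [alpha]. *)
  have at1 : chr_at alpha str (1%:M + w *: C) = 1.
    have := root_vec_conj x tT (inverses_small C ww) => /(congr1 (phi str)); rewrite phiZ phi1 mulr1 => <-.
    set ee := map_mx str _.
    have -> : (1%:M + w *: C) *m ee *m (1%:M - w *: C) = ee + w *: (C *m ee - ee *m C).
      rewrite mulmxBr mulmx1 mulmxDl mul1mx mulmxDl -!scalemxAl -!scalemxAr scalerA ww scale0r addr0.
      by rewrite scalerBr addrA.
    rewrite phiD phi1 phiZ; have -> : w * phi str (C *m ee - ee *m C) = 0; last by rewrite addr0.
    apply/hw; rewrite -(phiN _ sr) map_mxB !map_mxM Cr.
    have ere : map_mx red ee = map_mx res (root_vec x) by apply/matrixP => a b; rewrite !mxE sr.
    rewrite ere; set eb := map_mx res _ in ere *.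
    have [C2 [hC2 hphi]] := smallphi; have /ccE C2r := hC2.
    move: hphi; rewrite -(phiN _ sr) map_mxB !map_mxM C2r ere -/c0 => hphi.
    have phiB Y Z : phi res (Y - Z) = phi res Y - phi res Z by rewrite -scaleN1r phiD phiZ mulN1r.
    have brk : phi res (th X1 *m eb - eb *m th X1) = phi res (X1 *m eb - eb *m X1).
      have eE : rb s0 *m eb *m sg' = chr_at alpha res (rb s0) *: eb by apply: root_vec_conj.
      have := phiC (X1 *m eb - eb *m X1) sgT hsg.
      have -> : rb s0 *m (X1 *m eb - eb *m X1) *m sg' = chr_at alpha res (rb s0) *: (th X1 *m eb - eb *m th X1).
        rewrite scalerBr scalemxAr scalemxAl -eE mulmxBr mulmxBl /th /conj_sg !mulmxA.
        by rewrite -(mulmxA _ sg' (rb s0)) -(mulmxA (rb s0 *m eb) sg' (rb s0)) hsg.2 !mulmx1.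
      have [b hb] := chr_unit alpha sgT.
      rewrite phiZ => /(congr1 (fun z => b * z)); by rewrite !mulrA [b * _]mulrC hb !mul1r.
    rewrite -c1E mulmxBl mulmxBr mulmxDl mulmxDr.
    have -> : c0 *m eb + X1 *m eb - th X1 *m eb - (eb *m c0 + eb *m X1 - eb *m th X1) =
       (c0 *m eb - eb *m c0) + (X1 *m eb - eb *m X1) - (th X1 *m eb - eb *m th X1).
      by rewrite !opprD !opprK; move: (c0 *m eb) (X1 *m eb) (th X1 *m eb) (eb *m c0) (eb *m X1) (eb *m th X1) => m1 m2 m3 m4 m5 m6; apply/matrixP => u v; rewrite !mxE; ring.
    by rewrite phiB phiD hphi brk add0r subrr.
  have := in_Halpha_torus x (lg_mul tT t0T); rewrite chr_mul // at1 mul1r t0a //.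
have QI (t : elt D) : inert iota P (sval t) -> in_Halpha x str (g *m rho t *m g') (str (kp t)).
  move=> ti; rewrite (newE t (klift (cc t)) (kliftE _)); set C := _ - _.
  have [b bE] := Q2 (cc_lie t) (cc_eigen ti).
  have [bt hbt] := redS b.
  have -> : w *: C = (w * bt) *: map_mx str (root_vec x).
    rewrite -scalerA; apply/w_red; rewrite map_mxB map_mxD !map_mxM !kliftE cc_inert0 // mul1mx.
    have [_ h2] := inv0r t; rewrite rbI // mulmx1 in h2; rewrite h2 mulmx1 addrK bE map_mxZ hbt.
    by congr (_ *: _); apply/matrixP => u v; rewrite !mxE sr.
  rewrite -ru_small; last by rewrite mulrACA ww mul0r.
  rewrite -[str (kp t)]mul1r; apply: in_Halpha_mul (in_Halpha_unip _ _ _) (rho0H t).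
move=> s; have [m hm] := pA; have [z hz] := kpA m; have [es hes] := rhoL s.
have [s' [Qs' ag]] := loc_generated hP hn s (z :: es) hs0 QM Q0 QI.
have -> : rho s = rho s' by apply/esym/hes => y ye; apply: ag; rewrite inE ye orbT.
have -> // : str (kp s) = str (kp s').
apply/eqP; rewrite -subr_eq0 -rmorphB; apply/eqP/hm/hz; apply: ag; exact: mem_head.
Qed.
End SpecialSmall.

Lemma iter_unip_expand (A : comNzRingType) N (Z : 'M[A]_N) M :
  exists Q, iter M (mulmx (1%:M + Z)) 1%:M = 1%:M + M%:R *: Z + Z *m Z *m Q.
Proof.
elim: M => [|M [Q IH]]; first by exists 0; rewrite scale0r mulmx0 !addr0.
exists (Q + M%:R *: 1%:M + Z *m Q); rewrite iterS IH.
rewrite mulmxDl mul1mx !mulmxDr mulmx1 -!scalemxAr !mulmx1 -add1n natrD scalerDl scale1r !mulmxA.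
move: (1%:M : 'M[A]_N) (Z *m Z *m Q) (Z *m Z *m Z *m Q) (M%:R *: Z) (M%:R *: (Z *m Z)) => a b c d f.
by apply/matrixP => u v; rewrite !mxE; ring.
Qed.

(* If [(1 + Z)^M = 1] with [M] invertible then [M Z] lies in the square of any ideal containing
   the entries of [Z]. *)
Lemma coprime_unip (A : comNzRingType) N (I : A -> Prop) (Z : 'M[A]_N) M c j :
  is_ideal I -> M%:R * c = 1 :> A -> (forall a b, I (Z a b)) ->
  (forall a b, idpow I j ((iter M (mulmx (1%:M + Z)) 1%:M - 1%:M) a b)) ->
  forall a b, idpow I j (Z a b).
Proof.
move=> hI Mc hZ hM; elim: j hM => [|j IH] hM a b //.
have hj a' b' : idpow I j (Z a' b').
  by apply: IH => a'' b''; apply: (idpow_le hI (leqnSn j)); apply: hM.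
have [Q hQ] := iter_unip_expand Z M; have := hM a b; rewrite hQ (_ : 1%:M + _ + _ - 1%:M = M%:R *: Z + Z *m Z *m Q); last by rewrite addrC -addrA addKr.
have [I0 ID IM] := idpow_ideal j.+1 hI.
have sq : idpow I j.+1 ((Z *m Z *m Q) a b).
  rewrite mxE; apply: (big_ind (idpow I j.+1)) => // l _; rewrite mulrC; apply: IM.
  rewrite mxE; apply: (big_ind (idpow I j.+1)) => [||l' _]; [exact: I0 | exact: ID |].
  exact: (idmul_in (hZ _ _) (hj _ _)).
rewrite mxE => h; have {}h : idpow I j.+1 ((M%:R *: Z) a b).
  rewrite -[X in idpow _ _ X](addrK ((Z *m Z *m Q) a b)) -[X in _ + X]mulN1r.
  by apply: ID => //; apply: IM.
rewrite mxE in h; rewrite -[Z a b]mul1r -Mc [M%:R * c]mulrC -mulrA; exact: IM.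
Qed.

(** By continuity some prime-to-[p] power of [f d] is trivial modulo any given power of the maximal
    ideal; [coprime_unip] gives the same for [f d], and completeness concludes. *)
Lemma tame_trivial (p : nat) (k : finFieldType) (W : comNzRingType) (res : {rmorphism W -> k})
  (hW : is_witt_ring p res) (F : fieldExtType rat) (iota : {rmorphism F -> algC})
  (P : algC -> Prop) (A : comNzRingType) (str : {rmorphism W -> A}) (red : {rmorphism A -> k})
  (hA : is_coef res str red) N (f : elt (dec iota (FinPlace P)) -> 'M[A]_N)
  (d : elt (dec iota (FinPlace P))) :
  loc_multiplicative f -> adically_continuous (rker red) f -> map_mx red (f d) = 1%:M ->
  (forall e, exists M, ~~ (p %| M)%N /\ agree_on e (loc_one iota P) (loc_pow d M)) -> f d = 1%:M.
Proof.
move=> fm fc fd hd; have [_ _ un _ [sep _]] := hA.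
have hI : is_ideal (rker red) by apply: rker_ideal.
apply/eqP; rewrite -subr_eq0; apply/eqP/matrixP => a b; rewrite [RHS]mxE; apply: sep => j.
have [e he] := fc j (loc_one iota P); have [M [pM ag]] := hd e.
have [|c Mc] := un (M%:R : A).
  by rewrite rmorph_nat => /eqP; rewrite -(dvdn_pcharf (witt_pchar hW)) (negPf pM).
apply: (coprime_unip hI Mc) => a' b'.
  by have := congr1 (fun X : 'M_N => X a' b') fd; rewrite /rker !mxE rmorphB rmorph_nat => ->; rewrite subrr.
have := he _ ag a' b'; rewrite (loc_pow_mul d M fm) fm.1 [1%:M + _]addrC subrK.
by rewrite !mxE.
Qed.

(** * The tame relation near the root group *)

Section RootGroupRelations.
Variables (W : comNzRingType) (N : nat) (G T : lingroup W N) (alpha : lgchar T) (x : root_subgroup G alpha).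
Variables (A : comNzRingType) (str : {rmorphism W -> A}).
Local Notation e := (map_mx str (root_vec x)).

Lemma ru_nil_expand v : exists Q, ru_at x str v = 1%:M + v *: e + (v * v) *: Q.
Proof.
rewrite (ru_expand_le _ _ (leq_trans (leqnSn (ru_deg x)) (leqnSn _))) !big_ord_recl.
exists (\sum_(i < ru_deg x) v ^+ i *: map_mx str (ru_coef x i.+2)).
rewrite expr0 scale1r expr1 ru_coef0 map_mx1 addrA scaler_sumr; congr (_ + _).
by apply: eq_bigr => i _; rewrite scalerA -mulrA -!exprS.
Qed.

Lemma ru_mul_l v (Y : 'M[A]_N) : (v * v) *: Y = 0 -> ru_at x str v *m Y = Y + v *: (e *m Y).
Proof.
move=> h; have [Q ->] := ru_nil_expand v.
rewrite !mulmxDl mul1mx; have -> : (v * v) *: Q *m Y = 0 by rewrite -scalemxAl scalemxAr h mulmx0.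
by rewrite addr0 -scalemxAl.
Qed.
Lemma ru_mul_r v (Y : 'M[A]_N) : (v * v) *: Y = 0 -> Y *m ru_at x str v = Y + v *: (Y *m e).
Proof.
move=> h; have [Q ->] := ru_nil_expand v.
by rewrite !mulmxDr mulmx1 -!scalemxAr [X in _ + X]scalemxAl h mul0mx addr0.
Qed.

Lemma ru_inv v : inverses (ru_at x str v) (ru_at x str (- v)).
Proof. by split; rewrite -ru_add ?subrr ?addNr ru_zero. Qed.

Variable phi : 'M[A]_N -> A.
Hypotheses (phiD : forall Y Z, phi (Y + Z) = phi Y + phi Z) (phiZ : forall c Z, phi (c *: Z) = c * phi Z).
Variables (t0 t0' : 'M[A]_N) (n : nat).
Hypotheses (t0T : pts T str t0) (tt : inverses t0 t0') (ta : chr_at alpha str t0 = n%:R)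
  (phiC : forall Z, phi (t0 *m Z *m t0') = n%:R * phi Z).
Variables (KK : A -> Prop) (hK : is_ideal KK) (K2 : forall a b, KK a -> KK b -> a * b = 0).
Variables (z c : A) (zK : forall a, KK a -> z * z * a = 0) (nc : (n%:R - 1) * c = 1).
Local Notation br Y := (e *m Y - Y *m e).
Let KM (Y : 'M[A]_N) := forall a b, KK (Y a b).

Lemma KM2 Y Z : KM Y -> KM Z -> Y *m Z = 0.
Proof. by move=> hY hZ; apply/matrixP => a b; rewrite !mxE big1 // => l _; apply: K2. Qed.
Lemma KMl Q Y : KM Y -> KM (Q *m Y).
Proof. by have [K0 KD Km] := hK => hY a b; rewrite mxE; apply: (big_ind KK) => // l _; apply: Km. Qed.
Lemma KMr Q Y : KM Y -> KM (Y *m Q).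
Proof. by have [K0 KD Km] := hK => hY a b; rewrite mxE; apply: (big_ind KK) => // l _; rewrite mulrC; apply: Km. Qed.
Lemma KMz Y v : KM Y -> (v * z) * (v * z) *: Y = 0.
Proof. move=> hY; apply/matrixP => a b; rewrite !mxE.
by have -> : v * z * (v * z) * Y a b = v * v * (z * z * Y a b) by [ring]; rewrite zK ?mulr0. Qed.

Lemma ru_conj_small i Y : KM Y ->
  ru_at x str (i%:R * z) *m Y = (Y + (i%:R * z) *: br Y) *m ru_at x str (i%:R * z).
Proof.
move=> hY; set v := i%:R * z.
have vv Q : KM Q -> (v * v) *: Q = 0 by apply: KMz.
rewrite ru_mul_l ?vv // mulmxDl ru_mul_r ?vv // -scalemxAl mulmxBl.
rewrite !ru_mul_r ?vv //; try exact: KMl; try exact: KMr.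
have h1 := vv _ (KMr e (KMl e hY)); have h2 := vv _ (KMr e (KMr e hY)).
rewrite scalerBr !scalerDr !scalerA h1 h2 !addr0.
move: (v *: (e *m Y)) (v *: (Y *m e)) => a b; apply/matrixP => u u'; rewrite !mxE; ring.
Qed.

(** Comparing the two sides gives Ad(t0) k0 = n k0 + s_n z [e, k0] + n z [e, X], with s_n = 0 + 1 +
    ... + (n-1). The form [phi] scales by [n] under Ad(t0), so the terms in k0 cancel once z
    phi([e, k0]) = 0, which follows from bracketing the same identity with [e] since n - 1 is
    invertible. *)
Lemma tame_relation X k0 : KM X -> KM k0 ->
  (1%:M + X) *m t0 *m ((1%:M + k0) *m ru_at x str z) =
  iter n (mulmx ((1%:M + k0) *m ru_at x str z)) 1%:M *m ((1%:M + X) *m t0) ->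
  z * phi (X *m e - e *m X) = 0.
Proof.
move=> hX hk rel; have K1 Y Z : KM Y -> KM Z -> (1%:M + Y) *m (1%:M + Z) = 1%:M + (Y + Z).
  by move=> hY hZ; rewrite mulmxDl mul1mx mulmxDr mulmx1 KM2 // addr0 -addrA [Z + Y]addrC.
have [K0 KD Km] := hK.
have KMD Y Z : KM Y -> KM Z -> KM (Y + Z) by move=> hY hZ a b; rewrite mxE; apply: KD.
have KMZ v Y : KM Y -> KM (v *: Y) by move=> hY a b; rewrite mxE; apply: Km.
have KMB Y Z : KM Y -> KM Z -> KM (Y - Z) by move=> hY hZ; rewrite -scaleN1r; apply/KMD/KMZ.
have KMbr Y : KM Y -> KM (br Y) by move=> hY; apply: KMB; [apply: KMl | apply: KMr].
pose s i : A := (\sum_(l < i) l)%:R.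
(* Moving each root group factor past 1 + k0 costs a commutator [z [e, k0]]; these add up to the
   coefficient [s i]. *)
have it i : iter i (mulmx ((1%:M + k0) *m ru_at x str z)) 1%:M =
    (1%:M + (i%:R *: k0 + (s i * z) *: br k0)) *m ru_at x str (i%:R * z).
  elim: i => [|i IH].
    by rewrite /s big_ord0 !mul0r !scale0r !addr0 mul1mx ru_zero.
  have -> : iter i.+1 (mulmx ((1%:M + k0) *m ru_at x str z)) 1%:M =
     iter i (mulmx ((1%:M + k0) *m ru_at x str z)) 1%:M *m ((1%:M + k0) *m ru_at x str z).
    elim: (i) => [|i' IH']; first by rewrite /= mulmx1 mul1mx.
    by rewrite iterS {1}IH' mulmxA.
  rewrite IH -!mulmxA (mulmxA (ru_at x str (i%:R * z))) mulmxDr mulmx1 ru_conj_small //.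
  rewrite -{1}[ru_at x str (i%:R * z)]mul1mx -mulmxDl -!mulmxA -ru_add !mulmxA K1; first last.
  - by apply: KMD => //; apply/KMZ/KMbr.
  - by apply: KMD; apply: KMZ => //; apply: KMbr.
  rewrite -[i.+1 in RHS]addn1 natrD mulrDl mul1r; congr (_ *m _); congr (_ + _).
  by rewrite /s addn1 big_ord_recr /= natrD mulrDl !scalerDl scale1r addrACA.
have tz : t0 *m ru_at x str z = ru_at x str (n%:R * z) *m t0.
  by rewrite -ta -(ru_conj x z t0T tt) -mulmxA tt.2 mulmx1.
pose Ak := t0 *m k0 *m t0'.
have hAk : KM Ak by apply/KMr/KMl.
have L : (1%:M + X) *m t0 *m ((1%:M + k0) *m ru_at x str z) = (1%:M + (X + Ak)) *m (ru_at x str (n%:R * z) *m t0).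
  rewrite -(K1 X Ak) // -tz -!mulmxA; congr (_ *m _); rewrite !mulmxA; congr (_ *m _).
  by rewrite mulmxDr mulmx1 mulmxDl mul1mx /Ak -!mulmxA tt.2 mulmx1.
have R : iter n (mulmx ((1%:M + k0) *m ru_at x str z)) 1%:M *m ((1%:M + X) *m t0) =
   (1%:M + ((n%:R *: k0 + (s n * z) *: br k0) + (X + (n%:R * z) *: br X))) *m (ru_at x str (n%:R * z) *m t0).
  rewrite it -(K1 (_ + _)); first last.
  - by apply: KMD => //; apply/KMZ/KMbr.
  - by apply: KMD; apply: KMZ => //; apply: KMbr.
  rewrite -!mulmxA; congr (_ *m _); rewrite !mulmxA; congr (_ *m _).
  by rewrite mulmxDr mulmx1 ru_conj_small // mulmxDl mul1mx.
have eqn : Ak = n%:R *: k0 + (s n * z) *: br k0 + (n%:R * z) *: br X.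
  have [u1 u2] := ru_inv (n%:R * z).
  have := rel; rewrite L R => /(congr1 (fun M => M *m t0' *m ru_at x str (- (n%:R * z)))).
  rewrite -!mulmxA (mulmxA t0) tt.1 mul1mx u1 !mulmx1 => /addrI.
  by rewrite addrCA => /addrI.
have phiB Y Z : phi (Y - Z) = phi Y - phi Z by rewrite -scaleN1r phiD phiZ mulN1r.
have te : t0 *m e *m t0' = n%:R *: e by rewrite -ta; apply: root_vec_conj.
have nunit : exists n', n%:R * n' = 1 :> A by have [b hb] := chr_unit alpha t0T; exists b; rewrite -ta.
have [n' nn'] := nunit.
have brA : phi (br Ak) = phi (br k0).
  have : phi (t0 *m br k0 *m t0') = n%:R * phi (br Ak).
    have -> : t0 *m br k0 *m t0' = n%:R *: br Ak; last by rewrite phiZ.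
    rewrite scalerBr scalemxAl scalemxAr -te mulmxBr mulmxBl /Ak !mulmxA.
    by rewrite -(mulmxA _ t0' t0) -(mulmxA (t0 *m k0) t0' t0) tt.2 !mulmx1.
  rewrite phiC => /(congr1 (fun y => n' * y)).
  by rewrite !mulrA [n' * _]mulrC nn' !mul1r.
have zz Y : KM Y -> z * z * phi Y = 0.
  move=> hY; rewrite -phiZ (_ : _ *: _ = 0); last by have := KMz 1 hY; rewrite !mul1r.
  by rewrite -[X in phi X](scale0r Y) phiZ mul0r.
(* After multiplication by [z], every term of the bracketed identity carrying a further factor [z]
   dies. *)
have zk : z * phi (br k0) = 0.
  have h : z * phi (br Ak) = n%:R * (z * phi (br k0)).
    rewrite eqn; have -> : br (n%:R *: k0 + (s n * z) *: br k0 + (n%:R * z) *: br X) =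
       n%:R *: br k0 + z *: (s n *: br (br k0) + n%:R *: br (br X)).
      have brD Y Z : br (Y + Z) = br Y + br Z by rewrite mulmxDr mulmxDl opprD addrACA.
      have brZ v Y : br (v *: Y) = v *: br Y by rewrite -scalemxAr -scalemxAl scalerBr.
      rewrite (brD (n%:R *: k0 + _) _) (brD (n%:R *: k0) _) !brZ; move: (br (br X)) (br (br k0)) (br k0) => a b c'.
      by rewrite (scalerDr z) !scalerA [z * s n]mulrC [z * n%:R]mulrC addrA.
    rewrite phiD !phiZ mulrDr (mulrA z z) zz ?addr0; first by rewrite mulrCA.
    exact: (KMD _ _ (KMZ _ _ (KMbr _ (KMbr _ hk))) (KMZ _ _ (KMbr _ (KMbr _ hX)))).
  rewrite brA in h; have : (n%:R - 1) * (z * phi (br k0)) = 0 by rewrite mulrBl mul1r -h subrr.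
  by move/(congr1 (fun y => c * y)); rewrite mulrA [c * _]mulrC nc mul1r mulr0.
have := congr1 phi eqn; rewrite /Ak phiC !phiD !phiZ -mulrA zk mulr0 addr0 => /esym/eqP.
rewrite -subr_eq0 addrC addKr => /eqP h.
have {}h : z * phi (br X) = 0.
  have := congr1 (fun y => n' * y) h; rewrite mulr0 !mulrA [n' * _]mulrC nn' mul1r.
  by [].
rewrite -phiD; have -> : X *m e - e *m X = -1 *: br X by rewrite scaleN1r opprB.
by rewrite phiZ mulrCA h mulr0.
Qed.

Lemma torus_unip_inter y : pts T str (ru_at x str y) -> (forall t, pts T str t -> t *m t0 = t0 *m t) -> y = 0.
Proof.
move=> yT comm; have := ru_conj x y t0T tt; rewrite -comm // -mulmxA tt.1 mulmx1 ta => /ru_inj e1.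
have : (n%:R - 1) * y = 0 by rewrite mulrBl mul1r -e1 subrr.
by move/(congr1 (fun y => c * y)); rewrite mulrA [c * _]mulrC nc mul1r mulr0.
Qed.
End RootGroupRelations.

Section UnipotentDivisibility.
Variables (p : nat) (k : finFieldType) (W : comNzRingType) (res : {rmorphism W -> k}).
Hypothesis hW : is_witt_ring p res.
Variables (N : nat) (G T : lingroup W N) (alpha : lgchar T) (x : root_subgroup G alpha).
Local Notation id_W := (idfun : {rmorphism W -> W}).

(** The first-order term dominates: [y] is divisible by [p] and the root vector has a unit entry, so
    that entry of u(y) - 1 is [y] times a unit. *)
Lemma ru_div m y : res y = 0 ->
  (forall a b, pdiv_pow p m ((ru_at x id_W y - 1%:M) a b)) <-> pdiv_pow p m y.
Proof.
move=> y0; have idm Z : map_mx id_W Z = Z :> 'M[W]_N by apply/matrixP => u v; rewrite mxE.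
have [Q hQ] := ru_nil_expand x id_W y; rewrite idm in hQ.
have E a b : (ru_at x id_W y - 1%:M) a b = y * (root_vec x a b + y * Q a b).
  by rewrite hQ !mxE; ring.
split=> [h|[u yE] a b]; last first.
  by rewrite E {1}yE -mulrA; eexists.
have [i0 [j0 [einv hu]]] := root_vec_unit hW x.
have [|v hv] := witt_unit hW (u := root_vec x i0 j0 + y * Q i0 j0).
  rewrite rmorphD rmorphM y0 mul0r addr0 => h0; have := congr1 res hu.
  by rewrite rmorphM h0 mul0r rmorph1 => /esym/eqP; rewrite oner_eq0.
by have := h i0 j0; rewrite E => /(pdiv_powMl v); rewrite mulrCA [v * _]mulrC hv mulr1.
Qed.

(** Write B = t u(y) with [alpha] trivial on [t], so that [t] and u(y) commute. The tame relation
    forces t^n = t; as [t] is 1 modulo [p] and n - 1 is prime to [p], it is 1. *)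
Lemma tame_unipotent (t0 t0' B : 'M[W]_N) n : (exists r, split_torus_rank T r) ->
  pts T id_W t0 -> inverses t0 t0' -> chr_at alpha id_W t0 = n%:R -> n%:R != 1 :> k -> (0 < n)%N ->
  in_Halpha x id_W B 1 -> map_mx res B = 1%:M ->
  t0 *m B = iter n (mulmx B) 1%:M *m t0 -> exists2 y, res y = 0 & B = ru_at x id_W y.
Proof.
move=> [r [chi hchi]] t0T tt ta n1 n0 [t [y [tT BE ta1]]] Br rel.
have comm (A : comNzRingType) (s : {rmorphism W -> A}) u v : pts T s u -> pts T s v -> u *m v = v *m u.
  exact: (torus_comm hchi).
have rs : is_alg_hom id_W res res by [].
have [c nc] : exists c, (n%:R - 1) * c = 1 :> W.
  by apply: (witt_unit hW); rewrite rmorphB rmorph1 rmorph_nat => /eqP; rewrite subr_eq0 (negPf n1).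
have [t' tt'] := tT.1.
have tu v : t *m ru_at x id_W v = ru_at x id_W v *m t.
  by have := ru_conj x v tT tt'; rewrite ta1 mul1r => e; rewrite -{2}e -mulmxA tt'.2 mulmx1.
(* Residually u(y) is the inverse of [t], so it commutes with [t0], on which [alpha] is not 1. *)
have r1 : res y = 0 /\ map_mx res t = 1%:M.
  have h : map_mx res t *m ru_at x res (res y) = 1%:M by rewrite (ru_nat x y rs) -map_mxM -BE.
  have tTr := pts_nat rs tT; have ttr : inverses (map_mx res t) (map_mx res t') by split; rewrite -map_mxM ?tt'.1 ?tt'.2 map_mx1.
  have uE : ru_at x res (res y) = map_mx res t' by rewrite -[LHS]mul1mx -ttr.2 -mulmxA h mulmx1.
  have y0 : res y = 0.
    have ttr0 : inverses (map_mx res t0) (map_mx res t0') by split; rewrite -map_mxM ?tt.1 ?tt.2 map_mx1.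
    have tar : chr_at alpha res (map_mx res t0) = n%:R by rewrite (chr_nat alpha rs t0T) ta rmorph_nat.
    apply: (torus_unip_inter (x := x) (n := n) (c := res c) (pts_nat rs t0T) ttr0 tar) => [||u uT].
    - by rewrite -(rmorph_nat res) -(rmorph1 res) -rmorphB -rmorphM nc rmorph1.
    - by rewrite uE; apply: lg_inv tTr ttr.
    - exact: comm uT (pts_nat rs t0T).
  by split=> //; move: h; rewrite y0 ru_zero mulmx1.
have it i : iter i (mulmx B) 1%:M = iter i (mulmx t) 1%:M *m ru_at x id_W (i%:R * y).
  elim: i => [|i IH]; first by rewrite mul0r ru_zero mulmx1.
  rewrite !iterS IH BE -!mulmxA (mulmxA (ru_at x id_W y)).
  have -> : ru_at x id_W y *m iter i (mulmx t) 1%:M = iter i (mulmx t) 1%:M *m ru_at x id_W y.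
    elim: (i) => [|i' IH']; first by rewrite mulmx1 mul1mx.
    by rewrite iterS mulmxA -tu -mulmxA IH' !mulmxA.
  by rewrite -!mulmxA -ru_add -[i.+1]add1n natrD mulrDl mul1r.
have tn : pts T id_W (iter n (mulmx t) 1%:M).
  by elim: (n) => [|i IH]; [exact: lg_one | exact: lg_mul].
have t1 : iter n (mulmx t) 1%:M = t.
  have e1 : t *m ru_at x id_W (n%:R * y) *m t0 = iter n (mulmx t) 1%:M *m ru_at x id_W (n%:R * y) *m t0.
    rewrite -it -rel BE mulmxA (comm _ _ _ _ t0T tT) -!mulmxA; congr (_ *m _).
    by rewrite -ta -(ru_conj x y t0T tt) -mulmxA tt.2 mulmx1.
  have [u1 u2] := ru_inv x id_W (n%:R * y).
  have := congr1 (fun M => M *m t0' *m ru_at x id_W (- (n%:R * y))) e1.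
  by rewrite -!mulmxA (mulmxA t0) tt.1 mul1mx u1 !mulmx1 => /esym h0.
have tone : t = 1%:M.
  have tn1 : iter n.-1 (mulmx t) 1%:M = 1%:M.
    have := t1; case: (n) n0 => //= i _ h; have := congr1 (fun M => t' *m M) h.
    by rewrite mulmxA tt'.2 mul1mx.
  have [res1 res2] := r1; have hI := pdiv_pow_ideal W p 1.
  apply/eqP; rewrite -subr_eq0; apply/eqP/matrixP => a b; rewrite [RHS]mxE; apply: (witt_sep hW) => j.
  apply/pdiv_idpow; apply: (@coprime_unip _ _ _ _ n.-1 c) => // [|a' b'|a' b'].
  - by rewrite -subn1 natrB.
  - apply/(witt_res0 hW); have := congr1 (fun M : 'M_N => M a' b') res2.
    by rewrite !mxE rmorphB rmorph_nat => ->; rewrite subrr.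
  - rewrite [1%:M + _]addrC subrK tn1 subrr mxE; have [h _ _] := idpow_ideal j hI; exact: h.
by exists y; [case: r1 | rewrite BE tone mul1mx].
Qed.
End UnipotentDivisibility.

(** * The conormal module of a section *)

Lemma ideal_sum (A : comNzRingType) (I : A -> Prop) (T : finType) (f : T -> A) :
  is_ideal I -> (forall t, I (f t)) -> I (\sum_t f t).
Proof. by move=> [I0 ID _] h; apply: (big_ind I). Qed.

Lemma idealB (A : comNzRingType) (I : A -> Prop) x y : is_ideal I -> I x -> I y -> I (x - y).
Proof. by move=> [_ ID IM] hx hy; apply: ID => //; rewrite -mulN1r; apply: IM. Qed.

Lemma idmul_subr (A : comNzRingType) (I J : A -> Prop) x : is_ideal J -> idmul I J x -> J x.
Proof.
move=> [J0 JD JM] [r [hr ->]]; rewrite big_seq; apply: (big_ind J) => // u ur.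
by apply: JM; case: (hr u ur).
Qed.

Lemma ideal_add_principal (A : comNzRingType) (I : A -> Prop) (L : A -> Prop) e :
  is_ideal I -> is_ideal L -> is_ideal (fun x => exists r, L r /\ I (x - r * e)).
Proof.
move=> [I0 ID IM] [L0 LD LM]; split.
- by exists 0; rewrite mul0r subr0.
- move=> x y [r [hr h]] [r' [hr' h']]; exists (r + r'); split; first exact: LD.
  by rewrite mulrDl opprD addrACA; apply: ID.
- move=> a x [r [hr h]]; exists (a * r); split; first exact: LM.
  by rewrite -mulrA -mulrBr; apply: IM.
Qed.

(* Otherwise add the generators of [K] to [J] one at a time, up to the last step at which the
   ideal is still proper in [K]. *)
Lemma noetherian_step (A : comNzRingType) (J K : A -> Prop) :
  noetherian A -> is_ideal J -> is_ideal K -> (forall x, J x -> K x) ->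
  (forall (J' : A -> Prop) e, is_ideal J' -> (forall x, J x -> J' x) -> (forall x, J' x -> K x) -> K e -> ~ J' e ->
     (forall x, K x -> exists r, J' (x - r * e)) -> False) ->
  forall x, K x -> J x.
Proof.
move=> noe hJ hK JK step; have [n [g hg]] := noe K hK.
have gK i : K (g i).
  apply/hg; exists (fun j => (j == i)%:R); rewrite (bigD1 i) //= eqxx mul1r big1 ?addr0 // => j /negPf ->.
  by rewrite mul0r.
pose J_ l x := exists c : 'I_n -> A, J (x - \sum_(i < n | (i < l)%N) c i * g i).
have [J0 JD JM] := hJ; have [K0 KD KM] := hK.
have hJl l : is_ideal (J_ l).
  split.
  - by exists (fun _ => 0); rewrite big1 ?subr0 // => i _; rewrite mul0r.
  - move=> x y [c hc] [c' hc']; exists (fun i => c i + c' i).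
    rewrite (eq_bigr (fun i => c i * g i + c' i * g i)) => [|i _]; last by rewrite mulrDl.
    by rewrite big_split opprD addrACA; apply: JD.
  - move=> a x [c hc]; exists (fun i => a * c i).
    rewrite (eq_bigr (fun i => a * (c i * g i))) => [|i _]; last by rewrite mulrA.
    by rewrite -mulr_sumr -mulrBr; apply: JM.
have JJ l x : J x -> J_ l x.
  by move=> hx; exists (fun _ => 0); rewrite big1 ?subr0 // => i _; rewrite mul0r.
have JlK l x : J_ l x -> K x.
  move=> [c hc]; rewrite -(subrK (\sum_(i < n | (i < l)%N) c i * g i) x); apply: (KD _ _ (JK _ hc)).
  by apply: (big_ind K) => // i _; apply: KM.
have sub l x : J_ l.+1 x -> (forall i : 'I_n, i = l :> nat -> J_ l (g i)) -> J_ l x.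
  move=> [c hc] hl; have [I0 ID IM] := hJl l.
  have -> : x = (x - \sum_(i < n | (i < l.+1)%N) c i * g i) + \sum_(i < n | (i < l.+1)%N) c i * g i by rewrite subrK.
  apply: (ID _ _ (JJ _ _ hc)).
  apply: (big_ind (J_ l)) => // i; rewrite ltnS leq_eqVlt => /orP[/eqP il|il].
    by apply/IM/hl.
  apply: IM; exists (fun j => (j == i)%:R); rewrite (bigD1 i) //= eqxx mul1r big1 ?addr0 ?subrr // => j /andP[_ /negPf ->].
  by rewrite mul0r.
have full x : K x -> J_ n x.
  move=> /hg [c ->]; exists c.
  have -> : \sum_(i < n | (i < n)%N) c i * g i = \sum_i c i * g i by apply: eq_bigl => i; rewrite ltn_ord.
  by rewrite subrr.
have down l : (l <= n)%N -> forall x, K x -> J_ (n - l)%N x.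
  elim: l => [|l IH] ln; first by rewrite subn0.
  move=> x /(IH (ltnW ln)); have -> : (n - l = (n - l.+1).+1)%N by lia.
  move=> hx; apply: (sub _ _ hx) => i il; apply: contrapT => ni.
  apply: (step (J_ (n - l.+1)%N) (g i)) => // [y|y|y /(IH (ltnW ln))]; [exact: JJ | exact: JlK |].
  have -> : (n - l = (n - l.+1).+1)%N by lia.
  move=> [c hc]; exists (c i); exists c; rewrite (bigD1 i) /= in hc; last by rewrite il.
  rewrite opprD addrA in hc; rewrite (eq_bigl (fun j : 'I_n => (j < (n - l.+1).+1)%N && (j != i))) //.
  by move=> j; rewrite -(inj_eq val_inj) /=; lia.
move=> x /(down n (leqnn n)); rewrite subnn => -[c].
by rewrite big_pred0 ?subr0.
Qed.

Section SectionOfSurjection.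
Variables (R W : comNzRingType) (pi : {rmorphism R -> W}) (str : {rmorphism W -> R}).
Hypothesis ps : forall w, pi (str w) = w.
Hypothesis dom : forall x y : W, x * y = 0 -> x = 0 \/ y = 0.
Local Notation K := (rker pi).

Lemma section_split r : K (r - str (pi r)). Proof. by rewrite /rker rmorphB ps subrr. Qed.

Lemma spec_imageP P : spec_image pi P <-> forall x, K x -> sval P x.
Proof.
case: P => P [[P0 PD PM] P1 Pp]; split=> /= [[[P' [[P'0 _ _] _ _]] /= hP] x Kx|KP].
  by apply/hP; rewrite Kx.
have E x : P x <-> P (str (pi x)).
  split=> h; last by rewrite -(subrK (str (pi x)) x); apply: PD => //; apply/KP/section_split.
  rewrite (_ : str (pi x) = x + (-1) * (x - str (pi x))); last by ring.
  by apply: PD => //; apply/PM/KP/section_split.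
have pr : is_prime_ideal (fun w => P (str w)).
  split; [split | |]; rewrite ?rmorph0 ?rmorph1 //.
  - by move=> x y hx hy; rewrite rmorphD; apply: PD.
  - by move=> a x hx; rewrite rmorphM; apply: PM.
  - by move=> x y; rewrite rmorphM; apply: Pp.
by exists (exist _ _ pr) => x; apply: E.
Qed.

(* An element killing [K] but not lying in it covers the complement of [V(K)] by a closed set
   missing the generic point of [V(K)]. *)
Lemma component_of_section s : pi s <> 0 -> (forall x, K x -> s * x = 0) ->
  irreducible_component (spec_image pi).
Proof.
move=> s0 sK; have hK : is_ideal K by apply: rker_ideal.
have Kp : is_prime_ideal K.
  split=> //; first by rewrite /rker rmorph1 => /eqP; rewrite oner_eq0.
  by move=> x y; rewrite /rker rmorphM => /dom.
pose P0 : spec R := exist _ K Kp.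
have P0i : spec_image pi P0 by apply/spec_imageP.
have cl : spec_closed (spec_image pi) by exists K => P; apply: spec_imageP.
split=> //.
  split; first by exists P0.
  move=> Z1 Z2 [E1 h1] [E2 h2] cov; case: (cov P0 P0i) => h; [left|right] => P /spec_imageP hP.
    by apply/h1 => x /((h1 P0).1 h x) /hP.
  by apply/h2 => x /((h2 P0).1 h x) /hP.
move=> Z' Z'c [_ irr] ZZ' P hP.
have cl2 : spec_closed (fun P : spec R => sval P s).
  by exists (fun x => x = s) => Q; split=> [h x ->|h] //; apply: h.
have [|h|h] := irr _ _ cl cl2; first 1 last.
- exact: h.
- by case: s0; apply: (h P0); apply: ZZ'.
move=> Q _; case: (EM (sval Q s)) => hs; [by right | left]; apply/spec_imageP => x Kx.
case: (svalP Q) => [[Q0 _ _] _ Qp].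
by have := Qp s x; rewrite sK // => /(_ Q0) [].
Qed.
End SectionOfSurjection.

(** * Consequences of a triangular system of sections *)

Section Triangular.
Variables (p : nat) (k : finFieldType) (W : comNzRingType) (res : {rmorphism W -> k}) (hW : is_witt_ring p res).
Variables (R : comNzRingType) (str : {rmorphism W -> R}) (pi : {rmorphism R -> W}) (ps : forall w, pi (str w) = w).
Local Notation K := (rker pi).
Variables (m D : nat) (y : 'I_m -> R) (yK : forall i, K (y i))
  (gen : forall x, K x -> exists c : 'I_m -> R, x = \sum_i c i * y i)
  (pK : forall x, K x -> idmul K K ((p ^ D)%:R * x)) (D0 : (0 < D)%N).

Lemma section_gen x : K x -> exists w : 'I_m -> W, idmul K K (x - \sum_i str (w i) * y i).
Proof.
move=> /gen [c ->]; exists (fun i => pi (c i)); rewrite -sumrB.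
apply: ideal_sum; first by apply: idmul_ideal; apply: rker_ideal.
by move=> i; rewrite -mulrBl; apply: idmul_in => //; apply: section_split.
Qed.

Lemma section_finite : finite_subquotient K (idmul K K).
Proof.
have hK : is_ideal K by apply: rker_ideal.
have [K20 K2D K2M] := idmul_ideal hK hK.
have [s hs] := witt_reps hW D.
exists [seq \sum_i str (val (g i)) * y i | g : {ffun 'I_m -> seq_sub s}] => x Kx.
have [w hw] := section_gen Kx.
have ex i : exists u : seq_sub s, pdiv_pow p D (w i - val u).
  by have [v vs hv] := hs (w i); exists (SeqSub vs).
pose u i := sval (cid (ex i)); have uP i : pdiv_pow p D (w i - val (u i)) := svalP (cid (ex i)).
exists (\sum_i str (val ([ffun i => u i] i)) * y i); first by apply/codomP; eexists.
rewrite -(subrK (\sum_i str (w i) * y i) x) -addrA; apply: K2D => //.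
rewrite -sumrB; apply: ideal_sum; first exact: idmul_ideal.
move=> i; rewrite ffunE -mulrBl -rmorphB; have [z ->] := uP i.
by rewrite rmorphM rmorph_nat -mulrA; apply/pK; case: hK => _ _; apply.
Qed.

Lemma section_component : irreducible_component (spec_image pi).
Proof.
have hK : is_ideal K by apply: rker_ideal.
have [K0 KD KM] := hK.
have ex j : exists c : 'I_m -> R, (forall l, K (c l)) /\ (p ^ D)%:R * y j = \sum_l c l * y l.
  have [r [hr ->]] := pK (yK j).
  elim: r hr => [|u r IH] hr.
    by exists (fun _ => 0); split=> //; rewrite big_nil big1 // => l _; rewrite mul0r.
  have [|c [cK ce]] := IH; first by move=> v vr; apply: hr; rewrite inE vr orbT.
  have [u1 u2] := hr u (mem_head _ _); have [b hb] := gen u2.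
  exists (fun l => u.1 * b l + c l); split; first by move=> l; apply: KD => //; rewrite mulrC; apply: KM.
  rewrite big_cons ce {1}hb mulr_sumr -big_split; apply: eq_bigr => l _ /=.
  by rewrite mulrDl mulrA.
pose c j := sval (cid (ex j)); have cP j : (forall l, K (c j l)) /\ _ := svalP (cid (ex j)).
pose B : 'M[R]_m := \matrix_(j, l) ((p ^ D)%:R *+ (j == l) - c j l).
pose Y : 'cV[R]_m := \col_l y l.
have BY : B *m Y = 0.
  apply/matrixP => j o; rewrite !mxE (eq_bigr (fun l => (p ^ D)%:R *+ (j == l) * y l - c j l * y l)); last first.
    by move=> l _; rewrite !mxE mulrBl.
  rewrite sumrB -(cP j).2 (bigD1 j) //= eqxx mulr1n big1 ?addr0 ?subrr // => l.
  by rewrite eq_sym => /negPf ->; rewrite mulr0n mul0r.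
have sy j : \det B * y j = 0.
  have := congr1 (mulmx (\adj B)) BY; rewrite mulmxA mul_adj_mx mulmx0 mul_scalar_mx => /matrixP/(_ j 0).
  by rewrite !mxE.
apply: (component_of_section ps _ (s := \det B)) => [||x /gen [b ->]].
- exact: (witt_domain hW).
(* The [c j l] lie in the kernel of [pi], so the matrix becomes the scalar p^D and its determinant
   is nonzero in [W]. *)
- rewrite -det_map_mx (_ : map_mx pi B = ((p ^ D)%:R)%:M) ?det_scalar.
    rewrite -natrX => h; have := witt_nat hW h; move/eqP; rewrite -expnM expn_eq0.
    by rewrite eqn0Ngt prime_gt0 ?(witt_prime hW).
  by apply/matrixP => j l; rewrite !mxE rmorphB (cP j).1 subr0 rmorphMn rmorph_nat.
- by rewrite mulr_sumr big1 // => i _; rewrite mulrCA sy mulr0.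
Qed.

Variables (X : 'I_m -> {rmorphism R -> W}) (Xs : forall i w, X i (str w) = w)
  (Xp : forall i r, pdiv_pow p D (X i r - pi r))
  (Xlt : forall i j : 'I_m, (j < i)%N -> pdiv_pow p D.+1 (X i (y j)))
  (Xdiag : forall i, ~ pdiv_pow p D.+1 (X i (y i))).

Lemma section_iso : subquotient_iso p str K (idmul K K) (fun _ : 'I_m => D).
Proof.
have hK : is_ideal K by apply: rker_ideal.
have [K0 KD KM] := hK; have hK2 := idmul_ideal hK hK; have [K20 K2D K2M] := hK2.
have XK x i : K x -> pdiv_pow p D (X i x) by move=> h; have := Xp i x; rewrite h subr0.
have ex x i : exists w, K x -> X i x = (p ^ D)%:R * w.
  by case: (EM (K x)) => [/(XK x i) [w hw]|nK]; [exists w | exists 0].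
pose f x i : W := sval (cid (ex x i)).
have fP x i : K x -> X i x = (p ^ D)%:R * f x i := svalP (cid (ex x i)).
have inj (a b : W) : (p ^ D)%:R * a = (p ^ D)%:R * b -> a = b.
  move=> h; apply/eqP; rewrite -subr_eq0; apply/eqP/(witt_ptorsion hW (n := D)).
  by rewrite mulrBr h subrr.
have fD x y' i : K x -> K y' -> f (x + y') i = f x i + f y' i.
  by move=> hx hy; apply: inj; rewrite -fP ?rmorphD ?mulrDr -?fP //; apply: KD.
have fM w x i : K x -> f (str w * x) i = w * f x i.
  by move=> hx; apply: inj; rewrite -fP ?rmorphM ?Xs; [rewrite mulrCA -fP | apply: KM].
have K2K x : idmul K K x -> K x by apply: idmul_subr.
(* [X i] sends K into p^D W and K^2 into p^(2D) W; dividing by p^D leaves p^D. *)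
have fK2 x i : idmul K K x -> pdiv_pow p D (f x i).
  move=> hx; apply: (witt_pdivK hW (m := D)); rewrite -fP; last exact: K2K.
  have [r [hr ->]] := hx; rewrite rmorph_sum big_seq.
  apply: (big_ind (fun z => pdiv_pow p (D + D) z)).
  - exact: pdiv_pow_0.
  - by move=> *; apply: pdiv_powD.
  - by move=> u ur; rewrite rmorphM; have [h1 h2] := hr u ur; apply: pdiv_powM; apply: XK.
pose A : 'M[W]_m := \matrix_(i, j) f (y j) i.
have fsum (w : 'I_m -> W) i : f (\sum_j str (w j) * y j) i = \sum_j f (y j) i * w j.
  have : forall r : seq 'I_m, K (\sum_(j <- r) str (w j) * y j) /\ f (\sum_(j <- r) str (w j) * y j) i = \sum_(j <- r) f (y j) i * w j.
    elim=> [|j r [IH1 IH2]].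
      rewrite !big_nil; split=> //; apply: inj; rewrite -fP // rmorph0 mulr0 //.
    have h : K (str (w j) * y j) by apply: KM.
    by rewrite !big_cons; split; [apply: KD | rewrite fD // fM // IH2 mulrC].
  by case/(_ (index_enum _)).
have [v dv] : exists v, \det A * v = 1.
  apply: (witt_unit hW); rewrite -det_map_mx -det_tr det_trig; last first.
    apply/is_trig_mxP => j i ji; rewrite !mxE; apply/(witt_res0 hW)/(witt_pdivK hW (m := D)).
    by rewrite -fP // addn1; apply: Xlt.
  move/eqP; rewrite prodf_seq_eq0 => /hasP[i _ /andP[_ /eqP]]; rewrite !mxE => /(witt_res0 hW) [u hu].
  by apply: (Xdiag (i := i)); rewrite fP // hu; exists u; rewrite mulrA -natrM -expnD addn1.
pose A' := v *: \adj A.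
have AA' : A *m A' = 1%:M by rewrite -scalemxAr mul_mx_adj scale_scalar_mx mulrC dv.
have A'A : A' *m A = 1%:M by rewrite -scalemxAl mul_adj_mx scale_scalar_mx mulrC dv.
have sumK (w : 'I_m -> W) : K (\sum_j str (w j) * y j) by apply: ideal_sum => // j; apply: KM.
exists f; split.
- by move=> x y' hx hy j; rewrite fD // subrr; apply: pdiv_pow_0.
- by move=> w x hx j; rewrite fM // subrr; apply: pdiv_pow_0.
- move=> x hx; split=> [h j|h]; first exact: fK2.
  have [w hw] := section_gen hx.
  have Aw i : pdiv_pow p D ((A *m \col_j w j) i 0).
    rewrite mxE (eq_bigr (fun j => f (y j) i * w j)); last by move=> j _; rewrite !mxE.
    have := fK2 _ i hw; have -> : f (x - \sum_j str (w j) * y j) i = f x i - \sum_j f (y j) i * w j.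
      by apply: inj; rewrite mulrBr -fsum -!fP // ?rmorphB //; apply: idealB.
    by move=> h2; rewrite -[X in pdiv_pow _ _ X](subKr (f x i)); apply: pdiv_powB (h i) h2.
  have wD j : pdiv_pow p D (w j).
    have -> : w j = (A' *m (A *m \col_j w j)) j 0 by rewrite mulmxA A'A mul1mx mxE.
    rewrite mxE; apply: ideal_sum; first exact: pdiv_pow_ideal.
    by move=> i; apply: pdiv_powMl.
  rewrite -(subrK (\sum_i str (w i) * y i) x); apply: K2D => //.
  apply: ideal_sum => // j; have [z ->] := wD j; rewrite rmorphM rmorph_nat -mulrA; apply: pK; exact: KM.
- move=> a; exists (\sum_j str ((A' *m \col_i a i) j 0) * y j) => // i; rewrite fsum.
  have -> : \sum_j f (y j) i * (A' *m \col_i0 a i0) j 0 = (A *m (A' *m \col_i0 a i0)) i 0.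
    by rewrite [RHS]mxE; apply: eq_bigr => j _; rewrite !mxE.
  by rewrite mulmxA AA' mul1mx mxE subrr; apply: pdiv_pow_0.
Qed.
End Triangular.

(** * Functoriality of deformations *)

Section Functoriality.
Variables (k : finFieldType) (W : comNzRingType) (res : {rmorphism W -> k}).
Variables (F : fieldExtType rat) (iota : {rmorphism F -> algC}).
Variables (N M : nat) (G : lingroup W N) (C : lingroup W M) (mu : lghom G C).
Variables (rhob : elt (absgal iota) -> 'M[k]_N) (nu : elt (absgal iota) -> 'M[W]_M).

Section Equiv.
Variables (H : aut -> Prop) (A : comNzRingType) (str : {rmorphism W -> A}) (red : {rmorphism A -> k}).

Lemma Ghat_mul (g g' h h' : 'M[A]_N) : Ghat G str red g g' -> Ghat G str red h h' -> Ghat G str red (g *m h) (h' *m g').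
Proof.
move=> [gG [gg g'g] gr] [hG [hh h'h] hr]; split; first exact: lg_mul.
- by split; rewrite !mulmxA; [rewrite -(mulmxA g) hh mulmx1 | rewrite -(mulmxA h') g'g mulmx1].
- by rewrite map_mxM gr hr mulmx1.
Qed.

Lemma Ghat_inv (g g' : 'M[A]_N) : Ghat G str red g g' -> Ghat G str red g' g.
Proof.
move=> [gG [gg g'g] gr]; split=> //; first exact: lg_inv gG _.
by have := congr1 (map_mx red) gg; rewrite map_mxM gr mul1mx map_mx1.
Qed.

Lemma Ghat_one : Ghat G str red 1%:M 1%:M.
Proof. by split; [exact: lg_one | split; rewrite mulmx1 | exact: map_mx1]. Qed.

Lemma strictly_equiv_refl (f : elt H -> 'M[A]_N) : strictly_equiv G str red f f.
Proof. by exists 1%:M, 1%:M; split=> [|s]; [exact: Ghat_one | rewrite mul1mx mulmx1]. Qed.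

Lemma strictly_equiv_sym (f g : elt H -> 'M[A]_N) : strictly_equiv G str red f g -> strictly_equiv G str red g f.
Proof.
move=> [a [a' [aG h]]]; exists a', a; split=> [|s]; first exact: Ghat_inv.
by have [_ [_ a'a] _] := aG; rewrite h !mulmxA a'a mul1mx -mulmxA a'a mulmx1.
Qed.

Lemma strictly_equiv_trans (f g h : elt H -> 'M[A]_N) :
  strictly_equiv G str red f g -> strictly_equiv G str red g h -> strictly_equiv G str red f h.
Proof.
move=> [a [a' [aG ha]]] [b [b' [bG hb]]]; exists (b *m a), (a' *m b'); split=> [|s]; first exact: Ghat_mul.
by rewrite hb ha !mulmxA.
Qed.
End Equiv.

Section Push.
Variables (A B : comNzRingType) (strA : {rmorphism W -> A}) (redA : {rmorphism A -> k}).
Variables (strB : {rmorphism W -> B}) (redB : {rmorphism B -> k}) (f : {rmorphism A -> B}).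
Hypothesis hf : is_coef_hom strA redA strB redB f.
Lemma Ghat_push (g g' : 'M[A]_N) : Ghat G strA redA g g' -> Ghat G strB redB (map_mx f g) (map_mx f g').
Proof.
have [f1 f2] := hf; move=> [gG [gg g'g] gr]; split.
- exact: pts_nat f1 gG.
- by split; rewrite -map_mxM ?gg ?g'g map_mx1.
- by rewrite -gr; apply/matrixP => i j; rewrite !mxE f2.
Qed.

Lemma strictly_equiv_push (H : aut -> Prop) (r r' : elt H -> 'M[A]_N) : strictly_equiv G strA redA r r' ->
  strictly_equiv G strB redB (fun s => map_mx f (r s)) (fun s => map_mx f (r' s)).
Proof.
move=> [a [a' [aG h]]]; exists (map_mx f a), (map_mx f a'); split; first exact: Ghat_push.
by move=> s; rewrite h !map_mxM.
Qed.

Lemma idpow_push n x : idpow (rker redA) n x -> idpow (rker redB) n (f x).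
Proof.
have [_ f2] := hf; elim: n x => [|n IH] x //= [r [hr ->]].
exists [seq (f u.1, f u.2) | u <- r]; split; last first.
  by rewrite rmorph_sum big_map; apply: eq_bigr => u _; rewrite rmorphM.
move=> _ /mapP[u /hr [h1 h2] ->]; split; last exact: IH.
by rewrite /rker /= f2.
Qed.

Lemma is_lift_push (H : aut -> Prop) (rb : elt H -> 'M[k]_N) (nn : elt H -> 'M[W]_M) (r : elt H -> 'M[A]_N) :
  is_lift mu rb nn strA redA r -> is_lift mu rb nn strB redB (fun s => map_mx f (r s)).
Proof.
have [f1 f2] := hf; move=> [[rG rM rC] rr rn]; split.
- split=> [s|u s t c|n s]; first exact: pts_nat f1 (rG s).
    by rewrite (rM _ _ _ c) map_mxM.
  have [e he] := rC n s; exists e => t /he h i j.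
  by have := idpow_push (h i j); rewrite !mxE rmorphB.
- by move=> s; rewrite -rr; apply/matrixP => i j; rewrite !mxE f2.
- move=> s; rewrite (hom_nat mu (s := strA) (s' := strB) f1 (rG s)) rn.
  by apply/matrixP => i j; rewrite !mxE f1.
Qed.

(** Representability applied to the identity of [A] shows that the ideal attached to [r] is 0, so
    every image of [r] satisfies the condition. *)
Lemma condition_push v (D : loc_cond iota k W N v) r : is_deformation_condition res mu rhob nu D ->
  is_coef res strB redB -> D A strA redA r -> D B strB redB (fun s => map_mx f (r s)).
Proof.
move=> [D1 _ _ D4] hB hr; have [hA hl] := D1 _ _ _ _ hr; have [I [_ hI]] := D4 _ _ _ _ hA hl.
have rid : (fun s => map_mx (idfun : {rmorphism A -> A}) (r s)) = r.
  by apply: funext => s; apply/matrixP => i j; rewrite mxE.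
have I0 : forall x, I x -> x = 0.
  by apply/(hI _ _ _ (idfun : {rmorphism A -> A}) hA) => //; rewrite rid.
by apply/(hI _ _ _ f hB hf) => x /I0 ->; rewrite rmorph0.
Qed.
End Push.

Lemma is_lift_restr (v : place) (A : comNzRingType) (str : {rmorphism W -> A}) (red : {rmorphism A -> k}) r :
  is_lift mu rhob nu str red r -> loc_lift mu rhob nu str red (restr (v := v) r).
Proof.
move=> [[rG rM rC] rr rn]; split; [split | |] => [s|u s t c|n s|s|s]; rewrite /restr //.
  by apply: rM.
have [e he] := rC n (exist _ (sval s) (proj1 (svalP s))); exists e => t h; exact: he.
Qed.

Lemma strictly_equiv_restr v (A : comNzRingType) (str : {rmorphism W -> A}) (red : {rmorphism A -> k})
  (r r' : elt (absgal iota) -> 'M[A]_N) : strictly_equiv G str red r r' ->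
  strictly_equiv G str red (restr (v := v) r) (restr r').
Proof. by move=> [a [a' [aG h]]]; exists a, a'; split=> // s; apply: h. Qed.

Lemma factors_mono (I J : Type) (v : I -> place) (w : J -> place) (X : Type) (f : elt (absgal iota) -> X) :
  (forall i, exists j, v i = w j) -> factors v f -> factors w f.
Proof.
move=> vw hf s t h; apply: hf => x hx; apply: h => P Pp nP u ui; apply: hx ui => // i.
by have [j ->] := vw i.
Qed.

Lemma lift_mul (H : aut -> Prop) (rb : elt H -> 'M[k]_N) (nn : elt H -> 'M[W]_M) (A : comNzRingType)
  (str : {rmorphism W -> A}) (red : {rmorphism A -> k}) r (u : elt H) : is_lift mu rb nn str red r -> (forall x, sval u x = x) ->
  r u = 1%:M.
Proof.
move=> [[rG rM _] _ _] hu; have [[h [_ hr]] _] := rG u.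
have c : is_comp u u u by move=> x; rewrite !hu.
by rewrite -hr {2}(rM _ _ _ c) mulmxA hr mul1mx.
Qed.

Lemma conj_lift_multiplicative P (A : comNzRingType) (str : {rmorphism W -> A}) (red : {rmorphism A -> k}) r a a' :
  is_lift mu rhob nu str red r -> inverses a a' ->
  loc_multiplicative (fun s : elt (dec iota (FinPlace P)) => a *m restr r s *m a').
Proof.
move=> rl [aa a'a]; split.
  by rewrite (lift_mul (@is_lift_restr (FinPlace P) _ _ _ _ rl)) // mulmx1.
have [[_ rM _] _ _] := @is_lift_restr (FinPlace P) _ _ _ _ rl => u s t c.
rewrite (rM _ _ _ c) !mulmxA.
by rewrite -(mulmxA (a *m _) a' a) a'a mulmx1.
Qed.

Lemma conj_lift_continuous v (A : comNzRingType) (str : {rmorphism W -> A}) (red : {rmorphism A -> k}) r (a a' : 'M[A]_N) :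
  is_lift mu rhob nu str red r ->
  adically_continuous (rker red) (fun s : elt (dec iota v) => a *m restr r s *m a' : 'M[A]_N).
Proof.
move=> rl n s; have [[_ _ rC] _ _] := @is_lift_restr v _ _ _ _ rl; have [e he] := rC n s.
exists e => t /he h i j; have hI := idpow_ideal n (rker_ideal red); have [I0 ID IM] := hI.
have -> : (a *m restr r t *m a') i j - (a *m restr r s *m a') i j = (a *m (restr r t - restr r s) *m a') i j.
  by rewrite mulmxBr mulmxBl [RHS]mxE [X in _ = _ + X]mxE.
rewrite mxE; apply: (big_ind (idpow (rker red) n)) => // l _; rewrite mulrC; apply: (IM).
rewrite mxE; apply: (big_ind (idpow (rker red) n)) => // l' _; apply: (IM).
by have := h l' l; rewrite !mxE.
Qed.
End Functoriality.

(** * Local structure at a nice prime *)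

Section NiceLocal.
Variables (p : nat) (k : finFieldType) (W : comNzRingType) (res : {rmorphism W -> k}) (hW : is_witt_ring p res).
Variables (N : nat) (G : lingroup W N) (hG : lg_reductive G).
Variables (F : fieldExtType rat) (iota : {rmorphism F -> algC}).
Variables (kap : elt (absgal iota) -> W) (hkap : is_cyclotomic p kap).
Variables (rhob : elt (absgal iota) -> 'M[k]_N) (hrhob : is_rep G res (rker (idfun : {rmorphism k -> k})) rhob).
Variables (q : nice_data G) (hq : is_nice p res kap rhob q).
Local Notation P := (nice_place q).
Local Notation D := (dec iota (FinPlace P)).
Local Notation T := (nice_torus q).
Local Notation alpha := (nice_root q).
Local Notation x := (nice_unip q).
Local Notation rb := (restr rhob : elt D -> 'M[k]_N).
Local Notation kp := (restr kap : elt D -> W).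

Lemma nice_kappa : [/\ forall u s t, is_comp u s t -> kp u = kp s * kp t,
   forall m, exists z : algC, forall s t : elt D, sval s z = sval t z -> pdiv_pow p m (kp s - kp t),
   forall t : elt D, inert iota P (sval t) -> kp t = 1 &
   forall n (s : elt D), frob iota P n (sval s) -> kp s = n%:R].
Proof.
have [[hP Pp] _ _ _ _] := hq; split.
- by move=> u s t c; apply: (kap_mul hW hkap).
- move=> m; have [z hz] := kap_agree hW hkap m; exists z => s t st.
  exact: (hz (exist _ (sval s) (proj1 (svalP s))) (exist _ (sval t) (proj1 (svalP t))) st).
- move=> t [_ ht]; rewrite /restr (kap_mod hW hkap hP Pp (c := 1)) // => y yA; rewrite expr1; exact: ht.
- by move=> n s [_ hs]; apply: (kap_mod hW hkap hP Pp).
Qed.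

Lemma nice_unramified (t : elt D) : inert iota P (sval t) -> rb t = 1%:M.
Proof. by have [_ _ h _ _] := hq => ti; apply: h. Qed.

(** [T] is the identity component of the centralizer of Frobenius, so [t] commutes with [rb s0] and
    therefore with its unipotent factor; as alpha(t) = n is not 1, this factor is trivial. *)
Lemma nice_reductive_torus n (s0 : elt D) : frob iota P n (sval s0) -> n%:R != 1 :> k ->
  (forall (K : closedFieldType) (j : {rmorphism k -> K}),
     is_semisimple_mx (map_mx j (rb s0)) /\
     (forall y, pts T (j \o res : {rmorphism W -> K}) y <->
        identity_component (centralizer (pts G (j \o res : {rmorphism W -> K})) (map_mx j (rb s0))) y)) ->
  forall t u, pts T res t -> rb s0 = t *m ru_at x res u -> chr_at alpha res t = n%:R -> pts T res (rb s0) /\ u = 0.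
Proof.
move=> hs n1 reg t u tT tE ta; have [K [j ji]] := field_closure k.
have comm : t *m rb s0 = rb s0 *m t.
  have jj : is_alg_hom res (j \o res : {rmorphism W -> K}) j by [].
  have [_ h] := reg K j; have [Y [hY _ _ Yt]] := (h _).1 (pts_nat jj tT).
  have [_ c] := hY _ Yt; apply: (map_mx_inj (f := j)); by rewrite !map_mxM.
have [t' tt] := tT.1.
suff u0 : u = 0 by rewrite tE u0 ru_zero mulmx1.
have := ru_conj x u tT tt; rewrite ta.
have -> : t *m ru_at x res u *m t' = ru_at x res u.
  have := congr1 (fun Z => t' *m Z *m t') comm; rewrite tE !mulmxA tt.2 mul1mx -!mulmxA tt.1 mulmx1.
  by rewrite mul1mx.
move/ru_inj/eqP; rewrite -subr_eq0 -[X in X - _]mul1r -mulrBl mulf_eq0 subr_eq0 eq_sym (negPf n1) /=.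
by move/eqP.
Qed.

(** [acts_by_kappa] concerns the whole decomposition group; since inertia acts trivially and has
    trivial residual character, checking Frobenius suffices by density. *)
Lemma nice_kappa_roots n (s0 : elt D) (a : lgchar T) sg' : place_norm iota P n -> frob iota P n (sval s0) ->
  inverses (rb s0) sg' ->
  (forall X, root_space G a X -> rb s0 *m map_mx res X *m sg' = n%:R *: map_mx res X) ->
  acts_by_kappa res G kap rhob (FinPlace P) a.
Proof.
move=> hn hs hsg hX s X Xa; have [[hP Pp] _ _ _ _] := hq; have [kM kA kI kF] := nice_kappa.
have [rG rM rC] := hrhob; set Z := map_mx res X.
have [z hz] := kA 1%N; have [e he] := rC 1%N (exist _ (sval s) (proj1 (svalP s))).
have rM' (u v w : elt D) : is_comp u v w -> rb u = rb v *m rb w by move=> c; apply: rM.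
have iv (u : elt D) : exists v, inverses (rb u) v by have [h _] := rG (exist _ (sval u) (proj1 (svalP u))).
have gen (u : elt D) : (exists v, inverses (rb u) v /\ rb u *m Z *m v = res (kp u) *: Z) -> rb u *m Z = res (kp u) *: Z *m rb u.
  by move=> [v [uv <-]]; rewrite -mulmxA uv.2 mulmx1.
pose Q (u : elt D) := rb u *m Z = res (kp u) *: Z *m rb u.
have [s' [Qs' ag]] : exists s', Q s' /\ agree_on (z :: e) s s'.
  apply: (loc_generated hP hn s (z :: e) hs).
  - move=> u v w c; rewrite /Q => hv hw; rewrite (kM _ _ _ c) (rM' _ _ _ c).
    rewrite -mulmxA hw -!scalemxAl -!scalemxAr !mulmxA hv -!scalemxAl scalerA rmorphM.
    by rewrite [res (kp w) * _]mulrC.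
  - by apply: gen; exists sg'; split=> //; rewrite hX // (kF n s0 hs) rmorph_nat.
  - by move=> t ti; rewrite /Q nice_unramified // kI // rmorph1 scale1r mul1mx mulmx1.
have r1 : rb s = rb s'.
  apply/esym/matrixP => i j; apply/eqP; rewrite -subr_eq0; apply/eqP.
  have [|r [hr h]] := he (exist _ (sval s') (proj1 (svalP s'))) _ i j.
    by move=> y ye; apply: ag; rewrite inE ye orbT.
  rewrite [LHS]h big_seq big1 // => v /hr [h1 _]; rewrite /rker /= in h1.
  by rewrite h1 mul0r.
have k1 : res (kp s) = res (kp s').
  apply/eqP; rewrite -subr_eq0 -rmorphB; apply/eqP/(witt_res0 hW)/hz; apply: ag; exact: mem_head.
have [v sv] := iv s; rewrite k1 (_ : invmx (rb s) = v); last first.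
  have U : rb s \in unitmx by case: (mulmx1_unit sv.1).
  by rewrite -[LHS]mulmx1 -sv.1 mulmxA mulVmx // mul1mx.
by rewrite r1 Qs' -r1 -mulmxA sv.1 mulmx1.
Qed.
End NiceLocal.

Lemma nat_neq1_pchar (k : fieldType) p n : p \in [pchar k] -> n <> 1 %[mod p] -> n%:R != 1 :> k.
Proof.
move=> pk n1; apply/eqP => h; apply: n1; case: n h => [|n] h.
  by move: h => /esym/eqP; rewrite oner_eq0.
have : n%:R = 0 :> k by move: h; rewrite -addn1 natrD => /(congr1 (fun y => y - 1)); rewrite addrK subrr.
by move/eqP; rewrite -(dvdn_pcharf pk) => /dvdnP [l ->]; rewrite -[(l * p).+1]addn1 modnMDl.
Qed.

Section LocalData.
Variables (p : nat) (k : finFieldType) (W : comNzRingType) (res : {rmorphism W -> k}) (hW : is_witt_ring p res).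
Variables (N : nat) (G : lingroup W N) (hG : lg_reductive G) (M : nat) (C : lingroup W M) (mu : lghom G C).
Variables (F : fieldExtType rat) (iota : {rmorphism F -> algC}).
Variables (kap : elt (absgal iota) -> W) (hkap : is_cyclotomic p kap).
Variables (rhob : elt (absgal iota) -> 'M[k]_N) (hrhob : is_rep G res (rker (idfun : {rmorphism k -> k})) rhob).
Variable nu : elt (absgal iota) -> 'M[W]_M.
Variable q : nice_data G.
Local Notation P := (nice_place q).
Local Notation D := (dec iota (FinPlace P)).
Local Notation T := (nice_torus q).
Local Notation alpha := (nice_root q).
Local Notation x := (nice_unip q).
Local Notation rb := (restr rhob : elt D -> 'M[k]_N).
Local Notation kp := (restr kap : elt D -> W).
Local Notation id_W := (idfun : {rmorphism W -> W}).

(* A special lift [rw], moved by [ld_h] so that Frobenius takes the value [ld_t0] in the torus,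
   together with the eigenprojection [ld_phi] onto the root line. *)
Record local_data (rw : elt (absgal iota) -> 'M[W]_N) := LocalData {
  ld_n : nat; ld_s0 : elt D; ld_e : nat; ld_sg : 'M[k]_N;
  ld_phi : forall A : comNzRingType, {rmorphism W -> A} -> 'M[A]_N -> A;
  ld_t0 : 'M[W]_N; ld_t0' : 'M[W]_N; ld_h : 'M[W]_N; ld_h' : 'M[W]_N;
  ld_norm : place_norm iota P ld_n;
  ld_frob : frob iota P ld_n (sval ld_s0);
  ld_n1 : ld_n%:R != 1 :> k;
  ld_inv : inverses (rb ld_s0) ld_sg;
  ld_sgT : pts T res (rb ld_s0);
  ld_phiD : forall (A : comNzRingType) (s : {rmorphism W -> A}) Y Z, ld_phi s (Y + Z) = ld_phi s Y + ld_phi s Z;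
  ld_phiZ : forall (A : comNzRingType) (s : {rmorphism W -> A}) c Z, ld_phi s (c *: Z) = c * ld_phi s Z;
  ld_phiC : forall (A : comNzRingType) (s : {rmorphism W -> A}) t t' Z, pts T s t -> inverses t t' ->
          ld_phi s (t *m Z *m t') = chr_at alpha s t * ld_phi s Z;
  ld_phi1 : forall (A : comNzRingType) (s : {rmorphism W -> A}), ld_phi s (map_mx s (root_vec x)) = 1;
  ld_phiN : forall (A A' : comNzRingType) (s : {rmorphism W -> A}) (s' : {rmorphism W -> A'})
          (f : {rmorphism A -> A'}) Z, is_alg_hom s s' f -> ld_phi s' (map_mx f Z) = f (ld_phi s Z);
  ld_Q1 : forall Z, lie G res Z -> rb ld_s0 *m Z *m ld_sg = Z -> lie T res Z;
  ld_Q2 : forall Z, lie G res Z -> rb ld_s0 *m Z *m ld_sg = ld_n%:R *: Z -> exists c, Z = c *: map_mx res (root_vec x);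
  ld_sge : rb ld_s0 ^+ ld_e = 1;
  ld_e0 : ld_e%:R != 0 :> k;
  ld_Ghat : Ghat G id_W res ld_h ld_h';
  ld_special : forall s : elt D, in_Halpha x id_W (ld_h *m restr rw s *m ld_h') (kp s);
  ld_t0E : ld_h *m restr rw ld_s0 *m ld_h' = ld_t0;
  ld_t0T : pts T id_W ld_t0;
  ld_t0i : inverses ld_t0 ld_t0';
  ld_t0a : chr_at alpha id_W ld_t0 = ld_n%:R }.

(** Here [c] is the inverse of n - 1. Conjugating t u(y) by u(v) yields u(v + n y - n v) t, and v =
    n y / (n - 1) cancels the unipotent part. *)
Lemma ru_conj_torus t t0' y n c : pts T id_W t -> inverses t t0' -> chr_at alpha id_W t = n%:R -> (n%:R - 1) * c = 1 ->
  ru_at x id_W (n%:R * y * c) *m (t *m ru_at x id_W y) *m ru_at x id_W (- (n%:R * y * c)) = t.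
Proof.
move=> tT tt ta nc; have h := ru_conj x (y - n%:R * y * c) tT tt; rewrite ta in h.
have -> : t *m ru_at x id_W y = ru_at x id_W (n%:R * y) *m t.
  by rewrite -ta -(ru_conj x y tT tt) -mulmxA tt.2 mulmx1.
rewrite mulmxA -ru_add -mulmxA.
have -> : t *m ru_at x id_W (- (n%:R * y * c)) = ru_at x id_W (n%:R * - (n%:R * y * c)) *m t.
  by rewrite -ta -(ru_conj x _ tT tt) -mulmxA tt.2 mulmx1.
rewrite mulmxA -ru_add (_ : _ + _ = n%:R * y * (1 - (n%:R - 1) * c)); last by ring.
by rewrite nc subrr mulr0 ru_zero mul1mx.
Qed.

Lemma local_data_ex (hq : is_nice p res kap rhob q) rw :
  special_lift mu kap rhob nu x (v := FinPlace P) id_W res (restr rw) -> exists L : local_data rw, True.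
Proof.
move=> [rl [rho' [[a [a' [aG hr]]] hH]]].
have [[hP Pp] [n [hn n1 n2 hreg]] hI hT [hroot hact huni]] := hq.
have [kP [r rP]] := residue_field hP; have [s hs] := frob_exists hP rP hn.
pose s0 : elt D := exist _ s hs.1.
have [kM kA kI kF] := nice_kappa hW hkap hq.
have n1k := nat_neq1_pchar (witt_pchar hW) n1.
have reg (K : closedFieldType) (j : {rmorphism k -> K}) := hreg (exist _ (sval s0) (proj1 (svalP s0))) hs K j.
have [_ ar _] := rl.
have [aGG [aa a'a] a1] := aG.
have a'1 : map_mx res a' = 1%:M by have := congr1 (map_mx res) aa; rewrite map_mxM a1 mul1mx map_mx1.
have [t [y [tT tE ta]]] := hH s0.
have {}ta : chr_at alpha id_W t = n%:R by rewrite ta -(kF n s0 hs).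
have rs : is_alg_hom id_W res res by [].
have rbE : rb s0 = map_mx res t *m ru_at x res (res y).
  by rewrite (ru_nat x y rs) -map_mxM -tE hr !map_mxM a1 a'1 mul1mx mulmx1 ar.
have tar : chr_at alpha res (map_mx res t) = n%:R by rewrite (chr_nat alpha rs tT) ta rmorph_nat.
have [sgT y0] := nice_reductive_torus (s0 := s0) hs n1k reg (pts_nat rs tT) rbE tar.
have [sg hsg] := sgT.1.
have [[phi [p1 p2 p3 p4 p5]] [Q1 Q2 [e [e1 e2]]]] :=
  nice_package x hW hG hT hroot.1 sgT hsg (elimN eqP n1k) reg (fun b hb hX => huni b hb (nice_kappa_roots hW hkap hrhob hq (s0 := s0) hn hs hsg hX)).
have [c nc] : exists c, (n%:R - 1) * c = 1 :> W.
  by apply: (witt_unit hW); rewrite rmorphB rmorph1 rmorph_nat => /eqP; rewrite subr_eq0 (negPf n1k).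
have [t' tt] := tT.1.
pose v := n%:R * y * c.
have vG : Ghat G id_W res (ru_at x id_W v) (ru_at x id_W (- v)).
  split; [exact: ru_pts | exact: ru_inv |].
  by rewrite -(ru_nat x v rs) /v !rmorphM y0 mulr0 mul0r ru_zero.
have E (s1 : elt D) : ru_at x id_W v *m a *m restr rw s1 *m (a' *m ru_at x id_W (- v)) = ru_at x id_W v *m rho' s1 *m ru_at x id_W (- v).
  by rewrite hr !mulmxA.
have t0E : ru_at x id_W v *m rho' s0 *m ru_at x id_W (- v) = t by rewrite tE; apply: ru_conj_torus tt ta nc.
unshelve eexists.
  apply: (@LocalData rw n s0 e sg phi t t' (ru_at x id_W v *m a) (a' *m ru_at x id_W (- v))) => //.
  - exact: Ghat_mul vG aG.
  - move=> s1; rewrite E -[kp s1]mulr1 -[kp s1]mul1r.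
    apply: in_Halpha_mul (in_Halpha_unip _ _ _); apply: in_Halpha_mul (in_Halpha_unip _ _ _) _; exact: hH.
  - by rewrite E.
by [].
Qed.
End LocalData.

(** * The global argument *)

Lemma elt_inj (H : aut -> Prop) (s t : elt H) : sval s = sval t -> s = t.
Proof. by case: s t => s hs [t ht] /= st; subst t; congr exist; apply: Prop_irrelevance. Qed.

Lemma map_iter_mulmx (A B : comNzRingType) (f : {rmorphism A -> B}) N n (Z : 'M[A]_N) :
  map_mx f (iter n (mulmx Z) 1%:M) = iter n (mulmx (map_mx f Z)) 1%:M.
Proof. by elim: n => [|n IH]; rewrite ?map_mx1 // !iterS map_mxM IH. Qed.

Lemma entries_conj (A : comNzRingType) (I : A -> Prop) N (a a' Z : 'M[A]_N) : is_ideal I -> inverses a a' ->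
  (forall u v, I ((Z - 1%:M) u v)) -> forall u v, I ((a *m Z *m a' - 1%:M) u v).
Proof.
move=> [I0 ID IM] [aa _] h u v.
have -> : a *m Z *m a' - 1%:M = a *m (Z - 1%:M) *m a' by rewrite mulmxBr mulmxBl mulmx1 aa.
rewrite mxE; apply: (big_ind I) => // l _; rewrite mulrC; apply: (IM).
by rewrite mxE; apply: (big_ind I) => // l' _; apply: (IM).
Qed.

Lemma mx_divide (A : comNzRingType) N (Z Z' : 'M[A]_N) c :
  (forall u v, exists w, Z u v - Z' u v = c * w) -> exists E, Z = Z' + c *: E.
Proof.
move=> h; exists (\matrix_(u, v) sval (cid (h u v))); apply/matrixP => u v.
by rewrite !mxE -(svalP (cid (h u v))) addrC subrK.
Qed.

Lemma map_mx_eq1 (A B : comNzRingType) (f : {rmorphism A -> B}) N (Z : 'M[A]_N) :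
  map_mx f Z = 1%:M <-> forall u v, rker f ((Z - 1%:M) u v).
Proof.
split=> h; last apply/matrixP.
  by move=> u v; have := congr1 (fun M : 'M_N => M u v) h; rewrite /rker !mxE rmorphB rmorph_nat => ->; rewrite subrr.
move=> u v; have := h u v; rewrite /rker !mxE rmorphB rmorph_nat => /eqP.
by rewrite subr_eq0 => /eqP.
Qed.

Section Special.
Variables (k : finFieldType) (W : comNzRingType) (res : {rmorphism W -> k}).
Variables (F : fieldExtType rat) (iota : {rmorphism F -> algC}).
Variables (N M : nat) (G : lingroup W N) (C : lingroup W M) (mu : lghom G C) (kap : elt (absgal iota) -> W).
Variables (rhob : elt (absgal iota) -> 'M[k]_N) (nu : elt (absgal iota) -> 'M[W]_M).
Variables (T : lingroup W N) (a : lgchar T) (x : root_subgroup G a) (v : place).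
Variables (A : comNzRingType) (str : {rmorphism W -> A}) (red : {rmorphism A -> k}).

Lemma special_equiv (r r' : elt (absgal iota) -> 'M[A]_N) : is_lift mu rhob nu str red r ->
  strictly_equiv G str red r r' -> special_lift mu kap rhob nu x (v := v) str red (restr r') ->
  special_lift mu kap rhob nu x (v := v) str red (restr r).
Proof.
move=> rl rr [_ [r'' [h1 h2]]]; split; first exact: is_lift_restr.
by exists r''; split=> //; apply: strictly_equiv_trans h1; apply: strictly_equiv_restr.
Qed.
End Special.

(** * The universal lift at one nice prime *)

Section Main.
Variables (p : nat) (k : finFieldType) (W : comNzRingType) (res : {rmorphism W -> k}) (hW : is_witt_ring p res).
Variables (N : nat) (G : lingroup W N) (M : nat) (C : lingroup W M) (mu : lghom G C).
Variables (F : fieldExtType rat) (iota : {rmorphism F -> algC}).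
Variables (kap : elt (absgal iota) -> W) (hkap : is_cyclotomic p kap).
Variables (rhob : elt (absgal iota) -> 'M[k]_N) (nu : elt (absgal iota) -> 'M[W]_M).
Variables (R : comNzRingType) (strR : {rmorphism W -> R}) (redR : {rmorphism R -> k}) (hRc : is_coef res strR redR).
Variables (rhoR : elt (absgal iota) -> 'M[R]_N) (rlR : is_lift mu rhob nu strR redR rhoR).
Variables (pi : {rmorphism R -> W}) (hpi : is_coef_hom strR redR (idfun : {rmorphism W -> W}) res pi).
Local Notation id_W := (idfun : {rmorphism W -> W}).
Local Notation rw := (fun s => map_mx pi (rhoR s)).
Local Notation K := (rker pi).

Lemma pi_str w : pi (strR w) = w. Proof. by case: hpi => h _; rewrite h. Qed.
Lemma pi_res r : res (pi r) = redR r. Proof. by case: hpi. Qed.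

Section OnePrime.
Variables (q : nice_data G) (hq : is_nice p res kap rhob q) (L : local_data res kap rhob q rw).
Local Notation P := (nice_place q).
Local Notation D := (dec iota (FinPlace P)).
Local Notation x := (nice_unip q).
Local Notation ee A s := (@map_mx W A s N N (root_vec x)).

Definition conj_l : 'M[R]_N := map_mx strR (ld_h L).
Definition conj_r : 'M[R]_N := map_mx strR (ld_h' L).
Definition normalized (s : elt D) : 'M[R]_N := conj_l *m restr rhoR s *m conj_r.
Definition frob_dev : 'M[R]_N := normalized (ld_s0 L) *m map_mx strR (ld_t0' L) - 1%:M.
Definition frob_coord : R := ld_phi L strR (frob_dev *m ee R strR - ee R strR *m frob_dev).

Lemma conj_Ghat : Ghat G strR redR conj_l conj_r.
Proof.
have hs : is_coef_hom id_W res strR redR strR by split=> // w; have [h _ _ _ _] := hRc; rewrite h.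
by have h := Ghat_push hs (ld_Ghat L); exact: h.
Qed.

Lemma normalized_pi s : map_mx pi (normalized s) = ld_h L *m restr rw s *m ld_h' L.
Proof.
have e (Z : 'M[W]_N) : map_mx pi (map_mx strR Z) = Z by apply/matrixP => i j; rewrite !mxE pi_str.
by rewrite /normalized !map_mxM !e.
Qed.

Lemma normalized_frob : normalized (ld_s0 L) = (1%:M + frob_dev) *m map_mx strR (ld_t0 L).
Proof.
rewrite /frob_dev addrC subrK -mulmxA -map_mxM.
by have [_ ->] := ld_t0i L; rewrite map_mx1 mulmx1.
Qed.

Lemma frob_dev_ker u v : K (frob_dev u v).
Proof.
apply: (map_mx_eq1 pi _).1; rewrite map_mxM normalized_pi ld_t0E.
have -> : map_mx pi (map_mx strR (ld_t0' L)) = ld_t0' L by apply/matrixP => i j; rewrite !mxE pi_str.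
by have [] := ld_t0i L.
Qed.

Lemma ld_phiB (A : comNzRingType) (s : {rmorphism W -> A}) Y Z : ld_phi L s (Y - Z) = ld_phi L s Y - ld_phi L s Z.
Proof. by rewrite -scaleN1r ld_phiD ld_phiZ mulN1r. Qed.

Lemma ld_phi_ideal (A : comNzRingType) (s : {rmorphism W -> A}) (I : A -> Prop) (Y : 'M[A]_N) : is_ideal I ->
  (forall u v, I (Y u v)) -> I (ld_phi L s Y).
Proof.
move=> hI; have [I0 ID IM] := hI => hY; rewrite (matrix_sum_delta Y).
have s0 : ld_phi L s 0 = 0 by rewrite -(scale0r (0 : 'M[A]_N)) ld_phiZ mul0r.
have sm (T : Type) (r : seq T) (f : T -> 'M[A]_N) : (forall t, I (ld_phi L s (f t))) -> I (ld_phi L s (\sum_(t <- r) f t)).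
  by move=> h; elim: r => [|t r IH]; rewrite ?big_nil ?s0 // big_cons ld_phiD; apply: (ID).
by apply: (sm _ _ _) => u; apply: (sm _ _ _) => v; rewrite ld_phiZ mulrC; apply: (IM).
Qed.

Lemma frob_coord_ker : K frob_coord.
Proof.
have hK : is_ideal K by apply: rker_ideal.
have [K0 KD KM] := hK.
rewrite /frob_coord ld_phiB; apply: idealB => //; apply: (ld_phi_ideal _ hK) => u v; rewrite mxE;
  apply: (big_ind K) => // l _; [rewrite mulrC|]; apply: (KM); exact: frob_dev_ker.
Qed.

Lemma normalized_red (t : elt D) : map_mx redR (normalized t) = restr rhob t.
Proof.
have [_ [_ _] h1] := conj_Ghat; have [_ _ h2] := Ghat_inv conj_Ghat; have [_ h3 _] := rlR.
by rewrite /normalized !map_mxM h1 h2 mul1mx mulmx1; apply: h3.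
Qed.

Lemma normalized_mul : loc_multiplicative normalized.
Proof. by apply: conj_lift_multiplicative rlR _; case: conj_Ghat. Qed.

Lemma normalized_cont : adically_continuous (rker redR) normalized.
Proof. exact: conj_lift_continuous rlR. Qed.

Lemma frob_coord_divides d (t : elt (absgal iota)) (hd : (2 <= d)%N) : inert iota P (sval t) ->
  (forall u v, pdiv_pow p d.-1 ((rw t - 1%:M) u v)) -> ~ (forall u v, pdiv_pow p d ((rw t - 1%:M) u v)) ->
  exists r, K r /\ idmul K K ((p ^ d.-1)%:R * frob_coord - r * (p ^ (d.-1 + d.-1))%:R).
Proof.
move=> ti t1 t2; have hK : is_ideal K by apply: rker_ideal.
have [K0 KD KM] := hK.
pose t' : elt D := exist _ (sval t) ti.1.
have rt : restr rw t' = rw t by rewrite /restr; congr (map_mx pi (rhoR _)); apply: elt_inj.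
have [[hP Pp] _ _ hT _] := hq; have [kM kA kI kF] := nice_kappa hW hkap hq.
have rmul := normalized_mul.
have [dl [di hdl hM]] := tame_elt hP (t := t') (witt_prime hW) Pp (ld_frob L) ti.
have d1 : normalized dl = 1%:M.
  apply: (tame_trivial hW hRc rmul normalized_cont) => //.
  by rewrite normalized_red; apply: (nice_unramified hq).
have rel := hdl _ _ _ rmul; rewrite d1 mul1mx in rel.
set n := ld_n L in rel.
pose B := map_mx pi (normalized t').
have BE : B = ld_h L *m rw t *m ld_h' L by rewrite /B normalized_pi rt.
have [hG [hh h'h] h1] := ld_Ghat L.
have relW : ld_t0 L *m B = iter n (mulmx B) 1%:M *m ld_t0 L.
  by have := congr1 (map_mx pi) rel; rewrite map_mxM [map_mx pi (iter _ _ _ *m _)]map_mxM map_iter_mulmx -/B normalized_pi ld_t0E.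
have Hs : in_Halpha x id_W B 1 by have := ld_special L t'; rewrite (kI t' ti) BE rt.
have Br : map_mx res B = 1%:M.
  rewrite -(nice_unramified hq (t := t') ti) -normalized_red; apply/matrixP => u v.
  by rewrite [LHS]mxE [in LHS]mxE pi_res [RHS]mxE.
have n0 : (0 < n)%N.
  by have [f [fA /(_ 0)]] := ld_norm L; rewrite rmorph0 => /(_ (Aint0)) [i _]; apply: leq_ltn_trans (ltn_ord i).
have [_ hr _] := hT.
have [z z0 Bz] := tame_unipotent hW hr (ld_t0T L) (ld_t0i L) (ld_t0a L) (ld_n1 L) n0 Hs Br relW.
(* Triviality modulo p^(d-1) and ramification modulo p^d at [t] say exactly that [z] is p^(d-1)
   times a unit. *)
have z1 : pdiv_pow p d.-1 z.
  apply/(ru_div hW x d.-1 z0); rewrite -Bz BE; apply: entries_conj => //; exact: pdiv_pow_ideal.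
have z2 : ~ pdiv_pow p d z.
  move=> /(ru_div hW x d z0); rewrite -Bz BE => h; apply: t2.
  have -> : rw t = ld_h' L *m (ld_h L *m rw t *m ld_h' L) *m ld_h L.
    by rewrite !mulmxA h'h mul1mx -mulmxA h'h mulmx1.
  by apply: entries_conj => //; exact: pdiv_pow_ideal.
have [u zu] := z1.
have [u' uu] : exists u', u * u' = 1.
  apply: (witt_unit hW) => /(witt_res0 hW) [w hw]; apply: z2; exists w.
  by rewrite zu hw mulrA -natrM -expnD addn1 prednK // ltnW.
pose e2 := (p ^ (d.-1 + d.-1))%:R : R.
(* Modulo this ideal, K^2 + p^(2(d-1)) K, the image of K has square zero and is killed by the square
   of [z], as [tame_relation] requires. *)
have hI := ideal_add_principal e2 (idmul_ideal hK hK) hK.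
set I := (fun y => _) in hI.
have IK y : I y -> K y.
  move=> [r [hr' h]]; rewrite -(subrK (r * e2) y); apply: (KD).
    exact: idmul_subr h.
  by rewrite mulrC; apply: (KM).
have [|A [g [gs gk]]] := quotient_ring hI.
  by move/IK; rewrite /rker rmorph1 => /eqP; rewrite oner_eq0.
pose strA : {rmorphism W -> A} := g \o strR.
have gA : is_alg_hom strR strA g by [].
have iA : is_alg_hom id_W strA strA by [].
pose KK y := exists y0, K y0 /\ g y0 = y.
have hKK : is_ideal KK.
  split; first by exists 0; rewrite rmorph0.
    by move=> _ _ [a [Ka <-]] [b [Kb <-]]; exists (a + b); split; [apply: KD | rewrite rmorphD].
  by move=> a _ [b [Kb <-]]; have [a0 <-] := gs a; exists (a0 * b); split; [apply: KM | rewrite rmorphM].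
have KK2 a b : KK a -> KK b -> a * b = 0.
  move=> [a0 [Ka <-]] [b0 [Kb <-]]; rewrite -rmorphM; apply/gk; exists 0; split=> //.
  by rewrite mul0r subr0; apply: idmul_in.
have zKK a : KK a -> strA z * strA z * a = 0.
  move=> [a0 [Ka <-]]; rewrite -!rmorphM /= -rmorphM; apply/gk; exists (strR (u * u) * a0); split; first exact: KM.
  have -> : strR (z * z) * a0 - strR (u * u) * a0 * e2 = 0; last by have [] := idmul_ideal hK hK.
  by rewrite zu /e2 expnD natrM !rmorphM rmorph_nat; ring.
have [c nc] : exists c, (n%:R - 1) * c = 1 :> W.
  apply: (witt_unit hW); rewrite rmorphB rmorph1 rmorph_nat => /eqP; rewrite subr_eq0.
  by rewrite (negPf (ld_n1 L)).
have ncA : (n%:R - 1) * strA c = 1 by rewrite -(rmorph_nat strA) -(rmorph1 strA) -rmorphB -rmorphM nc.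
pose k0 := normalized t' *m map_mx strR (ru_at x id_W (- z)) - 1%:M.
have k0K a b : K (k0 a b).
  apply: (map_mx_eq1 pi _).1; rewrite map_mxM -/B Bz.
  have -> : map_mx pi (map_mx strR (ru_at x id_W (- z))) = ru_at x id_W (- z) by apply/matrixP => i j; rewrite !mxE pi_str.
  by have [] := ru_inv x id_W z.
have tE : normalized t' = (1%:M + k0) *m map_mx strR (ru_at x id_W z).
  rewrite /k0 addrC subrK -mulmxA -map_mxM.
  by have [_ ->] := ru_inv x id_W z; rewrite map_mx1 mulmx1.
pose t0A := map_mx strA (ld_t0 L); pose t0A' := map_mx strA (ld_t0' L).
have t0AT : pts (nice_torus q) strA t0A := pts_nat iA (ld_t0T L).
have t0Ai : inverses t0A t0A' by have [i1 i2] := ld_t0i L; split; rewrite -map_mxM ?i1 ?i2 map_mx1.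
have t0Aa : chr_at (nice_root q) strA t0A = n%:R by rewrite (chr_nat _ iA (ld_t0T L)) ld_t0a rmorph_nat.
have gstr (Z : 'M[W]_N) : map_mx g (map_mx strR Z) = map_mx strA Z by apply/matrixP => i j; rewrite !mxE.
have sE : map_mx g (normalized (ld_s0 L)) = (1%:M + map_mx g frob_dev) *m t0A.
  by rewrite normalized_frob map_mxM map_mxD map_mx1 gstr.
have tAE : map_mx g (normalized t') = (1%:M + map_mx g k0) *m ru_at x strA (strA z).
  by rewrite tE map_mxM map_mxD map_mx1 gstr (ru_nat x z iA).
have phiCA Z : ld_phi L strA (t0A *m Z *m t0A') = n%:R * ld_phi L strA Z.
  by rewrite (ld_phiC L Z t0AT t0Ai) t0Aa.
have XKK a b : KK (map_mx g frob_dev a b) by rewrite mxE; exists (frob_dev a b); split=> //; apply: frob_dev_ker.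
have kKK a b : KK (map_mx g k0 a b) by rewrite mxE; exists (k0 a b).
have := tame_relation (x := x) (ld_phiD L strA) (ld_phiZ L strA) t0AT t0Ai t0Aa phiCA hKK KK2 zKK ncA XKK kKK.
rewrite -sE -tAE -map_iter_mulmx -!map_mxM rel => /(_ erefl).
rewrite -gstr -!map_mxM -map_mxB (ld_phiN L _ gA) -/frob_coord -[strA z]/(g (strR z)) -rmorphM => /gk h.
have [_ _ IM] := hI; have := IM (strR u') _ h.
by rewrite mulrA -rmorphM zu mulrCA [u' * u]mulrC uu mulr1 rmorph_nat.
Qed.

Lemma normalized_map_mul (A : comNzRingType) (f : {rmorphism R -> A}) :
  loc_multiplicative (fun s => map_mx f (normalized s)).
Proof.
have [n1 nM] := normalized_mul; split; first by rewrite n1 map_mx1.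
by move=> u s t c; rewrite (nM _ _ _ c) map_mxM.
Qed.

Lemma normalized_locally_constant (A : comNzRingType) (strA : {rmorphism W -> A}) (redA : {rmorphism A -> k})
  (f : {rmorphism R -> A}) j : is_coef_hom strR redR strA redA f -> (forall y, idpow (rker redA) j y -> y = 0) ->
  locally_constant (fun s => map_mx f (normalized s)).
Proof.
move=> hf nil s; have [e he] := normalized_cont j s; exists e => t st.
have h u v := idpow_push hf (he t st u v).
apply/matrixP => u v; rewrite [LHS]mxE [RHS]mxE; apply/eqP; rewrite -subr_eq0 -rmorphB.
by apply/eqP/nil/h.
Qed.

Lemma normalized_pts (A : comNzRingType) (strA : {rmorphism W -> A}) (redA : {rmorphism A -> k})
  (f : {rmorphism R -> A}) s : is_coef_hom strR redR strA redA f -> pts G strA (map_mx f (normalized s)).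
Proof.
move=> [f1 _]; apply: pts_nat f1 _; have [cG _ _] := conj_Ghat; have [c'G _ _] := Ghat_inv conj_Ghat.
have [[rG _ _] _ _] := rlR; apply: lg_mul c'G; apply: lg_mul cG _; exact: rG.
Qed.

(** Through [pi] the universal lift becomes special, and [f] deviates from it by multiples of [w],
    so [special_small] applies; the vanishing of the image of [frob_coord] is its condition at
    Frobenius. *)
Lemma special_of_deviation (A : comNzRingType) (strA : {rmorphism W -> A}) (redA : {rmorphism A -> k})
  (f : {rmorphism R -> A}) j w : is_coef res strA redA -> is_coef_hom strR redR strA redA f ->
  (forall y, idpow (rker redA) j y -> y = 0) -> (exists l, forall y, pdiv_pow p l y -> strA y = 0) ->
  redA w = 0 -> (forall b, w * b = 0 <-> redA b = 0) -> (forall r, exists b, f r = strA (pi r) + w * b) ->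
  f frob_coord = 0 ->
  special_lift mu kap rhob nu x (v := FinPlace P) strA redA (restr (fun s => map_mx f (rhoR s))).
Proof.
move=> hA hf nil pA w0 hw hdev f0.
have [[hP Pp] _ _ hT _] := hq; have [kM kA kI kF] := nice_kappa hW hkap hq; have [TG _ _] := hT.
have [f1 f2] := hf; have [sr redS _ _ _] := hA.
pose f' : {rmorphism R -> A} := strA \o pi.
have hf' : is_coef_hom strR redR strA redA f'.
  by split=> [v|r]; rewrite /f' /= ?pi_str // sr pi_res.
have iA : is_alg_hom id_W strA strA by [].
have rE s : map_mx f' (normalized s) = map_mx strA (ld_h L *m restr rw s *m ld_h' L).
  by rewrite -normalized_pi; apply/matrixP => u v; rewrite !mxE.
pose t0A := map_mx strA (ld_t0 L).
have r0E : map_mx f' (normalized (ld_s0 L)) = t0A by rewrite rE ld_t0E.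
have dev (n1 n2 : nat) (Z : 'M[R]_(n1, n2)) : exists B, map_mx f Z = map_mx f' Z + w *: B.
  exists (\matrix_(u, v) sval (cid (hdev (Z u v)))); apply/matrixP => u v.
  by rewrite !mxE; exact: (svalP (cid (hdev (Z u v)))).
have fstr (Z : 'M[W]_N) : map_mx f (map_mx strR Z) = map_mx strA Z by apply/matrixP => u v; rewrite !mxE f1.
have [Y hY] := dev _ _ frob_dev.
have C0 : map_mx f frob_dev = w *: Y.
  rewrite hY (_ : map_mx f' frob_dev = 0) ?add0r //.
  by apply/matrixP => u v; rewrite [LHS]mxE [RHS]mxE /f' /= frob_dev_ker rmorph0.
have small s : exists B, map_mx f (normalized s) = (1%:M + w *: B) *m map_mx f' (normalized s).
  have [B hB] := dev _ _ (normalized s); have [[r' [_ r'r]] _] := normalized_pts s hf'.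
  by exists (B *m r'); rewrite mulmxDl mul1mx -scalemxAl -mulmxA r'r mulmx1.
have smallphi : exists B, map_mx f (normalized (ld_s0 L)) = (1%:M + w *: B) *m map_mx f' (normalized (ld_s0 L)) /\
    redA (ld_phi L strA (B *m ee A strA - ee A strA *m B)) = 0.
  exists Y; split; first by rewrite r0E normalized_frob map_mxM map_mxD map_mx1 C0 fstr.
  apply/hw; rewrite -ld_phiZ scalerBr scalemxAl scalemxAr -C0 -fstr -!map_mxM -map_mxB.
  by rewrite (ld_phiN L _ f1).
have [||||b [b' [bG hb]]] := special_small hW hP (ld_norm L) Pp (ld_frob L) kM kA TG (nice_unramified hq)
  (ld_inv L) (ld_sgT L) (ld_phiD L) (ld_phiZ L) (ld_phiC L) (ld_phi1 L) (ld_phiN L) (ld_Q1 (l := L)) (ld_Q2 (l := L))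
  (ld_sge L) (ld_e0 L) sr redS pA w0 hw (normalized_map_mul f) (normalized_map_mul f')
  (fun s => normalized_pts s hf) (fun s => normalized_pts s hf')
  (normalized_locally_constant hf nil) (normalized_locally_constant hf' nil) _ _ _ _ small smallphi.
- move=> s; rewrite -normalized_red; apply/matrixP => u v.
  by rewrite [LHS]mxE [in LHS]mxE [RHS]mxE; exact: hf'.2.
- by move=> s; rewrite rE; apply: (in_Halpha_nat iA); exact: ld_special.
- by rewrite r0E; apply: pts_nat iA (ld_t0T L).
- by rewrite r0E (chr_nat _ iA (ld_t0T L)) ld_t0a (kF _ _ (ld_frob L)).
split; first exact/is_lift_restr/(is_lift_push hf).
exists (fun s => b *m map_mx f (normalized s) *m b'); split; last exact: hb.
exists (b *m map_mx f conj_l), (map_mx f conj_r *m b'); split.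
  by apply: Ghat_mul bG _; have h := Ghat_push hf conj_Ghat; exact: h.
by move=> s; rewrite map_mxM [map_mx f (conj_l *m _)]map_mxM /restr !mulmxA.
Qed.

(** Expanding u(y) u(p^j) = u(p^j) u(y) and dividing by p^j shows that the commutator of u(y) with
    [e] is divisible by p^j, for every j. *)
Lemma ru_root_comm y : ru_at x id_W y *m root_vec x = root_vec x *m ru_at x id_W y.
Proof.
apply/eqP; rewrite -subr_eq0; apply/eqP/matrixP => u v; rewrite [RHS]mxE; apply: (witt_sep hW) => j.
have [Q hQ] := ru_nil_expand x id_W (p ^ j)%:R.
have eid : map_mx id_W (root_vec x) = root_vec x by apply/matrixP => a b; rewrite mxE.
set r := ru_at x id_W y; set e := root_vec x; rewrite eid -/e in hQ.
have h : r *m ru_at x id_W (p ^ j)%:R = ru_at x id_W (p ^ j)%:R *m r by rewrite -!ru_add addrC.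
rewrite hQ !mulmxDl !mulmxDr mul1mx mulmx1 -!scalemxAl -!scalemxAr -!addrA in h.
have key (a b c d : 'M[W]_N) : (p ^ j)%:R *: a + ((p ^ j)%:R * (p ^ j)%:R) *: b =
    (p ^ j)%:R *: c + ((p ^ j)%:R * (p ^ j)%:R) *: d -> pdiv_pow p j ((a - c) u v).
  move=> /(congr1 (fun M : 'M_N => M u v)); rewrite !mxE; move: (a u v) (b u v) (c u v) (d u v) => {}a {}b {}c {}d h1.
  exists (d - b); apply/eqP; rewrite -subr_eq0; apply/eqP/(witt_ptorsion hW (n := j)).
  have -> : (p ^ j)%:R * (a - c - (p ^ j)%:R * (d - b)) =
    ((p ^ j)%:R * a + (p ^ j)%:R * (p ^ j)%:R * b) - ((p ^ j)%:R * c + (p ^ j)%:R * (p ^ j)%:R * d) by ring.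
  by rewrite h1 subrr.
move/addrI: h; exact: key.
Qed.

(** For a special [f], Frobenius acts by [n] on a conjugate [e'] of the root vector. The conjugating
    matrix is 1 modulo [p], so [e'] is [e] modulo [p]; the deviation of Frobenius is divisible by
    p^D', and replacing [e'] by [e] in the coordinate costs a further factor [p]. *)
Lemma special_coord (f : {rmorphism R -> W}) D' : is_coef_hom strR redR id_W res f ->
  (forall r, pdiv_pow p D' (f r - pi r)) ->
  special_lift mu kap rhob nu x (v := FinPlace P) id_W res (restr (fun s => map_mx f (rhoR s))) ->
  pdiv_pow p D'.+1 (f frob_coord).
Proof.
move=> hf fD [_ [r' [[b [b' [bG hb]]] hH]]].
have [kM kA kI kF] := nice_kappa hW hkap hq; have [f1 f2] := hf.
have eid : map_mx id_W (root_vec x) = root_vec x by apply/matrixP => a c; rewrite mxE.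
set e := root_vec x in eid; set n := (ld_n L)%:R : W.
have fstr (Z : 'M[W]_N) : map_mx f (map_mx strR Z) = Z by apply/matrixP => u v; rewrite !mxE f1.
have cG := Ghat_mul (ld_Ghat L) (Ghat_inv bG); set c := ld_h L *m b' in cG; set c' := b *m ld_h' L in cG.
have [_ [cc' c'c] c1] := cG; have [_ _ c'1] := Ghat_inv cG.
pose S := map_mx f (normalized (ld_s0 L)).
have [t [y [tT tE ta]]] := hH (ld_s0 L).
have {}ta : chr_at (nice_root q) id_W t = n by rewrite ta; exact: (kF _ _ (ld_frob L)).
have [t' tt] := tT.1.
have SE : S = c *m (t *m ru_at x id_W y) *m c'.
  have [_ [bb' b'b] _] := bG.
  rewrite -tE hb /S /normalized map_mxM [map_mx f (conj_l *m _)]map_mxM !fstr /c /c' !mulmxA.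
  by rewrite -(mulmxA (ld_h L) b' b) b'b mulmx1 -(mulmxA _ b' b) b'b mulmx1.
clearbody c c'; pose e' := c *m e *m c'.
have te : t *m e = n *: (e *m t).
  by have := root_vec_conj x tT tt; rewrite ta eid -/e => h; rewrite scalemxAl -h -mulmxA tt.2 mulmx1.
have Se : S *m e' = n *: (e' *m S).
  have conj (A B : 'M[W]_N) : c *m A *m c' *m (c *m B *m c') = c *m (A *m B) *m c'.
    by rewrite !mulmxA -(mulmxA (c *m A) c' c) c'c mulmx1.
  have rc := ru_root_comm y; rewrite -/e in rc.
  have key : t *m ru_at x id_W y *m e = n *: (e *m (t *m ru_at x id_W y)).
    by rewrite -mulmxA rc mulmxA te -scalemxAl mulmxA.
  by rewrite SE /e' !conj key -scalemxAr -scalemxAl.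
pose Z := map_mx f frob_dev.
have SZ : S = (1%:M + Z) *m ld_t0 L by rewrite /S normalized_frob map_mxM map_mxD map_mx1 fstr.
have [E hE] : exists E, e' = e + p%:R *: E.
  have h u v : exists w, e' u v - e u v = p%:R * w.
    have [|w ->] := (witt_res0 hW (e' u v - e u v)).1; last by exists w; rewrite expn1.
    have := congr1 (fun M : 'M_N => M u v) (_ : map_mx res e' = map_mx res e).
    rewrite !mxE rmorphB => -> //; first by rewrite subrr.
    by rewrite /e' !map_mxM c1 c'1 mul1mx mulmx1.
  exact: mx_divide h.
clearbody e'; have [Z1 hZ1] : exists Z1, Z = (p ^ D')%:R *: Z1.
  have [u v|Z1] := @mx_divide _ _ Z 0 (p ^ D')%:R; last by rewrite add0r; exists Z1.
  have [w hw] := fD (frob_dev u v); exists w.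
  by rewrite -hw frob_dev_ker [(0 : 'M_N) u v]mxE !subr0 [LHS]mxE.
have t0i := ld_t0i L; set t0 := ld_t0 L in SZ t0i; set t0' := ld_t0' L in t0i.
have phiC Y : ld_phi L id_W (t0 *m Y *m t0') = n * ld_phi L id_W Y.
  by rewrite (ld_phiC L Y (ld_t0T L) t0i) ld_t0a.
have t0e : t0 *m e *m t0' = n *: e.
  by have := root_vec_conj x (ld_t0T L) t0i; rewrite ld_t0a eid.
have eq1 : t0 *m e' *m t0' + Z *m (t0 *m e' *m t0') = n *: (e' + e' *m Z).
  have L1 : (1%:M + Z) *m t0 *m e' *m t0' = t0 *m e' *m t0' + Z *m (t0 *m e' *m t0').
    by rewrite !mulmxDl !mul1mx !mulmxA.
  have R1 : e' *m ((1%:M + Z) *m t0) *m t0' = e' + e' *m Z.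
    by rewrite -!mulmxA t0i.1 mulmx1 mulmxDr mulmx1.
  by rewrite -L1 -R1 -SZ Se -scalemxAl.
(* Applying the coordinate form to [eq1] cancels the terms in [e'] alone, by equivariance under
   [t0]. *)
have eq2 : ld_phi L id_W (Z *m (t0 *m e' *m t0')) = n * ld_phi L id_W (e' *m Z).
  by have := congr1 (ld_phi L id_W) eq1; rewrite ld_phiD phiC ld_phiZ ld_phiD mulrDr => /addrI.
have eq3 : n * ld_phi L id_W (Z *m e - e *m Z) =
   p%:R * (p ^ D')%:R * (n * ld_phi L id_W (E *m Z1) - ld_phi L id_W (Z1 *m (t0 *m E *m t0'))).
  have h := eq2; rewrite hE mulmxDr mulmxDl t0e -scalemxAr -scalemxAl mulmxDr -!scalemxAr mulmxDl -scalemxAl in h.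
  rewrite !ld_phiD !ld_phiZ hZ1 -!scalemxAl -!scalemxAr !ld_phiZ in h.
  rewrite ld_phiB hZ1 -scalemxAl -scalemxAr !ld_phiZ.
  set a4 := ld_phi L id_W (Z1 *m (t0 *m E *m t0')) in h *; clearbody a4; move: h.
  move: (ld_phi L id_W (Z1 *m _)) (ld_phi L id_W (e *m Z1)) (ld_phi L id_W (E *m Z1)) => a1 a2 a3 h.
  have -> : n * ((p ^ D')%:R * a1 - (p ^ D')%:R * a2) = (n * ((p ^ D')%:R * a1) + p%:R * ((p ^ D')%:R * a4)) - p%:R * ((p ^ D')%:R * a4) - n * ((p ^ D')%:R * a2) by ring.
  by rewrite h; ring.
have [n' nn'] := chr_unit (nice_root q) (ld_t0T L); rewrite ld_t0a -/n in nn'.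
have -> : f frob_coord = ld_phi L id_W (Z *m e - e *m Z).
  rewrite /frob_coord -(ld_phiN L _ (f1 : is_alg_hom strR id_W f)) map_mxB !map_mxM fstr //.
exists (n' * (n * ld_phi L id_W (E *m Z1) - ld_phi L id_W (Z1 *m (t0 *m E *m t0')))).
rewrite mulrCA expnS natrM -eq3 mulrA [n' * n]mulrC nn' mul1r //.
Qed.
End OnePrime.
End Main.

Lemma ideal_full (A : comNzRingType) : is_ideal (fun _ : A => True).
Proof. by split. Qed.

(** * Universality and the auxiliary deformations *)

Section Global.
Variables (p : nat) (k : finFieldType) (W : comNzRingType) (res : {rmorphism W -> k}) (hW : is_witt_ring p res).
Variables (N : nat) (G : lingroup W N) (M : nat) (C : lingroup W M) (mu : lghom G C).
Variables (F : fieldExtType rat) (iota : {rmorphism F -> algC}).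
Variables (kap : elt (absgal iota) -> W) (hkap : is_cyclotomic p kap).
Variables (rhob : elt (absgal iota) -> 'M[k]_N) (nu : elt (absgal iota) -> 'M[W]_M).
Variables (ns : nat) (vS : 'I_ns -> place) (DS : forall a : 'I_ns, loc_cond iota k W N (vS a)).
Arguments DS : clear implicits.
Hypothesis hDS : forall a, is_deformation_condition res mu rhob nu (DS a).
Variables (m : nat) (q : 'I_m -> nice_data G) (hnice : forall i, is_nice p res kap rhob (q i)).
Variables (rhonew : elt (absgal iota) -> 'M[W]_N)
  (hrhonew : is_universal res mu rhob nu (SQ_new mu kap rhob nu DS q [set: 'I_m])
               (idfun : {rmorphism W -> W}) res rhonew).
Variables (R : comNzRingType) (strR : {rmorphism W -> R}) (redR : {rmorphism R -> k})
  (rhoR : elt (absgal iota) -> 'M[R]_N)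
  (hR : is_universal res mu rhob nu (SQ_old mu rhob nu DS q [set: 'I_m]) strR redR rhoR).
Variables (pi : {rmorphism R -> W}) (hpi : is_coef_hom strR redR (idfun : {rmorphism W -> W}) res pi)
  (hpirho : strictly_equiv G (idfun : {rmorphism W -> W}) res (fun s => map_mx pi (rhoR s)) rhonew).
Local Notation id_W := (idfun : {rmorphism W -> W}).
Local Notation K := (rker pi).
Local Notation rw := (fun s => map_mx pi (rhoR s)).
Variable L : forall i, local_data res kap rhob (q i) rw.
Local Notation y := (fun i => frob_coord strR (L i)).

Lemma old_push (A B : comNzRingType) (strA : {rmorphism W -> A}) (redA : {rmorphism A -> k})
  (strB : {rmorphism W -> B}) (redB : {rmorphism B -> k}) (f : {rmorphism A -> B}) r :
  is_coef_hom strA redA strB redB f -> is_coef res strB redB ->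
  glob_lift mu rhob nu (SQ_old mu rhob nu DS q [set: 'I_m]) strA redA r ->
  glob_lift mu rhob nu (SQ_old mu rhob nu DS q [set: 'I_m]) strB redB (fun s => map_mx f (r s)).
Proof.
move=> hf hB [rl rf rD]; have rl' := is_lift_push hf rl; split=> //.
  by move=> s t h; rewrite (rf s t h).
case=> [a|j]; last exact: is_lift_restr rl'.
exact: (condition_push hf (hDS a) hB (rD (inl a))).
Qed.

Lemma new_of_old (A : comNzRingType) (strA : {rmorphism W -> A}) (redA : {rmorphism A -> k}) r :
  glob_lift mu rhob nu (SQ_old mu rhob nu DS q [set: 'I_m]) strA redA r ->
  (forall i, special_lift mu kap rhob nu (nice_unip (q i)) (v := FinPlace (nice_place (q i))) strA redA (restr r)) ->
  glob_lift mu rhob nu (SQ_new mu kap rhob nu DS q [set: 'I_m]) strA redA r.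
Proof.
move=> [rl rf rD] sp; split=> //; case=> [a|j]; first exact: (rD (inl a)).
exact: sp.
Qed.

Lemma old_of_new (J : {set 'I_m}) (A : comNzRingType) (strA : {rmorphism W -> A}) (redA : {rmorphism A -> k}) r :
  glob_lift mu rhob nu (SQ_new mu kap rhob nu DS q J) strA redA r ->
  glob_lift mu rhob nu (SQ_old mu rhob nu DS q [set: 'I_m]) strA redA r.
Proof.
move=> [rl rf rD]; split=> //.
  apply: factors_mono rf; case=> [a|[j jJ]]; first by exists (inl a).
  by exists (inr (exist _ j (in_setT j))).
case=> [a|j]; first exact: (rD (inl a)).
exact: is_lift_restr rl.
Qed.

Let hRc : is_coef res strR redR. Proof. by case: hR. Qed.
Let rlR : is_lift mu rhob nu strR redR rhoR. Proof. by case: hR => _ []. Qed.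

(* Universality of [rhonew], then of [rhoR]: a map making [rhoR] special at all the nice primes
   factors through [pi]. *)
Lemma new_factors (A : comNzRingType) (strA : {rmorphism W -> A}) (redA : {rmorphism A -> k}) (g : {rmorphism R -> A}) :
  is_coef res strA redA -> is_coef_hom strR redR strA redA g ->
  (forall i, special_lift mu kap rhob nu (nice_unip (q i)) (v := FinPlace (nice_place (q i))) strA redA
     (restr (fun s => map_mx g (rhoR s)))) ->
  forall r, g r = strA (pi r).
Proof.
move=> hA hg sp; have [_ oldR univR] := hR; have [_ _ univN] := hrhonew.
have oldA := old_push hg hA oldR.
have [f0 [hf0 e0 _]] := univN _ _ _ _ hA (new_of_old oldA sp).
have [f1 [hf1 _ u1]] := univR _ _ _ _ hA oldA.
pose g' : {rmorphism R -> A} := strA \o pi.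
have [sA rA] := hpi; have [rsA _ _ _ _] := hA.
have hg' : is_coef_hom strR redR strA redA g'.
  by split=> [w|r]; rewrite /g' /= ?sA // rsA rA.
have hs : is_coef_hom id_W res strA redA strA by split.
have e1 : strictly_equiv G strA redA (fun s => map_mx g' (rhoR s)) (fun s => map_mx g (rhoR s)).
  have f0E (Z : 'M[W]_N) : map_mx f0 Z = map_mx strA Z.
    by apply/matrixP => a b; rewrite !mxE; exact: (hf0.1 (Z a b)).
  have gE s : map_mx g' (rhoR s) = map_mx strA (map_mx pi (rhoR s)) by apply/matrixP => a b; rewrite !mxE.
  have [b [b' [bG hb]]] := e0; have [c [c' [cG hc]]] := strictly_equiv_push hs hpirho.
  exists (b *m c), (c' *m b'); split; first exact: Ghat_mul.
  by move=> s; rewrite hb f0E hc gE !mulmxA.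
move=> r; rewrite (u1 g hg (strictly_equiv_refl _ _ _ _)) -[RHS]/(g' r).
by rewrite (u1 g' hg' e1).
Qed.

(** If the [y i] did not generate K, there would be an ideal J' containing them and some [e] in K
    outside J' with K = J' + R e. In the finite ring A = R / (J' + m e + p R), m the maximal ideal,
    [e] survives and spans the maximal ideal, whose square is 0. There the universal lift is special
    at every nice prime, so the projection to A factors through [pi], which kills [e]. *)
Lemma ker_generated x : K x -> exists c : 'I_m -> R, x = \sum_i c i * y i.
Proof.
have hK : is_ideal K by apply: rker_ideal.
have hm : is_ideal (rker redR) by apply: rker_ideal.
have [K0 KD KM] := hK; have [m0 mD mM] := hm.
have [rs rS rU rN rC] := hRc.
have yK i : K (y i) by apply: (frob_coord_ker hpi).
have Km x' : K x' -> redR x' = 0 by move=> h; rewrite -(pi_res hpi) h rmorph0.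
pose J x := exists c : 'I_m -> R, x = \sum_i c i * y i.
have hJ : is_ideal J.
  split.
  - by exists (fun _ => 0); rewrite big1 // => i _; rewrite mul0r.
  - move=> _ _ [c ->] [c' ->]; exists (fun i => c i + c' i); rewrite -big_split.
    by apply: eq_bigr => i _ /=; rewrite mulrDl.
  - by move=> a _ [c ->]; exists (fun i => a * c i); rewrite mulr_sumr; apply: eq_bigr => i _; rewrite mulrA.
have yJ i : J (y i).
  exists (fun j => (j == i)%:R); rewrite (bigD1 i) //= eqxx mul1r big1 ?addr0 // => j /negPf ->.
  by rewrite mul0r.
apply: (noetherian_step rN hJ hK) => [z [c ->]|J' e hJ' JJ' J'K Ke nJ'e cov].
  by apply: ideal_sum => // i; apply: (KM).
have hI' := ideal_add_principal e hJ' hm; set I' := (fun z => _) in hI'.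
have nI'e : ~ I' e.
  move=> [r [mr h]]; have [|u hu] := rU (1 - r).
    by rewrite rmorphB rmorph1 mr subr0 => /eqP; rewrite oner_eq0.
  apply: nJ'e; have [_ _ JM] := hJ'; have := JM u _ h.
  by rewrite -{1}[e]mul1r -mulrBl mulrA [u * _]mulrC hu mul1r.
have I'K z : I' z -> K z.
  move=> [r [_ h]]; rewrite -(subrK (r * e) z); apply: (KD); [exact: J'K | exact: KM].
have hI := ideal_add_principal p%:R hI' (ideal_full R); set I := (fun z => _) in hI.
have [I0 ID IM] := hI; have [I'0 I'D I'M] := hI'; have [J'0 J'D J'M] := hJ'.
have I'I z : I' z -> I z by exists 0; rewrite mul0r subr0.
have J'I z : J' z -> I z by move=> h; apply: I'I; exists 0; rewrite mul0r subr0; split=> //; exact: rmorph0.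
have mI r : redR r = 0 -> I (r * e).
  by move=> mr; apply: I'I; exists r; rewrite subrr.
have pI r : I (r * p%:R) by exists r; rewrite subrr.
have redp : redR p%:R = 0 by rewrite rmorph_nat -(rmorph_nat res) (witt_p0 hW).
have Ired z : I z -> redR z = 0.
  move=> [r [_ h]]; rewrite -(subrK (r * p%:R) z) rmorphD (Km _ (I'K _ h)) add0r rmorphM redp mulr0 //.
(* If e = r p modulo m e + J', subtracting the K-part of [r] leaves a constant times [p]; applying
   [pi] shows that this constant is 0, so [e] would lie in m e + J', which [nI'e] excludes. *)
have nIe : ~ I e.
  move=> [r [_ h]]; pose ka := r - strR (pi r); have kaK : K ka := section_split (pi_str hpi) r.
  have [r2 h2] := cov _ kaK.
  have h3 : I' (ka * p%:R).
    exists (r2 * p%:R); split; first by rewrite /rker rmorphM redp mulr0.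
    by rewrite mulrAC -mulrBl mulrC; apply: (J'M).
  have h4 : I' (e - strR (pi r) * p%:R).
    have -> : e - strR (pi r) * p%:R = (e - r * p%:R) + ka * p%:R by rewrite /ka; ring.
    exact: I'D.
  have h5 : pi r = 0.
    apply: (witt_ptorsion hW (n := 1)); rewrite expn1.
    have := I'K _ h4; rewrite /rker rmorphB Ke rmorphM rmorph_nat (pi_str hpi) sub0r => /eqP.
    by rewrite oppr_eq0 mulrC => /eqP.
  by apply: nI'e; move: h4; rewrite h5 rmorph0 mul0r subr0.
have nI1 : ~ I 1 by move=> h; apply: nIe; rewrite -[e]mulr1; apply: (IM).
have [A [g [gs gk]]] := quotient_ring hI nI1.
have [redA hredA] : exists h : {rmorphism A -> k}, forall x, h (g x) = redR x.
  by apply: (factor_rmorphism gs) => z /gk /Ired.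
pose strA : {rmorphism W -> A} := g \o strR.
have hg : is_coef_hom strR redR strA redA g by [].
have K_e ka : K ka -> exists r, g ka = g (r * e).
  move=> /cov [r h]; exists r; apply/eqP; rewrite -subr_eq0 -rmorphB; apply/eqP/gk; exact: J'I.
pose lft c : W := sval (cid (witt_surj hW c)); have lftE c : res (lft c) = c := svalP (cid (witt_surj hW c)).
have lft_p w : I (strR (w - lft (res w))).
  have [|u ->] := (witt_res0 hW (w - lft (res w))).1; first by rewrite rmorphB lftE subrr.
  by rewrite expn1 rmorphM rmorph_nat mulrC; apply: pI.
have ma a : redA a = 0 -> exists r, a = g (r * e).
  have [r <-] := gs a; rewrite hredA => mr.
  have [r2 h2] := K_e _ (section_split (pi_str hpi) r); exists r2; rewrite -h2 rmorphB.
  have : g (strR (pi r)) = 0; last by move->; rewrite subr0.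
  apply/gk; have [|u ->] := (witt_res0 hW (pi r)).1; first by rewrite (pi_res hpi).
  by rewrite expn1 rmorphM rmorph_nat mulrC; apply: pI.
have mm a b : redA a = 0 -> redA b = 0 -> a * b = 0.
  move=> ha /ma [r ->]; have [a0 a0E] := gs a; rewrite -a0E -rmorphM; apply/gk; rewrite mulrA; apply: mI.
  by rewrite rmorphM -hredA a0E ha mul0r.
have hmA : is_ideal (rker redA) by apply: rker_ideal.
have nil b : idpow (rker redA) 2 b -> b = 0.
  move=> h; have h0 : is_ideal (fun z : A => z = 0).
    by split=> // [z z' -> ->|z z' ->]; rewrite ?addr0 ?mulr0.
  apply: (idmul_sub h0 _ h) => z z' hz hz'; apply: mm => //.
  by apply: (idmul_sub hmA _ hz') => u v hu _; rewrite /rker rmorphM hu mul0r.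
have finA a : a \in [seq g (strR (lft c.1) + strR (lft c.2) * e) | c : (k * k)%type].
  have [r rE] := gs a; pose w := pi r.
  have [r2 h2] := K_e _ (section_split (pi_str hpi) r).
  apply/mapP; exists (res w, redR r2); first by rewrite mem_enum.
  have E : g r = g (strR (pi r)) + g (r2 * e) by rewrite -h2 -rmorphD addrC subrK.
  rewrite -rE E /= [RHS]rmorphD; congr (_ + _); apply/eqP;
    rewrite -subr_eq0 -rmorphB; apply/eqP/gk; first by rewrite -rmorphB; apply: lft_p.
  by rewrite -mulrBl; apply: mI; rewrite rmorphB rs lftE subrr.
have hA : is_coef res strA redA.
  split.
  - by move=> w; rewrite /strA /= hredA rs.
  - by move=> a; have [r hr] := rS a; exists (g r); rewrite hredA.
  - move=> a; have [r <-] := gs a; rewrite hredA => /rU [u hu]; exists (g u); by rewrite -rmorphM hu rmorph1.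
  - exact: (finite_noetherian finA).
  - exact: (nilpotent_complete (n := 2) hmA nil).
have ge0 : g e <> 0 by move/gk.
apply: ge0; rewrite (new_factors hA hg) ?Ke ?rmorph0 // => i.
apply: (special_of_deviation hW hkap hRc rlR hpi (hnice i) (L := L i) (j := 2) (w := g e)) => //.
- exists 1%N => w [u ->]; rewrite /strA /= expn1 rmorphM rmorph_nat; apply/gk; rewrite mulrC; exact: pI.
- by rewrite hredA Km.
- move=> b; have [r <-] := gs b; rewrite hredA -rmorphM; split=> [/gk h|mr]; last by apply/gk; rewrite mulrC; apply: mI.
  apply: contrapT => /rU [u hu]; apply: nIe; have := IM u _ h.
  by rewrite mulrCA [u * r]mulrC hu mulr1.
- move=> r; have [r2 h2] := K_e _ (section_split (pi_str hpi) r); exists (g r2).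
  by rewrite /strA /= -rmorphM [e * r2]mulrC -h2 rmorphB addrC subrK.
- by apply/gk/J'I/JJ'; apply: yJ.
Qed.

Lemma ker_pow D : (0 < D)%N ->
  (forall i, exists r, K r /\ idmul K K ((p ^ D)%:R * y i - r * (p ^ (D + D))%:R)) ->
  forall x, K x -> idmul K K ((p ^ D)%:R * x).
Proof.
move=> D0 hy.
have hK : is_ideal K by apply: rker_ideal.
have [K0 KD KM] := hK; have hK2 := idmul_ideal hK hK; have [K20 K2D K2M] := hK2.
have [rs rS rU rN rC] := hRc.
have one x : K x -> exists r, K r /\ idmul K K ((p ^ D)%:R * x - (p ^ D)%:R * ((p ^ D)%:R * r)).
  move=> /ker_generated [c ->]; pose r i := sval (cid (hy i)).
  have rP i : K (r i) /\ idmul K K ((p ^ D)%:R * y i - r i * (p ^ (D + D))%:R) := svalP (cid (hy i)).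
  exists (\sum_i c i * r i); split; first by apply: ideal_sum => // i; apply: (KM); case: (rP i).
  rewrite !mulr_sumr -sumrB; apply: ideal_sum => // i; have [_ h] := rP i; have := K2M (c i) _ h.
  by rewrite expnD natrM; congr (idmul K K _); ring.
have hL := ideal_add_principal (p ^ D)%:R hK2 hK; set I := (fun z => _) in hL.
have K2I z : idmul K K z -> I z by exists 0; rewrite mul0r subr0.
have main : forall z, I z -> idmul K K z.
  apply: (noetherian_step rN hK2 hL K2I) => J' e hJ' K2J' J'I [r0 [Kr0 he]] nJ'e cov.
  have [J0 JD JM] := hJ'.
  have [r [Kr hr]] := one _ Kr0.
  have [s hs] : exists s, J' ((p ^ D)%:R * r - s * e).
    by apply: cov; exists r; split=> //; rewrite mulrC subrr.
  (* Here [e] is p^D r0 modulo J', and [one] replaces p^D r0 by p^(2D) r, which is p^D s e by the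
     choice of [s]; since [p] is in the maximal ideal, 1 - p^D s is a unit. *)
  have h : J' ((1 - (p ^ D)%:R * s) * e).
    have -> : (1 - (p ^ D)%:R * s) * e = (e - r0 * (p ^ D)%:R) + ((p ^ D)%:R * r0 - (p ^ D)%:R * ((p ^ D)%:R * r))
        + (p ^ D)%:R * ((p ^ D)%:R * r - s * e) by ring.
    by apply: (JD); [apply: (JD); apply: K2J' | apply: (JM)].
  have [|u hu] := rU (1 - (p ^ D)%:R * s).
    rewrite rmorphB rmorph1 rmorphM natrX rmorphXn.
    have -> : redR p%:R = 0 by rewrite rmorph_nat -(rmorph_nat res) (witt_p0 hW).
    by rewrite expr0n eqn0Ngt D0 mul0r subr0 => /eqP; rewrite oner_eq0.
  by apply: nJ'e; have := JM u _ h; rewrite mulrA [u * _]mulrC hu mul1r.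
by move=> x Kx; apply: main; exists x; split=> //; rewrite mulrC subrr.
Qed.

(** Dropping the conditions at the nice primes, the auxiliary deformation is a point of the
    unrestricted ring. Congruent deformations give the same map to W/p^D by uniqueness, so this
    point agrees with [pi] modulo p^D. *)
Lemma aux_map (J : {set 'I_m}) rhoi D :
  is_universal res mu rhob nu (SQ_new mu kap rhob nu DS q J) id_W res rhoi -> congruent_mod p res G D rhoi rhonew ->
  exists X : {rmorphism R -> W}, [/\ is_coef_hom strR redR id_W res X,
    strictly_equiv G id_W res (fun s => map_mx X (rhoR s)) rhoi &
    forall r, pdiv_pow p D (X r - pi r)].
Proof.
move=> [hWc newi _] [A [str [red [hA e0]]]]; have [_ oldR univR] := hR.
have [X [hX eX _]] := univR _ _ _ _ hWc (old_of_new newi).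
exists X; split=> // r.
have hAc := trunc_coef hW hA; have [_ sk _] := hA; have [rsA _ _ _ _] := hAc.
have hs : is_coef_hom id_W res str red str by split.
have [_ newN _] := hrhonew; have oldN := old_push hs hAc (old_of_new newN).
have [f1 [_ _ u1]] := univR _ _ _ _ hAc oldN.
have comp (f : {rmorphism R -> W}) : is_coef_hom strR redR id_W res f -> is_coef_hom strR redR str red (str \o f).
  by move=> [h1 h2]; split=> [w|z] /=; rewrite ?h1 // rsA h2.
have mE (f : {rmorphism R -> W}) s : map_mx (str \o f) (rhoR s) = map_mx str (map_mx f (rhoR s)).
  by apply/matrixP => a b; rewrite !mxE.
have eq (f : {rmorphism R -> W}) : strictly_equiv G str red (fun s => map_mx str (map_mx f (rhoR s))) (fun s => map_mx str (rhonew s)) ->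
    strictly_equiv G str red (fun s => map_mx (str \o f) (rhoR s)) (fun s => map_mx str (rhonew s)).
  by move=> [b [b' [bG h]]]; exists b, b'; split=> // s; rewrite mE.
apply/sk; rewrite rmorphB.
have -> : str (X r) = f1 r.
  apply: (u1 (str \o X) (comp X hX)); apply: eq; apply: strictly_equiv_trans e0; exact: (strictly_equiv_push hs eX).
have -> : str (pi r) = f1 r; last by rewrite subrr.
apply: (u1 (str \o pi) (comp pi hpi)); apply: eq; exact: (strictly_equiv_push hs hpirho).
Qed.

(* Otherwise the auxiliary deformation would be special mod [p^(D+1)]. *)
Lemma aux_coord_nonzero (J : {set 'I_m}) rhoi D i (X : {rmorphism R -> W}) :
  is_universal res mu rhob nu (SQ_new mu kap rhob nu DS q J) id_W res rhoi ->
  is_coef_hom strR redR id_W res X -> strictly_equiv G id_W res (fun s => map_mx X (rhoR s)) rhoi ->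
  (forall r, pdiv_pow p D (X r - pi r)) ->
  ~ special_mod p res mu kap rhob nu (nice_unip (q i)) (FinPlace (nice_place (q i))) D.+1 rhoi -> (0 < D)%N ->
  ~ pdiv_pow p D.+1 (X (y i)).
Proof.
move=> [_ [rli _ _] _] hX eX XD ns0 D0 hy; apply: ns0.
have [A [str [red hA]]] := trunc_ring hW (ltn0Sn D); exists A, str, red; split=> //.
have hAc := trunc_coef hW hA; have [sS sk sr] := hA.
have hs : is_coef_hom id_W res str red str by split.
have hf : is_coef_hom strR redR str red (str \o X).
  by case: hX => [h1 h2]; split=> [w|z] /=; rewrite ?h1 // sr h2.
apply: (special_equiv (is_lift_push hs rli) (strictly_equiv_sym (strictly_equiv_push hs eX))).
have -> : (fun s => map_mx str (map_mx X (rhoR s))) = (fun s => map_mx (str \o X) (rhoR s)).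
  by apply: funext => s; apply/matrixP => a b; rewrite !mxE.
(* In W/p^(D+1) the class of p^D has the maximal ideal as its annihilator, and [X] deviates from
   [pi] by its multiples. *)
apply: (special_of_deviation hW hkap hRc rlR hpi (hnice i) (L := L i) (j := D.+1) (w := str (p ^ D)%:R)) => //.
- by move=> z; apply: (trunc_nilp hW hA).
- by exists D.+1 => z /sk.
- rewrite sr natrX rmorphXn (witt_p0 hW) expr0n eqn0Ngt D0 //.
- move=> b; have [w <-] := sS b; rewrite -rmorphM sr sk; split=> [h|/(witt_res0 hW) [u ->]].
    by apply/(witt_res0 hW)/(witt_pdivK hW (m := D)); rewrite addn1.
  by exists u; rewrite mulrA -natrM -expnD addn1.
- move=> r /=; have [w hw] := XD r; exists (str w); rewrite -rmorphM -hw rmorphB addrC subrK //.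
- by apply/sk.
Qed.

Lemma aux_coord_special (J : {set 'I_m}) rhoi D j (X : {rmorphism R -> W}) : j \in J ->
  is_universal res mu rhob nu (SQ_new mu kap rhob nu DS q J) id_W res rhoi ->
  is_coef_hom strR redR id_W res X -> strictly_equiv G id_W res (fun s => map_mx X (rhoR s)) rhoi ->
  (forall r, pdiv_pow p D (X r - pi r)) -> pdiv_pow p D.+1 (X (y j)).
Proof.
move=> jJ [_ [_ _ sp] _] hX eX XD.
apply: (special_coord hW hkap hpi (hnice j) (L j) hX XD).
exact: (special_equiv (is_lift_push hX rlR) eX (sp (inr (exist _ j jJ)))).
Qed.
End Global.

Theorem theorem3p1
  (p : nat) (k : finFieldType) (W : comNzRingType) (res : {rmorphism W -> k})
  (hW : is_witt_ring p res)
  (N : nat) (G : lingroup W N) (hG : split_reductive G)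
  (Gder : lingroup W N) (hGder : is_derived_group G Gder)
  (hsimple : lg_almost_simple Gder)
  (Nsc : nat) (Gsc : lingroup W Nsc) (cov : lghom Gsc Gder)
  (hsc : is_simply_connected_cover cov)
  (M : nat) (C : lingroup W M) (mu : lghom G C) (hmu : is_max_torus_quotient mu)
  (h : nat) (hh : coxeter_number G C h)
  (z : nat) (hz : center_order Gsc z)
  (hph : (h < p)%N)
  (F : fieldExtType rat) (iota : {rmorphism F -> algC})
  (kap : elt (absgal iota) -> W) (hkap : is_cyclotomic p kap)
  (ns : nat) (vS : 'I_ns -> place) (hS : is_place_set iota p vS)
  (rhob : elt (absgal iota) -> 'M[k]_N)
  (hrhob : is_rep G res (rker (idfun : {rmorphism k -> k})) rhob)
  (hrhobS : factors vS rhob)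
  (nu : elt (absgal iota) -> 'M[W]_M)
  (hnu : is_rep C (idfun : {rmorphism W -> W}) (rker res) nu)
  (hnuS : factors vS nu)
  (hnub : forall s, map_mx res (nu s) = hom_at mu res (rhob s))
  (himage : forall g, pts Gsc res g -> exists s, rhob s = hom_at cov res g)
  (hdeg : cyclotomic_degree iota p p.-1)
  (hp8 : (8 * z < p.-1)%N)
  (hpeven : ~~ odd z -> ((2 * h - 2) * z < p.-1)%N)
  (hpodd : odd z -> ((4 * h - 4) * z < p.-1)%N)
  (DS : forall a : 'I_ns, loc_cond iota k W N (vS a))
  (hDS : forall a, is_deformation_condition res mu rhob nu (DS a))
  (hDSsmooth : forall a, is_smooth_condition res (DS a))
  (n : nat) (hn : n <> 0%N)
  (hsel : class_dim (ad_act (res := res) (Gder := Gder) rhob)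
                    (ad_selmer (res := res) (Gder := Gder) rhob DS) n)
  (hdualsel : class_dim (addual_act (res := res) (Gder := Gder) rhob kap)
                        (ad_dual_selmer (res := res) (Gder := Gder) kap rhob DS) n)
  (m : nat) (hm : m = (n + 1)%N \/ m = (n + 3)%N)
  (q : 'I_m -> nice_data G)
  (hnice : forall i, is_nice p res kap rhob (q i))
  (hqinj : forall i j,
     same_place iota (FinPlace (nice_place (q i))) (FinPlace (nice_place (q j))) -> i = j)
  (hqS : forall i a, ~ same_place iota (vS a) (FinPlace (nice_place (q i))))
  (hQ : is_auxiliary res Gder mu kap rhob nu DS q [set: 'I_m])
  (d : nat) (hd : (2 <= d)%N)
  (rhonew : elt (absgal iota) -> 'M[W]_N)
  (hrhonew : is_universal res mu rhob nu (SQ_new mu kap rhob nu DS q [set: 'I_m])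
               (idfun : {rmorphism W -> W}) res rhonew)
  (ha : forall i, ~ unramified_mod p (nice_place (q i)) d rhonew)
  (hb : forall i : 'I_m, exists (Qi : {set 'I_m}) (rhoi : elt (absgal iota) -> 'M[W]_N),
     [/\ is_auxiliary res Gder mu kap rhob nu DS q Qi,
         (forall j : 'I_m, (j < i)%N -> j \in Qi) /\ i \notin Qi,
         is_universal res mu rhob nu (SQ_new mu kap rhob nu DS q Qi)
           (idfun : {rmorphism W -> W}) res rhoi,
         congruent_mod p res G d.-1 rhoi rhonew &
         special_mod p res mu kap rhob nu (nice_unip (q i))
             (FinPlace (nice_place (q i))) d.-1 rhoi /\
         ~ special_mod p res mu kap rhob nu (nice_unip (q i))
             (FinPlace (nice_place (q i))) d rhoi])
  (mq : 'I_m -> nat)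
  (hmq : forall i, unramified_mod p (nice_place (q i)) (mq i) rhonew /\
     forall r, unramified_mod p (nice_place (q i)) r rhonew -> (r <= mq i)%N)
  (R : comNzRingType) (strR : {rmorphism W -> R}) (redR : {rmorphism R -> k})
  (rhoR : elt (absgal iota) -> 'M[R]_N)
  (hR : is_universal res mu rhob nu (SQ_old mu rhob nu DS q [set: 'I_m])
          strR redR rhoR)
  (pi : {rmorphism R -> W})
  (hpi : is_coef_hom strR redR (idfun : {rmorphism W -> W}) res pi)
  (hpirho : strictly_equiv G (idfun : {rmorphism W -> W}) res
              (fun s => map_mx pi (rhoR s)) rhonew) :
  [/\ subquotient_iso p strR (rker pi) (idmul (rker pi) (rker pi)) mq,
      finite_subquotient (rker pi) (idmul (rker pi) (rker pi)) &
      irreducible_component (spec_image pi)].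
Proof.
have [hGr _] := hG; have [hRc [rlR _ _] _] := hR; have [_ [rlN rfN rsN] _] := hrhonew.
pose rw s := map_mx pi (rhoR s).
have rwl : is_lift mu rhob nu (idfun : {rmorphism W -> W}) res rw := is_lift_push hpi rlR.
have sp i : special_lift mu kap rhob nu (nice_unip (q i)) (v := FinPlace (nice_place (q i)))
    (idfun : {rmorphism W -> W}) res (restr rw).
  exact: (special_equiv rwl hpirho (rsN (inr (exist _ i (in_setT i))))).
have hL i : exists L : local_data res kap rhob (q i) rw, True by apply: (local_data_ex hW hGr hkap hrhob (hnice i) (sp i)).
pose L i := sval (cid (hL i)).
pose D := d.-1; have D0 : (0 < D)%N by rewrite /D; lia.
have dD : D.+1 = d by rewrite /D; lia.
(* [q i] is a place outside S and Q_i, so [rhoi] is trivial on its inertia; the congruence modulo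
   p^(d-1) carries this to [rhonew]. *)
have unr i : unramified_mod p (nice_place (q i)) D rhonew.
  move=> s si a b; have [Qi [rhoi [_ [_ iQ] [_ [rli fi _] _] [A [str [red [[_ sk _] [g [g' [gG hg]]]]]]] _]]] := hb i.
  have ri : rhoi s = 1%:M.
    pose s1 : elt (absgal iota) := exist _ (idfun : aut) (fun x => erefl).
    rewrite (fi s s1); first by apply: (lift_mul rli).
    have [[Pf _] _ _ _ _] := hnice i.
    move=> x hx; apply: (hx _ Pf) si; case=> [a'|[j jQ]] /= hx0; first exact: hqS hx0.
    by move: iQ; rewrite -(hqinj _ _ hx0) jQ.
  have [_ [gg' _] _] := gG; have := hg s; rewrite ri map_mx1 mulmx1 gg' => hx0.
  apply/sk; have := congr1 (fun Z : 'M_N => Z a b) hx0; rewrite !mxE rmorphB rmorph_nat => ->.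
  by rewrite subrr.
have mqD i : mq i = D.
  have [h1 h2] := hmq i; have := h2 D (unr i).
  have : ~ (d <= mq i)%N by move=> hx0; apply: (ha i) => s si a b; apply: pdiv_pow_le hx0 (h1 s si a b).
  by rewrite /D; lia.
pose y i := frob_coord strR (L i).
have e1 r (Z : 'M[W]_N) : (forall a b, pdiv_pow p r (Z a b - (1%:M : 'M[W]_N) a b)) <-> (forall a b, pdiv_pow p r ((Z - 1%:M) a b)).
  by split=> hx0 a b; have := hx0 a b; rewrite [(Z - _) a b]mxE [(- _ : 'M[W]_N) a b]mxE.
(* Ramification modulo p^d supplies an inertia element trivial modulo p^(d-1) but not modulo p^d;
   both properties pass from [rhonew] to the conjugate lift obtained through [pi]. *)
have hy i : exists r, rker pi r /\ idmul (rker pi) (rker pi) ((p ^ D)%:R * y i - r * (p ^ (D + D))%:R).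
  have [t [ti nt]] : exists t : elt (absgal iota), inert iota (nice_place (q i)) (sval t) /\
      ~ forall a b, pdiv_pow p d (rhonew t a b - (1%:M : 'M[W]_N) a b).
    apply: contrapT => hx0; apply: (ha i) => s si; apply: contrapT => nn; apply: hx0; by exists s.
  have [g [g' [[_ gg _] hg]]] := hpirho.
  have gg' : inverses g' g by case: gg.
  apply: (frob_coord_divides hW hkap hRc rlR hpi (hnice i) (L i) hd ti).
    have -> : map_mx pi (rhoR t) = g' *m rhonew t *m g.
      by rewrite hg !mulmxA gg.2 mul1mx -mulmxA gg.2 mulmx1.
    exact: (entries_conj (I := fun w => pdiv_pow p d.-1 w) (pdiv_pow_ideal W p _) gg' ((e1 _ _).1 (unr i t ti))).
  move=> hx0; apply: nt; apply/e1; rewrite hg.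
  exact: (entries_conj (I := fun w => pdiv_pow p d w) (pdiv_pow_ideal W p _) gg hx0).
have yK i : rker pi (y i) by apply: (frob_coord_ker hpi).
have gen : forall x, rker pi x -> exists c : 'I_m -> R, x = \sum_i c i * y i.
  exact: (ker_generated hW hkap hDS hnice hrhonew hR hpi hpirho L).
have pK := ker_pow hW hkap hDS hnice hrhonew hR hpi hpirho D0 hy.
have hX (i : 'I_m) : exists X : {rmorphism R -> W}, [/\ (forall w, X (strR w) = w), (forall r, pdiv_pow p D (X r - pi r)),
    (forall j : 'I_m, (j < i)%N -> pdiv_pow p D.+1 (X (y j))) & ~ pdiv_pow p D.+1 (X (y i))].
  have [Qi [rhoi [_ [ltQ _] ui cong [_ nsp]]]] := hb i; rewrite -dD in nsp.
  have [X [hX eX XD]] := aux_map hW hDS hrhonew hR hpi hpirho ui cong.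
  exists X; split=> //.
  - by case: hX.
  - move=> j /ltQ jQ; have hj := aux_coord_special hW hkap hnice hR hpi L jQ ui hX eX XD.
    exact: hj.
  - have hi := aux_coord_nonzero hW hkap hnice hR hpi (L := L) ui hX eX XD nsp D0.
    exact: hi.
pose X i := sval (cid (hX i)).
have XP i := svalP (cid (hX i)) : [/\ (forall w, X i (strR w) = w), (forall r, pdiv_pow p D (X i r - pi r)),
    (forall j : 'I_m, (j < i)%N -> pdiv_pow p D.+1 (X i (y j))) & ~ pdiv_pow p D.+1 (X i (y i))].
have -> : mq = (fun=> D) by apply: funext.
have ps := pi_str hpi.
split.
- apply: (section_iso hW ps yK gen pK (X := X)) => [i|i|i j|i]; by case: (XP i) => h1 h2 h3 h4; auto.
- exact: (section_finite hW ps yK gen pK).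
- exact: (section_component hW ps yK gen pK).
Qed.
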